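(* There exists a sentence $\varphi$ of the first order language of graphs such that $$\lim_{n\to\infty} \Pr\left[ P_n \models \varphi \right]$$ does not exist, where $P_n$ is a graph chosen uniformly at random from all labelled perfect graphs on the vertex set $\{1,\dots,n\}$.
   Context: A graph is perfect if, for every induced subgraph, the chromatic number equals the clique number. The first order language of graphs consists of formulas built from variables ranging over vertices, the quantifiers $\forall,\exists$, the logical connectives $\neg,\vee,\wedge$ (and derived ones), parentheses, and the binary relations $=$ and $\sim$ (adjacency). A sentence is a formula with no free variables; $G\models\varphi$ means the graph $G$ satisfies the sentence $\varphi$. *)

(* Defs.v *)
From HB Require Import structures.
From mathcomp Require Import all_boot all_order all_algebra.

Set Implicit Arguments.
Unset Strict Implicit.
Unset Printing Implicit Defensive.

Record sgraph (T : finType) := SGraph {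
  edges : {set {set T}};
  edgesP : [forall e in edges, #|e| == 2] }.

HB.instance Definition _ (T : finType) := [isSub for @edges T].
HB.instance Definition _ (T : finType) := [Finite of sgraph T by <:].

Definition adj (T : finType) (G : sgraph T) : rel T :=
  fun x y => [set x; y] \in edges G.

Lemma adj_irrefl (T : finType) (G : sgraph T) : irreflexive (adj G).
Proof.
move=> x; rewrite /adj setUid; apply/negP => xG.
by have /forall_inP/(_ _ xG) := edgesP G; rewrite cards1.
Qed.

Lemma induced_edgesP (T : finType) (G : sgraph T) (S : {set T}) :
  [forall e in [set e : {set {x : T | x \in S}} | val @: e \in edges G],
     #|e| == 2].
Proof.
apply/forall_inP => e; rewrite inE => eG.
by have /forall_inP/(_ _ eG) := edgesP G; rewrite (card_imset _ val_inj).
Qed.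

Definition induced (T : finType) (G : sgraph T) (S : {set T}) :
  sgraph {x : T | x \in S} := SGraph (induced_edgesP G S).

Definition clique (T : finType) (G : sgraph T) (A : {set T}) : bool :=
  [forall x in A, forall y in A, (x != y) ==> adj G x y].

Definition clique_number (T : finType) (G : sgraph T) : nat :=
  \max_(A : {set T} | clique G A) #|A|.

Definition colorable (T : finType) (G : sgraph T) (k : nat) : bool :=
  [exists c : {ffun T -> 'I_k}, forall x, forall y, adj G x y ==> (c x != c y)].

Lemma colorable_ex (T : finType) (G : sgraph T) : exists k, colorable G k.
Proof.
exists #|T|; apply/existsP; exists [ffun x => enum_rank x].
apply/forallP => x; apply/forallP => y; apply/implyP => xy.
rewrite !ffunE (inj_eq enum_rank_inj); apply: contraTneq xy => ->.
by rewrite adj_irrefl.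
Qed.

Definition chromatic_number (T : finType) (G : sgraph T) : nat :=
  ex_minn (colorable_ex G).

Definition perfect (T : finType) (G : sgraph T) : bool :=
  [forall S : {set T},
     chromatic_number (induced G S) == clique_number (induced G S)].

(* Well-scoped de Bruijn syntax: [formula k] is the type of formulas whose free
   variables are among k variables.  A quantifier binds variable 0 of its body
   and shifts the others by one. *)
Inductive formula : nat -> Type :=
| FEq  k of 'I_k & 'I_k : formula k
| FAdj k of 'I_k & 'I_k : formula k
| FNot k of formula k : formula k
| FAnd k of formula k & formula k : formula k
| FOr  k of formula k & formula k : formula k
| FAll k of formula k.+1 : formula k
| FEx  k of formula k.+1 : formula k.

Definition sentence := formula 0.

Fixpoint sat (T : finType) (G : sgraph T) (k : nat) (phi : formula k) :
    k.-tuple T -> bool :=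
  match phi in formula k return k.-tuple T -> bool with
  | FEq _ i j => fun v => tnth v i == tnth v j
  | FAdj _ i j => fun v => adj G (tnth v i) (tnth v j)
  | FNot _ p => fun v => ~~ sat G p v
  | FAnd _ p q => fun v => sat G p v && sat G q v
  | FOr _ p q => fun v => sat G p v || sat G q v
  | FAll _ p => fun v => [forall x : T, sat G p [tuple of x :: v]]
  | FEx _ p => fun v => [exists x : T, sat G p [tuple of x :: v]]
  end.

Definition models (T : finType) (G : sgraph T) (phi : sentence) : bool :=
  sat G phi [tuple].

(* The denominator is never 0, since the edgeless graph is perfect. *)
Definition Pr_perfect (R : numFieldType) (phi : sentence) (n : nat) : R :=
  (#|[set G : sgraph 'I_n | perfect G & models G phi]|%:R
   / #|[set G : sgraph 'I_n | perfect G]|%:R)%R.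

(* Main.v *)
(** A graph is unipolar if its vertex set splits into a clique [A] and a set [B]
    inducing a disjoint union of cliques (blocks).  Unipolar graphs are perfect by
    Hall's theorem, perfect graphs have no induced pentagon, and there are at most
    a constant times as many pentagon-free graphs as unipolar graphs: outside
    classes that are counted directly or by removing a bounded number of vertices,
    a pentagon-free graph or its complement is unipolar.  Hence a property of half
    of the unipolar graphs has probability at least some fixed [de > 0] in a random
    perfect graph.

    A random unipolar graph on [n = 2 ^ L] vertices has a random bipartite graph
    between [A] and [B], its clique [A] is the set of centres of induced claws, and
    many of its blocks have order [L] vertices.  Neighbourhoods of vertices of [A]
    cut arbitrary subsets out of a bounded number of blocks, and thus first order
    parameters can encode an arbitrary graph on a set of logarithmic size.  If
    [L = 2 ^ (4 * tower k)], the parameters can describe the [k]-th iterated power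
    set of a point; conversely every such description that separates a set which
    [A] does not shatter has height between [k] and [k + 3].  So a sentence can
    test [k] modulo a fixed number.  This yields more than [2 / de] mutually
    exclusive sentences, each of which has probability at least [de] for
    infinitely many [n]: their probabilities cannot all converge. *)

From HB Require Import structures.
Require Import Defs.
From mathcomp Require Import all_boot all_order all_algebra.
From mathcomp Require Import perm boolp reals exp.
From mathcomp Require Import zify ring lra.
Set Implicit Arguments.
Unset Strict Implicit.
Unset Printing Implicit Defensive.
Import Order.TTheory GRing.Theory Num.Theory.

(** * Counting principles *)

(** Since a positive fraction is enough, pentagon-free graphs are compared with unipolar ones only
    up to a constant factor, and this makes an induction on the number [n] of vertices possible.
    Deleting [h] vertices divides the number of unipolar graphs by at least [2 ^ (h * (n - h) / 2)];
    a class whose members can be rebuilt from [n - h] vertices in a little fewer ways takes a small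
    share of the induction hypothesis. Classes of the other kind are compared with
    [2 ^ (n * n / 4)]. Gadgets play the part of a regularity lemma: a large random pattern between
    two homogeneous sets forces every outside vertex to be almost constant on one of the sets, while
    gadget-free sets carry only [2 ^ o(n * n)] graphs. Against the degenerate competitors unipolar
    graphs win by the entropy of set partitions, about [n * log n / 4] bits. Separation arguments
    control the size of a definable set only up to two exponentials. On the scale of towers such an
    error shifts the height by a bounded amount, so residues spaced by 4 remain distinguishable. *)

Lemma leq_card_inj_in (X Y : finType) (f : X -> Y) (S : {set X}) (S' : {set Y}) :
  {in S, forall x, f x \in S'} -> {in S &, injective f} -> #|S| <= #|S'|.
Proof.
move=> fS fi; rewrite -(card_in_imset fi); apply: subset_leq_card.
by apply/fintype.subsetP => y /imsetP[x xS ->]; apply: fS.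
Qed.

Lemma leq_card_cover (X I : finType) (S : {set X}) (D : {set I})
    (P : I -> pred X) b :
  {in S, forall x, exists2 i, i \in D & P i x} ->
  {in D, forall i, #|[set x in S | P i x]| <= b} -> #|S| <= #|D| * b.
Proof.
move=> cov bd.
have sub : S \subset \bigcup_(i in D) [set x in S | P i x].
  apply/fintype.subsetP => x xS; have [i iD Pi] := cov x xS.
  by apply/bigcupP; exists i => //; rewrite inE xS.
apply: leq_trans (subset_leq_card sub) _.
apply: (@leq_trans (\sum_(i in D) #|[set x in S | P i x]|)).
  elim/big_rec2: _ => [|i m E _ IH]; first by rewrite cards0.
  by rewrite cardsU; apply: leq_trans (leq_subr _ _) _; rewrite leq_add2l.
by rewrite -sum_nat_const; apply: leq_sum => i iD; apply: bd.
Qed.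

(** Greedy packing: as long as fewer than [b] disjoint copies are chosen, either one more copy fits
    or the vertices chosen so far meet every copy. *)
Lemma exists_disjoint_tuples_or_hitting_set (X T : finType) (P : (X -> T) -> Prop) (A : {set T}) b :
  (exists gs : 'I_b -> X -> T,
     [/\ forall i x j y, gs i x = gs j y -> i = j /\ x = y,
         forall i x, gs i x \in A & forall i, P (gs i)]) \/
  (exists R : {set T}, [/\ R \subset A, #|R| <= #|X| * b &
     forall g, injective g -> (forall x, g x \in A :\: R) -> ~ P g]).
Proof.
elim: b => [|b IH].
  have f : 'I_0 -> X -> T by case.
  by left; exists f; split; case.
case: IH => [[gs [gi gA gP]]|[R [RA Rc RP]]]; last first.
  by right; exists R; split=> //; apply: leq_trans Rc _; rewrite leq_mul2l leqnSn orbT.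
pose R := [set gs u.1 u.2 | u in {: 'I_b * X}].
have Rc : #|R| <= #|X| * b.
  by apply: leq_trans (leq_imset_card _ _) _; rewrite card_prod card_ord mulnC.
case: (EM (exists g, [/\ injective g, forall x, g x \in A :\: R & P g])); last first.
  move=> no; right; exists R; split.
  - by apply/fintype.subsetP => y /imsetP[[i x] _ ->].
  - by apply: leq_trans Rc _; rewrite leq_mul2l leqnSn orbT.
  - by move=> g g1 g2 g3; apply: no; exists g.
case=> g [g1 g2 g3]; left.
have gR i x y : gs i x <> g y.
  move=> e; have := g2 y; rewrite inE -e => /andP[/negP h _]; apply: h.
  by apply/imsetP; exists (i, x).
exists (fun i => if unlift ord_max i is Some j then gs j else g); split.
- move=> i x j y; case: unliftP => [i' ->|->]; case: unliftP => [j' ->|->].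
  + by move/gi => [-> ->].
  + by move/gR.
  + by move/esym/gR.
  + by move/g1 => ->.
- move=> i x; case: unliftP => [i' _|_] //.
  by have := g2 x; rewrite inE => /andP[].
- by move=> i; case: unliftP.
Qed.

(** Traces on disjoint blocks are independent: a block with [#|P|] admissible traces in place of
    [2 ^ #|X|] saves a fixed number of bits, and the savings add up over the blocks. Most savings in
    the counts below come from here. *)
Lemma card_block_traces (I X Y : finType) (g : I -> X -> Y) (D : {set Y})
    (P : {set {set X}}) :
  (forall i x j y, g i x = g j y -> i = j /\ x = y) ->
  (forall i x, g i x \in D) ->
  #|[set N : {set Y} | (N \subset D) && [forall i, (g i @^-1: N) \in P]]|
    <= #|P| ^ #|I| * 2 ^ (#|D| - #|X| * #|I|).
Proof.
move=> gi gD.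
pose im := [set g i x | i in I, x in X].
have imD : im \subset D by apply/fintype.subsetP => y /imset2P[i x _ _ ->].
have cim : #|im| = #|X| * #|I|.
  have -> : im = [set g u.1 u.2 | u in {: I * X}].
    apply/setP => y; apply/imset2P/imsetP => [[i x _ _ ->]|[[i x] _ ->]];
      by [exists (i, x) | exists i x].
  rewrite card_imset ?card_prod 1?mulnC // => -[i x] [j y] /= /gi[-> ->] //.
pose f (N : {set Y}) := ([ffun i => g i @^-1: N] : {ffun I -> {set X}}, N :\: im).
have -> : #|P| ^ #|I| * 2 ^ (#|D| - #|X| * #|I|)
   = #|setX [set h : {ffun I -> {set X}} | h \in ffun_on [in P]] (powerset (D :\: im))|.
  rewrite cardsX card_powerset cardsD (setIidPr imD) cim; congr (_ * _).
  by rewrite cardsE card_ffun_on.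
apply: (@leq_card_inj_in _ _ f) => [N|N N'].
  rewrite inE => /andP[ND /forallP NP]; rewrite !inE /=; apply/andP; split.
    by apply/ffun_onP => i; rewrite ffunE; apply: NP.
  by apply: setSD.
rewrite !inE => _ _ [/ffunP e1 /setP e2]; apply/setP => y.
case yim : (y \in im).
  case/imset2P: yim => i x _ _ ->.
  by have := e1 i; rewrite !ffunE => /setP/(_ x); rewrite !inE.
by have := e2 y; rewrite !inE yim.
Qed.

(** * Graphs *)

Section Graphs.
Variable T : finType.
Implicit Types (G H : sgraph T) (A B S : {set T}) (x y z : T).

Lemma adj_sym G x y : adj G x y = adj G y x.
Proof. by rewrite /adj setUC. Qed.

Lemma adj_neq G x y : adj G x y -> x != y.
Proof. by apply: contraTneq => ->; rewrite adj_irrefl. Qed.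

Lemma sgraph_ext G H : (forall x y, adj G x y = adj H x y) -> G = H.
Proof.
move=> e; apply: val_inj; apply/setP => s.
have two (K : sgraph T) : s \in edges K -> exists x y, s = [set x; y].
  move=> sK; have /forall_inP/(_ _ sK)/cards2P[x [y [_ ->]]] := edgesP K.
  by exists x, y.
apply/idP/idP => h; have [x [y es]] := two _ h; move: h; rewrite es.
  by rewrite -[_ \in _]/(adj G x y) e.
by rewrite -[_ \in _]/(adj H x y) -e.
Qed.

Definition rel_edges (r : rel T) : {set {set T}} :=
  [set s : {set T} | [exists x, exists y, [&& x != y, r x y & s == [set x; y]]]].

Lemma rel_edgesP r : [forall e in rel_edges r, #|e| == 2].
Proof.
apply/forall_inP => s; rewrite inE => /existsP[x /existsP[y /and3P[xy _ /eqP->]]].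
by rewrite cards2 xy.
Qed.

Definition graph_of (r : rel T) : sgraph T := SGraph (rel_edgesP r).

Lemma adj_graph_of r x y : adj (graph_of r) x y = (x != y) && (r x y || r y x).
Proof.
rewrite /adj inE; apply/existsP/andP => [[u /existsP[v /and3P[uv ruv /eqP e]]]|[xy]].
  have xuv : x \in [set u; v] by rewrite -e set21.
  have yuv : y \in [set u; v] by rewrite -e set22.
  have uxy : u \in [set x; y] by rewrite e set21.
  have vxy : v \in [set x; y] by rewrite e set22.
  move: xuv yuv uxy vxy; rewrite !inE.
  case/orP => /eqP ex; case/orP => /eqP ey; rewrite ex ey ?eqxx.
  - by rewrite !orbb => _ /eqP ee; rewrite ee eqxx in uv.
  - by rewrite uv ruv.
  - by move=> _ _; rewrite eq_sym uv ruv orbT.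
  - by rewrite !orbb => /eqP ee; rewrite ee eqxx in uv.
case/orP => h; [exists x; apply/existsP; exists y|exists y; apply/existsP; exists x].
  by rewrite xy h eqxx.
by rewrite eq_sym xy h setUC eqxx.
Qed.

Definition compl G := graph_of (fun x y => ~~ adj G x y).

Lemma adj_compl G x y : adj (compl G) x y = (x != y) && ~~ adj G x y.
Proof. by rewrite adj_graph_of (adj_sym G y x) orbb. Qed.

Lemma complK : involutive compl.
Proof.
move=> G; apply: sgraph_ext => x y; rewrite !adj_compl.
case: (altP (x =P y)) => [->|_] /=; first by rewrite adj_irrefl.
by rewrite negbK.
Qed.

Definition restr G S := graph_of (fun x y => [&& x \in S, y \in S & adj G x y]).

Lemma adj_restr G S x y : adj (restr G S) x y = [&& x \in S, y \in S & adj G x y].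
Proof.
rewrite adj_graph_of (adj_sym G y x).
case: (altP (x =P y)) => [->|_] /=; first by rewrite adj_irrefl !andbF.
by rewrite [X in _ || X]andbCA orbb.
Qed.

Definition nbh G x := [set y | adj G x y].

Definition C5free G := forall a b c d e : T,
  ~ [/\ [&& adj G a b, adj G b c, adj G c d, adj G d e & adj G e a] &
     [&& ~~ adj G a c, ~~ adj G a d, ~~ adj G b d, ~~ adj G b e & ~~ adj G c e]].

Definition P3free_on G B := forall x y z, x \in B -> y \in B -> z \in B ->
  adj G x y -> adj G y z -> x != z -> adj G x z.

Definition cliq G A := forall x y, x \in A -> y \in A -> x != y -> adj G x y.
Definition stab G A := forall x y, x \in A -> y \in A -> ~~ adj G x y.

Definition unipolar G := exists A, cliq G A /\ P3free_on G (~: A).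

Lemma cliq_compl G A : cliq (compl G) A <-> stab G A.
Proof.
split=> h x y xA yA => [|xy]; last by rewrite adj_compl xy h.
case: (altP (x =P y)) => [->|xy]; first by rewrite adj_irrefl.
by have := h x y xA yA xy; rewrite adj_compl => /andP[].
Qed.

Lemma stab_compl G A : stab (compl G) A <-> cliq G A.
Proof. by rewrite -{2}(complK G) cliq_compl. Qed.

(** The pentagon is self-complementary: the complement of the cycle [a b c d e] is the cycle
    [a c e b d]. *)
Lemma C5free_compl G : C5free G -> C5free (compl G).
Proof.
move=> h a b c d e [/and5P[ab bc cd de ea] /and5P[ac ad bd be ce]].
have Nac : a != c by apply: contraNneq ad => ->.
have Nad : a != d by apply: contraNneq ac => ->; rewrite adj_sym.
have Nbd : b != d by apply: contraNneq be => ->.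
have Nbe : b != e by apply: contraNneq bd => ->; rewrite adj_sym.
have Nce : c != e by apply: contraNneq be => <-.
apply: (h a c e b d).
move: ab bc cd de ea ac ad bd be ce; rewrite !adj_compl Nac Nad Nbd Nbe Nce /=.
rewrite !negbK => /andP[_ ab] /andP[_ bc] /andP[_ cd] /andP[_ de] /andP[_ ea].
move=> ac ad bd be ce; split.
  by rewrite ac ce bd (adj_sym G e b) be (adj_sym G d a) ad.
by rewrite (adj_sym G a e) ea ab (adj_sym G c b) bc cd (adj_sym G e d) de.
Qed.

Lemma C5free_restr G S : C5free G -> C5free (restr G S).
Proof.
move=> h a b c d e [].
rewrite !adj_restr => /and5P[/and3P[aS bS ab] /and3P[_ cS bc] /and3P[_ dS cd] /and3P[_ eS de] /and3P[_ _ ea]].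
rewrite aS bS cS dS eS /= => H.
by apply: (h a b c d e); rewrite ab bc cd de ea.
Qed.

Lemma cliq_sub G A S : A \subset S -> cliq G S -> cliq G A.
Proof. by move=> /fintype.subsetP s h x y xA yA; apply: h; apply: s. Qed.

Lemma stab_sub G A S : A \subset S -> stab G S -> stab G A.
Proof. by move=> /fintype.subsetP s h x y xA yA; apply: h; apply: s. Qed.

Lemma P3free_on_sub G A S : A \subset S -> P3free_on G S -> P3free_on G A.
Proof. by move=> /fintype.subsetP s h x y z xA yA zA; apply: h; apply: s. Qed.

(** A disjoint union of cliques that is also complete multipartite: a single edge [x y] forces [x]
    to be adjacent to everything, so there is one block only. *)
Lemma P3_coP3_free G B : P3free_on G B -> P3free_on (compl G) B ->
  cliq G B \/ stab G B.
Proof.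
move=> h1 h2; case: (EM (cliq G B)) => [|nc]; first by left.
right => x y xB yB; apply/negP => xy.
have xNy := adj_neq xy.
have key u v z : u \in B -> v \in B -> z \in B -> adj G u v -> z != u -> adj G u z || adj G v z -> adj G u z.
  move=> uB vB zB uv zu /orP[//|vz]; apply: (h1 u v z) => //; by rewrite eq_sym.
have all1 z : z \in B -> z != x -> adj G x z.
  move=> zB zx; case: (altP (z =P y)) => [->//|zy].
  apply: (key x y z) => //; rewrite -[_ || _]negbK negb_or; apply/negP => /andP[n1 n2].
  have : adj (compl G) x y.
    apply: (h2 x z y) => //; by rewrite adj_compl ?n1 1?eq_sym ?zx // eq_sym ?zy adj_sym.
  by rewrite adj_compl xy andbF.
apply: nc => u v uB vB uv.
case: (altP (u =P x)) => [eu|ux]; first by rewrite eu; apply: all1 => //; rewrite eq_sym -eu.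
case: (altP (v =P x)) => [ev|vx]; first by rewrite ev adj_sym; apply: all1.
by apply: (h1 u x v) => //; [rewrite adj_sym|]; apply: all1.
Qed.

End Graphs.

(** * Bounds on cardinalities by real powers of two *)

Section Le2.
Variable R : realType.
Local Open Scope ring_scope.

Definition le2 (X : nat) (e : R) := X%:R <= 2 `^ e.

Lemma le2M X Y e f : le2 X e -> le2 Y f -> le2 (X * Y) (e + f).
Proof.
move=> h1 h2; rewrite /le2 natrM powRD; last by rewrite pnatr_eq0 implybT.
by apply: ler_pM.
Qed.

Lemma le2_weak X e f : le2 X e -> e <= f -> le2 X f.
Proof. by move=> h ef; apply: le_trans h _; apply: ler_powR => //; rewrite ler1n. Qed.

Lemma le2_leq X Y e : (X <= Y)%N -> le2 Y e -> le2 X e.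
Proof. by move=> XY; apply: le_trans; rewrite ler_nat. Qed.

Lemma le2_exp2 k : le2 (2 ^ k) k%:R.
Proof. by rewrite /le2 powR_mulrn ?natrX // ler0n. Qed.

Lemma le2X X e k : le2 X e -> le2 (X ^ k) (k%:R * e).
Proof.
move=> h; elim: k => [|k IH]; first by rewrite expn0 mul0r /le2 powRr0.
by rewrite expnS; apply: le2_weak (le2M h IH) _; rewrite -natr1 mulrDl mul1r addrC.
Qed.

Lemma le2_nat X e k : le2 X e -> e <= k%:R -> (X <= 2 ^ k)%N.
Proof.
move=> h ek; have := le2_weak h ek; rewrite /le2 powR_mulrn ?ler0n //.
by rewrite -natrX ler_nat.
Qed.

Lemma le2_0 e : le2 0 e.
Proof. exact: powR_ge0. Qed.

(** The constant [c] is the base 2 logarithm of [Q / (Q - 1)]: the number of bits saved when one of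
    [Q] patterns is forbidden. *)
Lemma le2_pred Q q : (1 < Q)%N -> le2 Q q ->
  exists2 c : R, 0 < c & le2 Q.-1 (q - c).
Proof.
move=> Q1 hq; pose x : R := Q.-1%:R / Q%:R.
have Q0 : (0 : R) < Q%:R by rewrite ltr0n (ltn_trans _ Q1).
have x0 : 0 < x by rewrite divr_gt0 // ltr0n -subn1 subn_gt0.
have x1 : x < 1 by rewrite ltr_pdivrMr // mul1r ltr_nat prednK // (ltn_trans _ Q1).
have l2 : (0 : R) < ln 2 by rewrite ln_gt0 // ltr1n.
exists (- ln x / ln 2); first by rewrite divr_gt0 // oppr_gt0 ln_lt0 // x0.
rewrite /le2 powRD; last by rewrite pnatr_eq0 implybT.
have -> : 2 `^ (- (- ln x / ln 2)) = x :> R.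
  rewrite /powR pnatr_eq0 /= mulNr divfK; last by rewrite gt_eqF.
  by rewrite opprK lnK.
by rewrite /x mulrA ler_pdivlMr // [X in X <= _]mulrC ler_wpM2r ?ler0n.
Qed.

(** Absorbs polynomial factors: [n.+1] choices made a bounded number of times cost an arbitrarily
    small linear number of bits. *)
Lemma le2_linear (c : R) : 0 < c -> exists n0, forall n, (n0 <= n)%N -> le2 n.+1 (c * n%:R).
Proof.
move=> c0; pose m := (Num.truncn (c^-1)).+1.
have m0 : (0 < m)%N by [].
have mc : m%:R^-1 <= c.
  rewrite -[c]invrK lef_pV2 ?posrE ?ltr0n ?invr_gt0 //.
  by apply: ltW; rewrite truncnS_gt.
exists (4 * m * m)%N => n nm; pose k := (n %/ m)%N.
have kb : (4 * m <= k)%N by rewrite leq_divRL.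
have : (n.+1 <= 2 ^ k)%N.
  have h1 : (n < k.+1 * m)%N by rewrite mulSn addnC; rewrite {1}(divn_eq n m) ltn_add2l ltn_mod.
  apply: leq_trans h1 _.
  (* The bound [j.+1 <= 2 ^ j] is squared for [j = k./2], so that a quadratic function of [k] stands
     against the linear [k.+1 * m]. *)
  have e : k = (k./2 + k./2 + odd k)%N by rewrite addnn addnC odd_double_half.
  set j := k./2 in e *.
  have j2 : (2 * m <= j.+1)%N by have := leq_b1 (odd k); lia.
  have hj : (j.+1 <= 2 ^ j)%N by apply: ltn_expl.
  have : (j.+1 * j.+1 <= 2 ^ k)%N.
    rewrite e expnD expnD; apply: leq_trans (leq_mul hj hj) _.
    by rewrite leq_pmulr // expn_gt0.
  apply: leq_trans; have := leq_b1 (odd k); nia.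
move=> h; apply: le2_leq h _; apply: le2_weak (le2_exp2 _) _.
apply: (@le_trans _ _ (m%:R^-1 * n%:R)); last by rewrite ler_wpM2r.
by rewrite mulrC ler_pdivlMr ?ltr0n // -natrM ler_nat leq_trunc_div.
Qed.

(** Chernoff-type bound: weighting a set of size [i <= s] by [q ^ (s - i)] gives at most
    [(1 + 1/q) ^ N * q ^ s], where [N] is the size of [D]. Here [q] is chosen with
    [1 + 1/q <= 2 ^ (d/2)], and [b] so that [s * q <= d * x / 2]. *)
Lemma le2_tail (d : R) : 0 < d -> exists2 b : R, 0 < b &
  forall (T : finType) (D : {set T}) (s : nat) (x : R), s%:R <= b * x -> #|D|%:R <= x ->
    le2 #|[set X : {set T} | (X \subset D) && (#|X| <= s)%N]| (d * x).
Proof.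
move=> d0; pose y : R := 2 `^ (d / 2) - 1.
have y0 : 0 < y.
  rewrite subr_gt0 /powR pnatr_eq0 /= expR_gt1 mulr_gt0 ?divr_gt0 //.
  by rewrite ln_gt0 // ltr1n.
pose q := (Num.truncn (y^-1)).+1.
have q0 : (0 : R) < q%:R by rewrite ltr0n.
have qy : 1 + q%:R^-1 <= 2 `^ (d / 2) :> R.
  rewrite -lerBrDl -/y -[y]invrK lef_pV2 ?posrE ?invr_gt0 //.
  by apply: ltW; rewrite truncnS_gt.
exists (d / 2 / q%:R); first by rewrite !divr_gt0.
move=> T D s x sx Dx.
pose N := #|D|.
have cnt : (#|[set X : {set T} | (X \subset D) && (#|X| <= s)%N]| * q ^ N <= q.+1 ^ N * q ^ s)%N.
  have -> : #|[set X : {set T} | (X \subset D) && (#|X| <= s)%N]| = (\sum_(i < s.+1) 'C(N, i))%N.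
    rewrite (eq_bigr (fun i : 'I_s.+1 => #|[set X : {set T} | X \subset D & #|X| == i]|)); last first.
      by move=> i _; rewrite cards_draws.
    rewrite -sum1_card (partition_big (fun X : {set T} => inord #|X| : 'I_s.+1) predT) //=.
    apply: eq_bigr => i _; rewrite -sum1_card; apply: eq_bigl => X; rewrite !inE.
    apply/andP/andP => [[/andP[-> h] /eqP <-]|[-> /eqP e]]; first by rewrite inordK.
    by rewrite e inord_val eqxx -ltnS ltn_ord.
  have E : (q.+1 ^ N = \sum_(i < N.+1) 'C(N, i) * (q ^ (N - i)))%N.
    by rewrite -addn1 Pascal; apply: eq_bigr => i _; rewrite exp1n muln1.
  rewrite E !big_distrl /=.
  apply: (@leq_trans (\sum_(i < s.+1 | (i < N.+1)%N) 'C(N, i) * (q ^ (N - i)) * q ^ s)%N).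
    rewrite [X in (_ <= X)%N]big_mkcond /=; apply: leq_sum => i _.
    case: ifPn => [iN|]; last by rewrite -leqNgt => h; rewrite bin_small ?mul0n.
    rewrite -mulnA leq_mul2l -expnD leq_pexp2l ?orbT //.
    by have := ltn_ord i; lia.
  pose F i := ('C(N, i) * q ^ (N - i) * q ^ s)%N.
  rewrite -/(F _); under eq_bigr do rewrite -/(F _).
  rewrite -(big_mkord (fun i => i < N.+1)%N F) -(big_mkord predT F).
  rewrite [X in (_ <= X)%N](big_cat_nat (n := minn s.+1 N.+1)) ?geq_minr //=.
  rewrite [X in (X <= _)%N](big_cat_nat (n := minn s.+1 N.+1)) ?geq_minl //=.
  rewrite [X in (_ + X <= _)%N]big1_seq ?addn0; last first.
    by move=> i; rewrite mem_index_iota => /andP[iN /andP[]]; lia.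
  by apply: leq_trans (leq_addr _ _); rewrite big_mkcond /=; apply: leq_sum => i _; case: ifP.
have x0 : 0 <= x by apply: le_trans Dx; rewrite ler0n.
have : (#|[set X : {set T} | (X \subset D) && (#|X| <= s)%N]|)%:R <= (1 + q%:R^-1) ^+ N * q%:R ^+ s :> R.
  have qN : (0 : R) < q%:R ^+ N by rewrite exprn_gt0.
  have -> : 1 + q%:R^-1 = q.+1%:R / q%:R :> R by rewrite -natr1 mulrDl divff ?gt_eqF // mul1r.
  by rewrite expr_div_n mulrAC ler_pdivlMr // -!natrX -!natrM ler_nat.
move=> h; apply: le_trans h _.
rewrite [d * x](_ : _ = d / 2 * x + d / 2 * x); last by rewrite -mulrDl -splitr.
rewrite powRD; last by rewrite pnatr_eq0 implybT.
apply: ler_pM; rewrite ?exprn_ge0 ?addr_ge0 ?invr_ge0 ?ler0n //.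
  apply: (@le_trans _ _ ((2 `^ (d / 2)) ^+ N)).
    by rewrite lerXn2r ?nnegrE ?powR_ge0 ?addr_ge0 ?invr_ge0 ?ler0n.
  rewrite -powR_mulrn ?powR_ge0 // -powRrM; apply: ler_powR; first by rewrite ler1n.
  by rewrite ler_pM2l // divr_gt0.
apply: (@le_trans _ _ ((2 `^ q%:R) ^+ s)).
  rewrite lerXn2r ?nnegrE ?powR_ge0 ?ler0n // powR_mulrn ?ler0n // -natrX ler_nat.
  by apply: ltnW; apply: ltn_expl.
rewrite -powR_mulrn ?powR_ge0 // -powRrM; apply: ler_powR; first by rewrite ler1n.
by rewrite mulrC -ler_pdivlMr // mulrAC.
Qed.

End Le2.

(** * Extremal combinatorics *)

Lemma exists_inj_ord (T : finType) (S : {set T}) K : K <= #|S| ->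
  exists2 p : 'I_K -> T, injective p & forall i, p i \in S.
Proof.
move=> KS; exists (fun i => enum_val (widen_ord KS i)).
  move=> i j /enum_val_inj/(congr1 val) /= e; exact: val_inj.
by move=> i; apply: enum_valP.
Qed.

Lemma ramsey (T : finType) (G : sgraph T) a b (S : {set T}) :
  2 ^ (a + b) <= #|S| ->
  (exists A : {set T}, [/\ A \subset S, cliq G A & #|A| = a]) \/
  (exists A : {set T}, [/\ A \subset S, stab G A & #|A| = b]).
Proof.
move e : (a + b) => m; elim: m a b S e => [|m IH] [|a] [|b] S // e hS;
  try by left; exists set0; split; rewrite ?sub0set ?cards0 // => x y; rewrite inE.
  by right; exists set0; split; rewrite ?sub0set ?cards0 // => x y; rewrite inE.
have [x xS] : exists x, x \in S.
  by apply/set0Pn; rewrite -card_gt0; apply: leq_trans hS; rewrite expn_gt0.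
pose S1 := [set y in S | adj G x y].
pose S0 := [set y in S | (y != x) && ~~ adj G x y].
have cS : #|S| = (#|S1| + #|S0|).+1.
  rewrite (cardsD1 x) xS add1n; congr _.+1.
  have I0 : S1 :&: S0 = set0.
    by apply/setP => y; rewrite !inE; case: (adj G x y); rewrite ?andbF ?andbT.
  have := cardsUI S1 S0; rewrite I0 cards0 addn0 => <-; apply: eq_card => y; rewrite !inE.
  case: (altP (y =P x)) => [->|_] /=; first by rewrite adj_irrefl !andbF.
  by case: (y \in S) => //=; case: (adj G x y).
rewrite expnS in hS.
have [h1|h0] : 2 ^ m <= #|S1| \/ 2 ^ m <= #|S0|.
- by case: (leqP (2 ^ m) #|S1|) => h; [left|right]; lia.
- have e1 : a + b.+1 = m by lia.
  have [[A [AS Ac cA]]|[A [AS As cA]]] := IH a b.+1 S1 e1 h1.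
    left; exists (x |: A); split.
    + apply/fintype.subsetP => y; rewrite !inE => /orP[/eqP->//|yA].
      by have := fintype.subsetP AS y yA; rewrite inE => /andP[].
    + have adjx y : y \in A -> adj G x y.
        by move=> yA; have := fintype.subsetP AS y yA; rewrite inE => /andP[].
      move=> u v; rewrite !inE => /orP[/eqP->|uA] /orP[/eqP->|vA] uv.
      * by rewrite eqxx in uv.
      * exact: adjx.
      * by rewrite adj_sym; apply: adjx.
      * exact: Ac.
    + rewrite cardsU1 cA; case: (boolP (x \in A)) => // xA.
      by have := fintype.subsetP AS x xA; rewrite inE adj_irrefl andbF.
  right; exists A; split=> //; apply: subset_trans AS _.
  by apply/fintype.subsetP => y; rewrite inE => /andP[].
- have e1 : a.+1 + b = m by lia.
  have [[A [AS Ac cA]]|[A [AS As cA]]] := IH a.+1 b S0 e1 h0.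
    left; exists A; split=> //; apply: subset_trans AS _.
    by apply/fintype.subsetP => y; rewrite inE => /andP[].
  right; exists (x |: A); split.
  + apply/fintype.subsetP => y; rewrite !inE => /orP[/eqP->//|yA].
    by have := fintype.subsetP AS y yA; rewrite inE => /andP[].
  + have adjx y : y \in A -> ~~ adj G x y.
      by move=> yA; have := fintype.subsetP AS y yA; rewrite inE => /and3P[].
    move=> u v; rewrite !inE => /orP[/eqP->|uA] /orP[/eqP->|vA].
    * by rewrite adj_irrefl.
    * exact: adjx.
    * by rewrite adj_sym; apply: adjx.
    * exact: As.
  + rewrite cardsU1 cA; case: (boolP (x \in A)) => // xA.
    by have := fintype.subsetP AS x xA; rewrite inE eqxx andbF.
Qed.

Definition shatters (T : finType) (F : {set {set T}}) (M : {set T}) :=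
  [forall X : {set T}, (X \subset M) ==> [exists S in F, S :&: M == X]].

Lemma shattersP (T : finType) (F : {set {set T}}) (M : {set T}) :
  reflect (forall X : {set T}, X \subset M -> exists2 S, S \in F & S :&: M = X)
    (shatters F M).
Proof.
apply: (iffP idP) => [/forallP h X XM|h].
  by have /implyP/(_ XM)/exists_inP[S SF /eqP] := h X; exists S.
apply/forallP => X; apply/implyP => XM.
by have [S SF e] := h X XM; apply/exists_inP; exists S => //; apply/eqP.
Qed.

(** Pajor's form of the Sauer-Shelah lemma. Split [F] by membership of [x]: a set shattered by one
    of the parts is shattered by [F], and a set [M] shattered by both parts yields [x |: M] in
    addition. *)
Lemma pajor (T : finType) (F : {set {set T}}) :
  #|F| <= #|[set M | shatters F M]|.
Proof.
have [D FD] : exists D : {set T}, forall S, S \in F -> S \subset D.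
  by exists setT => S _; rewrite subsetT.
move e : #|D| => m; elim: m D e F FD => [|m IH] D e F FD.
  have D0 : D = set0 by apply/eqP; rewrite -cards_eq0 e.
  have F0 : F \subset [set set0].
    by apply/fintype.subsetP => S /FD; rewrite D0 subset0 inE.
  case: (set_0Vmem F) => [->|[S SF]]; first by rewrite cards0.
  have := fintype.subsetP F0 S SF; rewrite inE => /eqP S0.
  apply: (@leq_trans 1); first by have := subset_leq_card F0; rewrite cards1.
  rewrite -(cards1 (set0 : {set T})); apply: subset_leq_card.
  rewrite sub1set inE; apply/shattersP => X; rewrite subset0 => /eqP->.
  by exists S => //; rewrite S0 set0I.
have [x xD] : exists x, x \in D by apply/set0Pn; rewrite -card_gt0 e.
have eD : #|D :\ x| = m by have := cardsD1 x D; rewrite xD e; lia.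
pose F0 := [set S in F | x \notin S].
pose F1 := [set S :\ x | S in F & x \in S].
have F0D S : S \in F0 -> S \subset D :\ x.
  by rewrite inE => /andP[/FD SD xS]; rewrite subsetD1 SD.
have F1D S : S \in F1 -> S \subset D :\ x.
  by move=> /imsetP[S']; rewrite inE => /andP[/FD S'D _] ->; apply: setSD.
have cF : #|F| = #|F0| + #|F1|.
  rewrite [#|F1|]card_in_imset; last first.
    move=> S S'; rewrite !inE => /andP[_ xS] /andP[_ xS'] eS.
    by rewrite -(setD1K xS) eS (setD1K xS').
  rewrite -(cardsID [set S : {set T} | x \notin S] F); congr (_ + _);
    by apply: eq_card => S; rewrite !inE ?negbK // andbC.
have notx (F' : {set {set T}}) M : (forall S, S \in F' -> S \subset D :\ x) ->
    shatters F' M -> x \notin M.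
  move=> F'D /shattersP/(_ _ (fintype.subxx M))[S /F'D SD eM].
  by apply/negP => xM; move: xM; rewrite -eM inE => /andP[/(fintype.subsetP SD)]; rewrite !inE eqxx.
have s0 := IH _ eD F0 F0D; have s1 := IH _ eD F1 F1D.
set Sh0 := [set M | shatters F0 M] in s0; set Sh1 := [set M | shatters F1 M] in s1.
have subU : (Sh0 :|: Sh1) \subset [set M | shatters F M & x \notin M].
  apply/fintype.subsetP => M; rewrite !inE => /orP[h|h].
    rewrite (notx _ _ F0D h) andbT; apply/shattersP => X XM.
    have [S] := shattersP _ _ h X XM; rewrite inE => /andP[SF _] <-; by exists S.
  have xM := notx _ _ F1D h; rewrite xM andbT; apply/shattersP => X XM.
  have [_ /imsetP[S] /[!inE] /andP[SF xS] -> <-] := shattersP _ _ h X XM.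
  exists S => //; apply/setP => y; rewrite !inE; case: (altP (y =P x)) => [->|] //=.
  by rewrite (negbTE xM) andbF.
have subI : [set x |: M | M in Sh0 :&: Sh1] \subset [set M | shatters F M & x \in M].
  apply/fintype.subsetP => _ /imsetP[M /[!inE] /andP[h0 h1] ->].
  rewrite setU11 andbT; apply/shattersP => X XM.
  have xM := notx _ _ F1D h1.
  have XxM : X :\ x \subset M by rewrite subDset.
  case: (boolP (x \in X)) => xX.
    have [_ /imsetP[S] /[!inE] /andP[SF xS] -> eX] := shattersP _ _ h1 _ XxM.
    exists S => //; apply/setP => y; move/setP/(_ y): eX; rewrite !inE.
    by case: (altP (y =P x)) => [->|] //=; rewrite xS xX.
  have [S /[!inE] /andP[SF xS] eX] := shattersP _ _ h0 _ XxM.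
  exists S => //; apply/setP => y; move/setP/(_ y): eX; rewrite !inE.
  by case: (altP (y =P x)) => [->|] //=; rewrite (negbTE xS) (negbTE xX).
rewrite cF; apply: leq_trans (leq_add s0 s1) _.
rewrite -cardsUI -(cardsID [set M : {set T} | x \notin M] [set M | shatters F M]).
apply: leq_add.
  apply: leq_trans (subset_leq_card subU) _; apply: subset_leq_card.
  by apply/fintype.subsetP => M; rewrite !inE.
have <- : #|[set x |: M | M in Sh0 :&: Sh1]| = #|Sh0 :&: Sh1|.
  apply: card_in_imset => M M'; rewrite !inE => /andP[h0 _] /andP[h0' _] eM.
  by rewrite -(setU1K (notx _ _ F0D h0)) eM (setU1K (notx _ _ F0D h0')).
apply: leq_trans (subset_leq_card subI) _; apply: subset_leq_card.
by apply/fintype.subsetP => M; rewrite !inE negbK andbC.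
Qed.

(** The [m] chosen rows of degree at least [h / (2 * D)] carry [2 * K * h] incidences, so at least
    [K * h / m] columns meet [K] of them. Sort these columns by the exact set of rows met: for [h]
    large against [2 ^ m], some class has [K] columns. *)
Lemma kovari_sos_turan K D : exists h0, forall (T : finType) (P Q : {set T}) (M : {set T * T}) h,
  h0 <= h -> #|P| = h -> #|Q| = h -> M \subset setX P Q -> h * h <= D * #|M| ->
  exists (p q : 'I_K -> T), [/\ injective p, injective q & forall i j, (p i, q j) \in M].
Proof.
pose m := 4 * D * K.
exists (2 * D * m + m * 2 ^ m + 1) => T P Q M h h0 cP cQ MPQ cM.
pose deg x := #|[set y in Q | (x, y) \in M]|.
have sumM (N : {set T * T}) : N \subset setX P Q -> #|N| = \sum_(x in P) #|[set y in Q | (x, y) \in N]|.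
  move=> NPQ; rewrite -sum1_card (partition_big (fun u => u.1) (mem P)) /=; last first.
    by move=> u /(fintype.subsetP NPQ); rewrite inE => /andP[].
  apply: eq_bigr => x xP; rewrite sum1_card.
  rewrite -[RHS](@card_imset _ _ (fun y => (x, y))); last by move=> y y' [].
  apply: eq_card => -[u v]; rewrite [LHS]unfold_in; apply/andP/imsetP => /=.
    case=> uvN /eqP ux; exists v; rewrite ?ux // inE -ux uvN andbT.
    by have := fintype.subsetP NPQ _ uvN; rewrite inE => /andP[].
  by case=> y; rewrite inE => /andP[yQ xy] [-> ->]; rewrite xy eqxx.
have degh x : deg x <= h by rewrite -cQ; apply: subset_leq_card; apply/fintype.subsetP => y; rewrite inE => /andP[].
pose Rich := [set x in P | h <= 2 * D * deg x].
have hpos : 0 < h by lia.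
have cR : h <= 2 * D * #|Rich|.
  have : 2 * D * #|M| <= 2 * D * #|Rich| * h + h * h.
    rewrite (sumM _ MPQ) big_distrr /= (bigID (mem Rich)) /=; apply: leq_add.
      rewrite -mulnA -sum_nat_const big_distrr /=; rewrite [X in _ <= X](_ : _ = \sum_(x in P | x \in Rich) 2 * D * h).
        by apply: leq_sum => x _; rewrite leq_mul2l degh orbT.
      by apply: eq_bigl => x; rewrite inE; case: (x \in P).
    rewrite -{1}cP -sum_nat_const; rewrite [X in _ <= X](bigID (mem Rich)) /=.
    apply: leq_trans (leq_addl _ _); apply: leq_sum => x /andP[xP].
    by rewrite inE xP /= -ltnNge => /ltnW.
  by nia.
have mR : m <= #|Rich| by nia.
have [p' p'i p'R] := exists_inj_ord mR.
pose c y := [set i : 'I_m | (p' i, y) \in M].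
pose Good := [set y in Q | K <= #|c y|].
have cG : K * h <= #|Good| * m.
  have : \sum_(i < m) deg (p' i) <= #|Good| * m + h * K.
    have -> : \sum_(i < m) deg (p' i) = \sum_(y in Q) #|c y|.
      rewrite (eq_bigr (fun i => \sum_(y in Q | (p' i, y) \in M) 1)); last first.
        by move=> i _; rewrite sum1_card; apply: eq_card => y; rewrite !inE.
      rewrite (exchange_big_dep (mem Q)) /=; last by move=> i y _ /andP[].
      apply: eq_bigr => y yQ; rewrite sum1_card; apply: eq_card => i.
      by rewrite !inE yQ.
    rewrite (bigID (mem Good)) /=; apply: leq_add.
      rewrite -sum_nat_const; rewrite [X in _ <= X](_ : _ = \sum_(x in Q | x \in Good) m).
        by apply: leq_sum => y _; rewrite -[X in _ <= X]card_ord max_card.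
      by apply: eq_bigl => x; rewrite inE; case: (x \in Q).
    rewrite -{1}cQ -sum_nat_const; rewrite [X in _ <= X](bigID (mem Good)) /=.
    apply: leq_trans (leq_addl _ _); apply: leq_sum => x /andP[xQ].
    by rewrite inE xQ /= -ltnNge => /ltnW.
  have : m * h <= 2 * D * \sum_(i < m) deg (p' i).
    rewrite big_distrr /= -{1}[m]card_ord -sum_nat_const; apply: leq_sum => i _.
    by have := p'R i; rewrite inE => /andP[].
  rewrite {1}/m; case: (posnP D) => [D0|Dp]; first by move: cM; rewrite D0; nia.
  by nia.
have [S hS] : exists S, K <= #|[set y in Good | c y == S]|.
  apply/existsP; apply: contraT; rewrite negb_exists => /forallP hn.
  have : #|Good| <= 2 ^ m * K.-1.
    have -> : 2 ^ m = #|[set: {set 'I_m}]| by rewrite -powersetT card_powerset cardsT card_ord.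
    apply: (@leq_card_cover _ _ _ _ (fun S y => c y == S)) => [y yG|S _]; first by exists (c y).
    by have := hn S; rewrite -ltnNge => /leq_trans; case: (K) (hn S) => //= k; rewrite -ltnNge ltnS.
  have [K0|Kp] := posnP K; first by have := hn set0; rewrite K0 leq0n.
  move=> hG; have : K * h <= 2 ^ m * K.-1 * m by apply: leq_trans cG _; rewrite leq_mul2r hG orbT.
  move=> a; have : K * h <= K * (m * 2 ^ m).
    by apply: leq_trans a _; rewrite mulnC mulnA [X in _ <= X]mulnC leq_mul2l leq_pred orbT.
  by rewrite leq_mul2l; lia.
have [q qi qG] := exists_inj_ord hS.
case: (posnP K) => [K0|Kp].
  have nf : forall i : 'I_K, False by move=> i; have := ltn_ord i; lia.
  by exists q, q; split=> // i; case: (nf i).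
have KS : K <= #|S|.
  by have := qG (Ordinal Kp); rewrite !inE => /andP[/andP[_ h1] /eqP <-].
have [r ri rS] := exists_inj_ord KS.
exists (fun i => p' (r i)), q; split=> // [i j /p'i/ri //|i j].
by have := qG j; rewrite !inE => /andP[_ /eqP e]; have := rS i; rewrite -e inE.
Qed.

(** * Gadgets *)

Lemma exists_maximal_disjoint_tuples (X T : finType) (P : (X -> T) -> Prop) (A : {set T}) :
  0 < #|X| -> exists b (gs : 'I_b -> X -> T),
     [/\ forall i x j y, gs i x = gs j y -> i = j /\ x = y,
         forall i x, gs i x \in A, forall i, P (gs i) &
         forall g, injective g -> (forall x, g x \in A :\: [set gs u.1 u.2 | u in {: 'I_b * X}]) -> ~ P g].
Proof.
move=> X0.
pose Q b := exists gs : 'I_b -> X -> T,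
     [/\ forall i x j y, gs i x = gs j y -> i = j /\ x = y,
         forall i x, gs i x \in A & forall i, P (gs i)].
have Q0 : Q 0.
  have f : 'I_0 -> X -> T by case.
  by exists f; split; case.
have Qb b : Q b -> b <= #|A|.
  case=> gs [gi gA _]; have [x0 _] : exists x, x \in X.
    by apply/card_gt0P.
  rewrite -[b]card_ord -(@card_imset _ _ (fun i => gs i x0)); last by move=> i j /gi[].
  by apply: subset_leq_card; apply/fintype.subsetP => y /imsetP[i _ ->].
have [b [Qb1 Qb2]] : exists b, Q b /\ ~ Q b.+1.
  apply: contrapT => no.
  have allQ b : Q b.
    by elim: b => // b IH; apply: contrapT => n; apply: no; exists b.
  by have := Qb _ (allQ #|A|.+1); rewrite ltnn.
case: Qb1 => gs [gi gA gP]; exists b, gs; split=> // g g1 g2 g3; apply: Qb2.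
have gR i x y : gs i x <> g y.
  move=> e; have := g2 y; rewrite inE -e => /andP[/negP h _]; apply: h.
  by apply/imsetP; exists (i, x).
exists (fun i => if unlift ord_max i is Some j then gs j else g); split.
- move=> i x j y; case: unliftP => [i' ->|->]; case: unliftP => [j' ->|->].
  + by move/gi => [-> ->].
  + by move/gR.
  + by move/esym/gR.
  + by move/g1 => ->.
- move=> i x; case: unliftP => [i' _|_] //.
  by have := g2 x; rewrite inE => /andP[].
- by move=> i; case: unliftP.
Qed.

(** An induced pentagon through a vertex outside a gadget uses two vertices on each side; their four
    mutual adjacencies must be available whatever large sets the vertices are taken from. *)
Definition rich K s (J : {set 'I_K * 'I_K}) :=
  forall (X X' Y Y' : {set 'I_K}) (t : {set bool * bool}),
    [disjoint X & X'] -> [disjoint Y & Y'] ->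
    s <= #|X| -> s <= #|X'| -> s <= #|Y| -> s <= #|Y'| ->
    exists (x : bool -> 'I_K) (y : bool -> 'I_K),
      [/\ x true \in X, x false \in X', y true \in Y, y false \in Y' &
          forall u v, ((x u, y v) \in J) = ((u, v) \in t)].

(** Union bound over [2 ^ (4 * K + 4)] choices of four sets and a pattern. A failure makes [s * s]
    disjoint 2 by 2 blocks miss one of 16 patterns, which has probability at most
    [(15/16) ^ (s * s)], and [s] is linear in [K]. *)
Lemma rich_exists (R : realType) (eta : R) : (0 < eta)%R ->
  exists K0, forall K s, K0 <= K -> (eta * K%:R <= s%:R)%R -> exists J, @rich K s J.
Proof.
move=> eta0.
have [c c0 hc] : exists2 c : R, (0 < c)%R & le2 15 (4 - c)%R.
  by apply: (@le2_pred R 16) => //; apply: (le2_exp2 R 4).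
pose e := (c * eta * eta)%R.
have e0 : (0 < e)%R by rewrite !mulr_gt0.
exists (Num.truncn (10 / e)%R).+2 => K s hK hs.
have hK' : (10 / e < K%:R)%R.
  by apply: (lt_le_trans (truncnS_gt _)); rewrite ler_nat; apply: leq_trans hK; rewrite ltnW.
apply: contrapT => no.
pose I := ({set 'I_K} * {set 'I_K} * {set 'I_K} * {set 'I_K} * {set bool * bool})%type.
pose ok (i : I) (J : {set 'I_K * 'I_K}) := let: (X, X', Y, Y', t) := i in
    [/\ [disjoint X & X'], [disjoint Y & Y'], [/\ s <= #|X|, s <= #|X'|, s <= #|Y| & s <= #|Y'|] &
    forall (x y : bool -> 'I_K), x true \in X -> x false \in X' -> y true \in Y -> y false \in Y' ->
      ~ forall u v, ((x u, y v) \in J) = ((u, v) \in t)].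
pose b := 15 ^ (s * s) * 2 ^ (K * K - 4 * (s * s)).
have cov : #|[set: {set 'I_K * 'I_K}]| <= #|[set: I]| * b.
  apply: (@leq_card_cover _ _ _ _ (fun i J => `[< ok i J >])) => [J _|[[[[X X'] Y] Y'] t] _].
    apply: contrapT => nJ; apply: no; exists J => X X' Y Y' t d1 d2 h1 h2 h3 h4.
    apply: contrapT => nx; apply: nJ; exists (X, X', Y, Y', t) => //.
    apply/asboolP; split=> // x y h5 h6 h7 h8 h; apply: nx; by exists x, y.
  case: (EM ([disjoint X & X'] /\ [disjoint Y & Y'] /\ [/\ s <= #|X|, s <= #|X'|, s <= #|Y| & s <= #|Y'|])); last first.
    move=> n; rewrite (_ : [set _ in _ | _] = set0) ?cards0 //; apply/setP => J; rewrite !inE /=.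
    by apply/asboolP => -[h1 h2 h3 _]; apply: n.
  case=> d1 [d2 [h1 h2 h3 h4]].
  have [x1 x1i x1X] := exists_inj_ord h1; have [x0 x0i x0X] := exists_inj_ord h2.
  have [y1 y1i y1Y] := exists_inj_ord h3; have [y0 y0i y0Y] := exists_inj_ord h4.
  pose xx i (u : bool) := if u then x1 i else x0 i.
  pose yy i (u : bool) := if u then y1 i else y0 i.
  pose g (i : 'I_s * 'I_s) (w : bool * bool) := (xx i.1 w.1, yy i.2 w.2).
  have inj2 (Z Z' : {set 'I_K}) (z1 z0 : 'I_s -> 'I_K) : [disjoint Z & Z'] -> injective z1 -> injective z0 ->
     (forall i, z1 i \in Z) -> (forall i, z0 i \in Z') ->
     forall i u j v, (if u then z1 i else z0 i) = (if v then z1 j else z0 j) -> i = j /\ u = v.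
    move=> d i1 i0 m1 m0 i [] j [] /= h.
    - by move/i1: h => ->.
    - by have := disjointFr d (m1 i); rewrite h m0.
    - by have := disjointFr d (m1 j); rewrite -h m0.
    - by move/i0: h => ->.
  have gi i w j z : g i w = g j z -> i = j /\ w = z.
    case: i j w z => i i' [j j'] [u u'] [v v'] [].
    move=> /(inj2 _ _ _ _ d1 x1i x0i x1X x0X)[/= -> ->].
    by move=> /(inj2 _ _ _ _ d2 y1i y0i y1Y y0Y)[/= -> ->].
  have := @card_block_traces _ _ _ g setT [set~ t] gi (fun _ _ => in_setT _).
  rewrite cardsT !card_prod !card_ord card_bool cardsC1 -(cardsT {set bool * bool}) -powersetT card_powerset cardsT card_prod card_bool /=.
  rewrite -/b => hb; apply: leq_trans hb; apply: subset_leq_card; apply/fintype.subsetP => J.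
  rewrite !inE subsetT /= => /asboolP[_ _ _ h]; apply/forallP => i; rewrite !inE.
  apply/eqP => et; apply: (h (xx i.1) (yy i.2) (x1X _) (x0X _) (y1Y _) (y0Y _)) => u v.
  by rewrite -et inE.
have : le2 (R := R) #|[set: {set 'I_K * 'I_K}]| ((K * K)%:R - 1)%R.
  apply: le2_leq cov _.
  have -> : #|[set: I]| = 2 ^ (4 * K + 4).
    rewrite cardsT !card_prod -!(cardsT {set _}) -!powersetT !card_powerset !cardsT card_prod card_bool card_ord.
    by rewrite -!expnD; congr (2 ^ _); lia.
  (* If [2 * s > K], two disjoint sets of size [s] do not fit and every pattern is rich. *)
  have [sK|Ks] := leqP (4 * (s * s)) (K * K); last first.
    case: (posnP s) => [s0|sp].
      by move: hs hK'; rewrite s0 mulr0n => hs hK'; exfalso; move: Ks; rewrite s0; lia.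
    case: (leqP (2 * s) K) => [|hs2]; first by nia.
    exfalso; apply: no; exists set0 => X X' Y Y' t d1 d2 h1 h2 h3 h4.
    have : #|X| + #|X'| <= K.
      have := cardsUI X X'; rewrite (_ : X :&: X' = set0) ?cards0 ?addn0 => [<-|].
        by rewrite -[X in _ <= X]card_ord max_card.
      by apply/eqP; rewrite setI_eq0.
    by move=> ?; have : False by lia.
  apply: le2_weak (le2M (le2_exp2 _ _) (le2M (le2X (s * s) hc) (le2_exp2 _ _))) _.
  rewrite natrB // !natrD !natrM.
  have K1 : (1 <= K%:R :> R)%R by rewrite ler1n; apply: leq_trans hK.
  have h1 : (10 < e * K%:R)%R by rewrite mulrC -ltr_pdivrMr.
  have h2 : (e * K%:R * K%:R <= c * (s%:R * s%:R))%R.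
    rewrite /e -!mulrA ler_pM2l // mulrA [X in (X <= _)%R](_ : _ = (eta * K%:R) * (eta * K%:R))%R; last by ring.
    by apply: ler_pM => //; rewrite mulr_ge0 // ltW.
  have h3 : (10 * K%:R <= e * K%:R * K%:R)%R by rewrite ler_wpM2r // ltW.
  by nra.
rewrite -powersetT card_powerset cardsT card_prod card_ord /le2 natrX -powR_mulrn ?ler0n //.
rewrite -[X in (X <= _)%R -> _]mulr1 powRD ?pnatr_eq0 ?implybT // powRN powRr1 ?ler0n //.
by rewrite ler_pM2l ?powR_gt0 //; apply/negP; rewrite -ltNge invf_lt1 // ltr1n.
Qed.

(** * Gadgets in graphs without induced pentagons *)

Section Gadget.
Variables (K : nat) (J : {set 'I_K * 'I_K}).

(** The three booleans make the notion invariant under complementation. *)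
Definition is_gad (T : finType) (G : sgraph T) (g : 'I_K + 'I_K -> T) :=
  injective g /\ exists c1 c2 c3 : bool,
  [/\ forall i j, i != j -> adj G (g (inl i)) (g (inl j)) = c1,
      forall i j, i != j -> adj G (g (inr i)) (g (inr j)) = c2 &
      forall i j, adj G (g (inl i)) (g (inr j)) = ((i, j) \in J) (+) c3].

Definition gadfree (T : finType) (G : sgraph T) (A : {set T}) :=
  forall g, (forall x, g x \in A) -> ~ is_gad G g.

Lemma gadfree_sub (T : finType) (G : sgraph T) (A B : {set T}) :
  A \subset B -> gadfree G B -> gadfree G A.
Proof. by move=> /fintype.subsetP s h g gA; apply: h => x; apply: s. Qed.

Lemma is_gad_compl (T : finType) (G : sgraph T) g : is_gad G g -> is_gad (compl G) g.
Proof.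
move=> [gi [c1 [c2 [c3 [h1 h2 h3]]]]]; split=> //; exists (~~ c1), (~~ c2), (~~ c3).
split=> i j; rewrite adj_compl (inj_eq gi).
- by move=> ij; rewrite h1 // (_ : inl i != inl j) //.
- by move=> ij; rewrite h2 // (_ : inr i != inr j) //.
- by rewrite h3 /= addbN.
Qed.

Lemma gadfree_compl (T : finType) (G : sgraph T) A : gadfree G A -> gadfree (compl G) A.
Proof. by move=> h g gA /is_gad_compl; rewrite complK; apply: h. Qed.

Definition near_hom (s : nat) (D : {set 'I_K}) := (#|D| < s) || (#|~: D| < s).

Definition trl (D : {set 'I_K + 'I_K}) := [set i | inl i \in D].
Definition trr (D : {set 'I_K + 'I_K}) := [set i | inr i \in D].

Lemma split2 (D : {set 'I_K}) s : s + s <= #|D| ->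
  exists X Y : {set 'I_K}, [/\ X \subset D, Y \subset D, [disjoint X & Y], s <= #|X| & s <= #|Y|].
Proof.
move=> h; have [p pi pD] := exists_inj_ord h.
exists [set p (lshift s i) | i in 'I_s], [set p (rshift s i) | i in 'I_s]; split.
- by apply/fintype.subsetP => x /imsetP[i _ ->].
- by apply/fintype.subsetP => x /imsetP[i _ ->].
- apply/pred0P => x /=; apply/negbTE/negP => /andP[/imsetP[i _ ->] /imsetP[j _ /pi]].
  by move/(congr1 val) => /= e; have := ltn_ord i; rewrite e; lia.
- by rewrite card_imset ?card_ord // => i j /pi/lshift_inj.
- by rewrite card_imset ?card_ord // => i j /pi/rshift_inj.
Qed.

(** If [v] were mixed on both sides, richness would supply two vertices on each side that close an
    induced pentagon with [v]. The four cases are the types of the two sides, and [c3] is absorbed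
    in the requested pattern. *)
Lemma gadget_trace (T : finType) (G : sgraph T) g v s :
  C5free G -> rich s J -> is_gad G g -> (forall x, g x != v) ->
  near_hom (s + s) (trl [set x | adj G v (g x)]) \/ near_hom (s + s) (trr [set x | adj G v (g x)]).
Proof.
move=> CG rJ [gi [c1 [c2 [c3 [h1 h2 h3]]]]] gv.
set tr := [set x | _].
case nl : (near_hom _ (trl tr)); first by left.
case nr : (near_hom _ (trr tr)); first by right.
move/negbT: nl; move/negbT: nr; rewrite /near_hom !negb_or -!leqNgt => /andP[q1 q0] /andP[p1 p0].
exfalso.
(* Two disjoint sets for each adjacency to [v]: when one side is a clique and the other is stable,
   the pentagon takes two vertices of the same adjacency to [v] on each side. *)
have P (b : bool) : exists X Y : {set 'I_K}, [/\ forall i, i \in X -> adj G v (g (inl i)) = b,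
    forall i, i \in Y -> adj G v (g (inl i)) = b, [disjoint X & Y], s <= #|X| & s <= #|Y|].
  have [X [Y [XD YD d hX hY]]] := split2 (if b as b return s + s <= #|if b then trl tr else ~: trl tr| then p1 else p0).
  by exists X, Y; split=> // i iX; [have := fintype.subsetP XD i iX|have := fintype.subsetP YD i iX];
    case: b {XD YD}; rewrite !inE // => /negbTE.
have Q (b : bool) : exists X Y : {set 'I_K}, [/\ forall i, i \in X -> adj G v (g (inr i)) = b,
    forall i, i \in Y -> adj G v (g (inr i)) = b, [disjoint X & Y], s <= #|X| & s <= #|Y|].
  have [X [Y [XD YD d hX hY]]] := split2 (if b as b return s + s <= #|if b then trr tr else ~: trr tr| then q1 else q0).
  by exists X, Y; split=> // i iX; [have := fintype.subsetP XD i iX|have := fintype.subsetP YD i iX];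
    case: b {XD YD}; rewrite !inE // => /negbTE.
have [X1 [X1' [P1 P1' dX1 sX1 sX1']]] := P true; have [X0 [X0' [P0 P0' dX0 sX0 sX0']]] := P false.
have [Y1 [Y1' [Q1 Q1' dY1 sY1 sY1']]] := Q true; have [Y0 [Y0' [Q0 Q0' dY0 sY0 sY0']]] := Q false.
have dj (f : 'I_K -> bool) (X Y : {set 'I_K}) : (forall i, i \in X -> f i = true) -> (forall i, i \in Y -> f i = false) -> [disjoint X & Y].
  move=> fX fY; apply/pred0P => x /=; apply/negbTE/negP => /andP[/fX e1 /fY e2].
  by rewrite e1 in e2.
have dX := dj _ _ _ P1 P0; have dY := dj _ _ _ Q1 Q0.
pose tt (a b c d : bool) : {set bool * bool} :=
  [set w | (if w.1 then (if w.2 then a else b) else (if w.2 then c else d)) (+) c3].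
have ne (x : bool -> 'I_K) (X Y : {set 'I_K}) : [disjoint X & Y] -> x true \in X -> x false \in Y -> x true != x false.
  by move=> d xX xY; apply: contraTneq xX => e; rewrite e (disjointFl d xY).
have tadj a b c d x y : (forall u w, ((x u, y w) \in J) = ((u, w) \in tt a b c d)) ->
  [/\ adj G (g (inl (x true))) (g (inr (y true))) = a,
      adj G (g (inl (x true))) (g (inr (y false))) = b,
      adj G (g (inl (x false))) (g (inr (y true))) = c &
      adj G (g (inl (x false))) (g (inr (y false))) = d].
  by move=> h; split; rewrite h3 h inE /= addbK.
case: c1 h1 => h1; case: c2 h2 => h2.
- have [x [y [x1 x0 y1 y0 /tadj[e1 e2 e3 e4]]]] := rJ X1 X0 Y1 Y0 (tt false false false true) dX dY sX1 sX0 sY1 sY0.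
  apply: (CG v (g (inl (x true))) (g (inl (x false))) (g (inr (y false))) (g (inr (y true)))).
  have nx := ne _ _ _ dX x1 x0; have ny : y false != y true by rewrite eq_sym; apply: ne dY y1 y0.
  rewrite (P1 _ x1) (P0 _ x0) (Q0 _ y0) (adj_sym G _ v) (Q1 _ y1) h1 // h2 // e4.
  by rewrite e2 e1 e3.
- have [x [y [x1 x0 y1 y0 /tadj[e1 e2 e3 e4]]]] := rJ X0 X0' Y1 Y1' (tt true false false true) dX0 dY1 sX0 sX0' sY1 sY1'.
  apply: (CG v (g (inr (y true))) (g (inl (x true))) (g (inl (x false))) (g (inr (y false)))).
  have nx := ne _ _ _ dX0 x1 x0; have ny := ne _ _ _ dY1 y1 y0.
  rewrite (Q1 _ y1) (adj_sym G (g (inr (y true)))) e1 h1 // e4 (adj_sym G _ v) (Q1' _ y0).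
  by rewrite (P0 _ x1) (P0' _ x0) (adj_sym G (g (inr (y true)))) e3 h2 // e2.
- have [x [y [x1 x0 y1 y0 /tadj[e1 e2 e3 e4]]]] := rJ X1 X1' Y0 Y0' (tt true false false true) dX1 dY0 sX1 sX1' sY0 sY0'.
  apply: (CG v (g (inl (x true))) (g (inr (y true))) (g (inr (y false))) (g (inl (x false)))).
  have nx := ne _ _ _ dX1 x1 x0; have ny := ne _ _ _ dY0 y1 y0.
  rewrite (P1 _ x1) e1 h2 // (adj_sym G (g (inr (y false)))) e4 (adj_sym G _ v) (P1' _ x0).
  by rewrite (Q0 _ y1) (Q0' _ y0) e2 h1 // (adj_sym G (g (inr (y true)))) e3.
- have [x [y [x1 x0 y1 y0 /tadj[e1 e2 e3 e4]]]] := rJ X1 X0 Y1 Y0 (tt false true true true) dX dY sX1 sX0 sY1 sY0.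
  apply: (CG v (g (inl (x true))) (g (inr (y false))) (g (inl (x false))) (g (inr (y true)))).
  have nx := ne _ _ _ dX x1 x0; have ny : y false != y true by rewrite eq_sym; apply: ne dY y1 y0.
  rewrite (P1 _ x1) e2 (adj_sym G (g (inr (y false))) (g (inl _))) e4 e3 (adj_sym G _ v) (Q1 _ y1).
  by rewrite (Q0 _ y0) (P0 _ x0) h1 // e1 h2.
Qed.

(** * The number of gadget-free graphs *)

Definition gadfree_graphs (T : finType) (A : {set T}) : {set sgraph T} :=
  [set restr G A | G in [set G | `[< gadfree G A >]]].

Section GadfreeCount.
Variables (T : finType) (A : {set T}) (h D s : nat).
Hypothesis K0 : 0 < K.
Hypothesis h0 : 0 < h.
Hypothesis kst : forall (P Q : {set T}) (M : {set T * T}),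
  #|P| = h -> #|Q| = h -> M \subset setX P Q -> h * h <= D * #|M| ->
  exists (p q : 'I_K -> T), [/\ injective p, injective q & forall i j, (p i, q j) \in M].

Definition cluster (c : {ffun T -> option T}) l := [set x | c x == Some l].

(** [ct.1] sends a vertex of a homogeneous set of size [h] to a representative of that set, and a
    leftover vertex to [None]; [ct.2] tells cliques from stable sets. Ramsey's theorem bounds the
    leftover of a maximal packing. *)
Definition clustering (ct : {ffun T -> option T} * {ffun T -> bool}) (H : sgraph T) :=
  [/\ forall l, cluster ct.1 l = set0 \/ (#|cluster ct.1 l| = h /\
        forall x y, x \in cluster ct.1 l -> y \in cluster ct.1 l -> x != y -> adj H x y = ct.2 l),
      #|[set x in A | ct.1 x == None]| <= 2 ^ (h + h),
      gadfree H A & forall x y, adj H x y -> (x \in A) && (y \in A)].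

Lemma clustering_exists H : H \in gadfree_graphs A -> exists ct, clustering ct H.
Proof.
case/imsetP => G; rewrite inE => /asboolP gG ->.
set H' := restr G A.
have adjH x y : x \in A -> y \in A -> adj H' x y = adj G x y.
  by move=> xA yA; rewrite adj_restr xA yA.
pose P (g : 'I_h -> T) := cliq H' [set g i | i in 'I_h] \/ stab H' [set g i | i in 'I_h].
have hI : 0 < #|'I_h| by rewrite card_ord.
have [b [gs [gi gA gP gmax]]] := exists_maximal_disjoint_tuples P A hI.
set im := [set _ | _ in _] in gmax.
pose z0 : 'I_h := Ordinal h0.
pose c : {ffun T -> option T} := [ffun x => if [pick u : 'I_b * 'I_h | gs u.1 u.2 == x] is Some u then Some (gs u.1 z0) else None].
have cE i j : c (gs i j) = Some (gs i z0).
  rewrite ffunE; case: pickP => [u /eqP/gi[-> _] //|/(_ (i, j))]; by rewrite eqxx.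
have cS x l : c x = Some l -> exists i j, x = gs i j /\ l = gs i z0.
  by rewrite ffunE; case: pickP => // u /eqP <- [<-]; exists u.1, u.2.
have clE i : cluster c (gs i z0) = [set gs i j | j in 'I_h].
  apply/setP => x; rewrite inE; apply/eqP/imsetP => [/cS[i' [j [-> /gi[-> _]]]]|[j _ ->]].
    by exists j.
  exact: cE.
pose t : {ffun T -> bool} := [ffun l => `[< cliq H' (cluster c l) >]].
exists (c, t); split=> /=.
- move=> l; case: (set_0Vmem (cluster c l)) => [->|[x]]; first by left.
  rewrite inE => /eqP/cS[i [j [ex el]]]; right; rewrite el clE; split.
    by rewrite card_imset ?card_ord // => u v /gi[].
  move=> u v uC vC uv; rewrite ffunE clE; case: (gP i) => hP.
    by rewrite (asboolT hP) hP.
  rewrite asboolF; first by apply/negbTE; apply: hP.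
  by move=> hc; have := hc u v uC vC uv; rewrite (negbTE (hP _ _ uC vC)).
- have -> : [set x in A | c x == None] = A :\: im.
    apply/setP => x; rewrite !inE andbC; congr (_ && _); rewrite ffunE.
    case: pickP => [u /eqP <-|no].
      by symmetry; apply/negbTE; rewrite negbK; apply/imsetP; exists u.
    by symmetry; apply/imsetP => -[u _ e]; have := no u; rewrite e eqxx.
  rewrite leqNgt; apply/negP => /ltnW /(ramsey H')[[S [SA Sc cS']]|[S [SA Ss cS']]].
    have hS : h <= #|S| by rewrite cS'.
    have [g g1 gS] := exists_inj_ord hS.
    apply: (gmax g g1) => [x|]; first by have := fintype.subsetP SA _ (gS x).
    left; apply: cliq_sub Sc; by apply/fintype.subsetP => _ /imsetP[x _ ->].
  have hS : h <= #|S| by rewrite cS'.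
  have [g g1 gS] := exists_inj_ord hS.
  apply: (gmax g g1) => [x|]; first by have := fintype.subsetP SA _ (gS x).
  right; apply: stab_sub Ss; by apply/fintype.subsetP => _ /imsetP[x _ ->].
- move=> g gA' [g1 [c1 [c2 [c3 [e1 e2 e3]]]]]; apply: (gG g gA'); split=> //.
  exists c1, c2, c3; split=> i j; rewrite -adjH ?gA' //; [exact: e1|exact: e2].
- by move=> x y; rewrite adj_restr => /and3P[-> ->].
Qed.

(** By [pajor] it is enough to count the shattered sets [M] of pairs. No pair of [M] lies inside a
    cluster, where [ct.2] fixes adjacency, and [M] is sparse between two clusters: otherwise it
    contains a [K] by [K] rectangle, on which shattering realises [J] and so a gadget. Pairs that
    meet a leftover vertex are few. *)
Lemma clustering_count ct :
  let n := #|T| in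
  (forall a, D * a <= n * n -> a + 2 ^ (h + h) * n <= s) -> 0 < D ->
  #|[set H in gadfree_graphs A | `[< clustering ct H >]]|
   <= #|[set M : {set {set T}} | (M \subset [set e : {set T} | #|e| == 2]) && (#|M| <= s)]|.
Proof.
move=> n hs D0; set S := [set H in _ | _].
have Sok H : H \in S -> clustering ct H by rewrite inE => /andP[_ /asboolP].
pose F := [set edges H | H in S].
have -> : #|S| = #|F| by rewrite card_imset //; apply: val_inj.
apply: leq_trans (pajor F) _; apply: subset_leq_card; apply/fintype.subsetP => M.
rewrite !inE => /shattersP sh.
have real (X : {set {set T}}) : X \subset M -> exists2 H, H \in S & edges H :&: M = X.
  by move=> /sh[_ /imsetP[H HS ->] e]; exists H.
have Me e : e \in M -> exists x y, [/\ e = [set x; y], x != y, x \in A, y \in A &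
    forall l, ~ (x \in cluster ct.1 l /\ y \in cluster ct.1 l)].
  move=> eM; have [|H HS eH] := real [set e]; first by rewrite sub1set.
  have eE : e \in edges H.
    have : e \in edges H :&: M by rewrite eH set11.
    by rewrite inE => /andP[].
  have /forall_inP/(_ _ eE)/cards2P[x [y [xy exy]]] := edgesP H.
  have axy : adj H x y by rewrite /adj -exy.
  have [h1 h2 h3 h4] := Sok _ HS; have /andP[xA yA] := h4 _ _ axy.
  exists x, y; split=> // l [xl yl].
  have [H' HS' eH'] := real set0 (sub0set _).
  have [h1' _ _ _] := Sok _ HS'.
  case: (h1 l) => [e0|[_ k]]; first by rewrite e0 inE in xl.
  case: (h1' l) => [e0|[_ k']]; first by rewrite e0 inE in xl.
  have : adj H' x y by rewrite k' // -(k x y).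
  by rewrite /adj -exy => eE'; have := in_set0 e; rewrite -eH' inE eE' eM.
apply/andP; split.
  apply/fintype.subsetP => e /Me[x [y [-> xy _ _ _]]]; by rewrite inE cards2 xy.
pose Lf := [set x in A | ct.1 x == None].
have [H0 HS0 _] := real set0 (sub0set _).
have [c1 cLf _ _] := Sok _ HS0.
pose Lab := [set l | cluster ct.1 l != set0].
have cLab : #|Lab| * h <= n.
  have -> : #|Lab| * h = \sum_(l in Lab) #|cluster ct.1 l|.
    rewrite -sum_nat_const; apply: eq_bigr => l; rewrite inE.
    by case: (c1 l) => [->|[-> _]] //; rewrite eqxx.
  have -> : \sum_(l in Lab) #|cluster ct.1 l| = #|[set x | if ct.1 x is Some l then l \in Lab else false]|.
    rewrite -[RHS]sum1_card [RHS](partition_big (fun x => odflt x (ct.1 x)) (mem Lab)) /=; last first.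
      by move=> x; rewrite inE; case: (ct.1 x).
    apply: eq_bigr => l lL; rewrite -sum1_card; apply: eq_bigl => x; rewrite !inE.
    case: (ct.1 x) => [l'|] //=; rewrite [Some _ == _](_ : _ = (l' == l)) //.
    by case: (altP (l' =P l)) => [->|]; rewrite ?andbF // ; move: lL; rewrite inE => ->.
  exact: max_card.
pose ML := [set e in M | [exists x in Lf, x \in e]].
pose MC := M :\: ML.
have cML : #|ML| <= 2 ^ (h + h) * n.
  apply: (@leq_trans (#|setX Lf [set: T]| * 1)); last first.
    by rewrite muln1 cardsX cardsT leq_mul2r cLf orbT.
  apply: (@leq_card_cover _ _ _ _ (fun u e => e == [set u.1; u.2])) => [e|u _].
    rewrite inE => /andP[eM /exists_inP[x xL xe]]; have [y [z [ee yz _ _ _]]] := Me _ eM.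
    move: xe; rewrite ee !inE => /orP[] /eqP ex.
      by exists (x, z); rewrite /= -?ex //; apply/setXP; split=> //; rewrite inE.
    by exists (x, y); rewrite /= -?ex 1?setUC //; apply/setXP; split=> //; rewrite inE.
  rewrite -(cards1 [set u.1; u.2]); apply: subset_leq_card.
  by apply/fintype.subsetP => e; rewrite !inE => /andP[].
pose MM l l' := [set u in setX (cluster ct.1 l) (cluster ct.1 l') | [set u.1; u.2] \in M].
have cMM l l' : l \in Lab -> l' \in Lab -> D * #|MM l l'| < h * h.
  rewrite !inE => lL lL'; rewrite ltnNge; apply/negP => hM.
  have sz k : cluster ct.1 k != set0 -> #|cluster ct.1 k| = h by case: (c1 k) => [->|[-> _]] //; rewrite eqxx.
  have [|p [q [pi qi pq]]] := kst (sz _ lL) (sz _ lL') _ hM.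
    by apply/fintype.subsetP => u; rewrite !inE => /andP[].
  have {pq}pq i j : [/\ p i \in cluster ct.1 l, q j \in cluster ct.1 l' & [set p i; q j] \in M].
    by have := pq i j; rewrite !inE /= => /andP[/andP[-> ->] ->].
  have ll : l != l'.
    apply/eqP => e; have [p1 p2 p3] := pq (Ordinal K0) (Ordinal K0).
    have [x [y [exy xy _ _ no]]] := Me _ p3; apply: (no l); move: p2; rewrite -e => p2.
    have sub z : z \in [set x; y] -> z \in cluster ct.1 l.
      by rewrite -exy => /set2P[] ->.
    by split; apply: sub; rewrite ?set21 ?set22.
  have dj x : x \in cluster ct.1 l -> x \in cluster ct.1 l' -> False.
    by rewrite !inE => /eqP -> /eqP[e]; rewrite e eqxx in ll.
  have pNq i j : p i <> q j.
    by move=> e; have [p1 p2 _] := pq i j; apply: (dj (p i)) => //; rewrite e.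
  (* Shattering provides a graph of the class whose edges within [M] are exactly the copy of [J] in
     the rectangle. *)
  have [|H HS eH] := real [set [set p u.1; q u.2] | u in J].
    by apply/fintype.subsetP => _ /imsetP[u _ ->]; case: (pq u.1 u.2).
  have [_ _ gH _] := Sok _ HS.
  have pA i : p i \in A.
    have [_ _ p3] := pq i (Ordinal K0); have [x [y [exy _ xA yA _]]] := Me _ p3.
    have : p i \in [set x; y] by rewrite -exy set21.
    by case/set2P => ->.
  have qA i : q i \in A.
    have [_ _ p3] := pq (Ordinal K0) i; have [x [y [exy _ xA yA _]]] := Me _ p3.
    have : q i \in [set x; y] by rewrite -exy set22.
    by case/set2P => ->.
  apply: (gH (fun u => match u with inl i => p i | inr j => q j end)).
    by case.
  split.
    move=> [i|i] [j|j]; [by move/pi=> ->|by move/pNq|by move/esym/pNq|by move/qi=> ->].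
  have [h1 _ _ _] := Sok _ HS.
  have inner k (r : 'I_K -> T) : injective r -> (forall i, r i \in cluster ct.1 k) ->
     forall i j, i != j -> adj H (r i) (r j) = ct.2 k.
    move=> ri rk i j ij; case: (h1 k) => [e0|[_ hh]]; first by have := rk i; rewrite e0 inE.
    by apply: hh => //; rewrite (inj_eq ri).
  exists (ct.2 l), (ct.2 l'), false; split.
  - by apply: inner => // i; case: (pq i i).
  - by apply: inner => // i; case: (pq i i).
  - move=> i j; rewrite addbF; have [p1 p2 p3] := pq i j.
    have -> : adj H (p i) (q j) = ([set p i; q j] \in edges H :&: M) by rewrite inE p3 andbT.
    rewrite eH; apply/imsetP/idP => [[[i' j'] ijJ /= e]|ijJ]; last by exists (i, j).
    have : p i \in [set p i'; q j'] by rewrite -e set21.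
    have : q j \in [set p i'; q j'] by rewrite -e set22.
    by rewrite !inE => /orP[/eqP/esym/pNq//|/eqP/qi ->] /orP[/eqP/pi ->|/eqP/pNq].
have cMC : D * #|MC| <= n * n.
  apply: (@leq_trans (D * (#|setX Lab Lab| * (h * h %/ D)))).
    rewrite leq_mul2l; apply/orP; right.
    apply: (@leq_card_cover _ _ _ _ (fun u e => [exists x in cluster ct.1 u.1, exists y in cluster ct.1 u.2, e == [set x; y]])).
      move=> e; rewrite inE => /andP[nL eM]; have [x [y [ee xy xA yA no]]] := Me _ eM.
      have lab z : z \in e -> z \in A -> exists l, z \in cluster ct.1 l /\ l \in Lab.
        move=> ze zA; case ez : (ct.1 z) => [l|].
          exists l; rewrite !inE ez eqxx; split=> //; apply/set0Pn; exists z; by rewrite inE ez.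
        exfalso; move/negP: nL; apply; rewrite inE eM; apply/exists_inP; exists z => //.
        by rewrite inE zA ez.
      have xe : x \in e by rewrite ee set21.
      have ye : y \in e by rewrite ee set22.
      have [l [xl lL]] := lab x xe xA; have [l' [yl lL']] := lab y ye yA.
      exists (l, l'); first by rewrite inE lL.
      apply/exists_inP; exists x => //; apply/exists_inP; exists y => //; by rewrite ee.
    move=> [l l'] /[!inE] /andP[/= lL lL'].
    rewrite leq_divRL //; apply: leq_trans (ltnW (cMM l l' _ _)); rewrite ?inE // mulnC leq_mul2l.
    apply/orP; right; apply: (@leq_trans #|[set [set u.1; u.2] | u in MM l l']|); last exact: leq_imset_card.
    apply: subset_leq_card; apply/fintype.subsetP => e.
    rewrite !inE => /andP[/andP[_ eM] /exists_inP[x xl /exists_inP[y yl /eqP ee]]].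
    by apply/imsetP; exists (x, y); rewrite // !inE /= -ee eM andbT; move: xl yl; rewrite !inE => -> ->.
  rewrite cardsX mulnCA; apply: (@leq_trans (#|Lab| * #|Lab| * (h * h))).
    by rewrite leq_mul2l mulnC leq_trunc_div orbT.
  by rewrite mulnACA; apply: leq_mul.
have -> : #|M| = #|MC| + #|ML|.
  rewrite addnC -(cardsID ML M) (_ : M :&: ML = ML) //; apply/setIidPr.
  by apply/fintype.subsetP => e; rewrite inE => /andP[].
apply: leq_trans (hs _ cMC); by rewrite leq_add2l.
Qed.
End GadfreeCount.
End Gadget.

(** There are only [2 ^ O(n log n)] clusterings, and the sparse sets of pairs are bounded by
    [le2_tail]; so the exponent is an arbitrarily small multiple of [n * n]. *)
Lemma gadfree_count (R : realType) K (J : {set 'I_K * 'I_K}) (gam : R) :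
  0 < K -> (0 < gam)%R -> exists n0, forall (T : finType) (A : {set T}), n0 <= #|T| ->
  le2 #|gadfree_graphs J A| (gam * (#|T|%:R * #|T|%:R))%R.
Proof.
move=> K0 g0.
have [b b0 tail] := @le2_tail R (gam / 2)%R (divr_gt0 g0 (ltr0Sn _ 1)).
pose D := (Num.truncn (2 / b)%R).+1.
have Db : (2 / b < D%:R)%R by apply: truncnS_gt.
have [h0 kst] := kovari_sos_turan K D.
pose h := h0.+1.
have [n1 lin] := @le2_linear R (gam / 4)%R (divr_gt0 g0 (ltr0Sn _ 3)).
pose E := (Num.truncn (2 ^ (h + h)%N * 2 / b)%R).+1.
have Eb : (2 ^ (h + h)%N * 2 / b < E%:R)%R by apply: truncnS_gt.
exists (maxn n1 E).+1 => T A hn; set n := #|T|.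
pose s := Num.truncn (b * (n%:R * n%:R))%R.
have n2 : (0 <= b * (n%:R * n%:R))%R by rewrite !mulr_ge0 // ltW.
have hs a : D * a <= n * n -> a + 2 ^ (h + h) * n <= s.
  move=> ha; rewrite -ltnS -(ltr_nat R); apply: le_lt_trans (truncnS_gt _).
  rewrite natrD natrM natrX.
  have nE : (E%:R <= n%:R :> R)%R by rewrite ler_nat; apply: leq_trans hn; apply: leq_trans (leqnSn _); apply: leq_maxr.
  have h1 : (D%:R * a%:R <= n%:R * n%:R :> R)%R by rewrite -!natrM ler_nat.
  have h2 : (2 * a%:R <= b * (n%:R * n%:R))%R.
    have : (2 / b * a%:R <= n%:R * n%:R)%R by apply: le_trans h1; apply: ler_wpM2r => //; apply: ltW.
    by rewrite mulrAC ler_pdivrMr // (mulrC b).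
  have h3 : (2 * (2 ^+ (h + h) * n%:R) <= b * (n%:R * n%:R))%R.
    have : (2 ^+ (h + h)%N * 2 / b <= n%:R)%R by apply: le_trans nE; apply: ltW.
    rewrite ler_pdivrMr // => h3.
    rewrite [X in (X <= _)%R](_ : _ = 2 ^+ (h + h) * 2 * n%:R)%R; last by ring.
    by rewrite [X in (_ <= X)%R](_ : _ = n%:R * b * n%:R)%R; [exact: ler_wpM2r|ring].
  by lra.
have cnt : #|gadfree_graphs J A| <= #|[set: {ffun T -> option T} * {ffun T -> bool}]| *
   #|[set M : {set {set T}} | (M \subset [set e : {set T} | #|e| == 2]) && (#|M| <= s)]|.
  apply: (@leq_card_cover _ _ _ _ (fun ct H => `[< @clustering K J T A h ct H >])) => [H HG|ct _]; last first.
    by apply: (@clustering_count K J T A h D s K0) => // P Q M cP; apply: kst cP; apply: leqnSn.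
  by have [ct hct] := @clustering_exists K J T A h (ltn0Sn _) H HG; exists ct => //; apply/asboolP.
apply: le2_leq cnt _.
have -> : (gam * (n%:R * n%:R) = gam / 2 * (n%:R * n%:R) + gam / 2 * (n%:R * n%:R))%R by field.
apply: le2M; last first.
  apply: tail.
    by rewrite truncn_le.
  rewrite card_draws bin2 -natrM ler_nat; apply: leq_trans (half_leq (leq_mul (leqnn n) (leq_pred n))) _.
  by rewrite -divn2 leq_div.
rewrite cardsT card_prod !card_ffun card_option card_bool -/n.
have l1 : le2 (R := R) n.+1 (gam / 4 * n%:R)%R.
  by apply: lin; apply: leq_trans hn; apply: leq_trans (leqnSn _); apply: leq_maxl.
have l2 : le2 (R := R) 2 (gam / 4 * n%:R)%R.
  by apply: le2_leq l1; rewrite ltnS; apply: leq_trans hn.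
apply: le2_weak (le2M (le2X n l1) (le2X n l2)) _.
by rewrite le_eqVlt; apply/orP; left; apply/eqP; field.
Qed.

(** * Rough structure of graphs without induced pentagons *)

Definition C5free_graphs (T : finType) := [set G : sgraph T | `[< C5free G >]].
Definition nC5free n := #|C5free_graphs 'I_n|.

Definition pull (T T' : finType) (f : T' -> T) (G : sgraph T) : sgraph T' :=
  graph_of (fun x y => adj G (f x) (f y)).

Lemma adj_pull (T T' : finType) (f : T' -> T) (G : sgraph T) x y :
  injective f -> adj (pull f G) x y = adj G (f x) (f y).
Proof.
move=> fi; rewrite adj_graph_of (adj_sym G (f y)) orbb -(inj_eq fi).
by case: (altP (f x =P f y)) => [->|] //=; rewrite adj_irrefl.
Qed.

Lemma C5free_pull (T T' : finType) (f : T' -> T) (G : sgraph T) :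
  injective f -> C5free G -> C5free (pull f G).
Proof.
move=> fi h a b c d e; rewrite !adj_pull //; exact: h.
Qed.

Lemma C5free_supported (T : finType) (S : {set T}) :
  #|[set G in C5free_graphs T | restr G S == G]| <= nC5free #|S|.
Proof.
pose f (i : 'I_#|S|) : T := enum_val i.
have fi : injective f by apply: enum_val_inj.
apply: (@leq_card_inj_in _ _ (pull f)) => [G|G G'].
  by rewrite !inE => /andP[/asboolP h _]; apply/asboolP; apply: C5free_pull.
rewrite !inE => /andP[_ /eqP e] /andP[_ /eqP e'] h; rewrite -e -e'.
apply: sgraph_ext => x y; rewrite !adj_restr.
case xS : (x \in S) => //; case yS : (y \in S) => //=.
have := congr1 (fun H => adj H (enum_rank_in xS x) (enum_rank_in xS y)) h.
by rewrite !adj_pull // /f !enum_rankK_in.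
Qed.

Lemma leq_expl m n e : m <= n -> m ^ e <= n ^ e.
Proof. by case: e => // e; rewrite leq_exp2r. Qed.

Lemma card_ffun_on_set (I T : finType) (S : {set T}) :
  #|[set h : {ffun I -> T} | h \in ffun_on [in S]]| = #|S| ^ #|I|.
Proof. by rewrite cardsE card_ffun_on. Qed.

Definition gverts (X T : finType) (g : X -> T) := [set g x | x in X].

Section R1.
Variables (K s t : nat) (J : {set 'I_K * 'I_K}).
Hypothesis s0 : 0 < s.
Hypothesis rJ : rich s J.
Local Notation X := ('I_K + 'I_K)%type.

(** The vertices off [g] are divided by the side of [g] on which their trace is almost constant: the
    right side for [A], the left side for the others. The class is small because [A] contains
    further gadgets. *)
Definition R1_at (T : finType) (g : {ffun X -> T}) (A : {set T}) (G : sgraph T) :=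
  [/\ C5free G, injective g, A \subset ~: gverts g,
    (forall v, v \in A -> near_hom (s + s) (trr [set x | adj G v (g x)])) /\
    (forall v, v \notin A -> v \notin gverts g -> near_hom (s + s) (trl [set x | adj G v (g x)])) &
    exists gs : 'I_t -> X -> T, [/\ forall i x j y, gs i x = gs j y -> i = j /\ x = y,
         forall i x, gs i x \in A & forall i, is_gad J G (gs i)]].

Definition R1 (T : finType) : {set sgraph T} :=
  [set G | `[< exists g A, R1_at g A G >]].

Definition Homs := [set D : {set 'I_K} | near_hom (s + s) D].
Definition Pats := [set D : {set X} | near_hom (s + s) (trl D) || near_hom (s + s) (trr D)].

Lemma card_gverts (T : finType) (g : X -> T) : injective g -> #|gverts g| = K + K.
Proof. by move=> gi; rewrite card_imset // card_sum card_ord. Qed.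

(** Almost constant traces cost little, so the bits to pay for are the neighbourhoods of the left
    vertices of [g] in [A] and of the right vertices in [B]. By [gadget_trace], applied to the
    gadgets [gs i], a left vertex shows only a pattern of [Pats] on each of them, which saves about
    [K] of [2 * K] bits each time. *)
Lemma R1_fiber (T : finType) (g : {ffun X -> T}) A (G' : sgraph T) :
  #|[set G | `[< R1_at g A G >] & restr G (~: gverts g) == G']|
  <= #|Homs| ^ #|T| * #|Pats| ^ (t * K) * 2 ^ (K * (#|T| - (K + K) - (K + K) * t)) * 2 ^ ((K + K) * (K + K)).
Proof.
set S := [set G | _ & _]; set V' := ~: gverts g.
case: (set_0Vmem S) => [->|[G0]]; first by rewrite cards0.
rewrite inE => /andP[/asboolP[C0 gi AV' [h1 h2] [gs [gsi gsA gsg]]] /eqP e0].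
have AV x : x \in A -> x \notin gverts g by move/(fintype.subsetP AV'); rewrite inE.
have SG G : G \in S -> R1_at g A G by rewrite inE => /andP[/asboolP].
have adjV G x y : G \in S -> x \in V' -> y \in V' -> adj G x y = adj G0 x y.
  rewrite inE => /andP[_ /eqP e] xV yV; move: (congr1 (fun H => adj H x y) e).
  by rewrite -e0 !adj_restr xV yV.
have gsG G i : G \in S -> is_gad J G (gs i).
  move=> GS; have [g1 [c1 [c2 [c3 [k1 k2 k3]]]]] := gsg i; split=> //.
  have eq x y : adj G (gs i x) (gs i y) = adj G0 (gs i x) (gs i y).
    by apply: adjV => //; apply: (fintype.subsetP AV'); apply: gsA.
  by exists c1, c2, c3; split=> a b; rewrite eq; [apply: k1|apply: k2|].
pose B := V' :\: A.
pose NA := [set N : {set T} | (N \subset A) && [forall i, (gs i @^-1: N) \in Pats]].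
pose f G := ([ffun v => if v \in A then trr [set x | adj G v (g x)] else
                if v \in gverts g then set0 else trl [set x | adj G v (g x)]] : {ffun T -> {set 'I_K}},
             [ffun j => nbh G (g (inl j)) :&: A] : {ffun 'I_K -> {set T}},
             [ffun j => nbh G (g (inr j)) :&: B] : {ffun 'I_K -> {set T}},
             [set u : X * X | adj G (g u.1) (g u.2)]).
pose cod := setX (setX (setX [set h : {ffun T -> {set 'I_K}} | h \in ffun_on [in Homs]]
                         [set h : {ffun 'I_K -> {set T}} | h \in ffun_on [in NA]])
                   [set h : {ffun 'I_K -> {set T}} | h \in ffun_on [in powerset B]])
             [set: {set X * X}].
apply: (@leq_trans #|cod|).
  apply: (@leq_card_inj_in _ _ f) => [G GS|G G1 GS GS1].
    have [CG _ _ [k1 k2] _] := SG _ GS.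
    rewrite !inE /= andbT; apply/andP; split; [apply/andP; split|]; apply/ffun_onP => v; rewrite ffunE.
    - rewrite inE; case: ifPn => vA; first exact: k1.
      case: ifPn => vg; last exact: k2.
      by rewrite /near_hom cards0 addn_gt0 s0.
    - rewrite inE subsetIr /=; apply/forallP => i; rewrite inE.
      have -> : gs i @^-1: (nbh G (g (inl v)) :&: A) = [set x | adj G (g (inl v)) (gs i x)].
        by apply/setP => x; rewrite !inE gsA andbT.
      apply/orP; apply: (gadget_trace CG rJ (gsG _ i GS)) => x.
      apply: contraNneq (AV _ (gsA i x)) => ->; by apply: imset_f.
    - by rewrite powersetE subsetIr.
  case=> /ffunP e1 /ffunP e2 /ffunP e3 /setP e4.
  have gv u v : v \in V' -> adj G (g u) v = adj G1 (g u) v.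
    move=> vV; have vg : v \notin gverts g by move: vV; rewrite inE.
    case vA : (v \in A).
      case: u => j.
        by have := e2 j; rewrite !ffunE => /setP/(_ v); rewrite !inE vA !andbT.
      have := e1 v; rewrite !ffunE vA => /setP/(_ j); rewrite !inE.
      by rewrite (adj_sym G) (adj_sym G1).
    case: u => j.
      have := e1 v; rewrite !ffunE vA (negbTE vg) => /setP/(_ j); rewrite !inE.
      by rewrite (adj_sym G) (adj_sym G1).
    have := e3 j; rewrite !ffunE => /setP/(_ v).
    by rewrite [v \in _ :&: _]inE [X in _ = X -> _]inE [v \in B]inE vA vV !andbT !inE.
  apply: sgraph_ext => x y.
  case xV : (x \in V'); case yV : (y \in V').
  - by rewrite !adjV.
  - move/negbT: yV; rewrite inE negbK => /imsetP[u _ ->].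
    by rewrite (adj_sym G) (adj_sym G1) gv.
  - by move/negbT: xV; rewrite inE negbK => /imsetP[u _ ->]; rewrite gv.
  - move/negbT: yV; rewrite inE negbK => /imsetP[u _ ->].
    move/negbT: xV; rewrite inE negbK => /imsetP[w _ ->].
    by have := e4 (w, u); rewrite !inE.
have c4 : #|[set: {set X * X}]| = 2 ^ ((K + K) * (K + K)).
  by rewrite -powersetT card_powerset cardsT card_prod card_sum card_ord.
rewrite !cardsX c4 !card_ffun_on_set !card_ord card_powerset.
rewrite leq_mul2r; apply/orP; right; rewrite -!mulnA leq_mul2l; apply/orP; right.
have cNA := @card_block_traces _ _ _ gs A Pats gsi gsA.
rewrite card_ord card_sum card_ord in cNA.
have tA : (K + K) * t <= #|A|.
  have <- : #|[set gs u.1 u.2 | u in {: 'I_t * X}]| = (K + K) * t.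
    by rewrite card_imset ?card_prod ?card_sum ?card_ord 1?mulnC // => -[i x] [j y] /= /gsi[-> ->].
  by apply: subset_leq_card; apply/fintype.subsetP => _ /imsetP[u _ ->].
have cB : #|B| = #|T| - (K + K) - #|A|.
  by rewrite cardsD (setIidPr AV') cardsCs setCK card_gverts.
have AT : #|A| <= #|T| - (K + K).
  by have := subset_leq_card AV'; rewrite [#|~: _|]cardsCs setCK card_gverts.
apply: (@leq_trans ((#|Pats| ^ t * 2 ^ (#|A| - (K + K) * t)) ^ K * (2 ^ #|B|) ^ K)).
  by rewrite leq_mul2r leq_expl ?orbT.
rewrite expnMn -!expnM -mulnA -expnD; rewrite leq_mul2l leq_exp2l // cB; apply/orP; right; nia.
Qed.

Lemma R1_count (T : finType) :
  #|R1 T| <= #|T| ^ (K + K) * 2 ^ #|T| * nC5free (#|T| - (K + K)) *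
    (#|Homs| ^ #|T| * #|Pats| ^ (t * K) * 2 ^ (K * (#|T| - (K + K) - (K + K) * t)) * 2 ^ ((K + K) * (K + K))).
Proof.
set b := (X in _ <= _ * _ * X).
have -> : #|T| ^ (K + K) * 2 ^ #|T| * nC5free (#|T| - (K + K)) * b =
   #|[set: {ffun X -> T} * {set T}]| * (nC5free (#|T| - (K + K)) * b).
  rewrite cardsT card_prod card_ffun card_sum card_ord -(cardsT {set T}) -powersetT card_powerset cardsT.
  by rewrite !mulnA.
apply: (@leq_card_cover _ _ _ _ (fun u G => `[< R1_at u.1 u.2 G >])) => [G|[g A] _].
  by rewrite inE => /asboolP[g [A h]]; exists (g, A) => //; apply/asboolP.
set S := [set _ in _ | _].
case: (EM (injective g)) => [gi|ngi]; last first.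
  rewrite (_ : S = set0) ?cards0 //; apply/setP => G; rewrite !inE; apply/negbTE/negP.
  by case/andP => _ /asboolP[_ gi _ _ _]; apply: ngi.
pose D := [set G in C5free_graphs T | restr G (~: gverts g) == G].
apply: (@leq_trans (#|D| * b)); last first.
  rewrite leq_mul2r; apply/orP; right; apply: leq_trans (C5free_supported _) _.
  by rewrite [#|~: _|]cardsCs setCK card_gverts.
apply: (@leq_card_cover _ _ _ _ (fun G' G => restr G (~: gverts g) == G')) => [G|G' _].
  rewrite inE => /andP[_ /asboolP[CG _ _ _ _]]; exists (restr G (~: gverts g)) => //.
  rewrite !inE; apply/andP; split; first by apply/asboolP; apply: C5free_restr.
  apply/eqP; apply: sgraph_ext => x y; rewrite !adj_restr.
  by case: (x \in _) => //; case: (y \in _).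
apply: leq_trans (R1_fiber g A G'); apply: subset_leq_card; apply/fintype.subsetP => G.
by rewrite !inE => /andP[/andP[_ ->] ->].
Qed.

(** A gadget divides the other vertices into two classes. Outside [R1] neither class contains [t]
    disjoint gadgets, so [2 * K * t] vertices of each class meet all its gadgets and can be left
    out. *)
Lemma rough_structure (T : finType) (G : sgraph T) : C5free G -> G \notin R1 T ->
  exists A B : {set T}, [/\ [disjoint A & B], #|~: (A :|: B)| <= (K + K) * (t + t).+1,
    gadfree J G A & gadfree J G B].
Proof.
move=> CG nR.
case: (EM (gadfree J G setT)) => [gf|ngf].
  exists setT, set0; split=> //.
  - by rewrite disjoint_sym disjoints_subset sub0set.
  - by rewrite setU0 setCT cards0.
  - by apply: gadfree_sub gf; rewrite sub0set.
have [g gG] : exists g, is_gad J G g.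
  by apply: contrapT => h; apply: ngf => g _ gg; apply: h; exists g.
have gi : injective g by case: gG.
pose A := [set v | (v \notin gverts g) && near_hom (s + s) (trr [set x | adj G v (g x)])].
pose B := [set v | (v \notin gverts g) && ~~ near_hom (s + s) (trr [set x | adj G v (g x)])].
have hB v : v \in B -> near_hom (s + s) (trl [set x | adj G v (g x)]).
  rewrite inE => /andP[vg nr].
  case: (gadget_trace (v := v) CG rJ gG) => // [x|]; last by move=> h; rewrite h in nr.
  by apply: contraNneq vg => <-; apply: imset_f.
(* Exchanging the sides of [g] exchanges the two classes; [R1_at] constrains [g] only through its
   traces, so it also applies to [B]. *)
pose sw (x : X) : X := match x with inl i => inr i | inr i => inl i end.
have swi : injective sw by move=> [i|i] [j|j] // [->].
have hit C : (C = A \/ C = B) -> exists R0 : {set T}, [/\ R0 \subset C, #|R0| <= (K + K) * t & gadfree J G (C :\: R0)].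
  move=> hC; have [[gs [gs1 gs2 gs3]]|[R0 [r1 r2 r3]]] := exists_disjoint_tuples_or_hitting_set (fun g => is_gad J G g) C t; last first.
    exists R0; split=> //; first by rewrite card_sum card_ord in r2.
    by move=> g' gC gg; apply: (r3 g') => //; case: gg.
  exfalso; move/negP: nR; apply; rewrite inE; apply/asboolP.
  case: hC => eC.
    exists (finfun g), A; split=> //.
    - by move=> x y; rewrite !ffunE => /gi.
    - apply/fintype.subsetP => v; rewrite !inE => /andP[vg _]; apply: contra vg.
      by case/imsetP => x _ ->; rewrite ffunE; apply: imset_f.
    - split=> v.
        rewrite inE => /andP[_]; congr near_hom; apply/setP => i; by rewrite !inE ffunE.
      move=> vA vg; have : v \in B.
        rewrite inE; move: vA; rewrite inE negb_and negbK.
        have -> : v \notin gverts g.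
          by apply: contra vg => /imsetP[x _ ->]; apply/imsetP; exists x => //; rewrite ffunE.
        by rewrite (_ : (v \in gverts g) = false) //; apply/negbTE; apply: contra vg => /imsetP[x _ ->]; apply/imsetP; exists x => //; rewrite ffunE.
      move/hB; congr near_hom; apply/setP => i; by rewrite !inE ffunE.
    - by exists gs; rewrite -eC.
  exists (finfun (g \o sw)), B; split=> //.
  - by move=> x y; rewrite !ffunE => /gi/swi.
  - apply/fintype.subsetP => v; rewrite !inE => /andP[vg _]; apply: contra vg.
    by case/imsetP => x _ ->; rewrite ffunE; apply: imset_f.
  - split=> v.
      move/hB; congr near_hom; apply/setP => i; by rewrite !inE ffunE.
    move=> vB vg; have : v \in A.
      have vg' : v \notin gverts g.
        apply: contra vg => /imsetP[x _ ->]; apply/imsetP; exists (sw x) => //; rewrite ffunE /=.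
        by case: x.
      by move: vB; rewrite !inE vg' /= negbK.
    rewrite inE => /andP[_]; congr near_hom; apply/setP => i; by rewrite !inE ffunE.
  - by exists gs; rewrite -eC.
have [RA [a1 a2 a3]] := hit A (or_introl erefl).
have [RB [b1 b2 b3]] := hit B (or_intror erefl).
exists (A :\: RA), (B :\: RB); split=> //.
  rewrite -setI_eq0; apply/eqP/setP => v; rewrite !inE; apply/negbTE/negP.
  by case/andP => /andP[_ /andP[_ h]] /andP[_ /andP[_]]; rewrite h.
apply: (@leq_trans #|gverts g :|: (RA :|: RB)|).
  apply: subset_leq_card; apply/fintype.subsetP => v; rewrite !inE.
  case: (v \in gverts g) => //=; case: (near_hom _ _); rewrite ?andbT ?andbF ?orbF ?orFb /= ?negbK => ->; by rewrite ?orbT.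
rewrite cardsU; apply: leq_trans (leq_subr _ _) _; rewrite card_gverts //.
rewrite cardsU; apply: (@leq_trans (K + K + (#|RA| + #|RB|))); first by rewrite leq_add2l leq_subr.
by rewrite mulnS mulnDr leq_add2l leq_add.
Qed.

End R1.

(** A trace on a gadget costs about [K] bits in place of [2 * K], and an almost constant trace on
    one side costs [h * K] bits with [h] as small as desired. *)
Lemma card_Homs_Pats (R : realType) (h : R) : (0 < h)%R -> exists2 b : R, (0 < b)%R &
  exists K0, forall K s, K0 <= K -> ((s + s)%:R <= b * K%:R)%R ->
  le2 #|Homs K s| (h * K%:R)%R /\ le2 #|Pats K s| (1 + K%:R + h * K%:R)%R.
Proof.
move=> h0.
have [b b0 tail] := @le2_tail R (h / 2)%R (divr_gt0 h0 (ltr0Sn _ 1)).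
exists b => //; exists (Num.truncn (2 / h)%R).+1 => K s hK hs.
have hK' : (1 <= h / 2 * K%:R)%R.
  have : (2 / h <= K%:R)%R by apply: ltW; apply: (lt_le_trans (truncnS_gt _)); rewrite ler_nat.
  by rewrite ler_pdivrMr // => ?; lra.
pose S := [set X : {set 'I_K} | (X \subset setT) && (#|X| <= s + s)].
have tS : le2 #|S| (h / 2 * K%:R)%R by apply: tail => //; rewrite cardsT card_ord.
have hS : #|Homs K s| <= 2 * #|S|.
  apply: (@leq_trans #|S :|: [set ~: X | X in S]|).
    apply: subset_leq_card; apply/fintype.subsetP => D; rewrite !inE subsetT /= => /orP[/ltnW-> //|/ltnW h1].
    by apply/orP; right; apply/imsetP; exists (~: D); rewrite ?setCK // !inE subsetT.
  rewrite cardsU; apply: leq_trans (leq_subr _ _) _.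
  by rewrite card_imset ?addnn -?mul2n //; apply: inv_inj; apply: setCK.
have l2 : le2 (R := R) 2 1 by have := le2_exp2 R 1; rewrite expn1.
have lH : le2 #|Homs K s| (h * K%:R)%R.
  by apply: le2_leq hS _; apply: le2_weak (le2M l2 tS) _; lra.
split=> //.
have cP (f : {set 'I_K + 'I_K} -> {set 'I_K}) (f' : {set 'I_K + 'I_K} -> {set 'I_K}) :
    (forall D D', f D = f D' -> f' D = f' D' -> D = D') ->
    #|[set D | near_hom (s + s) (f D)]| <= #|Homs K s| * 2 ^ K.
  move=> inj; have <- : #|[set: {set 'I_K}]| = 2 ^ K by rewrite -powersetT card_powerset cardsT card_ord.
  rewrite -cardsX; apply: (@leq_card_inj_in _ _ (fun D => (f D, f' D))) => [D|D D' _ _ [e1 e2]].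
    by rewrite !inE /= andbT.
  exact: inj.
have ext (D D' : {set 'I_K + 'I_K}) : trl D = trl D' -> trr D = trr D' -> D = D'.
  move=> /setP e1 /setP e2; apply/setP => -[i|i]; [have := e1 i|have := e2 i]; by rewrite !inE.
have hP : #|Pats K s| <= 2 * (#|Homs K s| * 2 ^ K).
  have -> : Pats K s = [set D | near_hom (s + s) (trl D)] :|: [set D | near_hom (s + s) (trr D)].
    by apply/setP => D; rewrite !inE.
  rewrite cardsU; apply: leq_trans (leq_subr _ _) _; rewrite mul2n -addnn; apply: leq_add.
    exact: (cP (@trl K) (@trr K) ext).
  by apply: (cP (@trr K) (@trl K)) => D D' e1 e2; apply: ext.
apply: le2_leq hP _; apply: le2_weak (le2M l2 (le2M lH (le2_exp2 _ K))) _; lra.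
Qed.

Lemma nat_above (R : realType) (x : R) : exists m : nat, forall k, m <= k -> (x <= k%:R)%R.
Proof.
exists (Num.truncn x).+1 => k hk; apply: ltW; apply: (lt_le_trans (truncnS_gt _)).
by rewrite ler_nat.
Qed.

(** The [t] gadgets save [t * K * K] bits, that is about [lam * K * n / 8] for [t] near
    [lam * n / (8 * K)]. This outweighs the choice of [A], the almost constant traces and the
    polynomial factors once [lam * K] is at least 128 and [n] is large. The 5 spare bits become the
    factor 32 in the induction. *)
Lemma rough (R : realType) (lam : R) : (0 < lam)%R ->
  exists K (J : {set 'I_K * 'I_K}), 0 < K /\ exists n0, forall T : finType, n0 <= #|T| ->
  exists (Bad : {set sgraph T}) X, [/\ #|Bad| <= nC5free (#|T| - (K + K)) * X,
    le2 X (K%:R * (#|T|%:R - (K + K)%:R) - 5 : R)%R &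
    forall G, C5free G -> G \notin Bad -> exists A B : {set T},
      [/\ [disjoint A & B], (#|~: (A :|: B)|%:R <= lam * #|T|%:R)%R, gadfree J G A & gadfree J G B]].
Proof.
move=> l0'.
wlog l1 : lam l0' / (lam <= 1)%R.
  move=> H; case: (lerP lam 1) => [|l1]; first exact: H.
  have [K [J [K0 [n0 h]]]] := H 1%R ltr01 (lexx _); exists K, J; split=> //; exists n0 => T hT.
  have [Bad [X [h1 h2 h3]]] := h T hT; exists Bad, X; split=> // G CG GB.
  have [A [B [k1 k2 k3 k4]]] := h3 G CG GB; exists A, B; split=> //.
  by apply: le_trans k2 _; rewrite ler_wpM2r // ltW.
have l0 := l0'.
pose h := (lam / 128)%R; have h0 : (0 < h)%R by rewrite divr_gt0.
have [b b0 [K1 hK1]] := card_Homs_Pats h0.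
have b4 : (0 < b / 4)%R by rewrite divr_gt0.
have [K2 hK2] := rich_exists b4.
have [K3 hK3] := nat_above (4 / b)%R; have [K4 hK4] := nat_above (128 / lam)%R.
pose K := (maxn (maxn K1 K2) (maxn K3 K4)).+1.
have KK : (K1 <= K) && (K2 <= K) && (K3 <= K) && (K4 <= K).
  by rewrite /K; clear; lia.
move: KK => /andP[/andP[/andP[KK1 KK2] KK3] KK4].
have Kb : (4 <= b * K%:R)%R.
  have : (4 / b <= K%:R)%R by apply: hK3.
  by rewrite ler_pdivrMr // mulrC.
have Kl : (128 <= lam * K%:R)%R.
  have : (128 / lam <= K%:R)%R by apply: hK4.
  by rewrite ler_pdivrMr // mulrC.
have K0 : 0 < K by [].
clearbody K.
pose s := Num.truncn (b / 2 * K%:R)%R.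
have s1 : (s%:R <= b / 2 * K%:R)%R by rewrite truncn_le; lra.
have s2 : (b / 2 * K%:R < s%:R + 1)%R by rewrite natr1; apply: truncnS_gt.
have s0 : 0 < s by rewrite -(ltr_nat R); lra.
clearbody s.
have [cH cP] : le2 #|Homs K s| (h * K%:R)%R /\ le2 #|Pats K s| (1 + K%:R + h * K%:R)%R.
  by apply: hK1 => //; rewrite natrD; lra.
have [J rJ] : exists J, @rich K s J by apply: hK2 => //; lra.
exists K, J; split=> //.
have c0 : (0 < lam / 128)%R by [].
have [n1 lin] := le2_linear c0.
have [n2 hn2] := nat_above (1000 * K%:R / lam)%R.
exists (maxn n1 n2) => T hT.
set n := #|T| in hT *.
have nK : (1000 * K%:R <= lam * n%:R)%R.
  have : (1000 * K%:R / lam <= n%:R)%R by apply: hn2; apply: leq_trans hT; apply: leq_maxr.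
  by rewrite ler_pdivrMr // (mulrC lam).
have ln : le2 (R := R) n (lam / 128 * n%:R)%R by apply: le2_leq (leqnSn _) _; apply: lin; apply: leq_trans hT; apply: leq_maxl.
have K1' : (1 <= K%:R :> R)%R by rewrite ler1n.
pose t := Num.truncn (lam * n%:R / (8 * K%:R))%R.
have ln0 : (0 <= lam * n%:R)%R by lra.
have K80 : (0 < 8 * K%:R :> R)%R by lra.
have t1 : (t%:R * (8 * K%:R) <= lam * n%:R)%R.
  by rewrite -ler_pdivlMr // truncn_le // divr_ge0 // ltW.
have t2 : (lam * n%:R < (t%:R + 1) * (8 * K%:R))%R.
  by rewrite -ltr_pdivrMr // natr1; apply: truncnS_gt.
clearbody t.
exists (R1 s t J T), (n ^ (K + K) * 2 ^ n *
    (#|Homs K s| ^ n * #|Pats K s| ^ (t * K) * 2 ^ (K * (n - (K + K) - (K + K) * t)) * 2 ^ ((K + K) * (K + K)))).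
split.
- apply: leq_trans (R1_count t s0 rJ T) _; rewrite -/n.
  by rewrite mulnAC [X in _ <= X]mulnC.
- have hh := le2M (le2M (le2X (K + K) ln) (le2_exp2 R n)) (le2M (le2M (le2M (le2X n cH) (le2X (t * K) cP)) (le2_exp2 R (K * (n - (K + K) - (K + K) * t)))) (le2_exp2 R ((K + K) * (K + K)))).
  apply: le2_weak hh _.
  have tn : (K + K) + (K + K) * t <= n.
    rewrite -(ler_nat R) !natrD natrM natrD.
    have : (lam * n%:R <= n%:R)%R by rewrite ler_piMl.
    by lra.
  rewrite -subnDA.
  rewrite !(natrM, natrD) natrB // !(natrM, natrD).
  have n0 : (0 <= n%:R :> R)%R by [].
  have T0 : (0 <= t%:R :> R)%R by [].
  rewrite /h.
  set a := n%:R%R in nK ln0 t1 t2 n0 *; set k := K%:R%R in Kb Kl K1' nK K80 t1 t2 *; set u := t%:R%R in t1 t2 T0 *.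
  have lk0 : (0 <= lam * k)%R by lra.
  have e1 : (lam * a * k <= (u + 1) * (8 * k) * k)%R by apply: ler_wpM2r; lra.
  have e2 : (lam * k <= k)%R by rewrite ler_piMl //; lra.
  have e3 : (u * k * (lam * k) <= u * k * k)%R by apply: ler_wpM2l => //; rewrite mulr_ge0 //; lra.
  have e4 : (128 * (u * k) <= lam * k * (u * k))%R by apply: ler_wpM2r => //; rewrite mulr_ge0 //; lra.
  have e5 : (128 * a <= lam * k * a)%R by apply: ler_wpM2r.
  have e6 : (1000 * k * k <= lam * a * k)%R by apply: ler_wpM2r => //; lra.
  have e7 : (k <= k * k)%R by rewrite ler_peMl //; lra.
  have e8 : (0 <= u * k * k)%R by rewrite !mulr_ge0 //; lra.
  by lra.
- move=> G CG GR; have [A [B [k1 k2 k3 k4]]] := rough_structure rJ CG GR.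
  exists A, B; split=> //; apply: (@le_trans _ _ ((K + K) * (t + t).+1)%:R%R); first by rewrite ler_nat.
  rewrite natrM natrD -natr1 natrD.
  by lra.
Qed.

(** * Classes that are counted directly *)

Definition cross (T : finType) (G : sgraph T) (A B : {set T}) :=
  [set u in setX A B | adj G u.1 u.2].

Lemma in_cross (T : finType) (G : sgraph T) (A B : {set T}) x y :
  ((x, y) \in cross G A B) = [&& x \in A, y \in B & adj G x y].
Proof. by rewrite !inE -andbA. Qed.

Section Direct.
Variables (K : nat) (J : {set 'I_K * 'I_K}) (T : finType).

Lemma card_given_cross (A B : {set T}) (C : {set {set T * T}}) g :
  (forall A : {set T}, #|gadfree_graphs J A| <= g) ->
  #|[set G | [&& `[< gadfree J G A >], `[< gadfree J G B >] & cross G A B \in C]]|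
   <= g * g * #|C| * 2 ^ (#|~: (A :|: B)| * #|T|).
Proof.
move=> hg; set E := ~: (A :|: B); set S := [set G | _].
pose f G := (restr G A, restr G B, cross G A B, cross G E setT).
apply: (@leq_trans #|setX (setX (setX (gadfree_graphs J A) (gadfree_graphs J B)) C) (powerset (setX E [set: T]))|).
  apply: (@leq_card_inj_in _ _ f) => [G|G G'].
    rewrite inE => /and3P[h1 h2 h3]; rewrite !inE h3 !andbT; apply/andP; split.
      by apply/andP; split; apply: imset_f; rewrite inE.
    by apply/fintype.subsetP => u; rewrite inE => /andP[].
  move=> _ _ ef; apply: sgraph_ext => x y.
  have /= e1 := congr1 (fun z => z.1.1.1) ef; have /= e2 := congr1 (fun z => z.1.1.2) ef.
  have /= e3 := congr1 (fun z => z.1.2) ef; have /= e4 := congr1 snd ef.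
  have eE x0 y0 : x0 \in E -> adj G x0 y0 = adj G' x0 y0.
    by move=> xE; have := congr1 (fun D : {set T * T} => (x0, y0) \in D) e4; rewrite !in_cross xE in_setT.
  case xE : (x \in E); first exact: eE.
  case yE : (y \in E); first by rewrite (adj_sym G) (adj_sym G') eE.
  have eAB x0 y0 : x0 \in A -> y0 \in B -> adj G x0 y0 = adj G' x0 y0.
    by move=> xA yB; have := congr1 (fun D : {set T * T} => (x0, y0) \in D) e3; rewrite !in_cross xA yB.
  have eAA : x \in A -> y \in A -> adj G x y = adj G' x y.
    by move=> xA yA; have := congr1 (fun H => adj H x y) e1; rewrite !adj_restr xA yA.
  have eBB : x \in B -> y \in B -> adj G x y = adj G' x y.
    by move=> xA yA; have := congr1 (fun H => adj H x y) e2; rewrite !adj_restr xA yA.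
  move: xE yE; rewrite !inE !negb_or => /negbT; rewrite negb_and !negbK => /orP[xA|xB] /negbT;
    rewrite negb_and !negbK => /orP[yA|yB]; [exact: eAA|exact: eAB| |exact: eBB].
  by rewrite (adj_sym G) (adj_sym G') eAB.
rewrite !cardsX card_powerset cardsX cardsT; apply: leq_mul => //; apply: leq_mul => //.
by apply: leq_mul.
Qed.

Definition imbalanced m q : {set sgraph T} := [set G | `[< exists A B : {set T},
  [/\ [disjoint A & B], #|~: (A :|: B)| <= m, #|A| * #|B| <= q, gadfree J G A & gadfree J G B] >]].

Lemma card_pairs_of_sets : #|[set: {set T} * {set T}]| = 2 ^ (#|T| + #|T|).
Proof. by rewrite cardsT card_prod -cardsT -powersetT card_powerset cardsT expnD. Qed.

Lemma imbalanced_count m q g : (forall A : {set T}, #|gadfree_graphs J A| <= g) ->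
  #|imbalanced m q| <= 2 ^ (#|T| + #|T|) * (g * g * 2 ^ q * 2 ^ (m * #|T|)).
Proof.
move=> hg; rewrite -card_pairs_of_sets.
apply: (@leq_card_cover _ _ _ _ (fun u G => [&& #|~: (u.1 :|: u.2)| <= m, #|u.1| * #|u.2| <= q,
   `[< gadfree J G u.1 >] & `[< gadfree J G u.2 >]])) => [G|[A B] _].
  rewrite inE => /asboolP[A [B [_ h1 h2 h3 h4]]]; exists (A, B); rewrite ?inE //=.
  by rewrite h1 h2 (asboolT h3) (asboolT h4).
case: (leqP #|~: (A :|: B)| m) => h1; last first.
  by rewrite (_ : [set _ in _ | _] = set0) ?cards0 //; apply/setP => G; rewrite !inE /= ?andbF.
case: (leqP (#|A| * #|B|) q) => h2; last first.
  by rewrite (_ : [set _ in _ | _] = set0) ?cards0 //; apply/setP => G; rewrite !inE /= ?andbF.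
apply: leq_trans (leq_trans (card_given_cross A B (powerset (setX A B)) hg) _).
  apply: subset_leq_card; apply/fintype.subsetP => G; rewrite !inE /= => /andP[_ /andP[-> ->]] /=.
  by apply/fintype.subsetP => u; rewrite inE => /andP[].
by rewrite card_powerset cardsX !leq_mul // leq_exp2l // leq_mul2r h1 orbT.
Qed.

(** None of the [b * b] disjoint [u] by [w] blocks shows [tau]. With [b] linear in [n] this saves a
    quadratic number of bits, which pays for everything else about a graph with two gadget-free
    parts. The pattern may depend on the graph. *)
Definition avoids u w b (A B : {set T}) (G : sgraph T) := exists (tau : {set 'I_u * 'I_w})
   (xs : 'I_b -> 'I_u -> T) (ys : 'I_b -> 'I_w -> T),
   [/\ forall i x j y, xs i x = xs j y -> i = j /\ x = y,
       forall i x j y, ys i x = ys j y -> i = j /\ x = y,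
       forall i x, xs i x \in A, forall i x, ys i x \in B &
       forall i j, [set v | adj G (xs i v.1) (ys j v.2)] != tau].

Definition avoiding m u w b : {set sgraph T} := [set G | `[< exists A B : {set T},
  [/\ [disjoint A & B], #|~: (A :|: B)| <= m, gadfree J G A, gadfree J G B & avoids u w b A B G] >]].

Lemma disjoint_mul_le (A B : {set T}) : [disjoint A & B] -> #|A| * #|B| * 4 <= #|T| * #|T|.
Proof.
move=> h2; have AB : #|A| + #|B| <= #|T|.
  have := cardsUI A B; rewrite (_ : A :&: B = set0) ?cards0 ?addn0 => [<-|]; first exact: max_card.
  by apply/eqP; rewrite setI_eq0.
have e : #|A| * #|B| * 4 <= (#|A| + #|B|) * (#|A| + #|B|).
  by rewrite mulnC; have := nat_AGM2 #|A| #|B|; rewrite /leqif => -[]; rewrite -mulnn.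
by apply: leq_trans e _; apply: leq_mul.
Qed.

Lemma avoiding_size m u w b G : G \in avoiding m u w b -> u * w * (b * b) <= (#|T| * #|T|) %/ 4.
Proof.
rewrite inE => /asboolP[A [B [h1 _ _ _ [tau [xs [ys [k1 k2 k3 k4 _]]]]]]].
rewrite leq_divRL //; apply: leq_trans (disjoint_mul_le h1); rewrite leq_mul2r /= mulnACA.
apply: leq_mul.
  have <- : #|[set xs z.1 z.2 | z in {: 'I_b * 'I_u}]| = u * b.
    by rewrite card_imset ?card_prod ?card_ord 1?mulnC // => -[i x] [j y] /= /k1[-> ->].
  by apply: subset_leq_card; apply/fintype.subsetP => _ /imsetP[z _ ->].
have <- : #|[set ys z.1 z.2 | z in {: 'I_b * 'I_w}]| = w * b.
  by rewrite card_imset ?card_prod ?card_ord 1?mulnC // => -[i x] [j y] /= /k2[-> ->].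
by apply: subset_leq_card; apply/fintype.subsetP => _ /imsetP[z _ ->].
Qed.

Lemma avoiding_count m u w b g : (forall A : {set T}, #|gadfree_graphs J A| <= g) -> 0 < u -> 0 < w ->
  #|avoiding m u w b| <= 2 ^ (#|T| + #|T|) * (2 ^ (u * w) * #|T| ^ (u * b) * #|T| ^ (w * b)) *
    (g * g * ((2 ^ (u * w)).-1 ^ (b * b) * 2 ^ ((#|T| * #|T|) %/ 4 - u * w * (b * b))) * 2 ^ (m * #|T|)).
Proof.
move=> hg u0 w0; set q := (_ %/ 4).
pose I := ({set 'I_u * 'I_w} * {ffun 'I_b * 'I_u -> T} * {ffun 'I_b * 'I_w -> T})%type.
have cI : #|[set: I]| = 2 ^ (u * w) * #|T| ^ (u * b) * #|T| ^ (w * b).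
  rewrite cardsT !card_prod !card_ffun !card_prod !card_ord -cardsT -powersetT card_powerset cardsT card_prod !card_ord.
  by rewrite (mulnC b u) (mulnC b w).
rewrite -cI -card_pairs_of_sets -cardsX.
set bb := (X in _ <= _ * X).
pose P (i : {set T} * {set T} * I) (G : sgraph T) :=
  [/\ #|~: (i.1.1 :|: i.1.2)| <= m, [disjoint i.1.1 & i.1.2], gadfree J G i.1.1, gadfree J G i.1.2 &
   [/\ injective i.2.1.2, injective i.2.2, forall x, i.2.1.2 x \in i.1.1, forall x, i.2.2 x \in i.1.2 &
       forall k l, [set v | adj G (i.2.1.2 (k, v.1)) (i.2.2 (l, v.2))] != i.2.1.1]].
apply: (@leq_card_cover _ _ _ _ (fun i G => `[< P i G >])) => [G|[[A B] [[tau xs] ys]] _].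
  rewrite inE => /asboolP[A [B [h1 h2 h3 h4 [tau [xs [ys [k1 k2 k3 k4 k5]]]]]]].
  exists (A, B, (tau, [ffun z => xs z.1 z.2], [ffun z => ys z.1 z.2])); first by apply/setXP; rewrite !inE.
  apply/asboolP; split=> //=; split.
  - by move=> [i x] [j y]; rewrite !ffunE => /k1[/= -> ->].
  - by move=> [i x] [j y]; rewrite !ffunE => /k2[/= -> ->].
  - by move=> x; rewrite ffunE.
  - by move=> x; rewrite ffunE.
  - move=> i j; apply: contraNneq (k5 i j) => <-; apply/eqP/setP => v; by rewrite !inE !ffunE.
set S := [set _ in _ | _].
case: (set_0Vmem S) => [->|[G0]]; first by rewrite cards0.
rewrite inE => /andP[_ /asboolP[/= h1 h2 _ _ [k1 k2 k3 k4 _]]].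
pose gg (i : 'I_b * 'I_b) (v : 'I_u * 'I_w) := (xs (i.1, v.1), ys (i.2, v.2)).
have ggi i x j y : gg i x = gg j y -> i = j /\ x = y.
  by case: i x j y => [i i'] [x x'] [j j'] [y y'] /= [/k1[-> ->] /k2[-> ->]].
have ggD i x : gg i x \in setX A B by rewrite inE k3 k4.
have cC := @card_block_traces _ _ _ gg (setX A B) [set~ tau] ggi ggD.
set C := [set N | _] in cC.
apply: leq_trans (leq_trans (card_given_cross A B C hg) _).
  apply: subset_leq_card; apply/fintype.subsetP => G; rewrite !inE => /andP[_ /asboolP[/= _ _ g1 g2 [_ _ _ _ k5]]].
  rewrite (asboolT g1) (asboolT g2) /=; apply/andP; split.
    by apply/fintype.subsetP => z; rewrite inE => /andP[].
  apply/forallP => i; rewrite !inE; apply: contraNneq (k5 i.1 i.2) => <-; apply/eqP/setP => v.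
  by rewrite !inE /= k3 k4.
apply: leq_mul; last by rewrite leq_exp2l // leq_mul2r h1 orbT.
apply: leq_mul => //; apply: leq_trans cC _.
have -> : #|[set~ tau]| = (2 ^ (u * w)).-1.
  by rewrite cardsC1 -cardsT -powersetT card_powerset cardsT card_prod !card_ord.
rewrite !card_prod !card_ord cardsX leq_mul2l leq_exp2l //; apply/orP; right; apply: leq_sub2r.
by rewrite /q leq_divRL // disjoint_mul_le.
Qed.

End Direct.

Section DirectSmall.
Variable R : realType.
Local Open Scope ring_scope.

(** The cross edges fall short of [n * n / 4] by [z * n * n]; the insides of the two gadget-free
    parts and the vertices outside them take [z / 8] each. Of the 10 spare bits, 9 give the factor
    512 and one covers the rounding of [n * n / 4]. *)
Lemma imbalanced_small (z : R) : 0 < z -> exists2 lam : R, 0 < lam &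
  forall K (J : {set 'I_K * 'I_K}), (0 < K)%N -> exists n0, forall T : finType, (n0 <= #|T|)%N ->
  forall m q, m%:R <= lam * #|T|%:R -> q%:R <= #|T|%:R * #|T|%:R / 4 - z * (#|T|%:R * #|T|%:R) ->
  le2 #|imbalanced J T m q| (#|T|%:R * #|T|%:R / 4 - 10 : R).
Proof.
move=> z0; exists (z / 8); first by rewrite divr_gt0.
move=> K J K0; have z8 : 0 < z / 8 by rewrite divr_gt0.
have [n1 gf] := gadfree_count J K0 z8.
have [n2 hn2] := nat_above (100 / z).
exists (maxn n1 (maxn n2 1)) => T hT m q hm hq.
set n := #|T| in hT hm hq *.
have hn1 : (n1 <= n)%N by apply: leq_trans hT; apply: leq_maxl.
have nz : 100 <= z * n%:R.
  have : 100 / z <= n%:R by apply: hn2; apply: leq_trans hT; rewrite leq_max leq_maxl orbT.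
  by rewrite ler_pdivrMr // (mulrC z).
have n1' : 1 <= n%:R :> R by rewrite ler1n; apply: leq_trans hT; rewrite !leq_max leqnn !orbT.
have [g hg1 hg2] : exists2 g, (forall A : {set T}, #|gadfree_graphs J A| <= g)%N & le2 g (z / 8 * (n%:R * n%:R)).
  exists (\max_(A : {set T}) #|gadfree_graphs J A|) => [A|]; first exact: leq_bigmax.
  have hc0 : (0 < #|{set T}|)%N by apply/card_gt0P; exists set0.
  by have [A ->] := bigop.eq_bigmax (fun A : {set T} => #|gadfree_graphs J A|) hc0; apply: gf.
apply: le2_leq (imbalanced_count m q hg1) _.
apply: le2_weak (le2M (le2_exp2 R _) (le2M (le2M (le2M hg2 hg2) (le2_exp2 R q)) (le2_exp2 R _))) _.
rewrite natrD natrM -/n; clear - nz n1' hm hq.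
set a := n%:R in nz n1' hm hq *; set mm := m%:R in hm *; set qq := q%:R in hq *.
have e1 : mm * a <= z / 8 * a * a by rewrite ler_wpM2r //; lra.
have e2 : 100 * a <= z * a * a by rewrite ler_wpM2r //; lra.
have e3 : 1 <= a * a by rewrite mulr_ege1.
by lra.
Qed.

Lemma avoiding_small u w (b : R) : (0 < u)%N -> (0 < w)%N -> 0 < b -> exists2 lam : R, 0 < lam &
  forall K (J : {set 'I_K * 'I_K}), (0 < K)%N -> exists n0, forall T : finType, (n0 <= #|T|)%N ->
  forall m s, m%:R <= lam * #|T|%:R -> b * #|T|%:R <= s%:R -> (s <= #|T|)%N ->
  le2 #|avoiding J T m u w s| (#|T|%:R * #|T|%:R / 4 - 10 : R).
Proof.
move=> u0 w0 b0.
have [c c0 hc] : exists2 c : R, 0 < c & le2 (2 ^ (u * w)).-1 ((u * w)%:R - c).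
  apply: le2_pred; last exact: le2_exp2.
  by rewrite -{1}(expn0 2) ltn_exp2l // muln_gt0 u0.
pose z := c * b * b; have z0 : 0 < z by rewrite !mulr_gt0.
have z8 : 0 < z / 8 by rewrite divr_gt0.
exists (z / 8) => //.
move=> K J K0; have [n1 gf] := gadfree_count J K0 z8.
have uw0 : 0 < z / 8 / (u + w)%:R by rewrite divr_gt0 // ltr0n addn_gt0 u0.
have [n3 lin] := le2_linear uw0.
have [n2 hn2] := nat_above (100 * (u * w)%:R / z).
exists (maxn n1 (maxn n2 (maxn n3 1))) => T hT m s hm hs sT.
set n := #|T| in hT hm hs sT *.
have hn1 : (n1 <= n)%N by apply: leq_trans hT; apply: leq_maxl.
have nz : 100 * (u * w)%:R <= z * n%:R.
  have : 100 * (u * w)%:R / z <= n%:R by apply: hn2; apply: leq_trans hT; rewrite !leq_max leqnn orbT.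
  by rewrite ler_pdivrMr // (mulrC z).
have n1' : 1 <= n%:R :> R by rewrite ler1n; apply: leq_trans hT; rewrite !leq_max leqnn !orbT.
have ln : le2 n (z / 8 / (u + w)%:R * n%:R).
  apply: le2_leq (leqnSn _) _; apply: lin; apply: leq_trans hT; by rewrite !leq_max leqnn !orbT.
have [g hg1 hg2] : exists2 g, (forall A : {set T}, #|gadfree_graphs J A| <= g)%N & le2 g (z / 8 * (n%:R * n%:R)).
  exists (\max_(A : {set T}) #|gadfree_graphs J A|) => [A|]; first exact: leq_bigmax.
  have hc0 : (0 < #|{set T}|)%N by apply/card_gt0P; exists set0.
  by have [A ->] := bigop.eq_bigmax (fun A : {set T} => #|gadfree_graphs J A|) hc0; apply: gf.
case: (set_0Vmem (avoiding J T m u w s)) => [->|[G0 /avoiding_size hqs]].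
  by rewrite cards0; apply: le2_0.
apply: le2_leq (avoiding_count m s hg1 u0 w0) _; rewrite -/n in hqs *.
set q := (n * n %/ 4)%N in hqs *.
have hq : q%:R <= n%:R * n%:R / 4 :> R.
  by rewrite ler_pdivlMr // -!natrM ler_nat leq_trunc_div.
apply: le2_weak (le2M (le2M (le2_exp2 R _) (le2M (le2M (le2_exp2 R _) (le2X _ ln)) (le2X _ ln)))
  (le2M (le2M (le2M hg2 hg2) (le2M (le2X _ hc) (le2_exp2 R _))) (le2_exp2 R _))) _.
rewrite natrB // !(natrM, natrD).
have uw1 : 0 < u%:R + w%:R :> R by rewrite -natrD ltr0n addn_gt0 u0.
have E : z / 8 / (u%:R + w%:R) * (u%:R * s%:R + w%:R * s%:R) = z / 8 * s%:R.
  by rewrite -mulrDl mulrA divfK // gt_eqF.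
have sn : s%:R <= n%:R :> R by rewrite ler_nat.
have hmn : m%:R * n%:R <= z / 8 * (n%:R * n%:R) by rewrite mulrA ler_wpM2r.
have hcs : z * (n%:R * n%:R) <= c * (s%:R * s%:R).
  rewrite /z -!mulrA ler_pM2l // [X in X <= _](_ : _ = (b * n%:R) * (b * n%:R)); last by ring.
  by apply: ler_pM => //; rewrite mulr_ge0 // ltW.
rewrite natrM in nz.
clear - nz n1' hq E sn hmn hcs z0 u0 w0.
have u1 : 1 <= u%:R * w%:R :> R by rewrite -natrM ler1n muln_gt0 u0.
have e0 : 1 <= n%:R * n%:R :> R by rewrite mulr_ege1.
have e1 : z / 8 * s%:R * n%:R <= z / 8 * n%:R * n%:R.
  by rewrite ler_wpM2r // ler_wpM2l // ltW // divr_gt0.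
have e2 : 100 * (u%:R * w%:R) * n%:R <= z * n%:R * n%:R by rewrite ler_wpM2r.
have e3 : n%:R <= u%:R * w%:R * n%:R :> R by rewrite ler_peMl.
have e4 : u%:R * w%:R <= u%:R * w%:R * n%:R :> R by rewrite ler_peMr // mulr_ge0.
have E' : z / 8 / (u%:R + w%:R) * (u%:R * s%:R + w%:R * s%:R) * n%:R = z / 8 * s%:R * n%:R by rewrite E.
set y := z / 8 / (u%:R + w%:R) in E' *.
by lra.
Qed.

End DirectSmall.

(** * Classes that are counted by removing two or three vertices *)

Section Local.
Variables (T : finType) (m r lo : nat).
Implicit Types (G : sgraph T) (A B : {set T}).
Let n := #|T|.

(** The last clause, which forbids large complete rectangles between the sides, makes the pair
    almost determined by the graph, so that it need not be paid for with [2 ^ n] choices. *)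
Definition split_pair G A B :=
  [/\ [disjoint A & B], cliq G A, P3free_on G B, #|~: (A :|: B)| <= m &
   [/\ lo <= #|A|, lo <= #|B| & forall X Y : {set T}, X \subset A -> Y \subset B ->
      (forall x y, x \in X -> y \in Y -> adj G x y) -> #|X| < r \/ #|Y| < r]].

Definition symdiff (A B : {set T}) := (A :\: B) :|: (B :\: A).

Lemma symdiffK A B : symdiff (symdiff A B) B = A.
Proof.
by apply/setP => x; rewrite !inE; case: (x \in A); case: (x \in B).
Qed.

Lemma symdiff_close A B A1 B1 : [disjoint A & B] -> [disjoint A1 & B1] ->
  #|~: (A1 :|: B1)| <= m -> lo <= #|A| -> lo <= #|B| -> lo <= #|A1| -> lo <= #|B1| ->
  #|A :&: B1| < r ->
  #|symdiff A A1| <= 3 * (n - 2 * lo) + 2 * r + 4 * m /\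
  #|symdiff B B1| <= 3 * (n - 2 * lo) + 2 * r + 4 * m.
Proof.
move=> dAB dAB1 hm a b a1 b1 hr.
have sum (X Y : {set T}) : [disjoint X & Y] -> #|X| + #|Y| <= n.
  move=> d; have := cardsUI X Y; rewrite (_ : X :&: Y = set0) ?cards0 ?addn0 => [<-|]; first exact: max_card.
  by apply/eqP; rewrite setI_eq0.
have s1 := sum _ _ dAB; have s2 := sum _ _ dAB1.
have uni (X Y Z : {set T}) : X \subset Y :|: Z -> #|X| <= #|Y| + #|Z|.
  by move=> h; apply: leq_trans (subset_leq_card h) _; rewrite cardsU leq_subr.
have h1 : #|A :\: A1| <= #|A :&: B1| + #|~: (A1 :|: B1)|.
  apply: uni; apply/fintype.subsetP => x; rewrite !inE => /andP[/negbTE -> ->] /=.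
  by case: (x \in B1).
have h2 : #|A1 :\: A| + #|A| = #|A1| + #|A :\: A1|.
  have e1 := cardsID A A1; have e2 := cardsID A1 A.
  by rewrite setIC in e1; lia.
have h3 : #|B :\: B1| <= #|A1 :\: A| + #|~: (A1 :|: B1)|.
  apply: uni; apply/fintype.subsetP => x; rewrite !inE => /andP[/negbTE -> xB] /=.
  by rewrite (disjointFl dAB xB) orbF; case: (x \in A1).
have h4 : #|B1 :\: B| + #|B| = #|B1| + #|B :\: B1|.
  have e1 := cardsID B B1; have e2 := cardsID B1 B.
  by rewrite setIC in e1; lia.
have u1 : #|symdiff A A1| <= #|A :\: A1| + #|A1 :\: A| by apply: uni.
have u2 : #|symdiff B B1| <= #|B :\: B1| + #|B1 :\: B| by apply: uni.
by clear - h1 h2 h3 h4 u1 u2 s1 s2 a b a1 b1 hr hm; lia.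
Qed.

(** If [A] met both [A1] and [B1] in [r] vertices, the clique [A] would contain a forbidden
    rectangle between [A1] and [B1]. So the pair is close to [(A1, B1)] or to [(B1, A1)], the sides
    having almost half of the vertices each. *)
Lemma split_pair_count G :
  #|[set u : {set T} * {set T} | `[< split_pair G u.1 u.2 >]]|
    <= 2 * (#|[set X : {set T} | #|X| <= 3 * (n - 2 * lo) + 2 * r + 4 * m]| *
            #|[set X : {set T} | #|X| <= 3 * (n - 2 * lo) + 2 * r + 4 * m]|).
Proof.
set d := 3 * _ + _ + _; set D := [set X : {set T} | _]; set S := [set u | _].
case: (set_0Vmem S) => [->|[[A1 B1]]]; first by rewrite cards0.
rewrite inE => /asboolP /= [d1 c1 p1 m1 [l1 l1' r1]].
have -> : 2 * (#|D| * #|D|) = #|setX [set: bool] (setX D D)| by rewrite !cardsX cardsT card_bool.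
pose f (u : {set T} * {set T}) := if #|u.1 :&: B1| < r then (true, (symdiff u.1 A1, symdiff u.2 B1))
   else (false, (symdiff u.1 B1, symdiff u.2 A1)).
apply: (@leq_card_inj_in _ _ f) => [[A B]|[A B] [A' B']].
  rewrite inE => /asboolP /= [d2 c2 p2 m2 [l2 l2' r2]]; rewrite /f /=.
  case: ifPn => h.
    have [k1 k2] := symdiff_close d2 d1 m1 l2 l2' l1 l1' h.
    by rewrite !inE /= k1 k2.
  have h' : #|A :&: A1| < r.
    have := r1 (A :&: A1) (A :&: B1) (subsetIr _ _) (subsetIr _ _).
    case=> // [x y|hx]; last by rewrite hx in h.
    rewrite !inE => /andP[xA xA1] /andP[yA yB1]; apply: c2 => //.
    by apply: contraTneq yB1 => <-; rewrite (disjointFr d1 xA1).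
  have d1' : [disjoint B1 & A1] by rewrite disjoint_sym.
  have m1' : #|~: (B1 :|: A1)| <= m by rewrite setUC.
  have [k1 k2] := symdiff_close d2 d1' m1' l2 l2' l1' l1 h'.
  by rewrite !inE /= k1 k2.
move=> _ _; rewrite /f /=; case: ifP => _; case: ifP => _ // [e1 e2].
  by rewrite -(symdiffK A A1) -(symdiffK B B1) e1 e2 !symdiffK.
by rewrite -(symdiffK A B1) -(symdiffK B A1) e1 e2 !symdiffK.
Qed.

Section Remove.
Variables (h : nat) (Att : sgraph T -> {set T} -> {set T} -> ('I_h -> {set T}) -> Prop).

Definition removable : {set sgraph T} := [set G | `[< C5free G /\ exists (H : {ffun 'I_h -> T}) (A B : {set T}),
  let G' := restr G (~: gverts H) in
  [/\ injective H, A :|: B \subset ~: gverts H, split_pair G' A B &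
      Att G' A B (fun i => nbh G (H i) :&: (A :|: B))] >]].

(** Besides the removed vertices and the remaining graph, one pays for the pair by
    [split_pair_count], for the attachment to [A :|: B] by [attb], and one bit for each pair of a
    removed vertex and a vertex outside [A :|: B]. *)
Lemma removable_count attb :
  (forall G' A B, split_pair G' A B ->
    #|[set D : {ffun 'I_h -> {set T}} | [forall i, D i \subset A :|: B] && `[< Att G' A B D >]]| <= attb) ->
  #|removable| <= n ^ h * nC5free (n - h) * (2 * (#|[set X : {set T} | #|X| <= 3 * (n - 2 * lo) + 2 * r + 4 * m]| *
            #|[set X : {set T} | #|X| <= 3 * (n - 2 * lo) + 2 * r + 4 * m]|) * (attb * 2 ^ (h * m))).
Proof.
move=> hatt; set near := 2 * _; rewrite -mulnA.
have <- : #|[set: {ffun 'I_h -> T}]| = n ^ h by rewrite cardsT card_ffun card_ord.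
pose P (H : {ffun 'I_h -> T}) A B G := let G' := restr G (~: gverts H) in
  [/\ injective H, A :|: B \subset ~: gverts H, split_pair G' A B &
      Att G' A B (fun i => nbh G (H i) :&: (A :|: B))].
apply: (@leq_card_cover _ _ _ _ (fun (H : {ffun 'I_h -> T}) G => `[< C5free G /\ exists A B, P H A B G >])) => [G|H _].
  rewrite inE => /asboolP[CG [H [A [B hP]]]]; exists H; first by rewrite inE.
  by apply/asboolP; split=> //; exists A, B.
set S := [set _ in _ | _].
case: (EM (injective H)) => [Hi|nHi]; last first.
  rewrite (_ : S = set0) ?cards0 //; apply/setP => G; rewrite !inE; apply/negbTE/negP.
  by case/andP => _ /asboolP[_ [A [B [Hi _ _ _]]]]; apply: nHi.
pose D := [set G in C5free_graphs T | restr G (~: gverts H) == G].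
have cH : #|~: gverts H| = n - h by rewrite cardsCs setCK card_imset // card_ord.
apply: (@leq_trans (#|D| * (near * (attb * 2 ^ (h * m))))); last first.
  by rewrite leq_mul2r -cH C5free_supported orbT.
apply: (@leq_card_cover _ _ _ _ (fun G' G => restr G (~: gverts H) == G')) => [G|G' _].
  rewrite inE => /andP[_ /asboolP[CG _]]; exists (restr G (~: gverts H)) => //.
  rewrite !inE; apply/andP; split; first by apply/asboolP; apply: C5free_restr.
  apply/eqP; apply: sgraph_ext => x y; rewrite !adj_restr.
  by case: (x \in _) => //; case: (y \in _).
apply: (@leq_trans (#|[set u : {set T} * {set T} | `[< split_pair G' u.1 u.2 >]]| * (attb * 2 ^ (h * m)))); last first.
  by rewrite leq_mul2r split_pair_count orbT.
apply: (@leq_card_cover _ _ _ _ (fun u G => `[< P H u.1 u.2 G >])) => [G|[A B] /[!inE] /asboolP /= hsp].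
  rewrite !inE => /andP[/andP[_ /asboolP[CG [A [B hP]]]] /eqP e]; exists (A, B); last by apply/asboolP.
  by rewrite inE; apply/asboolP => /=; case: hP => _ _; rewrite e.
set S' := [set _ in _ | _].
have S'P G : G \in S' -> restr G (~: gverts H) = G' /\ Att G' A B (fun i => nbh G (H i) :&: (A :|: B)).
  rewrite !inE => /andP[/andP[_ /eqP e] /asboolP[_ _ _]]; by rewrite e.
have [_ _ _ hm _] := hsp.
apply: (@leq_trans (attb * 2 ^ #|setX [set: 'I_h] (~: (A :|: B))|)); last first.
  by rewrite cardsX cardsT card_ord leq_mul2l leq_exp2l // leq_mul2l hm !orbT.
apply: (@leq_trans #|setX [set D : {ffun 'I_h -> {set T}} | [forall i, D i \subset A :|: B] && `[< Att G' A B D >]]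
   (powerset (setX [set: 'I_h] (~: (A :|: B))))|); last first.
  by rewrite cardsX card_powerset leq_mul2r hatt ?orbT.
apply: (@leq_card_inj_in _ _ (fun G => ([ffun i => nbh G (H i) :&: (A :|: B)] : {ffun 'I_h -> {set T}},
   [set v in setX [set: 'I_h] (~: (A :|: B)) | adj G (H v.1) v.2]))) => [G /S'P[e hA]|G G1 GS GS1].
  rewrite !inE /=; apply/andP; split; last by apply/fintype.subsetP => v; rewrite inE => /andP[].
  apply/andP; split; first by apply/forallP => i; rewrite ffunE subsetIr.
  apply/asboolP; rewrite (_ : fun_of_fin _ = (fun i => nbh G (H i) :&: (A :|: B))) //.
  by apply: funext => i; rewrite ffunE.
move=> ef; have /= /ffunP e1 := congr1 fst ef; have /= /setP e2 := congr1 snd ef.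
have HG i x : adj G (H i) x = adj G1 (H i) x.
  case xAB : (x \in A :|: B).
    by have := e1 i; rewrite !ffunE => /setP/(_ x); rewrite !in_setI xAB !andbT !inE.
  by have := e2 (i, x); rewrite !in_set /= -!in_setU xAB.
have [e _] := S'P _ GS; have [e' _] := S'P _ GS1.
apply: sgraph_ext => x y.
case xV : (x \in gverts H); first by case/imsetP: xV => i _ ->.
case yV : (y \in gverts H); first by case/imsetP: yV => i _ ->; rewrite (adj_sym G) (adj_sym G1).
have := congr1 (fun H => adj H x y) (etrans e (esym e')).
by rewrite !adj_restr !inE xV yV.
Qed.

End Remove.

Lemma avoid_count h w b (S : {set T}) (tau : {set 'I_h * 'I_w}) (gs : 'I_b -> 'I_w -> T) :
  (forall i x j y, gs i x = gs j y -> i = j /\ x = y) -> (forall i x, gs i x \in S) ->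
  #|[set D : {ffun 'I_h -> {set T}} | [forall i, D i \subset S] &&
      [forall j, [set v | gs j v.2 \in D v.1] != tau]]|
   <= (2 ^ (h * w)).-1 ^ b * 2 ^ (h * #|S| - h * w * b).
Proof.
move=> gi gS.
pose g (j : 'I_b) (v : 'I_h * 'I_w) := (v.1, gs j v.2).
have ggi i x j y : g i x = g j y -> i = j /\ x = y.
  by case: x y => [x x'] [y y'] [-> /gi[-> ->]].
have ggS i x : g i x \in setX [set: 'I_h] S by rewrite !inE gS.
have := @card_block_traces _ _ _ g _ [set~ tau] ggi ggS.
have -> : #|[set~ tau]| = (2 ^ (h * w)).-1.
  by rewrite cardsC1 -cardsT -powersetT card_powerset cardsT card_prod !card_ord.
rewrite cardsX cardsT card_prod !card_ord; apply: leq_trans.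
apply: (@leq_card_inj_in _ _ (fun D : {ffun 'I_h -> {set T}} => [set v : 'I_h * T | v.2 \in D v.1])) => [D|D D' _ _ /setP e].
  rewrite !inE => /andP[/forallP h1 /forallP h2]; apply/andP; split.
    by apply/fintype.subsetP => v; rewrite !inE => /(fintype.subsetP (h1 _)).
  apply/forallP => j; rewrite !inE; apply: contraNneq (h2 j) => <-; apply/eqP/setP => v.
  by rewrite !inE.
by apply/ffunP => i; apply/setP => x; have := e (i, x); rewrite !inE.
Qed.

Section AttAvoid.
Variables (h w b : nat) (sd : bool) (tau : {set 'I_h * 'I_w}).
Variable own : sgraph T -> {set T} -> {set T} -> {set {set T}}.
Variable tup : sgraph T -> ('I_w -> T) -> Prop.

(** The side [S] chosen by [sd] is the one opposite to the removed vertices: there they avoid [tau]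
    on all tuples. On the side [O] their neighbourhoods come from a small family [own]. This leaves
    about [h * n / 2] free bits, as in a unipolar graph, minus a saving for each of [b] disjoint
    tuples. *)
Definition att_avoid (G : sgraph T) (A B : {set T}) (D : 'I_h -> {set T}) :=
  let S := if sd then B else A in let O := if sd then A else B in
  [/\ exists gs : 'I_b -> 'I_w -> T, [/\ forall i x j y, gs i x = gs j y -> i = j /\ x = y,
         forall i x, gs i x \in S & forall i, tup G (gs i)],
      forall i, D i :&: O \in own G A B &
      forall g, injective g -> (forall x, g x \in S) -> tup G g -> [set v | g v.2 \in D v.1] != tau].

Lemma att_avoid_count G A B o : #|own G A B| <= o -> h * w * b <= h * #|if sd then B else A| ->
  #|[set D : {ffun 'I_h -> {set T}} | [forall i, D i \subset A :|: B] && `[< att_avoid G A B D >]]|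
  <= o ^ h * ((2 ^ (h * w)).-1 ^ b * 2 ^ (h * #|if sd then B else A| - h * w * b)).
Proof.
move=> ho hw; set S := if sd then B else A in hw *; pose O := if sd then A else B.
set Q := [set D | _].
case: (set_0Vmem Q) => [->|[D0]]; first by rewrite cards0.
rewrite inE => /andP[_ /asboolP[[gs [g1 g2 g3]] _ _]].
have SO : S :|: O = A :|: B by rewrite /S /O; case: (sd); rewrite // setUC.
have c := avoid_count tau g1 g2; set Z := [set D | _] in c.
apply: leq_trans (leq_mul (leq_expl h ho) c).
have <- : #|[set D : {ffun 'I_h -> {set T}} | D \in ffun_on [in own G A B]]| = #|own G A B| ^ h.
  by rewrite card_ffun_on_set card_ord.
rewrite -cardsX.
apply: (@leq_card_inj_in _ _ (fun D : {ffun 'I_h -> {set T}} => ([ffun i => D i :&: O] : {ffun 'I_h -> {set T}},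
    [ffun i => D i :&: S] : {ffun 'I_h -> {set T}}))) => [D|D D'].
  rewrite inE => /andP[_ /asboolP[_ k1 k2]]; rewrite !inE /=; apply/andP; split.
    by apply/ffun_onP => i; rewrite ffunE; apply: k1.
  apply/andP; split; first by apply/forallP => i; rewrite ffunE subsetIr.
  apply/forallP => j; apply: contraNneq (k2 (gs j) _ (g2 j) (g3 j)) => [<-|x y /g1[] //].
  apply/eqP/setP => v; by rewrite !in_set ffunE in_setI g2 andbT.
rewrite !inE => /andP[/forallP s1 _] /andP[/forallP s2 _] ef.
have /= /ffunP e1 := congr1 fst ef; have /= /ffunP e2 := congr1 snd ef.
apply/ffunP => i; apply/setP => x.
case xAB : (x \in A :|: B); last first.
  by apply/idP/idP => [/(fintype.subsetP (s1 i))|/(fintype.subsetP (s2 i))]; rewrite xAB.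
move: xAB; rewrite -SO in_setU => /orP[xS|xO].
  by have := e2 i; rewrite !ffunE => /setP/(_ x); rewrite !in_setI xS !andbT.
by have := e1 i; rewrite !ffunE => /setP/(_ x); rewrite !in_setI xO !andbT.
Qed.

End AttAvoid.

Definition blk G (B : {set T}) x := [set y in B | (y == x) || adj G x y].

(** This family and [own_blk] list the traces that a misplaced vertex has on the side where it
    belongs; for [b3] a small fraction of [n] both have few members. *)
Definition own_hom (b3 : nat) (G : sgraph T) (A B : {set T}) : {set {set T}} :=
  [set X : {set T} | (X \subset A) && ((#|A :\: X| <= b3) || (#|X| <= b3))].

Definition own_blk (b3 : nat) (G : sgraph T) (A B : {set T}) : {set {set T}} :=
  [set X : {set T} | (#|X| <= b3) || [exists x in B, #|symdiff X (blk G B x)| <= b3]].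

Lemma own_hom_count b3 G A B : #|own_hom b3 G A B| <= 2 * #|[set X : {set T} | #|X| <= b3]|.
Proof.
set D := [set X : {set T} | _].
have <- : #|setX [set: bool] D| = 2 * #|D| by rewrite cardsX cardsT card_bool.
apply: (@leq_card_inj_in _ _ (fun X : {set T} => if #|X| <= b3 then (true, X) else (false, A :\: X))) => [X|X Y].
  rewrite inE => /andP[XA]; case: ifPn => [h _|h]; rewrite !inE /= ?h //.
  by rewrite orbF.
rewrite !inE => /andP[XA _] /andP[YA _]; case: ifP => _; case: ifP => _ // [] // /setP e.
apply/setP => x; case xA : (x \in A); first by have := e x; rewrite !inE xA !andbT => /negb_inj.
by apply/idP/idP => [/(fintype.subsetP XA)|/(fintype.subsetP YA)]; rewrite xA.
Qed.

Lemma own_blk_count b3 G A B : #|own_blk b3 G A B| <= n.+1 * #|[set X : {set T} | #|X| <= b3]|.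
Proof.
have <- : #|[set: option T]| = n.+1 by rewrite cardsT card_option.
apply: (@leq_card_cover _ _ _ _ (fun o X => if o is Some x then #|symdiff X (blk G B x)| <= b3 else #|X| <= b3)) => [X|o _].
  rewrite inE => /orP[h|/exists_inP[x xB h]]; by [exists None; rewrite ?inE|exists (Some x); rewrite ?inE].
case: o => [x|]; last by apply: subset_leq_card; apply/fintype.subsetP => X; rewrite !inE => /andP[].
apply: (@leq_card_inj_in _ _ (fun X => symdiff X (blk G B x))) => [X|X Y _ _ e].
  by rewrite !inE => /andP[].
by rewrite -(symdiffK X (blk G B x)) e symdiffK.
Qed.

End Local.

Lemma blk_refl (T : finType) (G : sgraph T) (S : {set T}) v : v \in S -> v \in blk G S v.
Proof. by move=> vS; rewrite inE vS eqxx. Qed.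

Lemma blk_sym_eq (T : finType) (G : sgraph T) (S : {set T}) u v : P3free_on G S -> u \in S -> v \in blk G S u ->
  blk G S v = blk G S u.
Proof.
move=> pf uS; rewrite inE => /andP[vS /orP[/eqP -> //|uv]]; apply/setP => w; rewrite !inE.
case wS : (w \in S) => //=; case: (altP (w =P v)) => [->|wv]; first by rewrite uv orbT.
case: (altP (w =P u)) => [->|wu]; first by rewrite adj_sym uv.
apply/idP/idP => h1; first by apply: (pf u v w uS vS wS uv h1); rewrite eq_sym.
by apply: (pf v u w) => //; rewrite 1?adj_sym // eq_sym.
Qed.

Lemma blk_meet (T : finType) (G : sgraph T) (S : {set T}) u v z : P3free_on G S -> u \in S -> v \in S ->
  z \in blk G S u -> z \in blk G S v -> u != v -> adj G u v.
Proof.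
move=> pf uS vS zu zv uv; have e : blk G S u = blk G S v by rewrite -(blk_sym_eq pf uS zu) (blk_sym_eq pf vS zv).
have := blk_refl G uS; rewrite e inE => /andP[_ /orP[/eqP E|]]; first by rewrite E eqxx in uv.
by rewrite adj_sym.
Qed.

(** * Exact structure outside small classes *)

Definition i20 : 'I_2 := @Ordinal 2 0 isT.
Definition i21 : 'I_2 := @Ordinal 2 1 isT.
Definition i30 : 'I_3 := @Ordinal 3 0 isT.
Definition i31 : 'I_3 := @Ordinal 3 1 isT.
Definition i32 : 'I_3 := @Ordinal 3 2 isT.

Lemma ord2_ind (P : 'I_2 -> Prop) : P i20 -> P i21 -> forall i, P i.
Proof.
move=> h0 h1 [[|[|k]] hk] //.
  by rewrite (_ : Ordinal hk = i20) //; apply: val_inj.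
by rewrite (_ : Ordinal hk = i21) //; apply: val_inj.
Qed.

Lemma ord3_ind (P : 'I_3 -> Prop) : P i30 -> P i31 -> P i32 -> forall i, P i.
Proof.
move=> h0 h1 h2 [[|[|[|k]]] hk] //.
- by rewrite (_ : Ordinal hk = i30) //; apply: val_inj.
- by rewrite (_ : Ordinal hk = i31) //; apply: val_inj.
- by rewrite (_ : Ordinal hk = i32) //; apply: val_inj.
Qed.

Definition tup2 (T : Type) (x y : T) (i : 'I_2) := if val i == 0 then x else y.
Definition tup3 (T : Type) (x y z : T) (i : 'I_3) :=
  if val i == 0 then x else if val i == 1 then y else z.

Lemma tup2_inj (T : eqType) (x y : T) : x != y -> injective (tup2 x y).
Proof.
move=> xy; elim/ord2_ind => //; elim/ord2_ind => // /eqP; rewrite /tup2 /=.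
  by rewrite (negbTE xy).
by rewrite eq_sym (negbTE xy).
Qed.

Lemma tup3_inj (T : eqType) (x y z : T) : x != y -> y != z -> x != z -> injective (tup3 x y z).
Proof.
move=> xy yz xz; elim/ord3_ind => //; elim/ord3_ind => // /eqP; rewrite /tup3 /=;
  by rewrite ?(negbTE xy) ?(negbTE xz) ?(negbTE yz) // eq_sym ?(negbTE xy) ?(negbTE xz) ?(negbTE yz).
Qed.

Lemma exists_disjoint_tuples (T X : finType) b (S : {set T}) : #|X| * b <= #|S| ->
  exists gs : 'I_b -> X -> T, (forall i x j y, gs i x = gs j y -> i = j /\ x = y) /\ forall i x, gs i x \in S.
Proof.
move=> h; have [p pi pS] := exists_inj_ord h.
have e : #|{: 'I_b * X}| = #|X| * b by rewrite card_prod card_ord mulnC.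
exists (fun i x => p (cast_ord e (enum_rank (i, x)))); split=> // i x j y /pi/cast_ord_inj/enum_rank_inj[-> ->] //.
Qed.

Definition P3_tup (T : finType) (G : sgraph T) (g : 'I_3 -> T) :=
  [/\ adj G (g i30) (g i31), adj G (g i31) (g i32) & ~~ adj G (g i30) (g i32)].
Definition coP3_tup (T : finType) (G : sgraph T) (g : 'I_3 -> T) :=
  [/\ adj G (g i30) (g i31), ~~ adj G (g i30) (g i32) & ~~ adj G (g i31) (g i32)].
Definition edge_tup (T : finType) (G : sgraph T) (g : 'I_2 -> T) := adj G (g i20) (g i21).

(** * Almost unipolar pairs, up to complementation *)

Section Structure.
Variables (K : nat) (J : {set 'I_K * 'I_K}) (T : finType).
Implicit Types (G H : sgraph T) (A B : {set T}).

Lemma avoids_compl u w b A B G : [disjoint A & B] -> avoids u w b A B (compl G) -> avoids u w b A B G.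
Proof.
move=> d [tau [xs [ys [h1 h2 h3 h4 h5]]]]; exists (~: tau), xs, ys; split=> // i j.
apply: contraNneq (h5 i j) => e; apply/eqP/setP => v; rewrite inE adj_compl.
have -> : xs i v.1 != ys j v.2.
  by apply: contraTneq (h3 i v.1) => ->; rewrite (disjointFl d (h4 _ _)).
by have /setP/(_ v) := e; rewrite !inE => ->; rewrite negbK.
Qed.

Lemma avoiding_compl m u w b G : compl G \in avoiding J T m u w b -> G \in avoiding J T m u w b.
Proof.
rewrite !inE => /asboolP[A [B [h1 h2 h3 h4 h5]]]; apply/asboolP; exists A, B; split=> //.
- by rewrite -(complK G); apply: gadfree_compl.
- by rewrite -(complK G); apply: gadfree_compl.
- exact: avoids_compl.
Qed.

Lemma imbalanced_compl m q G : compl G \in imbalanced J T m q -> G \in imbalanced J T m q.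
Proof.
rewrite !inE => /asboolP[A [B [h1 h2 h3 h4 h5]]]; apply/asboolP; exists A, B; split=> //;
  by rewrite -(complK G); apply: gadfree_compl.
Qed.

(** An edge [x0 x1] and an induced path [y0 y1 y2] joined exactly by [x0 y0] and [x1 y2] form the
    pentagon [x0 x1 y2 y1 y0]. *)
Lemma edges_P3s_avoid b A B G (xs : 'I_b -> 'I_2 -> T) (ys : 'I_b -> 'I_3 -> T) : C5free G ->
  (forall i x j y, xs i x = xs j y -> i = j /\ x = y) -> (forall i x j y, ys i x = ys j y -> i = j /\ x = y) ->
  (forall i x, xs i x \in A) -> (forall i x, ys i x \in B) ->
  (forall i, edge_tup G (xs i)) -> (forall i, P3_tup G (ys i)) -> avoids 2 3 b A B G.
Proof.
move=> CG h1 h2 h3 h4 h5 h6; exists [set (i20, i30); (i21, i32)], xs, ys; split=> // i j.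
apply/eqP => /setP e; have [p1 p2 p3] := h6 j; have p4 := h5 i.
have := e (i20, i30); have := e (i20, i31); have := e (i20, i32).
have := e (i21, i30); have := e (i21, i31); have := e (i21, i32).
rewrite !inE /= => q6 q5 q4 q3 q2 q1.
apply: (CG (xs i i20) (xs i i21) (ys j i32) (ys j i31) (ys j i30)).
rewrite -/(edge_tup G (xs i)) p4 q6 (adj_sym G (ys j i32)) p2 (adj_sym G (ys j i31)) p1.
by rewrite (adj_sym G (ys j i30)) q1 q3 q2 q5 q4 (adj_sym G (ys j i32)) p3.
Qed.

Definition near_split m G A B :=
  [/\ [disjoint A & B], #|~: (A :|: B)| <= m, gadfree J G A /\ gadfree J G B, cliq G A & P3free_on G B].

Lemma stab_of_no_edge G A : (forall g, injective g -> (forall x, g x \in A) -> ~ edge_tup G g) -> stab G A.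
Proof.
move=> h x y xA yA; apply/negP => xy; apply: (h (tup2 x y)) => //.
  exact/tup2_inj/adj_neq/xy.
by elim/ord2_ind.
Qed.

Lemma P3free_of_no_P3 G B : (forall g, injective g -> (forall x, g x \in B) -> ~ P3_tup G g) -> P3free_on G B.
Proof.
move=> h x y z xB yB zB xy yz xz; apply: contraT => nxz; exfalso.
apply: (h (tup3 x y z)) => //.
  by apply: tup3_inj => //; [exact: adj_neq xy|exact: adj_neq yz].
by elim/ord3_ind.
Qed.

Lemma disjoint_cardC A B A0 B0 m k l : #|~: (A :|: B)| <= m -> A0 \subset A -> B0 \subset B ->
  #|A :\: A0| <= k -> #|B :\: B0| <= l -> #|~: (A0 :|: B0)| <= m + k + l.
Proof.
move=> h1 sA sB h2 h3.
apply: (@leq_trans #|~: (A :|: B) :|: ((A :\: A0) :|: (B :\: B0))|).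
  apply: subset_leq_card; apply/fintype.subsetP => x; rewrite !inE.
  by case: (x \in A0); case: (x \in B0); case: (x \in A); case: (x \in B).
rewrite cardsU; apply: leq_trans (leq_subr _ _) _; rewrite -addnA; apply: leq_add => //.
by rewrite cardsU; apply: leq_trans (leq_subr _ _) _; apply: leq_add.
Qed.

(** An almost complete [A] contains [b] disjoint edges, so [B] cannot contain [b] disjoint induced
    paths and becomes a union of cliques after [3 * b] deletions. *)
Lemma near_split_step m b A B H (R : {set T}) : C5free H -> [disjoint A & B] -> #|~: (A :|: B)| <= m ->
  gadfree J H A -> gadfree J H B -> R \subset A -> #|R| <= 6 * b -> cliq H (A :\: R) ->
  8 * b <= #|A| -> ~ avoids 2 3 b A B H -> exists A0 B0, near_split (m + 9 * b) H A0 B0 /\ A0 \subset A /\ B0 \subset B.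
Proof.
move=> CH d hm gA gB RA cR cl hA nav.
have hAR : #|'I_2| * b <= #|A :\: R|.
  by rewrite card_ord cardsD (setIidPr RA); clear - cR hA; lia.
have [xs [x1 x2]] := exists_disjoint_tuples hAR.
have [[ys [y1 y2 y3]]|[R' [r1 r2 r3]]] := exists_disjoint_tuples_or_hitting_set (P3_tup H) B b.
  exfalso; apply: nav; apply: (edges_P3s_avoid CH x1 y1) => // [i x|i].
    by have := x2 i x; rewrite inE => /andP[].
  by apply: cl => //; apply/eqP => /x1[_ /(congr1 val)].
exists (A :\: R), (B :\: R'); split; last by rewrite !subsetDl.
split=> //.
- rewrite -setI_eq0; apply/eqP/setP => x; rewrite !inE; case xA : (x \in A); rewrite ?andbF //.
  by rewrite (disjointFr d xA) !andbF.
- apply: leq_trans (disjoint_cardC hm (subsetDl A R) (subsetDl B R') (k := 6 * b) (l := 3 * b) _ _) _.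
  + by rewrite setDDr setDv set0U (setIidPr RA).
  + by rewrite setDDr setDv set0U (setIidPr r1); rewrite card_ord in r2.
  + by clear; lia.
- by split; [apply: gadfree_sub gA|apply: gadfree_sub gB]; rewrite subsetDl.
- exact: P3free_of_no_P3.
Qed.

(** If [A] is not almost homogeneous, it has many disjoint edges and many disjoint non-edges, so [B]
    has few disjoint induced paths in the graph and in its complement. By [P3_coP3_free], [B] is
    then almost homogeneous and the parts exchange roles. *)
Lemma near_split_or_compl m b A B G : C5free G -> [disjoint A & B] -> #|~: (A :|: B)| <= m ->
  gadfree J G A -> gadfree J G B -> 8 * b <= #|A| -> 8 * b <= #|B| ->
  G \notin avoiding J T m 2 3 b ->
  exists H A0 B0, (H = G \/ H = compl G) /\ near_split (m + 9 * b) H A0 B0.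
Proof.
move=> CG d hm gA gB hA hB nav.
have d' : [disjoint B & A] by rewrite disjoint_sym.
have hm' : #|~: (B :|: A)| <= m by rewrite setUC.
have CH H : (H = G \/ H = compl G) -> C5free H by case=> ->; [|apply: C5free_compl].
have gH H : (H = G \/ H = compl G) -> gadfree J H A /\ gadfree J H B.
  by case=> -> //; split; apply: gadfree_compl.
have navAB H : (H = G \/ H = compl G) -> ~ avoids 2 3 b A B H /\ ~ avoids 2 3 b B A H.
  move=> hH; split=> hav; move/negP: nav; apply; case: hH => eH; rewrite -?eH.
  - by rewrite inE; apply/asboolP; exists A, B; rewrite eH in hav *.
  - apply: avoiding_compl; rewrite -eH inE; apply/asboolP; exists A, B.
    by have [? ?] := gH H (or_intror eH).
  - by rewrite inE; apply/asboolP; exists B, A; rewrite eH in hav *.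
  - apply: avoiding_compl; rewrite -eH inE; apply/asboolP; exists B, A.
    by have [? ?] := gH H (or_intror eH).
have CK H : (H = G \/ H = compl G) -> (compl H = G \/ compl H = compl G).
  by case=> ->; [right|left; rewrite complK].
have hitA H : (H = G \/ H = compl G) -> (exists R : {set T}, [/\ R \subset A, #|R| <= 6 * b & cliq H (A :\: R)]) \/
    exists xs : 'I_b -> 'I_2 -> T, [/\ forall i x j y, xs i x = xs j y -> i = j /\ x = y, forall i x, xs i x \in A & forall i, edge_tup (compl H) (xs i)].
  move=> hH; have [h|[R [r1 r2 r3]]] := exists_disjoint_tuples_or_hitting_set (edge_tup (compl H)) A b; first by right.
  left; exists R; split=> //; first by rewrite card_ord in r2; clear - r2; lia.
  by rewrite -stab_compl; apply: stab_of_no_edge.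
have fin H : (H = G \/ H = compl G) -> (exists R : {set T}, [/\ R \subset A, #|R| <= 6 * b & cliq H (A :\: R)]) ->
    exists H A0 B0, (H = G \/ H = compl G) /\ near_split (m + 9 * b) H A0 B0.
  move=> hH [R [r1 r2 r3]]; have [g1 g2] := gH _ hH; have [n1 _] := navAB _ hH.
  have [A0 [B0 [h _]]] := near_split_step (CH _ hH) d hm g1 g2 r1 r2 r3 hA n1.
  by exists H, A0, B0.
case: (hitA G (or_introl erefl)) => [h|[xs [x1 x2 x3]]]; first exact: (fin G (or_introl erefl)).
case: (hitA (compl G) (or_intror erefl)) => [h|[zs [z1 z2 z3]]]; first exact: (fin (compl G) (or_intror erefl)).
have hitB H (ws : 'I_b -> 'I_2 -> T) : (H = G \/ H = compl G) ->
   (forall i x j y, ws i x = ws j y -> i = j /\ x = y) -> (forall i x, ws i x \in A) -> (forall i, edge_tup H (ws i)) ->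
   exists R : {set T}, [/\ R \subset B, #|R| <= 3 * b & P3free_on H (B :\: R)].
  move=> hH w1 w2 w3.
  have [[ys [y1 y2 y3]]|[R [r1 r2 r3]]] := exists_disjoint_tuples_or_hitting_set (P3_tup H) B b.
    exfalso; case: (navAB _ hH) => n1 _; apply: n1; exact: (edges_P3s_avoid (CH _ hH) w1 y1).
  exists R; split=> //; first by rewrite card_ord in r2.
  exact: P3free_of_no_P3.
have [R1 [a1 a2 a3]] := hitB (compl G) xs (or_intror erefl) x1 x2 x3.
rewrite complK in z3; have [R2 [c1 c2 c3]] := hitB G zs (or_introl erefl) z1 z2 z3.
have RB : R1 :|: R2 \subset B by rewrite subUset a1.
have cR : #|R1 :|: R2| <= 6 * b.
  by rewrite cardsU; apply: leq_trans (leq_subr _ _) _; clear - a2 c2; lia.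
have hom : cliq G (B :\: (R1 :|: R2)) \/ stab G (B :\: (R1 :|: R2)).
  apply: P3_coP3_free; [apply: P3free_on_sub c3|apply: P3free_on_sub a3];
    by apply: setDS; rewrite ?subsetUl ?subsetUr.
have finB H : (H = G \/ H = compl G) -> cliq H (B :\: (R1 :|: R2)) ->
    exists H A0 B0, (H = G \/ H = compl G) /\ near_split (m + 9 * b) H A0 B0.
  move=> hH hc; have [g1 g2] := gH _ hH; have [_ n1] := navAB _ hH.
  have [A0 [B0 [h _]]] := near_split_step (CH _ hH) d' hm' g2 g1 RB cR hc hB n1.
  by exists H, A0, B0.
case: hom => hom; first exact: (finB G (or_introl erefl)).
by apply: (finB (compl G) (or_intror erefl)); rewrite cliq_compl.
Qed.

End Structure.

(** * Exceptional attachments and degenerate graphs *)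

Section LocalClasses.
Variables (T : finType) (m r lo b3 b4 p : nat).

(** Each [tau] is what would complete a pentagon. For [loc_nonedge] it is [x g0 g1 y g2], with [x],
    [y] two non-adjacent clique-side vertices and [g] an edge plus an isolated vertex of [B]; for
    [loc_P3], an induced path of block-side vertices and an edge of [A]; for [loc_hom], three
    clique-side vertices against an edge or a non-edge of a homogeneous part of [B]. Always
    [h * w = 6]. *)
Definition loc_nonedge := removable (T := T) m r lo
  (att_avoid (h := 2) (w := 3) b4 true [set (i20, i30); (i20, i32); (i21, i31); (i21, i32)]
    (own_hom (2 * b3)) (@coP3_tup T)).
Definition loc_P3 := removable (T := T) m r lo
  (att_avoid (h := 3) (w := 2) p false [set (i30, i20); (i32, i21)]
    (own_blk (4 * b3)) (fun _ _ => True)).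
Definition loc_hom (c : bool) := removable (T := T) m r lo
  (att_avoid (h := 3) (w := 2) p true
    (if c then [set (i30, i20); (i32, i21)] else [set (i30, i20); (i32, i20); (i31, i21); (i32, i21)])
    (own_hom (2 * b3)) (fun G g => adj G (g i20) (g i21) = c)).

(** Both sides are set partitions (for [A] possibly after complementation) in which all but [k]
    vertices lie in one block or are pairwise in different blocks, so the partitions have little
    entropy. *)
Definition degenerate k : {set sgraph T} := [set G | `[< exists A : {set T},
  [/\ P3free_on G (~: A), P3free_on G A \/ P3free_on (compl G) A,
      exists2 A0 : {set T}, A0 \subset A & cliq G A0 /\ #|A :\: A0| <= k &
      exists2 Y0 : {set T}, Y0 \subset ~: A & (cliq G Y0 \/ stab G Y0) /\ #|~: A :\: Y0| <= k] >]].

End LocalClasses.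

(** * Placing the exceptional vertices *)

Section Classify.
Variables (K : nat) (J : {set 'I_K * 'I_K}) (T : finType) (m r lo b3 b4 p : nat).
Variables (G : sgraph T) (A0 B0 : {set T}).
Hypothesis CG : C5free G.
Hypothesis ns : near_split J m G A0 B0.
Hypothesis b3_gt0 : 0 < b3.
Hypothesis nav2 : G \notin avoiding J T m 2 2 b3.
Hypothesis nav1 : G \notin avoiding J T m 1 1 r.
Hypothesis loA : lo + 3 <= #|A0|.
Hypothesis loB : lo + 3 <= #|B0|.
Hypothesis pA : 2 * p <= #|A0|.
Hypothesis pB : 2 * p + 3 * b4 <= #|B0|.
Hypothesis nnon : G \notin loc_nonedge T (m + 3) r lo b3 b4.
Hypothesis nP3 : G \notin loc_P3 T (m + 3) r lo b3 p.
Hypothesis nhom : forall c, G \notin loc_hom T (m + 3) r lo b3 p c.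

Let dAB : [disjoint A0 & B0]. Proof. by case: ns. Qed.
Let clA : cliq G A0. Proof. by case: ns. Qed.
Let pfB : P3free_on G B0. Proof. by case: ns. Qed.
Let N x := nbh G x.

Lemma in_nbh x y : (y \in N x) = adj G x y. Proof. by rewrite inE. Qed.

Lemma not_avoids22 : ~ avoids 2 2 b3 A0 B0 G.
Proof.
move=> h; move/negP: nav2; apply; rewrite inE; apply/asboolP; exists A0, B0.
by case: ns => h1 h2 [h3 h4] _ _.
Qed.

Lemma no_rect (X Y : {set T}) : X \subset A0 -> Y \subset B0 ->
  (forall x y, x \in X -> y \in Y -> adj G x y) -> #|X| < r \/ #|Y| < r.
Proof.
move=> XA YB h; case: (ltnP #|X| r) => [|hX]; [by left|case: (ltnP #|Y| r) => [|hY]; first by right].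
exfalso; move/negP: nav1; apply; rewrite inE; apply/asboolP; exists A0, B0.
case: ns => h1 h2 [h3 h4] _ _; split=> //.
have [xs xi xX] := exists_inj_ord hX; have [ys yi yY] := exists_inj_ord hY.
exists set0, (fun i _ => xs i), (fun i _ => ys i); split.
- by move=> i x j y /xi ->; rewrite (ord1 x) (ord1 y).
- by move=> i x j y /yi ->; rewrite (ord1 x) (ord1 y).
- by move=> i _; apply: (fintype.subsetP XA).
- by move=> i _; apply: (fintype.subsetP YB).
- move=> i j; apply/eqP => /setP/(_ (ord0, ord0)); rewrite !inE /= h //.
Qed.

Lemma split_pair_remove h (H : {ffun 'I_h -> T}) : h <= 3 ->
  split_pair (m + 3) r lo (restr G (~: gverts H)) (A0 :\: gverts H) (B0 :\: gverts H).
Proof.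
move=> h3; have cH : #|gverts H| <= 3 by apply: leq_trans h3; apply: leq_trans (leq_imset_card _ _) _; rewrite card_ord.
have [_ hm _ _ _] := ns.
have inV x (S : {set T}) : x \in S :\: gverts H -> x \in S /\ x \in ~: gverts H by rewrite !inE => /andP[-> ->].
have cD (S : {set T}) : #|S| <= #|S :\: gverts H| + 3.
  rewrite -[#|S|](cardsID (gverts H)) addnC leq_add2l; apply: leq_trans cH.
  by apply: subset_leq_card; rewrite subsetIr.
split.
- rewrite -setI_eq0; apply/eqP/setP => x; rewrite !inE; case xA : (x \in A0); rewrite ?andbF //.
  by rewrite (disjointFr dAB xA) !andbF.
- by move=> x y /inV[xA xV] /inV[yA yV] xy; rewrite adj_restr xV yV clA.
- move=> x y z /inV[xA xV] /inV[yA yV] /inV[zA zV]; rewrite !adj_restr xV yV zV /=; exact: pfB.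
- apply: (@leq_trans #|~: (A0 :|: B0) :|: gverts H|).
    apply: subset_leq_card; apply/fintype.subsetP => x; rewrite !inE.
    by case: (x \in gverts H); rewrite ?orbT // orbF.
  by rewrite cardsU; apply: leq_trans (leq_subr _ _) _; apply: leq_add.
- split.
  + by have := leq_trans loA (cD A0); rewrite leq_add2r.
  + by have := leq_trans loB (cD B0); rewrite leq_add2r.
  + move=> X Y XA YB hXY; apply: no_rect.
    * by apply: subset_trans XA _; apply: subsetDl.
    * by apply: subset_trans YB _; apply: subsetDl.
    * by move=> x y xX yY; have := hXY x y xX yY; rewrite adj_restr => /and3P[].
Qed.

Definition typeB e := N e :&: B0 \in own_blk (4 * b3) G A0 B0.

Lemma symdiff_sub (X Y Z : {set T}) : X :\: Y \subset Z -> Y :\: X \subset Z -> #|symdiff X Y| <= #|Z|.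
Proof. by move=> h1 h2; apply: subset_leq_card; rewrite subUset h1. Qed.

(** A vertex outside both parts that is mixed on [A0] must look like a member of a block: pentagons
    through [e] force [N e] to meet [B0] in almost a clique and almost a whole block, up to [4 * b3]
    vertices. *)
Lemma classify e : e \notin A0 -> e \notin B0 ->
  [\/ #|A0 :\: N e| <= 2 * b3, typeB e |
      #|A0 :&: N e| <= 2 * b3].
Proof.
move=> eA eB; case: (leqP #|A0 :\: N e| (2 * b3)) => hA; first by constructor 1.
case: (leqP #|A0 :&: N e| b3) => hA1; first by constructor 3; apply: leq_trans hA1 _; rewrite leq_pmull.
have h2 : #|'I_2| * b3 <= #|A0 :\: N e| by rewrite card_ord ltnW.
have [xs [x1 x2]] := exists_disjoint_tuples h2.
have x3 i x : xs i x \in A0 /\ ~~ adj G e (xs i x) by have := x2 i x; rewrite !inE => /andP[-> ->].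
have [[ys [y1 y2 y3]]|[R [r1 r2 r3]]] := exists_disjoint_tuples_or_hitting_set (edge_tup (compl G)) (N e :&: B0) b3.
  (* Two non-adjacent neighbours [y0], [y1] of [e] in [B0] matched with two non-neighbours in [A0]
     give the pentagon [e y0 x0 x1 y1]. So few vertices meet all non-adjacent pairs of [N e] in
     [B0]. *)
  exfalso; apply: not_avoids22; exists [set (i20, i20); (i21, i21)], xs, ys; split=> //.
  - by move=> i x; case: (x3 i x).
  - by move=> i x; have := y2 i x; rewrite inE => /andP[].
  move=> i j; apply/eqP => /setP E.
  have q1 := E (i20, i20); have q2 := E (i20, i21); have q3 := E (i21, i20); have q4 := E (i21, i21).
  rewrite !inE /= in q1 q2 q3 q4.
  have ye k : adj G e (ys j k) by have := y2 j k; rewrite !inE => /andP[].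
  have [a0 e0] := x3 i i20; have [a1 e1] := x3 i i21.
  have aa : adj G (xs i i20) (xs i i21) by apply: clA => //; apply/eqP => /x1[_ /(congr1 val)].
  have := y3 j; rewrite /edge_tup adj_compl => /andP[_ yy].
  apply: (CG (a := e) (b := ys j i20) (c := xs i i20) (d := xs i i21) (e := ys j i21)).
  rewrite ye (adj_sym G (ys j i20)) q1 aa q4 (adj_sym G (ys j i21)) ye e0 e1.
  by rewrite (adj_sym G (ys j i20)) q3 yy q2.
have clQ : cliq G ((N e :&: B0) :\: R) by rewrite -stab_compl; apply: stab_of_no_edge.
rewrite card_ord in r2.
have sub_blk x : x \in (N e :&: B0) :\: R -> (N e :&: B0) :\: blk G B0 x \subset R.
  move=> xQ; apply/fintype.subsetP => y; rewrite in_setD => /andP[yb yNB].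
  apply: contraNT yb => yR; rewrite inE; have yB : y \in B0 by move: yNB; rewrite inE => /andP[].
  rewrite yB /=; case: (altP (y =P x)) => //= yx; apply: clQ => //; rewrite 1?eq_sym //.
  by rewrite in_setD yR.
have [z1 zi zA] := exists_inj_ord (ltnW hA1).
have h0 : b3 <= #|A0 :\: N e| by apply: leq_trans (ltnW hA); rewrite leq_pmull.
have [z0 z0i z0A] := exists_inj_ord h0.
have zA1 i : z1 i \in A0 /\ adj G e (z1 i) by have := zA i; rewrite !inE => /andP[-> ->].
have zA0 i : z0 i \in A0 /\ ~~ adj G e (z0 i) by have := z0A i; rewrite !inE => /andP[-> ->].
pose ws (i : 'I_b3) := tup2 (z1 i) (z0 i).
have z10 i j : z1 i <> z0 j by move=> E; have [_] := zA1 i; rewrite E; apply/negP; case: (zA0 j).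
have w1 i x j y : ws i x = ws j y -> i = j /\ x = y.
  elim/ord2_ind: x; elim/ord2_ind: y => /=; rewrite /ws /tup2 /=.
  - by move/zi ->.
  - by move/z10.
  - by move/esym/z10.
  - by move/z0i ->.
have [[ys [y1 y2 y3]]|[R2 [s1 s2 s3]]] := exists_disjoint_tuples_or_hitting_set
   (fun g : 'I_2 -> T => [/\ adj G e (g i20), ~~ adj G e (g i21) & adj G (g i20) (g i21)]) B0 b3.
  (* A neighbour [z1] and a non-neighbour [z0] of [e] in [A0], with an edge [y0 y1] of [B0] that
     leaves [N e], give the pentagon [e y0 y1 z0 z1]. *)
  exfalso; apply: not_avoids22; exists [set (i21, i21)], ws, ys; split=> //.
  - by move=> i; elim/ord2_ind; rewrite /ws /tup2 /=; [case: (zA1 i)|case: (zA0 i)].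
  move=> i j; apply/eqP => /setP E.
  have q1 := E (i20, i20); have q2 := E (i20, i21); have q3 := E (i21, i20); have q4 := E (i21, i21).
  rewrite !inE /ws /tup2 /= in q1 q2 q3 q4.
  have [a1 e1] := zA1 i; have [a0 e0] := zA0 i; have [k1 k2 k3] := y3 j.
  have aa : adj G (z0 i) (z1 i) by apply: clA => //; apply/eqP => /esym/z10.
  apply: (CG (a := e) (b := ys j i20) (c := ys j i21) (d := z0 i) (e := z1 i)).
  rewrite k1 k3 (adj_sym G (ys j i21)) q4 aa (adj_sym G _ e) e1 k2 e0.
  by rewrite (adj_sym G (ys j i20)) q3 (adj_sym G (ys j i20)) q1 (adj_sym G (ys j i21)) q2.
rewrite card_ord in s2.
have cRR : #|R :|: R2| <= 4 * b3.
  by rewrite cardsU; apply: leq_trans (leq_subr _ _) _; clear - r2 s2; lia.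
constructor 2; rewrite /typeB inE.
case: (set_0Vmem ((N e :&: B0) :\: (R :|: R2))) => [E0|[x xQ]].
  apply/orP; left; have : N e :&: B0 \subset R :|: R2 by rewrite -setD_eq0 E0.
  by move/subset_leq_card => h; apply: leq_trans h _.
apply/orP; right; apply/exists_inP; exists x; first by move: xQ; rewrite !inE => /and3P[].
have xR : x \in (N e :&: B0) :\: R.
  by move: xQ; rewrite !in_setD in_setU negb_or -andbA => /and3P[-> _ ->].
apply: leq_trans cRR; apply: symdiff_sub.
  by apply: subset_trans (sub_blk x xR) _; apply: subsetUl.
apply/fintype.subsetP => y; rewrite in_setD !in_setI => /andP[yN yb].
have [yB yx] : y \in B0 /\ (y == x) || adj G x y by move: yb; rewrite inE => /andP[].
rewrite yB andbT in_nbh in yN; rewrite in_setU; apply/orP; right.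
have [xN xB xR2] : [/\ adj G e x, x \in B0 & x \notin R2].
  by move: xQ; rewrite !inE negb_or => /andP[/andP[_ ->] /andP[-> ->]].
have xy : adj G x y.
  by case/orP: yx => // /eqP E; move: yN; rewrite E xN.
apply: contraT => yR2; exfalso; apply: (s3 (tup2 x y)).
- by apply: tup2_inj; apply: adj_neq xy.
- by elim/ord2_ind; rewrite /tup2 /= !inE; apply/andP.
- by rewrite /tup2 /=.
Qed.

(** A vertex outside both parts goes to the block side exactly when its trace on [B0] is that of a
    block member; by [classify], the remaining ones have an almost trivial trace on [A0]. *)
Definition sideA := [set x | (x \in A0) || (x \notin B0) && ~~ `[< typeB x >]].

Lemma sideA_hom x : x \in sideA -> x \notin B0 /\
  ((x \in A0) \/ (#|A0 :\: N x| <= 2 * b3 \/ #|A0 :&: N x| <= 2 * b3)).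
Proof.
rewrite inE => /orP[xA|/andP[xB /asboolP nB]]; first by rewrite (disjointFr dAB xA); split=> //; left.
split=> //; case xA : (x \in A0); first by left.
right; case: (classify (negbT xA) xB) => [h|h|h]; [by left|by case: nB|by right].
Qed.

Lemma blk_rest h (H : {ffun 'I_h -> T}) x : x \in B0 -> x \notin gverts H ->
  blk (restr G (~: gverts H)) (B0 :\: gverts H) x = blk G B0 x :\: gverts H.
Proof.
move=> xB xH; apply/setP => y; rewrite !in_set adj_restr !inE xH /=.
by case: (y \in gverts H).
Qed.

Lemma typeB_other y : y \notin sideA -> y \notin A0 /\ typeB y.
Proof.
rewrite inE negb_or negb_and negbK => /andP[yA /orP[|/negPn/asboolP //]] yB; split=> //; rewrite /typeB inE; apply/orP; right; apply/exists_inP; exists y => //.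
(* The neighbourhood of [y] in [B0] is its block without [y] itself, and [4 * b3] is positive. *)
apply: (@leq_trans #|[set y]|); last by rewrite cards1 muln_gt0.
apply: symdiff_sub; apply/fintype.subsetP => z; rewrite !inE.
  by move=> /and3P[h a b]; move: h; rewrite a b orbT.
by case/andP => h /andP[zB]; rewrite zB andbT in h; rewrite (negbTE h) orbF.
Qed.

Lemma sideA_own h (H : {ffun 'I_h -> T}) i : H i \in sideA ->
  nbh G (H i) :&: (A0 :\: gverts H) \in
    own_hom (2 * b3) (restr G (~: gverts H)) (A0 :\: gverts H) (B0 :\: gverts H).
Proof.
move=> /sideA_hom[_ hx]; rewrite inE subsetIr /=.
have mono (X Y : {set T}) : X \subset Y -> #|Y| <= 2 * b3 -> #|X| <= 2 * b3.
  by move=> /subset_leq_card h1; apply: leq_trans.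
case: hx => [xA|[h1|h1]]; apply/orP.
- left; rewrite (_ : _ :\: _ = set0) ?cards0 //; apply/setP => z; rewrite !inE; apply/negbTE/negP.
  case/and3P => k1 k2 k3; move: k1; rewrite k2 k3 !andbT clA //.
  by apply: contraNneq k2 => <-; apply: imset_f.
- left; apply: mono h1; apply/fintype.subsetP => z; rewrite !inE => /and3P[k1 k2 k3].
  by move: k1; rewrite k2 k3 !andbT.
- by right; apply: mono h1; apply/fintype.subsetP => z; rewrite !inE => /and3P[-> _ ->].
Qed.

Lemma sideB_own h (H : {ffun 'I_h -> T}) y : y \notin sideA ->
  nbh G y :&: (B0 :\: gverts H) \in
    own_blk (4 * b3) (restr G (~: gverts H)) (A0 :\: gverts H) (B0 :\: gverts H).
Proof.
move=> /typeB_other[_]; rewrite /typeB inE => /orP[h1|/exists_inP[x xB h1]]; rewrite inE; apply/orP.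
  left; apply: leq_trans h1; apply: subset_leq_card; apply/fintype.subsetP => z.
  by rewrite !inE => /and3P[-> _ ->].
case: (set_0Vmem (blk G B0 x :\: gverts H)) => [E0|[z]].
  left; apply: leq_trans h1; apply: subset_leq_card; apply/fintype.subsetP => z.
  rewrite !in_setI in_setD => /and3P[z1 z2 z3]; rewrite in_setU; apply/orP; left.
  rewrite in_setD in_setI z1 z3 !andbT; apply/negP => zb.
  by have /setP/(_ z) := E0; rewrite in_setD z2 zb inE.
rewrite in_setD => /andP[zH zb]; right; apply/exists_inP; exists z.
  by rewrite in_setD zH; move: zb; rewrite inE => /andP[].
have zB : z \in B0 by move: zb; rewrite inE => /andP[].
rewrite blk_rest // (blk_sym_eq pfB xB zb); apply: leq_trans h1; apply: subset_leq_card.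
apply/fintype.subsetP => w; rewrite !in_setU !in_setD !in_setI !in_setD.
by case: (w \in gverts H); rewrite /= ?andbF.
Qed.

Lemma sub_rest h (H : {ffun 'I_h -> T}) : (A0 :\: gverts H) :|: (B0 :\: gverts H) \subset ~: gverts H.
Proof. by rewrite subUset !subsetDr. Qed.

Lemma rest_all h (H : {ffun 'I_h -> T}) (S : {set T}) : (forall i, H i \notin S) -> S :\: gverts H = S.
Proof.
move=> hH; apply/setP => z; rewrite inE; case: imsetP => //= -[i _ ->].
by rewrite (negbTE (hH i)).
Qed.

(** The common frame of the four arguments that follow: vertices with small own-side traces whose
    attachment can never show [tau], because of a pentagon, put the graph into a removable class.
    [htup] says that the tuple condition depends only on adjacency within the tuple. *)
Lemma removable_intro h w b (sd : bool) (tau : {set 'I_h * 'I_w})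
    (own : sgraph T -> {set T} -> {set T} -> {set {set T}}) tup (H : {ffun 'I_h -> T})
    (S := if sd then B0 else A0) (O := if sd then A0 else B0) :
  h <= 3 -> injective H -> (forall i, H i \notin S) ->
  (forall G1 (g : 'I_w -> T), (forall i j, adj G1 (g i) (g j) = adj G (g i) (g j)) -> tup G1 g <-> tup G g) ->
  (exists gs : 'I_b -> 'I_w -> T, [/\ forall i x j y, gs i x = gs j y -> i = j /\ x = y,
         forall i x, gs i x \in S & forall i, tup G (gs i)]) ->
  (forall i, nbh G (H i) :&: (O :\: gverts H) \in
     own (restr G (~: gverts H)) (A0 :\: gverts H) (B0 :\: gverts H)) ->
  (forall g, injective g -> (forall x, g x \in S) -> tup G g ->
     (forall i j, adj G (H i) (g j) = ((i, j) \in tau)) -> False) ->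
  G \in removable (m + 3) r lo (att_avoid b sd tau own tup).
Proof.
move=> h3 Hi HS htup [gs [g1 g2 g3]] hown hpat; rewrite inE; apply/asboolP; split=> //.
have eS := rest_all HS.
have eS' : (if sd then B0 :\: gverts H else A0 :\: gverts H) = S by rewrite -[RHS]eS /S; case: (sd).
have eO' : (if sd then A0 :\: gverts H else B0 :\: gverts H) = O :\: gverts H by rewrite /O; case: (sd).
have SV x : x \in S -> x \in ~: gverts H by rewrite -eS !inE => /andP[].
have tupE g : (forall x, g x \in S) -> tup (restr G (~: gverts H)) g <-> tup G g.
  by move=> gS; apply: htup => i j; rewrite adj_restr !SV.
exists H, (A0 :\: gverts H), (B0 :\: gverts H); split=> //; first exact: sub_rest.
  exact: split_pair_remove.
split=> [|i|g gi gS gP] /=; rewrite ?eS' ?eO'.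
- by exists gs; split=> // i; apply/tupE.
- have -> : nbh G (H i) :&: (A0 :\: gverts H :|: (B0 :\: gverts H)) :&: (O :\: gverts H) = nbh G (H i) :&: (O :\: gverts H).
    rewrite -setIA; congr (_ :&: _); apply/setIidPr; rewrite /O; case: (sd); [exact: subsetUl|exact: subsetUr].
  exact: hown.
- rewrite eS' in gS; apply/eqP => /setP E; apply: (hpat g gi gS).
    exact/(tupE _ gS).
  move=> i j; rewrite -E !inE /= -[LHS]andbT; congr (_ && _); have := gS j; rewrite -[in X in X -> _]eS inE => /andP[-> ].
  by rewrite /S; case: (sd) => -> //; rewrite orbT.
Qed.

Lemma coP3_tup_ext (G1 : sgraph T) (g : 'I_3 -> T) :
  (forall i j, adj G1 (g i) (g j) = adj G (g i) (g j)) -> coP3_tup G1 g <-> coP3_tup G g.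
Proof. by move=> e; rewrite /coP3_tup !e. Qed.

Lemma sideA_clique (ys : 'I_b4 -> 'I_3 -> T) : (forall i x j y, ys i x = ys j y -> i = j /\ x = y) ->
  (forall i x, ys i x \in B0) -> (forall i, coP3_tup G (ys i)) -> cliq G sideA.
Proof.
move=> y1 y2 y3 x y xS yS xy; apply: contraT => nxy; exfalso.
pose H : {ffun 'I_2 -> T} := finfun (tup2 x y).
have HS i : H i \in sideA by rewrite ffunE; elim/ord2_ind: i.
move/negP: nnon; apply; apply: (removable_intro (H := H)) => //.
- by move=> i j; rewrite !ffunE; apply: tup2_inj.
- by move=> i; case: (sideA_hom (HS i)).
- exact: coP3_tup_ext.
- by exists ys.
- by move=> i; apply: sideA_own.
move=> g gi gS [p1 p2 p3] q.
have q00 := q i20 i30; have q01 := q i20 i31; have q02 := q i20 i32.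
have q10 := q i21 i30; have q11 := q i21 i31; have q12 := q i21 i32.
rewrite !ffunE /tup2 /= !inE /= in q00 q01 q02 q10 q11 q12.
apply: (CG (a := x) (b := g i30) (c := g i31) (d := y) (e := g i32)).
rewrite q00 p1 (adj_sym G (g i31)) q11 q12 (adj_sym G (g i32)) q02.
by rewrite q01 nxy (adj_sym G (g i30)) q10 p2 p3.
Qed.

Lemma P3_vs_edge (H : {ffun 'I_3 -> T}) (g : 'I_2 -> T) : P3_tup G H -> adj G (g i20) (g i21) ->
  (forall i j, adj G (H i) (g j) = ((i, j) \in [set (i30, i20); (i32, i21)])) -> False.
Proof.
move=> [p1 p2 p3] gg q.
have q00 := q i30 i20; have q01 := q i30 i21; have q10 := q i31 i20; have q11 := q i31 i21.
have q20 := q i32 i20; have q21 := q i32 i21.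
rewrite !inE /= in q00 q01 q10 q11 q20 q21.
apply: (CG (a := H i30) (b := H i31) (c := H i32) (d := g i21) (e := g i20)).
by rewrite p1 p2 q21 (adj_sym G (g i21)) gg (adj_sym G (g i20)) q00 p3 q01 q11 q10 q20.
Qed.

Lemma sideB_P3free : P3free_on G (~: sideA).
Proof.
apply: P3free_of_no_P3 => g gi gS gP.
pose H : {ffun 'I_3 -> T} := finfun g.
have HS i : H i \notin sideA by rewrite ffunE; have := gS i; rewrite inE.
move/negP: nP3; apply; apply: (removable_intro (H := H)) => //.
- by move=> i j; rewrite !ffunE; apply: gi.
- by move=> i; case: (typeB_other (HS i)).
- have h2 : #|'I_2| * p <= #|A0| by rewrite card_ord.
  by have [xs [x1 x2]] := exists_disjoint_tuples h2; exists xs.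
- by move=> i; apply: sideB_own.
move=> g' gi' gS' _; apply: P3_vs_edge; first by rewrite /P3_tup !ffunE.
by apply: clA => //; apply/eqP => /gi'/(congr1 val).
Qed.

Lemma sideA_hom_class (Y0 : {set T}) (c : bool) (g : 'I_3 -> T) : Y0 \subset B0 -> 2 * p <= #|Y0| ->
  (forall x y, x \in Y0 -> y \in Y0 -> x != y -> adj G x y = c) ->
  injective g -> (forall i, g i \in sideA) -> (if c then P3_tup G g else coP3_tup G g) -> False.
Proof.
move=> YB pY hY gi gS gP.
pose H : {ffun 'I_3 -> T} := finfun g.
have HS i : H i \in sideA by rewrite ffunE.
move/negP: (nhom c); apply; apply: (removable_intro (H := H)) => //.
- by move=> i j; rewrite !ffunE; apply: gi.
- by move=> i; case: (sideA_hom (HS i)).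
- by move=> G1 g' ->.
- have h2 : #|'I_2| * p <= #|Y0| by rewrite card_ord.
  have [xs [x1 x2]] := exists_disjoint_tuples h2; exists xs; split=> //.
    by move=> i x; apply: (fintype.subsetP YB).
  by move=> i; apply: hY => //; apply/eqP => /x1[_ /(congr1 val)].
- by move=> i; apply: sideA_own.
move=> g' gi' gS' cc q; clear -CG gP cc q; case: c gP cc q => [[p1 p2 p3] cc|[p1 p2 p3] /negbT cc].
  by apply: P3_vs_edge cc; rewrite /P3_tup !ffunE.
move=> q; have q00 := q i30 i20; have q01 := q i30 i21; have q10 := q i31 i20; have q11 := q i31 i21.
have q20 := q i32 i20; have q21 := q i32 i21.
rewrite !ffunE !inE /= in q00 q01 q10 q11 q20 q21.
apply: (CG (a := g i30) (b := g i31) (c := g' i21) (d := g i32) (e := g' i20)).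
rewrite p1 q11 (adj_sym G (g' i21)) q21 q20 (adj_sym G (g' i20)) q00.
by rewrite q01 p2 p3 q10 (adj_sym G (g' i21)) cc.
Qed.

Lemma P3free_compl_of_no_coP3 (B : {set T}) :
  (forall g, injective g -> (forall x, g x \in B) -> ~ coP3_tup G g) -> P3free_on (compl G) B.
Proof.
move=> h; apply: P3free_of_no_P3 => g gi gB; rewrite /P3_tup !adj_compl => -[/andP[n1 a1] /andP[n2 a2]].
rewrite negb_and !negbK => /orP[/eqP/gi/(congr1 val) //|a3].
apply: (h (tup3 (g i30) (g i32) (g i31))).
- by apply: tup3_inj => //; [exact: adj_neq a3|rewrite eq_sym].
- by elim/ord3_ind; rewrite /tup3 /=; apply: gB.
- by split; rewrite /tup3 //= adj_sym.
Qed.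

(** With many disjoint triples inducing an edge and an isolated vertex in [B0], the split by [sideA]
    is exactly unipolar. Otherwise [B0] is homogeneous up to [3 * b4] vertices, and the two classes
    [loc_hom] make [sideA] a union of cliques or complete multipartite. *)
Lemma unipolar_or_degenerate k : m + 3 * b4 <= k -> unipolar G \/ G \in degenerate T k.
Proof.
move=> hk.
have [[ys [y1 y2 y3]]|[R [r1 r2 r3]]] := exists_disjoint_tuples_or_hitting_set (coP3_tup G) B0 b4.
  left; exists sideA; split; [exact: sideA_clique y3|exact: sideB_P3free].
rewrite card_ord in r2; right; rewrite inE; apply/asboolP; exists sideA.
have YB : B0 :\: R \subset B0 by apply: subsetDl.
have hY : cliq G (B0 :\: R) \/ stab G (B0 :\: R).
  apply: P3_coP3_free; last exact: P3free_compl_of_no_coP3.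
  by move=> x y z xB yB zB; apply: pfB; apply: (fintype.subsetP YB).
have cY : 2 * p <= #|B0 :\: R|.
  by rewrite cardsD (setIidPr r1); have h1 := pB; clear - h1 r2; lia.
have [_ hm _ _ _] := ns.
split.
- exact: sideB_P3free.
- case: hY => hY; [left|right].
    apply: P3free_of_no_P3 => g gi gS gP; apply: (sideA_hom_class (c := true) YB cY _ gi gS gP) => x y xY yY xy.
    exact: hY.
  apply: P3free_compl_of_no_coP3 => g gi gS gP; apply: (sideA_hom_class (c := false) YB cY _ gi gS gP) => x y xY yY xy.
  by apply/negbTE/hY.
- exists A0; first by apply/fintype.subsetP => x xA; rewrite inE xA.
  split=> //; apply: leq_trans (leq_trans hm _); last by apply: leq_trans hk; apply: leq_addr.
  apply: subset_leq_card; apply/fintype.subsetP => x; rewrite !inE => /andP[/negbTE -> /=].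
  by case/andP.
- exists (B0 :\: R).
    apply/fintype.subsetP => x /(fintype.subsetP YB) xB; rewrite in_setC; apply/negP => /sideA_hom[].
    by rewrite xB.
  split=> //; apply: leq_trans hk; apply: (@leq_trans #|~: (A0 :|: B0) :|: R|).
    apply: subset_leq_card; apply/fintype.subsetP => x; rewrite in_setU in_setC in_setU in_setD in_setC in_setD => /andP[h1 h2].
    have /negbTE -> : x \notin A0 by case: (typeB_other h2).
    by move: h1; case: (x \in B0); case: (x \in R); rewrite //= ?orbT.
  by rewrite cardsU; apply: leq_trans (leq_subr _ _) _; apply: leq_add.
Qed.

End Classify.

(** * Counting unipolar graphs *)

Section Degenerate.
Variable T : finType.
Implicit Types (G : sgraph T) (S Z : {set T}).

(** Adjacency on [S] is equality of codes, or inequality if [t] is false. On [Z] the code is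
    prescribed, constant if [c] and injective otherwise, so only the codes on [S :\: Z] have to be
    recorded. *)
Definition coded G S Z (c t : bool) (F : T -> option T) :=
  (forall u v, u \in S -> v \in S -> u != v -> adj G u v = ((F u == F v) == t)) /\
  (forall z, z \in Z -> F z = if c then None else Some z).

(** A block is named by a vertex of [Z] if it contains one, else by one of its vertices. A clique
    [Z] lies in a single block, renamed [None]; a stable [Z] meets each block at most once, so its
    vertices name themselves. *)
Lemma P3free_coded G S Z : P3free_on G S -> Z \subset S -> cliq G Z \/ stab G Z ->
  exists (c : bool) (F : T -> option T), coded G S Z c true F.
Proof.
move=> pf /fintype.subsetP ZS hZ; pose c := `[< cliq G Z >].
have hc : if c then cliq G Z else stab G Z.
  by rewrite /c; case: asboolP => // n; case: hZ.
exists c; pose F v := if [pick z in Z :&: blk G S v] is Some z then (if c then None else Some z)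
  else [pick z in blk G S v].
have Fspec v : v \in S -> (exists z, [/\ z \in Z, z \in blk G S v & F v = if c then None else Some z])
    \/ (exists z, [/\ z \in blk G S v, F v = Some z & Z :&: blk G S v = set0]).
  move=> vS; rewrite /F; case: pickP => [z|h].
    by rewrite inE => /andP[h1 h2]; left; exists z.
  right; have E : Z :&: blk G S v = set0 by apply/setP => z; rewrite h inE.
  case: pickP => [z zb|/(_ v)]; first by exists z.
  by rewrite (blk_refl _ vS).
exists F; split=> [u v uS vS uv|z zZ].
  rewrite eqb_id; apply/idP/eqP => [h|e].
    have E : blk G S v = blk G S u by apply: blk_sym_eq => //; rewrite inE vS h orbT.
    by rewrite /F E.
  case: (Fspec u uS) => [[z [z1 z2 z3]]|[z [z2 z3 _]]]; case: (Fspec v vS) => [[w [w1 w2 w3]]|[w [w2 w3 _]]];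
    move: e; rewrite z3 w3.
  - move: hc; case: (c) => hc; last by case=> E; subst w; apply: blk_meet z2 w2 uv.
    move=> _; apply: (blk_meet (z := w) pf uS vS _ w2 uv).
    rewrite -(blk_sym_eq pf uS z2) inE (ZS _ w1) /=.
    by case: (altP (w =P z)) => //= wz; apply: hc; rewrite 1?eq_sym.
  - by case: (c) => // -[E]; subst w; apply: blk_meet z2 w2 uv.
  - by case: (c) => // -[E]; subst w; apply: blk_meet z2 w2 uv.
  - by case=> E; subst w; apply: blk_meet z2 w2 uv.
have zS := ZS _ zZ.
case: (Fspec z zS) => [[w [w1 w2 ->]]|[w [_ _ /setP/(_ z)]]]; last by rewrite !inE zZ zS eqxx.
move: hc; case: (c) => // hc; congr Some.
move: w2; rewrite inE => /andP[_ /orP[/eqP //|h]]; by have := hc z w zZ w1; rewrite h.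
Qed.

Lemma coded_compl G S Z c F : coded (compl G) S Z c true F -> coded G S Z c false F.
Proof.
move=> [h1 h2]; split=> // u v uS vS uv; have := h1 u v uS vS uv; rewrite adj_compl uv /=.
by rewrite eqb_id eqbF_neg => <-; rewrite negbK.
Qed.

Definition codes k : {set {set T} * {ffun T -> option T}} :=
  [set u : {set T} * {ffun T -> option T} | (#|u.1| <= k) && (u.2 \in pffun_on None (mem u.1) predT)].

Lemma card_codes k : #|codes k| <= 2 ^ #|T| * #|T|.+1 ^ k.
Proof.
have <- : #|[set: {set T}]| = 2 ^ #|T| by rewrite -powersetT card_powerset cardsT.
apply: (@leq_card_cover _ _ _ _ (fun Q u => (u.1 == Q))) => [u _|Q _].
  by exists u.1; rewrite ?inE.
case: (leqP #|Q| k) => hQ; last first.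
  rewrite (_ : [set _ in _ | _] = set0) ?cards0 //; apply/setP => u; rewrite !inE.
  by apply/negbTE/negP => /andP[/andP[h _] /eqP E]; move: h; rewrite E leqNgt hQ.
apply: leq_trans (leq_pexp2l (ltn0Sn _) hQ).
rewrite -card_option -(card_pffun_on (None : option T) (mem Q) predT).
rewrite -[X in _ <= X]cardsE.
apply: (@leq_card_inj_in _ _ snd) => [u|[a b] [a' b']]; rewrite !inE => /andP[/andP[_ h1] /eqP E].
  by rewrite -E.
by case/andP => _ /eqP E' /= E2; rewrite /= in E E' E2; rewrite E E' E2.
Qed.

(** Each side costs two booleans, a set of at most [k] exceptional vertices and their codes; the
    cross edges number at most [n * n / 4]. *)
Lemma degenerate_count k :
  #|degenerate T k| <= 2 ^ #|T| * ((4 * (2 ^ #|T| * #|T|.+1 ^ k)) ^ 2 * 2 ^ (#|T| * #|T| %/ 4)).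
Proof.
have cS : #|[set: {set T}]| = 2 ^ #|T| by rewrite -powersetT card_powerset cardsT.
rewrite -{1}cS.
pose side G S (x : (bool * bool) * ({set T} * {ffun T -> option T})) :=
  coded G S (S :\: x.2.1) x.1.1 x.1.2 (fun v => if v \in x.2.1 then x.2.2 v else if x.1.1 then None else Some v).
have sideP G S Z c t F : coded G S Z c t F -> Z \subset S -> #|S :\: Z| <= k ->
    exists2 x, x \in setX [set: bool * bool] (codes k) & side G S x.
  move=> [h1 h2] ZS hk; exists ((c, t), (S :\: Z, [ffun v => if v \in S :\: Z then F v else None])).
    rewrite !inE /= hk /=; apply/pffun_onP; split=> //.
    by apply/fintype.subsetP => v; rewrite inE ffunE; case: ifP.
  have FE v : v \in S -> (if v \in S :\: Z then [ffun v => if v \in S :\: Z then F v else None] v else if c then None else Some v) = F v.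
    by move=> vS; case: (boolP (v \in S :\: Z)) => [h|]; [rewrite ffunE h|rewrite inE vS andbT negbK => /h2].
  split=> /= [u v uS vS uv|z].
    by rewrite !FE //; apply: h1.
  by rewrite in_setD => /andP[/negbTE ->].
apply: (@leq_card_cover _ _ _ _ (fun (A : {set T}) G => `[< exists x, x \in setX [set: bool * bool] (codes k) /\ side G A x >]
    && `[< exists x, x \in setX [set: bool * bool] (codes k) /\ side G (~: A) x >])).
  move=> G; rewrite inE => /asboolP[A [pB pA [A0 sA [clA cA]] [Y0 sY [hY cY]]]]; exists A; first by rewrite inE.
  have [x xD xs] : exists2 x, x \in setX [set: bool * bool] (codes k) & side G A x.
    case: pA => pA.
      by have [c [F hF]] := P3free_coded pA sA (or_introl clA); apply: sideP hF _ _.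
    have [c [F hF]] := P3free_coded pA sA (or_intror (proj2 (stab_compl _ _) clA)).
    by apply: sideP (coded_compl hF) _ _.
  have [c [F hF]] := P3free_coded pB sY hY; have [y yD ys] := sideP _ _ _ _ _ _ hF sY cY.
  by apply/andP; split; apply/asboolP; [exists x|exists y].
move=> A _.
have cD : #|setX [set: bool * bool] (codes k)| <= 4 * (2 ^ #|T| * #|T|.+1 ^ k).
  by rewrite cardsX cardsT card_prod card_bool leq_mul2l card_codes orbT.
set D := setX _ _ in cD *.
apply: (@leq_trans (#|setX D D| * 2 ^ (#|T| * #|T| %/ 4))).
  apply: (@leq_card_cover _ _ _ _ (fun xy G => `[< side G A xy.1 /\ side G (~: A) xy.2 >])) => [G|[x y] _].
    rewrite inE => /andP[_ /andP[/asboolP[x [xD hx]] /asboolP[y [yD hy]]]]; exists (x, y); last by apply/asboolP.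
    by rewrite in_setX xD.
  apply: (@leq_trans #|powerset (setX A (~: A))|); last first.
    rewrite card_powerset leq_exp2l // cardsX leq_divRL //.
    by apply: disjoint_mul_le; rewrite -setI_eq0 setICr.
  apply: (@leq_card_inj_in _ _ (fun G => cross G A (~: A))) => [G _|G G'].
    by rewrite powersetE; apply/fintype.subsetP => v; rewrite !inE => /andP[].
  rewrite !inE => /andP[_ /asboolP[[a1 _] [b1 _]]] /andP[_ /asboolP[[a2 _] [b2 _]]] /setP E.
  have X u v : u \in A -> v \notin A -> adj G u v = adj G' u v.
    by move=> uA vA; have := E (u, v); rewrite !inE /= uA vA.
  apply: sgraph_ext => u v; case: (altP (u =P v)) => [->|uv]; first by rewrite !adj_irrefl.
  case uA : (u \in A); case vA : (v \in A).
  - by rewrite a1 // a2.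
  - by rewrite X // vA.
  - by rewrite adj_sym X ?uA // adj_sym.
  - by rewrite b1 ?b2 // inE ?uA ?vA.
by rewrite cardsX leq_mul2r -mulnn leq_mul ?orbT.
Qed.

End Degenerate.

(** * Lower bounds for the number of unipolar graphs *)

Definition unipolar_graphs (T : finType) := [set G : sgraph T | `[< unipolar G >]].
Definition nUni n := #|unipolar_graphs 'I_n|.

Lemma unipolar_pull (T T' : finType) (f : T' -> T) (G : sgraph T) :
  injective f -> unipolar G -> unipolar (pull f G).
Proof.
move=> fi [A [cA pB]]; exists (f @^-1: A); split=> [x y|x y z]; rewrite !inE.
  by move=> xA yA xy; rewrite adj_pull //; apply: cA; rewrite ?(inj_eq fi).
by move=> xA yA zA; rewrite !adj_pull // => h1 h2 xz; apply: (pB _ (f y)); rewrite ?inE ?(inj_eq fi).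
Qed.

Lemma pull_inj (T T' : finType) (f : T' -> T) : bijective f -> injective (@pull T T' f).
Proof.
move=> fb; have fi := bij_inj fb; case: fb => g gK fK G G' e; apply: sgraph_ext => x y.
by have := congr1 (fun H => adj H (g x) (g y)) e; rewrite !adj_pull // !fK.
Qed.

Lemma card_unipolar (T : finType) : #|unipolar_graphs T| = nUni #|T|.
Proof.
have eb : bijective (@enum_rank T) by exists enum_val; [apply: enum_rankK|apply: enum_valK].
have vb : bijective (@enum_val T predT) by exists enum_rank; [apply: enum_valK|apply: enum_rankK].
apply/eqP; rewrite eqn_leq; apply/andP; split.
  apply: (@leq_card_inj_in _ _ (pull enum_val)) => [G|G G' _ _]; last exact: pull_inj.
  by rewrite !inE => /asboolP h; apply/asboolP; apply: unipolar_pull => //; apply: bij_inj.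
apply: (@leq_card_inj_in _ _ (pull enum_rank)) => [G|G G' _ _]; last exact: pull_inj.
by rewrite !inE => /asboolP h; apply/asboolP; apply: unipolar_pull => //; apply: bij_inj.
Qed.

Section Extend.
Variable T : finType.

Definition ext_rel (G : sgraph T) (N : {set T}) (x y : option T) :=
  match x, y with Some u, Some v => adj G u v | None, Some v => v \in N | _, _ => false end.
Definition ext (G : sgraph T) (N : {set T}) : sgraph (option T) := graph_of (ext_rel G N).

Lemma ext_old G N u v : adj (ext G N) (Some u) (Some v) = adj G u v.
Proof.
rewrite adj_graph_of /= (adj_sym G v) orbb.
by case: eqP => [[->]|] //=; rewrite adj_irrefl.
Qed.

Lemma ext_new G N v : adj (ext G N) None (Some v) = (v \in N).
Proof. by rewrite adj_graph_of /= orbF. Qed.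

Lemma ext_inj G G' N N' : ext G N = ext G' N' -> G = G' /\ N = N'.
Proof.
move=> e; split; first by apply: sgraph_ext => u v; rewrite -(ext_old G N) e ext_old.
by apply/setP => v; rewrite -(ext_new G N) e ext_new.
Qed.

(* The new vertex joins the side opposite to the larger one: it becomes a new
   clique vertex, or a new singleton block. *)
Lemma unipolar_extend (G : sgraph T) : unipolar G -> exists (C S : {set T}),
  [/\ [disjoint C & S], uphalf #|T| <= #|S| & forall X : {set T}, X \subset S -> unipolar (ext G (C :|: X))].
Proof.
move=> [A [cA pB]].
have cT : #|A| + #|~: A| = #|T| by rewrite cardsC.
have [h|h] : uphalf #|T| <= #|~: A| \/ uphalf #|T| <= #|A| by clear -cT; lia.
  exists A, (~: A); split=> //; first by rewrite -setI_eq0 setICr.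
  move=> X XB; exists (None |: Some @: A); split=> [x y|x y z].
    rewrite !inE => /orP[/eqP ->|/imsetP[u uA ->]] /orP[/eqP ->|/imsetP[v vA ->]] //.
    - by rewrite ext_new inE vA.
    - by rewrite adj_sym ext_new inE uA.
    - by rewrite ext_old => uv; apply: cA.
  rewrite !inE !negb_or; case: x y z => [x|] [y|] [z|] //=; rewrite !mem_imset; try exact: Some_inj.
  by rewrite !ext_old => xA yA zA h1 h2 xz; apply: (pB x y z); rewrite ?inE.
exists set0, A; split=> //; first by rewrite -setI_eq0 set0I.
move=> X XB; exists (Some @: A); split=> [x y|x y z].
  case/imsetP => u uA -> /imsetP[v vA ->]; by rewrite ext_old => uv; apply: cA.
have NX u : u \notin A -> adj (ext G (set0 :|: X)) None (Some u) = false.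
  by move=> uA; rewrite ext_new !inE; apply/negbTE; apply: contra uA => /(fintype.subsetP XB).
rewrite !inE; case: x y z => [x|] [y|] [z|] //=; rewrite ?mem_imset; try exact: Some_inj.
- by rewrite !ext_old => xA yA zA h1 h2 xz; apply: (pB x y z); rewrite ?inE.
- by move=> _ yA _ _; rewrite adj_sym NX.
- by move=> xA _ zA; rewrite adj_sym NX.
- by move=> _ yA _; rewrite NX.
Qed.

End Extend.

(** The split of each graph and the enumeration of part of its larger side are fixed in advance, so
    the old graph and then the free subset can be read off the extension. *)
Lemma nUni_step n : nUni n * 2 ^ uphalf n <= nUni n.+1.
Proof.
have e : nUni n.+1 = #|unipolar_graphs (option 'I_n)| by rewrite card_unipolar card_option card_ord.
rewrite e.
have /boolp.choice[CS hCS] : forall G : sgraph 'I_n, exists CS : {set 'I_n} * {set 'I_n}, unipolar G ->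
   [/\ [disjoint CS.1 & CS.2], uphalf n <= #|CS.2| & forall X : {set 'I_n}, X \subset CS.2 -> unipolar (ext G (CS.1 :|: X))].
  move=> G; case: (EM (unipolar G)) => [/unipolar_extend[C [S]]|nu]; last by exists (set0, set0).
  by rewrite card_ord => h; exists (C, S).
have /boolp.choice[f hf] : forall G : sgraph 'I_n, exists f : 'I_(uphalf n) -> 'I_n, unipolar G ->
   injective f /\ forall i, f i \in (CS G).2.
  move=> G; case: (EM (unipolar G)) => [/hCS[_ h _]|nu].
    by have [f f1 f2] := exists_inj_ord h; exists f.
  have hl : uphalf n <= n by rewrite leq_uphalf_double -addnn leq_addr.
  by exists (widen_ord hl).
have -> : 2 ^ uphalf n = #|[set: {set 'I_(uphalf n)}]| by rewrite -powersetT card_powerset cardsT card_ord.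
rewrite /nUni -cardsX.
apply: (@leq_card_inj_in _ _ (fun u : sgraph 'I_n * {set 'I_(uphalf n)} => ext u.1 ((CS u.1).1 :|: f u.1 @: u.2))).
  move=> [G X]; rewrite !inE andbT /= => /asboolP uG; apply/asboolP.
  have [_ _] := hCS _ uG; apply; have [_ h] := hf _ uG.
  by apply/fintype.subsetP => x /imsetP[i _ ->].
move=> [G X] [G' X']; rewrite !inE !andbT /= => /asboolP uG _ /ext_inj[E].
subst G'; move/setP => E; congr pair; have [fi fS] := hf _ uG; have [d _ _] := hCS _ uG.
apply/setP => i; have := E (f G i); rewrite !in_setU (disjointFl d (fS i)) /=.
by rewrite !mem_imset.
Qed.

Lemma nUni_gt0 n : 0 < nUni n.
Proof.
apply/card_gt0P; exists (graph_of (fun _ _ => false)); rewrite inE; apply/asboolP.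
by exists set0; split=> [x y|x y z]; rewrite ?inE // adj_graph_of andbF.
Qed.

(** Half of the vertices form the clique. Of the others, [q] are representatives of blocks and [q]
    more choose a block by an arbitrary map; the cross edges are free. *)
Lemma nUni_partition_bound n : 2 ^ (n * n %/ 4) * (n %/ 4) ^ (n %/ 4) <= nUni n.
Proof.
set q := n %/ 4.
case: (posnP q) => [q0|q_gt0].
  have n4 : n < 4 by move: q0; rewrite /q; clear; lia.
  rewrite q0 expn0 muln1; case: n n4 {q q0} => [|[|[|[|n]]]] // _; rewrite /= ?nUni_gt0 //.
  - by apply: leq_trans (nUni_step 1); rewrite leq_pmull // nUni_gt0.
  - apply: leq_trans (nUni_step 2); rewrite (_ : 2 ^ _ = 2 * 2) // leq_mul2r; apply/orP; right.
    by apply: leq_trans (nUni_step 1); rewrite leq_pmull // nUni_gt0.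
pose h := n./2.
pose A := [set i : 'I_n | i < h].
have hq : h + q + q <= n by rewrite /h /q; clear; lia.
have inR (i : 'I_q) : h + i < n by have := ltn_ord i; move: hq; clear; lia.
have inQ (i : 'I_q) : h + q + i < n by have := ltn_ord i; move: hq; clear; lia.
pose rp (i : 'I_q) : 'I_n := Ordinal (inR i).
pose qp (i : 'I_q) : 'I_n := Ordinal (inQ i).
have rpi : injective rp by move=> i j /(congr1 val)/addnI/val_inj.
have qpi : injective qp by move=> i j /(congr1 val)/addnI/val_inj.
pose cl (f : {ffun 'I_q -> 'I_q}) (x : 'I_n) : 'I_n := if [pick i | qp i == x] is Some i then rp (f i) else x.
pose g (u : {set 'I_n * 'I_n} * {ffun 'I_q -> 'I_q}) : sgraph 'I_n := graph_of (fun x y =>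
  if x \in A then (y \in A) || ((x, y) \in u.1) else (y \notin A) && (cl u.2 x == cl u.2 y)).
have qpR f i : cl f (qp i) = rp (f i).
  by rewrite /cl; case: pickP => [j /eqP/qpi ->|/(_ i)] //; rewrite eqxx.
have rpR f i : cl f (rp i) = rp i.
  rewrite /cl; case: pickP => // j /eqP/(congr1 val) /= E; have := ltn_ord i; move: E; clear; lia.
have rA i : rp i \notin A by rewrite inE /= -leqNgt leq_addr.
have qA i : qp i \notin A by rewrite inE /= -leqNgt -addnA leq_addr.
have cA : #|A| = h.
  have hn : h <= n by rewrite /h; clear; lia.
  have wi : injective (widen_ord hn) by move=> i j /(congr1 val) /= e; apply: val_inj.
  rewrite -[RHS]card_ord -(card_imset _ wi); apply: eq_card => i.
  rewrite inE; apply/idP/imsetP => [ih|[j _ ->]]; last by rewrite /= ltn_ord.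
  by exists (Ordinal ih) => //; apply: val_inj.
have -> : 2 ^ (n * n %/ 4) = #|powerset (setX A (~: A))|.
  rewrite card_powerset cardsX [#|~: _|]cardsCs setCK cA card_ord; congr (2 ^ _); rewrite /h; clear.
  have [k [->|->]] : exists k, n = k.*2 \/ n = k.*2.+1 by exists n./2; have := odd_double_half n; case: (odd n); lia.
    by rewrite doubleK -addnn addnK; lia.
  by rewrite /= uphalf_double; nia.
have -> : q ^ q = #|[set: {ffun 'I_q -> 'I_q}]| by rewrite cardsT card_ffun card_ord.
rewrite -cardsX; apply: (@leq_card_inj_in _ _ g) => [u _|[C f] [C' f']].
  rewrite inE; apply/asboolP; exists A; split=> [x y xA yA xy|x y z]; rewrite ?inE.
    by rewrite adj_graph_of xy /= xA yA.
  rewrite -!leqNgt => xA yA zA.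
  have NA (w : 'I_n) : h <= w -> (w \in A) = false by move=> hw; rewrite inE ltnNge hw.
  rewrite !adj_graph_of !NA //= => /andP[_ e1] /andP[_ e2] -> /=.
  have {}e1 : cl u.2 x = cl u.2 y by case/orP: e1 => /eqP.
  by case/orP: e2 => /eqP e2; rewrite e1 e2 eqxx.
rewrite !inE !andbT => /fintype.subsetP sC /fintype.subsetP sC' E.
have EA x y := congr1 (fun H => adj H x y) E.
congr pair.
  apply/setP => -[x y]; case xyS : ((x, y) \in setX A (~: A)); last first.
    by apply/idP/idP => [/sC|/sC']; rewrite xyS.
  move: xyS; rewrite in_setX /= in_setC => /andP[xA yA].
  have := EA x y; rewrite !adj_graph_of /= xA (negbTE yA) /= !orbF.
  by have -> : x != y by apply: contraNneq yA => <-.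
apply/ffunP => i; have := EA (rp (f i)) (qp i); rewrite !adj_graph_of /= (negbTE (rA _)) (negbTE (qA _)) /=.
rewrite !qpR !rpR eqxx /= andbT.
have -> : rp (f i) != qp i.
  by apply/eqP => /(congr1 val); rewrite /= -addnA => /addnI E'; have := ltn_ord (f i); rewrite E' ltnNge leq_addr.
by rewrite (eq_sym (rp (f' i))) orbb => /esym/eqP/rpi.
Qed.

Lemma nUni_ge n : 2 ^ (n * n %/ 4) <= nUni n.
Proof.
apply: leq_trans (nUni_partition_bound n); rewrite leq_pmulr // expn_gt0.
by case: (n %/ 4).
Qed.

(** The codes cost [n.+1 ^ (2 * k)], at most [q ^ (4 * k)], which is at most the square root of
    [q ^ q] for [k = n %/ 40]. The remaining [q ^ (q - 4 * k)] is superexponential and absorbs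
    [2 ^ (3 * n + 8)]. *)
Lemma degenerate_small : exists n0, forall n, n0 <= n -> #|degenerate 'I_n (n %/ 40)| * 16 <= nUni n.
Proof.
have [e he] : exists e, 60 <= e by exists 60.
exists (4 * (2 ^ e + 6)) => n hn.
apply: leq_trans (nUni_partition_bound n); set q := n %/ 4; set k := n %/ 40.
have hq : 2 ^ e + 6 <= q by rewrite /q leq_divRL // mulnC.
apply: leq_trans (leq_mul (degenerate_count _ _) (leqnn 16)) _; rewrite !card_ord.
have n1 : n.+1 <= q ^ 2.
  have : n < 4 * q.+1 by rewrite /q mulnC; apply: ltn_ceil.
  have : 6 <= q by apply: leq_trans hq; apply: leq_addl.
  rewrite expnS expn1; clear; nia.
have k8 : 8 * k <= q by rewrite /k /q; clear; lia.
have e1 : n.+1 ^ k <= q ^ (2 * k) by rewrite expnM leq_expl.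
have e2 : 2 ^ (60 * (q - 4 * k)) <= q ^ (q - 4 * k).
  rewrite expnM; apply: leq_expl; apply: (@leq_trans (2 ^ e)); first by rewrite leq_exp2l.
  by apply: leq_trans hq; apply: leq_addr.
have e3 : 3 * n + 8 <= 60 * (q - 4 * k).
  have : n < 4 * q.+1 by rewrite /q mulnC; apply: ltn_ceil.
  have : 6 <= q by apply: leq_trans hq; apply: leq_addl.
  clear - k8; lia.
have -> : 2 ^ n * ((4 * (2 ^ n * n.+1 ^ k)) ^ 2 * 2 ^ (n * n %/ 4)) * 16 =
   2 ^ (n * n %/ 4) * (2 ^ (3 * n + 8) * (n.+1 ^ k) ^ 2).
  rewrite !expnMn expnD mulnC -mulnA; set a := 2 ^ (n * n %/ 4); set b := (n.+1 ^ k) ^ 2.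
  rewrite (_ : 3 * n = n + n + n); last by clear; lia.
  rewrite !expnD; set c := 2 ^ n; rewrite -[4 ^ 2]/(16) -[2 ^ 8]/(16 * 16) [c ^ 2]expnS expn1.
  clear; ring.
rewrite leq_mul2l; apply/orP; right.
have -> : q ^ q = q ^ (q - 4 * k) * (q ^ (2 * k)) ^ 2.
  by rewrite -expnM -expnD; congr (q ^ _); clear - k8; lia.
by apply: leq_mul; [apply: leq_trans e2; rewrite leq_exp2l|apply: leq_expl].
Qed.

(** * The inductive comparison of pentagon-free and unipolar graphs *)

Section Main1.
Variable R : realType.
Local Open Scope ring_scope.

Lemma nUni_shift k h : (nUni k)%:R * 2 `^ (h%:R * k%:R / 2) <= (nUni (k + h))%:R :> R.
Proof.
elim: h => [|h IH]; first by rewrite mul0r mul0r powRr0 mulr1 addn0.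
rewrite addnS; apply: le_trans (_ : (nUni (k + h) * 2 ^ uphalf (k + h))%N%:R <= _); last first.
  by rewrite ler_nat nUni_step.
have -> : h.+1%:R * k%:R / 2 = h%:R * k%:R / 2 + k%:R / 2 :> R by rewrite -addn1 natrD; ring.
rewrite powRD; last by apply/implyP; rewrite pnatr_eq0.
rewrite mulrA natrM; apply: ler_pM => //; first by rewrite mulr_ge0 ?powR_ge0.
  exact: powR_ge0.
rewrite natrX -powR_mulrn //; apply: ler_powR; first by rewrite ler1n.
have : (k <= 2 * uphalf (k + h))%N by rewrite mul2n -leq_uphalf_double; lia.
by rewrite -(ler_nat R) natrM; lra.
Qed.

Lemma direct_le n X : le2 X (n%:R * n%:R / 4 - 10 : R) -> (X * 512 <= nUni n)%N.
Proof.
move=> hX; apply: leq_trans (nUni_ge n); rewrite -[512%N]/(2 ^ 9)%N.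
apply: (@le2_nat R _ (n%:R * n%:R / 4 - 10 + 9%:R)); first exact: le2M (le2_exp2 R _).
have : (n * n < 4 * (n * n %/ 4).+1)%N by rewrite mulnC; apply: ltn_ceil.
rewrite -(ltr_nat R) !natrM -[X in _ < _ * X]natr1; set a := (n * n %/ 4)%:R; set b : R := n%:R * n%:R.
by clear; lra.
Qed.

(** The induction hypothesis for [n - h] combined with [nUni_shift]; the 5 missing bits are the
    factor 32. *)
Lemma recur_le M n h X : (h <= n)%N -> (nC5free (n - h) <= M * nUni (n - h))%N ->
  le2 X (h%:R * (n - h)%:R / 2 - 5 : R) -> (nC5free (n - h) * X * 32 <= M * nUni n)%N.
Proof.
move=> hn hM hX; rewrite -mulnA.
apply: leq_trans (_ : M * nUni (n - h) * (X * 32) <= _)%N; first by rewrite leq_mul2r hM orbT.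
rewrite -mulnA leq_mul2l; apply/orP; right.
rewrite -(ler_nat R); have := nUni_shift (n - h) h; rewrite subnK // => hs; apply: le_trans hs.
rewrite natrM ler_wpM2l //.
have := le2M hX (le2_exp2 R 5) => H; apply: le2_weak H _; by lra.
Qed.

Lemma removable_small : exists2 be : R, 0 < be /\ be <= 1 / 8 & exists n0, forall T : finType, (n0 <= #|T|)%N ->
  forall m r lo b3 h w sd (tau : {set 'I_h * 'I_w}) (own : sgraph T -> {set T} -> {set T} -> {set {set T}}) tup,
  m%:R <= be * #|T|%:R -> r%:R <= be * #|T|%:R -> b3%:R <= be * #|T|%:R ->
  #|T|%:R - 2 * lo%:R <= be * #|T|%:R -> (2 * lo <= #|T|)%N -> (h * w = 6)%N -> (1 < h <= 3)%N ->
  (forall G A B, #|own G A B| <= #|T|.+1 * (2 * #|[set X : {set T} | (#|X| <= 4 * b3)%N]|))%N ->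
  exists2 X, (#|removable (T := T) (m + 3) r lo (att_avoid (h := h) (w := w) (#|T| %/ 200) sd tau own tup)| <= nC5free (#|T| - h) * X)%N &
    le2 X (h%:R * (#|T| - h)%:R / 2 - 5 : R).
Proof.
have [c c0 hc] : exists2 c : R, 0 < c & le2 (2 ^ 6).-1 (6%:R - c) by apply: le2_pred; last exact: le2_exp2.
(* Missing one pattern on [n / 200] tuples saves [c * n / 200], that is [32 * ep * n]. The removed
   vertices, the pair, the own-side traces, the imbalance and the vertices outside the pair cost
   about half of this. *)
pose ep := c / 6400; have ep0 : 0 < ep by rewrite divr_gt0.
have [b0 b00 tail] := le2_tail ep0.
have [n1 lin] := le2_linear ep0.
pose be := Num.min (1 / 8) (Num.min ep (b0 / 30)).
have be0 : 0 < be by rewrite !lt_min ep0 !divr_gt0.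
have be1 : be <= 1 / 8 by rewrite ge_min lexx.
have beep : be <= ep by rewrite !ge_min lexx orbT.
have beb : 30 * be <= b0.
  have : be <= b0 / 30 by rewrite !ge_min lexx !orbT.
  by lra.
exists be => //.
have [n2 hn2] := nat_above (18 / b0).
have [n3 hn3] := nat_above (400 * (23 + c) / c).
exists (maxn n1 (maxn n2 (maxn n3 10))) => T; set n := #|T|; rewrite !geq_max => /and4P[N1 N2 N3 N4].
move=> m r lo b3 h w sd tau own tup hm hr hb hlo lon hw h23 hown.
have xb : 18 <= b0 * n%:R by have := hn2 _ N2; rewrite ler_pdivrMr // (mulrC b0).
have xc : 400 * (23 + c) <= c * n%:R by have := hn3 _ N3; rewrite ler_pdivrMr // (mulrC c).
set b := (n %/ 200)%N.
have bn : (200 * b <= n < 200 * b.+1)%N by rewrite /b mulnC leq_divM (mulnC 200%N) ltn_ceil.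
have T0 k : k%:R <= b0 * n%:R -> le2 #|[set X : {set T} | (#|X| <= k)%N]| (ep * n%:R).
  move=> hk; have := tail T setT k n%:R hk; rewrite cardsT => /(_ (lexx _)).
  by apply: le2_leq; apply: subset_leq_card; apply/fintype.subsetP => X; rewrite !inE subsetT.
set t := #|[set X : {set T} | (#|X| <= 3 * (n - 2 * lo) + 2 * r + 4 * (m + 3))%N]|.
set t4 := #|[set X : {set T} | (#|X| <= 4 * b3)%N]| in hown.
have ht4 : le2 t4 (ep * n%:R).
  apply: T0; rewrite natrM; apply: le_trans (_ : 30 * be * n%:R <= _); last by rewrite ler_wpM2r.
  have : 0 <= be * n%:R by rewrite mulr_ge0 // ltW.
  by clear - hb; lra.
have hnlo : (n - 2 * lo)%:R <= be * n%:R.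
  case: (leqP (2 * lo) n) => hl; first by rewrite natrB // natrM.
  have /eqP -> : (n - 2 * lo == 0)%N by rewrite subn_eq0 ltnW.
  by rewrite mulr_ge0 // ltW.
have ht : le2 t (ep * n%:R).
  apply: T0.
  have -> : (3 * (n - 2 * lo) + 2 * r + 4 * (m + 3))%N%:R = 3 * (n - 2 * lo)%:R + 2 * r%:R + 4 * (m%:R + 3) :> R.
    by rewrite !(natrM, natrD).
  have : 30 * be * n%:R <= b0 * n%:R by rewrite ler_wpM2r.
  by clear - hnlo hr hm xb; lra.
have lo3 : (6 * b <= 2 * lo)%N.
  rewrite -(ler_nat R) !natrM.
  have : be * n%:R <= 1 / 8 * n%:R by rewrite ler_wpM2r.
  have /andP[+ _] := bn; rewrite -(ler_nat R) natrM => q1 q2; have b0' : 0 <= b%:R :> R by [].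
  clear - q1 q2 hlo b0'; set y : R := b%:R in q1 b0' *; set x : R := n%:R in q1 q2 hlo *.
  by set z := be * x in q2 hlo; lra.
pose o := (n.+1 * (2 * t4))%N.
pose att := (o ^ h * ((2 ^ (h * w)).-1 ^ b * 2 ^ (h * (n - lo) - h * w * b)))%N.
exists (n ^ h * (2 * (t * t) * (att * 2 ^ (h * (m + 3)))))%N.
  rewrite mulnA [(nC5free _ * _)%N]mulnC; apply: removable_count => G A B [dAB _ _ _ [lA lB _]].
  have cS : (lo <= #|if sd then B else A| <= n - lo)%N.
    have : (#|A| + #|B| <= n)%N.
      have := cardsUI A B; rewrite (_ : A :&: B = set0) ?cards0 ?addn0 => [<-|]; first exact: max_card.
      by apply/eqP; rewrite setI_eq0.
    by move: lA lB; clear; case: (sd); lia.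
  case/andP: cS => c1 c2; have hwb : (h * w * b <= h * #|if sd then B else A|)%N.
    rewrite hw; apply: leq_trans lo3 _; apply: leq_mul => //; by case/andP: h23.
  apply: leq_trans (att_avoid_count tau tup (hown G A B) hwb) _.
  by rewrite /att leq_mul2l leq_mul2l leq_exp2l // leq_sub2r ?orbT // leq_mul2l c2 orbT.
have hn : le2 n (ep * n%:R) by apply: le2_leq (lin n N1).
have ho : le2 o (ep * n%:R + (1%:R + ep * n%:R)).
  by apply: le2M; [apply: lin|apply: le2M => //; apply: (le2_exp2 R 1)].
have hpr : le2 (2 ^ (h * w)).-1 (6%:R - c) by rewrite hw.
have H := le2M (le2X h hn) (le2M (le2M (le2_exp2 R 1) (le2M ht ht)) (le2M (le2M (le2X h ho) (le2M (le2X b hpr) (le2_exp2 R (h * (n - lo) - h * w * b)))) (le2_exp2 R (h * (m + 3))))).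
apply: le2_weak H _.
have hbnd : (h * w * b <= h * (n - lo))%N.
  rewrite hw; apply: leq_trans lo3 _; apply: leq_mul; first by case/andP: h23.
  by clear - lon; lia.
have lon' : (lo <= n)%N by clear - lon; lia.
rewrite natrB // !natrM natrB // natrD.
have hn' : (h <= n)%N by case/andP: h23 => _ h3; apply: leq_trans h3 _; apply: leq_trans N4.
rewrite natrB //.
have h3 : h%:R = 2 :> R \/ h%:R = 3 :> R.
  by case/andP: h23; clear; case: h => [|[|[|[|h]]]] // _ _; [left|right].
have hwR : h%:R * w%:R = 6 :> R by rewrite -natrM hw.
rewrite hwR.
have /andP[_] := bn; rewrite -(ltr_nat R) natrM -[X in _ < _ * X]natr1 => bx.
have bex : be * n%:R <= ep * n%:R by rewrite ler_wpM2r.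
have cb : c * n%:R <= c * (200 * (b%:R + 1)) by rewrite ler_wpM2l // ltW.
have exc : ep * n%:R * 6400 = c * n%:R by rewrite /ep; field.
clear - h3 cb bex hm hlo xc c0 exc.
move: hm hlo h3 cb bex xc exc.
set x := n%:R; set y := b%:R; set ee := ep * x; set bb := be * x; set cx := c * x; set l := lo%:R; set mm := m%:R.
set cy := c * y.
move=> hm hlo h3 cb bex xc exc.
have cb' : cx <= 200 * cy + 200 * c by rewrite /cy; lra.
have -> : y * (6 - c) = 6 * y - cy by rewrite /cy; ring.
case: h3 => -> ; lra.
Qed.

End Main1.

Section Main1.
Variable R : realType.
Local Open Scope ring_scope.

(** The constants depend on one another in the order [be], [mu], [lam], and only then comes the
    gadget with its size [K]. In the induction step every class found up to complementation counts
    twice: nine recursive terms take at most [9/32] of [M * nUni n], and the direct, degenerate and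
    unipolar terms together stay below [3 * nUni n], hence below [3/8] of it. *)
Lemma C5free_unipolar_bound : exists M, forall n, (nC5free n <= M * nUni n)%N.
Proof.
have [be [be0 be1] [n1 RM]] := removable_small R.
have z0 : 0 < be * be / 16 by rewrite divr_gt0 ?mulr_gt0.
have [l1 l10 H1] := imbalanced_small z0.
have be20 : 0 < be / 2 by rewrite divr_gt0.
have [l2 l20 H2] := avoiding_small (isT : 0 < 2)%N (isT : 0 < 2)%N be20.
have [l3 l30 H3] := avoiding_small (isT : 0 < 1)%N (isT : 0 < 1)%N be20.
pose mu := Num.min (Num.min l1 l2) (Num.min l3 (be / 40)).
have mu0 : 0 < mu by rewrite !lt_min l10 l20 l30 divr_gt0.
have [mu1 mu2 mu3 mube] : [/\ mu <= l1, mu <= l2, mu <= l3 & mu <= be / 40].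
  by rewrite !ge_min !lexx !orbT.
have mu40 : 0 < mu / 40 by rewrite divr_gt0.
have [l4 l40 H4] := avoiding_small (isT : 0 < 2)%N (isT : 0 < 3)%N mu40.
pose lam := Num.min l4 (mu / 4).
have lam0 : 0 < lam by rewrite lt_min l40 divr_gt0.
have [lam1 lam2] : lam <= l4 /\ lam <= mu / 4 by rewrite !ge_min !lexx !orbT.
have [K [J [K0 [n2 RO]]]] := rough lam0.
have [n3 {}H1] := H1 K J K0; have [n4 {}H2] := H2 K J K0; have [n5 {}H3] := H3 K J K0; have [n6 {}H4] := H4 K J K0.
have [n7 DE] := degenerate_small.
have [n8 hn8] := nat_above (40 / mu + 100 / be).
pose n0 := maxn n1 (maxn n2 (maxn n3 (maxn n4 (maxn n5 (maxn n6 (maxn n7 (maxn n8 (maxn (K + K) 3)))))))).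
(* The sum settles all [n < n0]; the 8 leaves room for the non-recursive terms. *)
pose M := (8 + \sum_(i < n0) nC5free i)%N.
exists M; elim/ltn_ind => n IH.
case: (ltnP n n0) => hn.
  apply: leq_trans (_ : M * 1 <= _)%N; last by rewrite leq_mul2l nUni_gt0 orbT.
  by rewrite muln1 /M (bigD1 (Ordinal hn)) //= addnCA leq_addr.
move: hn; rewrite !geq_max => /and4P[N1 N2 N3 /and4P[N4 N5 N6 /and4P[N7 N8 NK N9]]].
have cT : #|'I_n| = n by rewrite card_ord.
pose x : R := n%:R.
have x0 : 0 <= x by [].
have [xmu xbe] : 40 <= mu * x /\ 100 <= be * x.
  have h8 := hn8 _ N8; rewrite -/x in h8.
  have i1 : 0 < 40 / mu by rewrite divr_gt0.
  have i2 : 0 < 100 / be by rewrite divr_gt0.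
  have k1 : 40 / mu <= x by clear - h8 i1 i2; lra.
  have k2 : 100 / be <= x by clear - h8 i1 i2; lra.
  by move: k1 k2; rewrite !ler_pdivrMr // (mulrC x) (mulrC x).
have trunc (y : R) : 0 <= y -> (Num.truncn y)%:R <= y /\ y < (Num.truncn y)%:R + 1.
  by move=> y0; rewrite truncn_le // natr1; split=> //; apply: truncnS_gt.
pose m := Num.truncn (mu * x); pose b2 := Num.truncn (mu * x / 20); pose m1 := Num.truncn (lam * x).
pose b3 := Num.truncn (be * x); pose lo := (Num.truncn ((1 - be) / 2 * x)).+1.
pose q := Num.truncn (x * x / 4 - be * be / 16 * (x * x)).
have [m_le m_gt] := trunc (mu * x) (ltac:(rewrite mulr_ge0 // ltW //)).
have [b2_le b2_gt] := trunc (mu * x / 20) (ltac:(rewrite divr_ge0 // mulr_ge0 // ltW //)).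
have [m1_le m1_gt] := trunc (lam * x) (ltac:(rewrite mulr_ge0 // ltW //)).
have [b3_le b3_gt] := trunc (be * x) (ltac:(rewrite mulr_ge0 // ltW //)).
have bebe : be * be <= 1 / 8 * (1 / 8) by apply: ler_pM => //; apply: ltW.
have [lo_le lo_gt] := trunc ((1 - be) / 2 * x) (ltac:(rewrite mulr_ge0 //; lra)).
have xx0 : 0 <= x * x by rewrite mulr_ge0.
have bexx : be * be / 16 * (x * x) <= x * x / 4.
  have : be * be / 16 * (x * x) <= 1 / 4 * (x * x) by rewrite ler_wpM2r //; clear - bebe; lra.
  by clear; lra.
have [q_le q_gt] := trunc (x * x / 4 - be * be / 16 * (x * x)) (ltac:(rewrite subr_ge0 //)).
rewrite -/m -/b2 -/m1 -/b3 -/q in m_le m_gt b2_le b2_gt m1_le m1_gt b3_le b3_gt q_le q_gt.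
have loE : lo%:R = (Num.truncn ((1 - be) / 2 * x))%:R + 1 :> R by rewrite natr1.
have [lo1 lo2] : (1 - be) * x <= 2 * lo%:R /\ 2 * lo%:R <= (1 - be) * x + 2.
  by rewrite loE; clear - lo_le lo_gt; lra.
clear loE lo_le lo_gt.
have muxb : mu * x <= be / 40 * x by rewrite ler_wpM2r.
have lamx : lam * x <= mu / 4 * x by rewrite ler_wpM2r.
have bex8 : be * x <= 1 / 8 * x by rewrite ler_wpM2r.
have m1m : (m1 + 9 * b2 <= m)%N.
  rewrite -ltnS -(ltr_nat R) natrD natrM -[X in _ < X]natr1; clear - m1_le b2_le m_gt lamx xmu; lra.
have m1m' : (m1 <= m)%N by apply: leq_trans m1m; apply: leq_addr.
have b3_gt0 : (0 < b3)%N by rewrite -(ltr_nat R); clear - b3_gt xbe; lra.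
have hx : x = #|'I_n|%:R by rewrite card_ord.
have b3n : (b3 <= #|'I_n|)%N by rewrite -(ler_nat R) -hx; clear - b3_le bex8 x0; lra.
have b2n : (b2 <= #|'I_n|)%N by rewrite -(ler_nat R) -hx; clear - b2_le muxb bex8 x0; lra.
have tw k : (k <= n -> k <= #|'I_n|)%N by rewrite card_ord.
have mul (l : R) : mu <= l -> m%:R <= l * #|'I_n|%:R.
  by move=> hl; rewrite -hx; apply: le_trans m_le _; rewrite ler_wpM2r.
have I1 : le2 #|imbalanced J 'I_n m q| (x * x / 4 - 10).
  rewrite hx; apply: H1 => //; [exact: tw|exact: mul|by rewrite -hx].
have I2 : le2 #|avoiding J 'I_n m 2 2 b3| (x * x / 4 - 10).
  rewrite hx; apply: H2 => //; [exact: tw|exact: mul|by rewrite -hx; clear - b3_gt xbe; lra].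
have I3 : le2 #|avoiding J 'I_n m 1 1 b3| (x * x / 4 - 10).
  rewrite hx; apply: H3 => //; [exact: tw|exact: mul|by rewrite -hx; clear - b3_gt xbe; lra].
have I4 : le2 #|avoiding J 'I_n m1 2 3 b2| (x * x / 4 - 10).
  rewrite hx; apply: H4 => //; first exact: tw.
    by rewrite -hx; apply: le_trans m1_le _; rewrite ler_wpM2r.
  by rewrite -hx; clear - b2_gt xmu; lra.
have /direct_le D1 := I1; have /direct_le D2 := I2; have /direct_le D3 := I3; have /direct_le D4 := I4.
have D5 := DE _ N7.
have IHh h : (0 < h <= n)%N -> (nC5free (n - h) <= M * nUni (n - h))%N.
  by case/andP => h0 hn; apply: IH; rewrite ltn_subrL h0 /=; apply: leq_trans hn.
have [Bad [X [B1 B2 B3]]] := RO 'I_n (tw _ N2).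
rewrite card_ord in B1 B2 B3.
have R1 : (#|Bad| * 32 <= M * nUni n)%N.
  apply: leq_trans (recur_le NK (IHh _ _) (X := X) _); first by rewrite leq_mul2r B1 orbT.
    by rewrite addn_gt0 K0 NK.
  apply: le2_weak B2 _; rewrite natrB // natrD; clear; lra.
have loc h w sd (tau : {set 'I_h * 'I_w}) (own : sgraph 'I_n -> {set 'I_n} -> {set 'I_n} -> {set {set 'I_n}}) tup : (h * w = 6)%N -> (1 < h <= 3)%N ->
  (forall G A B, #|own G A B| <= #|'I_n|.+1 * (2 * #|[set X : {set 'I_n} | (#|X| <= 4 * b3)%N]|))%N ->
  (#|removable (T := 'I_n) (m + 3) b3 lo (att_avoid (h := h) (w := w) (#|'I_n| %/ 200) sd tau own tup)| * 32 <= M * nUni n)%N.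
  move=> hw h23 hown.
  have [|||||Y Y1 Y2] := RM 'I_n (tw _ N1) m b3 lo b3 h w sd tau own tup _ _ _ _ _ hw h23 hown.
  - by apply: mul; clear - mube be0; lra.
  - by rewrite -hx.
  - by rewrite -hx.
  - by rewrite -hx; clear - lo1; lra.
  - by rewrite -(ler_nat R) natrM -hx; clear - lo2 xbe; lra.
  rewrite card_ord in Y1 Y2 *.
  have hn : (0 < h <= n)%N.
    by case/andP: h23 => q1 q2; rewrite (ltnW q1) (leq_trans q2) // (leq_trans _ N9).
  apply: leq_trans (recur_le _ (IHh _ hn) Y2); last by case/andP: hn.
  by rewrite leq_mul2r Y1 orbT.
have tmono (s s' : nat) : (s <= s')%N -> (#|[set X : {set 'I_n} | (#|X| <= s)%N]| <= #|[set X : {set 'I_n} | (#|X| <= s')%N]|)%N.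
  by move=> ss; apply: subset_leq_card; apply/fintype.subsetP => Y; rewrite !inE => h; apply: leq_trans h ss.
have ownh (G : sgraph 'I_n) A B : (#|own_hom (2 * b3) G A B| <= #|'I_n|.+1 * (2 * #|[set X : {set 'I_n} | (#|X| <= 4 * b3)%N]|))%N.
  apply: leq_trans (own_hom_count _ _ _ _) _; apply: leq_trans (leq_pmull _ _) => //.
  by rewrite leq_mul2l tmono ?orbT // leq_mul2r orbT.
have ownb (G : sgraph 'I_n) A B : (#|own_blk (4 * b3) G A B| <= #|'I_n|.+1 * (2 * #|[set X : {set 'I_n} | (#|X| <= 4 * b3)%N]|))%N.
  apply: leq_trans (own_blk_count _ _ _ _) _; rewrite leq_mul2l; apply/orP; right.
  by rewrite leq_pmull.
pose p := (#|'I_n| %/ 200)%N.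
have L1 : (#|loc_nonedge 'I_n (m + 3) b3 lo b3 p| * 32 <= M * nUni n)%N by apply: loc.
have L2 : (#|loc_P3 'I_n (m + 3) b3 lo b3 p| * 32 <= M * nUni n)%N by apply: loc.
have L3 c : (#|loc_hom 'I_n (m + 3) b3 lo b3 p c| * 32 <= M * nUni n)%N by apply: loc.
pose V := avoiding J 'I_n m 2 2 b3 :|: avoiding J 'I_n m 1 1 b3 :|: loc_nonedge 'I_n (m + 3) b3 lo b3 p
   :|: loc_P3 'I_n (m + 3) b3 lo b3 p :|: loc_hom 'I_n (m + 3) b3 lo b3 p true :|: loc_hom 'I_n (m + 3) b3 lo b3 p false
   :|: unipolar_graphs 'I_n :|: degenerate 'I_n (n %/ 40).
have cU (X1 X2 : {set sgraph 'I_n}) : (#|X1 :|: X2| <= #|X1| + #|X2|)%N by rewrite cardsU leq_subr.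
have cover : C5free_graphs 'I_n \subset Bad :|: imbalanced J 'I_n m q :|: avoiding J 'I_n m1 2 3 b2 :|: V :|: (@compl _) @: V.
  apply/fintype.subsetP => G; rewrite inE => /asboolP CG.
  rewrite !in_setU; case GB : (G \in Bad) => //=; case GI : (G \in imbalanced _ _ _ _) => //=.
  case GA : (G \in avoiding _ _ _ _ _ _) => //=.
  have [A [B [dAB hm gA gB]]] := B3 G CG (negbT GB).
  have nimb H (A9 B9 : {set 'I_n}) : H = G \/ H = compl G -> [disjoint A9 & B9] -> (#|~: (A9 :|: B9)| <= m)%N ->
      gadfree J H A9 -> gadfree J H B9 -> (lo + 3 <= #|A9|)%N /\ (lo + 3 <= #|B9|)%N.
    move=> HG d hm1 g1 g2.
    have nI : H \notin imbalanced J 'I_n m q.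
      case: HG => ->; first by rewrite GI.
      by apply/negP => /imbalanced_compl; rewrite GI.
    have : (q.+1 <= #|A9| * #|B9|)%N.
      rewrite ltnNge; apply: contra nI => h; rewrite inE; apply/asboolP; exists A9, B9; split=> //.
    rewrite -(ler_nat R) natrM -natr1.
    have sAB : (#|A9| + #|B9| <= n)%N.
      have := cardsUI A9 B9; rewrite (_ : A9 :&: B9 = set0) ?cards0 ?addn0 => [<-|]; last by apply/eqP; rewrite setI_eq0.
      by apply: leq_trans (max_card _) _; rewrite card_ord.
    rewrite -(ler_nat R) natrD -/x in sAB.
    (* If the product of the parts exceeds [q], then each part differs from [x / 2] downwards by at
       most [be * x / 4], whereas [lo] is about [x / 2 - be * x / 2]. *)
    have key (a b : nat) : a%:R + b%:R <= x -> (q%:R + 1 <= a%:R * b%:R :> R) -> (lo + 3 <= a)%N.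
      move=> hab hq; rewrite leqNgt; apply/negP; rewrite -(ltr_nat R) natrD => hlt.
      move: hab hq hlt; set u : R := a%:R; set v : R := b%:R => hab hq hlt.
      have u0 : 0 <= u by [].
      have e1 : u * v <= u * (x - u) by rewrite ler_wpM2l //; clear - hab; lra.
      have e2 : u <= x / 2 - be * x / 4 by clear - hlt lo2 xbe; lra.
      have e3 : be * x / 4 * (be * x / 4) <= (x / 2 - u) * (x / 2 - u).
        by apply: ler_pM; clear - e2 xbe; lra.
      clear - e1 e3 hq q_gt; nra.
    move=> hq; split; first exact: (key _ #|B9|).
    by apply: (key _ #|A9|); [rewrite addrC|rewrite mulrC].
  have hm' : (#|~: (A :|: B)| <= m1)%N.
    by rewrite -ltnS -(ltr_nat R) -natr1; apply: le_lt_trans hm m1_gt.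
  have [loA loB] := nimb G A B (or_introl erefl) dAB (leq_trans hm' m1m') gA gB.
  have b8 : (8 * b2 <= lo + 3)%N by rewrite -(ler_nat R) natrM natrD; clear - b2_le lo1 muxb bex8 x0; lra.
  have [H [A0 [B0 [HG ns]]]] := near_split_or_compl CG dAB hm' gA gB (leq_trans b8 loA) (leq_trans b8 loB) (negbT GA).
  have ns' : near_split J m H A0 B0 by case: ns => k1 k2 k3 k4 k5; split=> //; apply: leq_trans m1m.
  suff HV : H \in V.
    case: HG HV => ->; first by rewrite /V !in_setU => ->.
    by move=> hV; apply/orP; right; apply/imsetP; exists (compl G); rewrite ?complK.
  have CH : C5free H by case: HG => -> //; apply: C5free_compl.
  have [d0 hm0 [g0 g0'] _ _] := ns'.
  have [loA0 loB0] := nimb H A0 B0 HG d0 hm0 g0 g0'.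
  have pb : (2 * p + 3 * p <= lo + 3)%N.
    have : (200 * p <= n)%N by rewrite /p card_ord mulnC leq_divM.
    by rewrite -!(ler_nat R) !(natrM, natrD) -/x; clear - lo1 bex8 x0; lra.
  have mk : (m + 3 * p <= n %/ 40)%N.
    rewrite leq_divRL // -(ler_nat R) natrM natrD natrM -/x.
    have : (200 * p <= n)%N by rewrite /p card_ord mulnC leq_divM.
    by rewrite -(ler_nat R) natrM -/x; clear - m_le muxb bex8 x0; lra.
  rewrite !in_setU; case h1 : (H \in avoiding J 'I_n m 2 2 b3) => //=.
  case h2 : (H \in avoiding J 'I_n m 1 1 b3) => //=.
  case h3 : (H \in loc_nonedge _ _ _ _ _ _) => //=; case h4 : (H \in loc_P3 _ _ _ _ _ _) => //=.
  case h5 : (H \in loc_hom _ _ _ _ _ _ true) => //=; case h6 : (H \in loc_hom _ _ _ _ _ _ false) => //=.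
  have h56 c : H \notin loc_hom 'I_n (m + 3) b3 lo b3 p c by case: c; rewrite ?h5 ?h6.
  have p2 : (2 * p <= #|A0|)%N by apply: leq_trans (leq_trans pb loA0); rewrite leq_addr.
  case: (unipolar_or_degenerate CH ns' b3_gt0 (negbT h1) (negbT h2) loA0 loB0 p2 (leq_trans pb loB0) (negbT h3) (negbT h4) h56 mk) => [hu|->].
    by rewrite [H \in unipolar_graphs _]inE; apply/orP; left; apply/asboolP.
  by rewrite orbT.
have cV : (#|V| <= #|avoiding J 'I_n m 2 2 b3| + #|avoiding J 'I_n m 1 1 b3| + #|loc_nonedge 'I_n (m + 3) b3 lo b3 p|
   + #|loc_P3 'I_n (m + 3) b3 lo b3 p| + #|loc_hom 'I_n (m + 3) b3 lo b3 p true| + #|loc_hom 'I_n (m + 3) b3 lo b3 p false|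
   + nUni n + #|degenerate 'I_n (n %/ 40)|)%N.
  by do 6![apply: leq_trans (cU _ _) _; apply: leq_add => //]; apply: cU.
have cC : (#|(@compl _) @: V| <= #|V|)%N by apply: leq_imset_card.
have tot : (nC5free n <= #|Bad| + #|imbalanced J 'I_n m q| + #|avoiding J 'I_n m1 2 3 b2| + #|V| + #|V|)%N.
  apply: leq_trans (subset_leq_card cover) _.
  apply: leq_trans (cU _ _) _; apply: leq_add => //; apply: leq_trans (cU _ _) _; apply: leq_add => //.
  by apply: leq_trans (cU _ _) _; apply: leq_add => //; apply: cU.
have L3t := L3 true; have L3f := L3 false.
have M8 : (8 * nUni n <= M * nUni n)%N by rewrite leq_mul2r /M leq_addr orbT.
clear - tot cV R1 D1 D2 D3 D4 D5 L1 L2 L3t L3f M8.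
move: tot cV R1 D1 D2 D3 D4 D5 L1 L2 L3t L3f M8.
set MU := (M * nUni n)%N; set U := nUni n; set v := #|V|; set c1 := #|Bad|; set c2 := #|imbalanced _ _ _ _|.
set c3 := #|avoiding _ _ _ 2 3 _|; set c4 := #|avoiding _ _ _ 2 2 _|; set c5 := #|avoiding _ _ _ 1 1 _|.
set c6 := #|loc_nonedge _ _ _ _ _ _|; set c7 := #|loc_P3 _ _ _ _ _ _|; set c8 := #|loc_hom _ _ _ _ _ _ true|.
set c9 := #|loc_hom _ _ _ _ _ _ false|; set c10 := #|degenerate _ _|; clearbody MU U v c1 c2 c3 c4 c5 c6 c7 c8 c9 c10.
by clear; lia.
Qed.

End Main1.

(** * Unipolar graphs are perfect *)

(** The induction of Halmos and Vaughan: a proper non-empty tight subset is matched separately from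
    the rest, whose sets lose the values used; without such a subset any value for [i0] leaves the
    condition intact. *)
Lemma hall (I T : finType) (t0 : T) (D : {set I}) (F : I -> {set T}) :
  (forall J : {set I}, J \subset D -> #|J| <= #|\bigcup_(i in J) F i|) ->
  exists f : I -> T, {in D &, injective f} /\ forall i, i \in D -> f i \in F i.
Proof.
have [k hk] : exists k, #|D| <= k by exists #|D|.
elim: k D F hk => [|k IH] D F hk hall.
  have D0 : D = set0 by apply/eqP; rewrite -cards_eq0 -leqn0.
  by exists (fun _ => t0); rewrite D0; split=> [i j|i]; rewrite inE.
case: (set_0Vmem D) => [D0|[i0 i0D]].
  by exists (fun _ => t0); rewrite D0; split=> [i j|i]; rewrite inE.
case: (EM (exists J : {set I}, [/\ J \proper D, J != set0 & #|\bigcup_(i in J) F i| <= #|J|])) => [[J [JD J0 Jt]]|nJ].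
  have cJ : #|J| <= k by rewrite -ltnS; apply: leq_trans (proper_card JD) hk.
  have sJ := proper_sub JD.
  have [f [fi fF]] := IH J F cJ (fun K KJ => hall K (subset_trans KJ sJ)).
  set U := \bigcup_(i in J) F i in Jt.
  have cDJ : #|D :\: J| <= k.
    have h1 := cardsID J D; rewrite (setIidPr sJ) in h1.
    have h2 : 0 < #|J| by rewrite card_gt0.
    by move: h1 h2 hk; clear; lia.
  have [g [gi gF]] : exists g : I -> T, {in D :\: J &, injective g} /\ forall i, i \in D :\: J -> g i \in F i :\: U.
    apply: (IH (D :\: J) (fun i => F i :\: U)) => // K /fintype.subsetP KD.
    have KJ0 : K :&: J = set0.
      by apply/setP => i; rewrite !inE; case iK : (i \in K) => //=; have := KD i iK; rewrite !inE => /andP[/negbTE].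
    have h1 : #|K| + #|J| <= #|\bigcup_(i in K :|: J) F i|.
      have := cardsUI K J; rewrite KJ0 cards0 addn0 => <-; apply: hall; rewrite subUset sJ andbT.
      by apply/fintype.subsetP => i /KD; rewrite inE => /andP[].
    have h2 : #|\bigcup_(i in K :|: J) F i| <= #|\bigcup_(i in K) (F i :\: U)| + #|U|.
      apply: leq_trans (_ : #|(\bigcup_(i in K) (F i :\: U)) :|: U| <= _); last by rewrite cardsU leq_subr.
      apply: subset_leq_card; apply/fintype.subsetP => t /bigcupP[i iKJ tF]; rewrite inE.
      case tU : (t \in U); rewrite ?orbT // orbF; apply/bigcupP; exists i; last by rewrite inE tU.
      move: iKJ; rewrite inE => /orP[//|iJ]; case/bigcupP: (negbT tU); by exists i.
    by move: h1 h2 Jt; clear; lia.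
  have fU i : i \in J -> f i \in U by move=> iJ; apply/bigcupP; exists i => //; apply: fF.
  have gU i : i \in D -> i \notin J -> g i \notin U.
    by move=> iD iJ; have := gF i; rewrite !inE iJ iD => /(_ isT)/andP[].
  exists (fun i => if i \in J then f i else g i); split=> [i j iD jD|i iD].
    case iJ : (i \in J); case jJ : (j \in J) => E.
    - exact: fi.
    - by have := gU j jD (negbT jJ); rewrite -E fU.
    - by have := gU i iD (negbT iJ); rewrite E fU.
    - by apply: gi => //; rewrite inE ?iJ ?jJ ?iD ?jD.
  case iJ : (i \in J); first exact: fF.
  by have := gF i; rewrite !inE iJ iD => /(_ isT)/andP[].
have /card_gt0P[t tF] : 0 < #|F i0|.
  have := hall [set i0]; rewrite sub1set i0D big_set1 cards1; exact.
have cD : #|D :\ i0| <= k by rewrite -ltnS; apply: leq_trans hk; rewrite [#|D|](cardsD1 i0) i0D.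
have [g [gi gF]] : exists g : I -> T, {in D :\ i0 &, injective g} /\ forall i, i \in D :\ i0 -> g i \in F i :\ t.
  apply: (IH (D :\ i0) (fun i => F i :\ t)) => // K KD.
  case: (altP (K =P set0)) => [->|K0]; first by rewrite cards0.
  have pK : K \proper D.
    by apply: sub_proper_trans KD _; apply: properD1.
  have h1 : #|K| < #|\bigcup_(i in K) F i|.
    by rewrite ltnNge; apply/negP => h; apply: nJ; exists K.
  have h2 : #|\bigcup_(i in K) F i| <= #|\bigcup_(i in K) (F i :\ t)| + 1.
    apply: leq_trans (_ : #|(\bigcup_(i in K) (F i :\ t)) :|: [set t]| <= _); last first.
      by rewrite cardsU cards1 leq_subr.
    apply: subset_leq_card; apply/fintype.subsetP => u /bigcupP[i iK uF]; rewrite !inE.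
    case: (altP (u =P t)) => [|ut]; rewrite ?orbT // orbF; apply/bigcupP; exists i => //.
    by rewrite !inE ut.
  by move: h1 h2; clear; lia.
exists (fun i => if i == i0 then t else g i); split=> [i j iD jD|i iD].
  have gt l : l \in D -> l != i0 -> g l != t.
    by move=> lD l0; have := gF l; rewrite !inE l0 lD => /(_ isT)/andP[].
  case: eqP => [->|/eqP i0']; case: eqP => [->|/eqP j0'] // E.
  - by have := gt j jD j0'; rewrite -E eqxx.
  - by have := gt i iD i0'; rewrite E eqxx.
  - by apply: gi => //; rewrite !inE ?i0' ?j0'.
case: eqP => [-> //|/eqP i0']; by have := gF i; rewrite !inE i0' iD => /(_ isT)/andP[].
Qed.

Section Perfect.
Variable T : finType.
Implicit Types (G : sgraph T).

Lemma cliqueP G (A : {set T}) : reflect (cliq G A) (clique G A).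
Proof.
apply: (iffP forall_inP) => [h x y xA yA xy|h x xA]; first by have /forall_inP/(_ y yA)/implyP := h x xA; apply.
by apply/forall_inP => y yA; apply/implyP => xy; apply: h.
Qed.

Lemma colorableP G k : reflect (exists c : T -> 'I_k, forall x y, adj G x y -> c x != c y) (colorable G k).
Proof.
apply: (iffP existsP) => [[c /forallP h]|[c h]].
  by exists c => x y xy; have /forallP/(_ y)/implyP := h x; apply.
exists (finfun c); apply/forallP => x; apply/forallP => y; apply/implyP => xy; rewrite !ffunE; exact: h.
Qed.

Lemma clique_number_le_colors G k : colorable G k -> clique_number G <= k.
Proof.
case/colorableP => c hc; apply/bigmax_leqP => A /cliqueP cA.
rewrite -[k]card_ord; apply: leq_trans (_ : #|c @: A| <= _); last exact: max_card.
rewrite card_in_imset // => x y xA yA E; apply/eqP; apply: contraT => xy.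
by have := hc x y (cA x y xA yA xy); rewrite E eqxx.
Qed.

Lemma clique_card_le G (A : {set T}) : cliq G A -> #|A| <= clique_number G.
Proof. by move/cliqueP => cA; rewrite /clique_number (bigD1 A) //= leq_maxl. Qed.

(** Colour the clique [A] injectively, then each block by Hall's theorem, a vertex having as list
    [L v] the colours that its neighbours in [A] do not use. For a subset [K] of a block, the
    colours missing from all lists come from the common neighbourhood [Q] of [K] in [A], and [K]
    with [Q] is a clique. *)
Lemma unipolar_colorable G : unipolar G -> colorable G (clique_number G).
Proof.
move=> [A [cA pB]]; set w := clique_number G; set B := ~: A in pB.
case: (pickP T) => [v0 _|noT]; last first.
  have hE (x : T) : False by have := noT x.
  by apply/colorableP; exists (fun x => match hE x with end) => x; case: (hE x).
have w0 : 0 < w.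
  apply: leq_trans (_ : #|[set v0]| <= _); first by rewrite cards1.
  by apply: clique_card_le => x y; rewrite !inE => /eqP -> /eqP ->; rewrite eqxx.
pose c0 : 'I_w := Ordinal w0.
have cAw : #|A| <= #|[set: 'I_w]| by rewrite cardsT card_ord; apply: clique_card_le.
have [a [ai _]] : exists a : T -> 'I_w, {in A &, injective a} /\ forall i, i \in A -> a i \in [set: 'I_w].
  apply: (hall c0) => K KA; case: (set_0Vmem K) => [->|[x xK]]; first by rewrite cards0.
  apply: leq_trans (subset_leq_card KA) _; apply: leq_trans cAw _; apply: subset_leq_card.
  by apply/fintype.subsetP => i _; apply/bigcupP; exists x.
pose L v : {set 'I_w} := ~: (a @: (A :&: nbh G v)).
have /boolp.choice[g hg] : forall C : {set T}, exists g : T -> 'I_w, C \subset B -> cliq G C ->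
    {in C &, injective g} /\ forall v, v \in C -> g v \in L v.
  move=> C; case: (EM (C \subset B /\ cliq G C)) => [[CB cC]|nC]; last by exists (fun _ => c0) => h1 h2; case: nC.
  have [g hg] : exists g : T -> 'I_w, {in C &, injective g} /\ forall v, v \in C -> g v \in L v; last by exists g.
  apply: (hall c0) => K KC.
  case: (set_0Vmem K) => [->|[x0 x0K]]; first by rewrite cards0.
  pose Q := A :&: \bigcap_(v in K) nbh G v.
  have QP q : q \in Q -> q \in A /\ forall v, v \in K -> adj G v q.
    rewrite inE => /andP[qA /bigcapP h]; split=> // v vK; by have := h v vK; rewrite inE.
  have cQK : #|K| + #|Q| <= w.
    have d : K :&: Q = set0.
      apply/setP => x; rewrite in_setI in_set0; apply/negP => /andP[xK /QP[xA _]].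
      by have := fintype.subsetP CB x (fintype.subsetP KC x xK); rewrite inE xA.
    have := cardsUI K Q; rewrite d cards0 addn0 => <-; apply: clique_card_le => x y.
    rewrite !in_setU => /orP[xK|/QP[xA hx]] /orP[yK|/QP[yA hy]] xy.
    - by apply: cC => //; apply: (fintype.subsetP KC).
    - exact: hy.
    - by rewrite adj_sym; apply: hx.
    - exact: cA.
  have : ~: (\bigcup_(v in K) L v) \subset a @: Q.
    apply/fintype.subsetP => i; rewrite inE => /bigcupP h.
    have hi v : v \in K -> i \in a @: (A :&: nbh G v).
      by move=> vK; apply/negPn/negP => n; apply: h; exists v => //; rewrite inE.
    have /imsetP[q] := hi x0 x0K; rewrite inE => /andP[qA _] iq; apply/imsetP; exists q => //.
    rewrite inE qA; apply/bigcapP => v /hi/imsetP[q']; rewrite !inE => /andP[q'A h'] iq'.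
    by rewrite (ai q q') // -iq.
  move/subset_leq_card => h1; have h2 := leq_imset_card a Q.
  have := cardsC (\bigcup_(v in K) L v); rewrite card_ord => h3.
  rewrite -(leq_add2r #|~: (\bigcup_(v in K) L v)|) h3; apply: leq_trans cQK.
  by rewrite leq_add2l; apply: leq_trans h1 h2.
have blkB v : blk G B v \subset B by apply/fintype.subsetP => x; rewrite inE => /andP[].
have blkc v : v \in B -> cliq G (blk G B v).
  move=> vB x y xb yb xy; have xB := fintype.subsetP (blkB v) x xb; have yB := fintype.subsetP (blkB v) y yb.
  apply: (blk_meet (z := v) pB xB yB _ _ xy); rewrite (blk_sym_eq pB vB) //; exact: blk_refl.
apply/colorableP; exists (fun v => if v \in A then a v else g (blk G B v) v) => x y xy.
have cross u v : u \in A -> v \notin A -> adj G u v -> a u != g (blk G B v) v.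
  move=> uA vA uv; have vB : v \in B by rewrite inE.
  have [_ h] := hg _ (blkB v) (blkc v vB); have := h v (blk_refl _ vB); rewrite inE.
  apply: contraNneq => <-; apply: imset_f; by rewrite !inE uA adj_sym.
have xNy := adj_neq xy.
case xA : (x \in A); case yA : (y \in A).
- by apply: contraNneq xNy => /ai ->.
- by apply: cross => //; rewrite yA.
- by rewrite eq_sym; apply: cross; rewrite ?xA // adj_sym.
- have xB : x \in B by rewrite inE xA.
  have yB : y \in B by rewrite inE yA.
  have yb : y \in blk G B x by rewrite inE yB xy orbT.
  rewrite (blk_sym_eq pB xB yb); have [h _] := hg _ (blkB x) (blkc x xB).
  by apply: contraNneq xNy => /h -> //; apply: blk_refl.
Qed.

End Perfect.

Lemma adj_induced (T : finType) (G : sgraph T) (S : {set T}) (x y : {x : T | x \in S}) :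
  adj (induced G S) x y = adj G (val x) (val y).
Proof. by rewrite /adj inE imsetU1 imset_set1. Qed.

Lemma unipolar_perfect (T : finType) (G : sgraph T) : unipolar G -> perfect G.
Proof.
move=> uG; apply/forallP => S; rewrite /chromatic_number; case: ex_minnP => k hk hmin.
rewrite eqn_leq clique_number_le_colors // andbT; apply: hmin; apply: unipolar_colorable.
have [A [cA pB]] := uG; exists [set x : {x : T | x \in S} | val x \in A]; split=> [x y|x y z]; rewrite !inE.
  by move=> xA yA xy; rewrite adj_induced; apply: cA.
by move=> xA yA zA; rewrite !adj_induced => h1 h2 xz; apply: (pB _ (val y)); rewrite ?inE.
Qed.

Lemma perfect_C5free (T : finType) (G : sgraph T) : perfect G -> C5free G.
Proof.
move=> pG a b c d e [/and5P[ab bc cd de ea] /and5P[ac ad bd be ce]].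
pose S : {set T} := [set a; b; c; d; e].
have := forallP pG S; rewrite /chromatic_number; case: ex_minnP => k /colorableP[col hcol] _ /eqP Ek.
have symF x y : ~~ adj G x y -> adj G y x = false by rewrite adj_sym => /negbTE.
have ac' := symF _ _ ac; have ad' := symF _ _ ad; have bd' := symF _ _ bd; have be' := symF _ _ be; have ce' := symF _ _ ce.
have tri x y z : x \in S -> y \in S -> z \in S -> adj G x y -> adj G y z -> adj G x z -> False.
  rewrite !inE -!orbA => /or4P[/eqP->|/eqP->|/eqP->|/orP[/eqP->|/eqP->]];
    move=> /or4P[/eqP->|/eqP->|/eqP->|/orP[/eqP->|/eqP->]];
    rewrite ?adj_irrefl ?ac' ?ad' ?bd' ?be' ?ce' ?(negbTE ac) ?(negbTE ad) ?(negbTE bd) ?(negbTE be) ?(negbTE ce) //;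
    move=> /or4P[/eqP->|/eqP->|/eqP->|/orP[/eqP->|/eqP->]];
    rewrite ?adj_irrefl ?ac' ?ad' ?bd' ?be' ?ce' ?(negbTE ac) ?(negbTE ad) ?(negbTE bd) ?(negbTE be) ?(negbTE ce) //.
have k2 : k <= 2.
  rewrite Ek; apply/bigmax_leqP => A /cliqueP cA; rewrite leqNgt; apply/negP => /card_gt2P[x [y [z [[xA yA zA] [xy yz zx]]]]].
  apply: (tri (val x) (val y) (val z) (valP x) (valP y) (valP z)); rewrite -adj_induced; apply: cA => //.
  by rewrite eq_sym.
have [aS bS cS] : [/\ a \in S, b \in S & c \in S] by rewrite !inE !eqxx !orbT.
have [dS eS] : d \in S /\ e \in S by rewrite !inE !eqxx !orbT.
have hc x y (xS : x \in S) (yS : y \in S) : adj G x y -> val (col (Sub x xS)) != val (col (Sub y yS)).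
  by move=> xy; apply: (hcol); rewrite adj_induced.
have := hc _ _ aS bS ab; have := hc _ _ bS cS bc; have := hc _ _ cS dS cd; have := hc _ _ dS eS de.
have := hc _ _ eS aS ea.
have lt2 x : val (col x) < 2 by apply: leq_trans (ltn_ord _) k2.
have := lt2 (Sub a aS); have := lt2 (Sub b bS); have := lt2 (Sub c cS); have := lt2 (Sub d dS); have := lt2 (Sub e eS).
move: (val (col (Sub a aS))) (val (col (Sub b bS))) (val (col (Sub c cS))) (val (col (Sub d dS))) (val (col (Sub e eS))).
by clear; case=> [|[|?]] //; case=> [|[|?]] //; case=> [|[|?]] //; case=> [|[|?]] //; case=> [|[|?]].
Qed.

(** * Typical set partitions *)

Section Bell.
Variable T : finType.
Implicit Types (H : sgraph T) (S Q : {set T}).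

(* Set partitions of [S], encoded as disjoint unions of cliques. *)
Definition parts S : {set sgraph T} := [set H | (restr H S == H) && `[< P3free_on H S >]].

Lemma partsP H S : reflect ((forall x y, adj H x y -> x \in S /\ y \in S) /\ P3free_on H S) (H \in parts S).
Proof.
rewrite inE; apply: (iffP andP) => [[/eqP e /asboolP p]|[h p]].
  by split=> // x y; rewrite -e adj_restr => /and3P[].
split; last exact/asboolP.
apply/eqP; apply: sgraph_ext => x y; rewrite adj_restr.
by case xy : (adj H x y); rewrite ?andbF // andbT; have [-> ->] := h x y xy.
Qed.

Definition part_of (V : eqType) S (f : T -> V) : sgraph T :=
  graph_of (fun x y => [&& x \in S, y \in S & f x == f y]).

Lemma adj_part_of (V : eqType) S (f : T -> V) x y :
  adj (part_of S f) x y = [&& x != y, x \in S, y \in S & f x == f y].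
Proof.
rewrite adj_graph_of (eq_sym (f y)); case: (x \in S); case: (y \in S); rewrite ?andbF ?orbF ?orbb //.
Qed.

Lemma part_of_parts (V : eqType) S (f : T -> V) : part_of S f \in parts S.
Proof.
apply/partsP; split=> [x y|x y z xS yS zS]; rewrite !adj_part_of; first by case/and4P.
move=> /and4P[_ _ _ /eqP ->] /and4P[_ _ _ /eqP ->] ->; by rewrite xS zS eqxx.
Qed.

Lemma parts_blkE H S x y : H \in parts S -> x \in S -> y \in S ->
  adj H x y = (x != y) && (blk H S x == blk H S y).
Proof.
case/partsP => _ pf xS yS; apply/idP/andP => [xy|[xy /eqP e]].
  split; first exact: adj_neq xy.
  by apply/eqP/esym; apply: blk_sym_eq => //; rewrite inE yS xy orbT.
by have := blk_refl H yS; rewrite -e inE => /andP[_ /orP[/eqP E|//]]; rewrite E eqxx in xy.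
Qed.

(** Put [j] fixed vertices into different blocks and let every other vertex choose one of them. *)
Lemma parts_ge S j : 0 < j <= #|S| -> j ^ (#|S| - j) <= #|parts S|.
Proof.
case/andP => j0 jS; have [r ri rS] := exists_inj_ord jS.
pose Rr := r @: [set: 'I_j].
have cR : #|Rr| = j by rewrite card_imset // cardsT card_ord.
have RS : Rr \subset S by apply/fintype.subsetP => x /imsetP[i _ ->].
have -> : #|S| - j = #|S :\: Rr| by rewrite cardsD (setIidPr RS) cR.
pose o : 'I_j := Ordinal j0.
have <- : #|[set f : {ffun T -> 'I_j} | f \in pffun_on o (mem (S :\: Rr)) predT]| = j ^ #|S :\: Rr|.
  by rewrite cardsE card_pffun_on card_ord.
pose cl (f : {ffun T -> 'I_j}) x := if x \in Rr then x else r (f x).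
apply: (@leq_card_inj_in _ _ (fun f => part_of S (cl f))) => [f _|f f']; first exact: part_of_parts.
rewrite !inE => /pffun_onP[/fintype.subsetP hf _] /pffun_onP[/fintype.subsetP hf' _] E.
apply/ffunP => x; case xS : (x \in S :\: Rr); last first.
  have out (h : {ffun T -> 'I_j}) : {subset [pred x | h x != o] <= mem (S :\: Rr)} -> h x = o.
    by move=> hh; apply/eqP; apply: contraFT xS => /hh.
  by rewrite (out f) ?(out f').
move: xS; rewrite inE => /andP[xR xS].
have fR : r (f x) \in Rr by apply: imset_f.
have xr : r (f x) != x by apply: contraNneq xR => <-.
have := congr1 (fun H => adj H (r (f x)) x) E; rewrite !adj_part_of xr xS (fintype.subsetP RS _ fR) /=.
by rewrite /cl fR (negbTE xR) eqxx => /esym/eqP/ri.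
Qed.

Lemma parts_mul S Q : Q \subset S -> #|parts Q| * #|parts (S :\: Q)| <= #|parts S|.
Proof.
move=> QS; rewrite -cardsX.
pose un (u : sgraph T * sgraph T) := graph_of (fun x y => adj u.1 x y || adj u.2 x y).
have unE u x y : adj (un u) x y = adj u.1 x y || adj u.2 x y.
  rewrite adj_graph_of (adj_sym u.1 y) (adj_sym u.2 y) orbb; case: eqP => [->|] //=.
  by rewrite !adj_irrefl.
have side u x y : u.1 \in parts Q -> u.2 \in parts (S :\: Q) ->
    (adj u.1 x y -> x \in Q /\ y \in Q) /\ (adj u.2 x y -> [/\ x \in S, y \in S, x \notin Q & y \notin Q]).
  move=> /partsP[h1 _] /partsP[h2 _]; split=> [/h1 //|/h2]; by rewrite !inE => -[/andP[-> ->] /andP[-> ->]].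
apply: (@leq_card_inj_in _ _ un) => [[a b]|[a b] [a' b']].
  rewrite in_setX => /andP[u1 u2]; have sd x y := side (a, b) x y u1 u2; rewrite /= in sd.
  case/partsP: (u1) => _ p1; case/partsP: (u2) => _ p2; apply/partsP; split=> [x y|x y z xS yS zS].
    rewrite unE => /orP[/(proj1 (sd x y))[xQ yQ]|/(proj2 (sd x y))[-> -> _ _] //].
    by rewrite !(fintype.subsetP QS).
  rewrite !unE => /orP[xy|xy] /orP[yz|yz] xz.
  - have [xQ yQ] := proj1 (sd _ _) xy; have [_ zQ] := proj1 (sd _ _) yz; by rewrite (p1 x y z).
  - by have [_ yQ] := proj1 (sd _ _) xy; have [_ _ nyQ _] := proj2 (sd _ _) yz; rewrite yQ in nyQ.
  - by have [yQ _] := proj1 (sd _ _) yz; have [_ _ _ nyQ] := proj2 (sd _ _) xy; rewrite yQ in nyQ.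
  - have [_ _ xQ yQ] := proj2 (sd _ _) xy; have [_ _ _ zQ] := proj2 (sd _ _) yz.
    by rewrite (p2 x y z) ?orbT // inE ?xQ ?yQ ?zQ.
rewrite !in_setX => /andP[u1 u2] /andP[v1 v2] E.
have EA x y : adj a x y || adj b x y = adj a' x y || adj b' x y.
  by rewrite -(unE (a, b)) -(unE (a', b')) E.
have sd x y := side (a, b) x y u1 u2; have sd' x y := side (a', b') x y v1 v2; rewrite /= in sd sd'.
congr pair; apply: sgraph_ext => x y.
  case xQ : (x \in Q).
    have := EA x y; have -> : adj b x y = false by apply/negP => /(proj2 (sd x y))[_ _]; rewrite xQ.
    by have -> : adj b' x y = false by [apply/negP => /(proj2 (sd' x y))[_ _]; rewrite xQ]; rewrite !orbF.
  have -> : adj a x y = false by apply/negP => /(proj1 (sd x y))[]; rewrite xQ.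
  by symmetry; apply/negP => /(proj1 (sd' x y))[]; rewrite xQ.
case xQ : (x \in Q).
  have -> : adj b x y = false by apply/negP => /(proj2 (sd x y))[_ _]; rewrite xQ.
  by symmetry; apply/negP => /(proj2 (sd' x y))[_ _]; rewrite xQ.
have := EA x y; have -> : adj a x y = false by apply/negP => /(proj1 (sd x y))[]; rewrite xQ.
by have -> : adj a' x y = false by apply/negP => /(proj1 (sd' x y))[]; rewrite xQ.
Qed.

Definition blocks H S := [set blk H S x | x in S].

Lemma parts_few_blocks S b : #|[set H in parts S | #|blocks H S| <= b]| <= b ^ #|S|.
Proof.
case: (set_0Vmem S) => [->|[x0 x0S]].
  rewrite cards0 expn0; apply: (@leq_trans #|[set graph_of (fun _ _ : T => false)]|); last by rewrite cards1.
  apply: subset_leq_card; apply/fintype.subsetP => H /setIdP[/partsP[h _] _]; rewrite in_set1.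
  by apply/eqP; apply: sgraph_ext => x y; rewrite adj_graph_of andbF; apply/negP => /h[]; rewrite inE.
case: b => [|b].
  rewrite (_ : [set _ in _ | _] = set0) ?cards0 //; apply/setP => H; rewrite [in LHS]inE [RHS]inE leqn0 cards_eq0.
  apply/negbTE; rewrite negb_and; apply/orP; right; apply/set0Pn; exists (blk H S x0); exact: imset_f.
have <- : #|[set f : {ffun T -> 'I_b.+1} | f \in pffun_on ord0 (mem S) predT]| = b.+1 ^ #|S|.
  by rewrite cardsE card_pffun_on card_ord.
apply: leq_trans (leq_imset_card (fun f : {ffun T -> 'I_b.+1} => part_of S f) _).
apply: subset_leq_card; apply/fintype.subsetP => H /setIdP[HP hb].
apply/imsetP; exists [ffun x => if x \in S then inord (index (blk H S x) (enum (blocks H S))) else ord0].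
  rewrite inE; apply/pffun_onP; split=> //; apply/fintype.subsetP => x; rewrite inE ffunE.
  by case: ifP => //; rewrite eqxx.
apply: sgraph_ext => x y; rewrite adj_part_of !ffunE.
case/partsP: (HP) => h _.
case xS : (x \in S); last by rewrite andbF; apply/negP => /h[]; rewrite xS.
case yS : (y \in S); last by rewrite andbF; apply/negP => /h[]; rewrite yS.
rewrite (parts_blkE HP xS yS) /=; congr (_ && _).
have ib z : z \in S -> blk H S z \in enum (blocks H S) by move=> zS; rewrite mem_enum; apply: imset_f.
have lt z : z \in S -> index (blk H S z) (enum (blocks H S)) < b.+1.
  by move=> /ib hz; rewrite ltnS -ltnS; apply: leq_trans hb; rewrite cardE index_mem.
apply/eqP/eqP => [-> //|/(congr1 val)]; rewrite /= !inordK ?lt // => e.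
by rewrite -(nth_index set0 (ib x xS)) e nth_index // ib.
Qed.

(** The [k] blocks can be numbered in [k] factorial ways, and all the resulting maps to ['I_k] are
    different. *)
Lemma parts_exact_blocks S k : #|[set H in parts S | #|blocks H S| == k]| * k`! <= k ^ #|S|.
Proof.
case: k => [|k].
  rewrite fact0 muln1; case: (set_0Vmem S) => [S0|[x0 x0S]].
    apply: leq_trans (parts_few_blocks S 0); apply: subset_leq_card; apply/fintype.subsetP => H.
    by move=> /setIdP[HP /eqP e]; apply/setIdP; rewrite e.
  rewrite (_ : [set _ in _ | _] = set0) ?cards0 //; apply/setP => H; rewrite [in LHS]inE [RHS]inE cards_eq0.
  apply/negbTE; rewrite negb_and; apply/orP; right; apply/set0Pn; exists (blk H S x0); exact: imset_f.
have <- : #|[set f : {ffun T -> 'I_k.+1} | f \in pffun_on ord0 (mem S) predT]| = k.+1 ^ #|S|.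
  by rewrite cardsE card_pffun_on card_ord.
have <- : #|[set: 'S_k.+1]| = k.+1`! by rewrite cardsT card_Sn.
rewrite -cardsX.
pose ix H x : 'I_k.+1 := inord (index (blk H S x) (enum (blocks H S))).
pose F (u : sgraph T * 'S_k.+1) : {ffun T -> 'I_k.+1} := [ffun x => if x \in S then u.2 (ix u.1 x) else ord0].
have ib H z : z \in S -> blk H S z \in enum (blocks H S) by move=> zS; rewrite mem_enum; apply: imset_f.
have lt H z : #|blocks H S| == k.+1 -> z \in S -> index (blk H S z) (enum (blocks H S)) < k.+1.
  by move=> /eqP <- hz; rewrite cardE index_mem; apply: ib.
apply: (@leq_card_inj_in _ _ F) => [[H s] _|[H s] [H' s']].
  rewrite inE; apply/pffun_onP; split=> //; apply/fintype.subsetP => x; rewrite inE ffunE.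
  by case: ifP => //; rewrite eqxx.
rewrite !in_setX !in_setT !andbT => /setIdP[HP hk] /setIdP[HP' hk'] E.
have {}E x : x \in S -> s (ix H x) = s' (ix H' x).
  by move=> xS; have := congr1 (fun f : {ffun T -> 'I_k.+1} => f x) E; rewrite !ffunE xS.
have ixP G x y : #|blocks G S| == k.+1 -> x \in S -> y \in S -> (ix G x == ix G y) = (blk G S x == blk G S y).
  move=> hG xS yS; apply/eqP/eqP => [/(congr1 val)|e]; last by rewrite /ix e.
  rewrite /= !inordK ?lt // => e.
  by rewrite -(nth_index set0 (ib G x xS)) e nth_index // ib.
have EH : H = H'.
  apply: sgraph_ext => x y; case/partsP: (HP) => h _; case/partsP: (HP') => h' _.
  case xS : (x \in S); last first.
    have -> : adj H x y = false by apply/negP => /h[]; rewrite xS.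
    by symmetry; apply/negP => /h'[]; rewrite xS.
  case yS : (y \in S); last first.
    have -> : adj H x y = false by apply/negP => /h[]; rewrite yS.
    by symmetry; apply/negP => /h'[]; rewrite yS.
  rewrite (parts_blkE HP xS yS) (parts_blkE HP' xS yS) -!ixP //; congr (_ && _).
  by rewrite -(inj_eq (@perm_inj _ s)) !E // (inj_eq (@perm_inj _ s')).
subst H'; congr pair; apply/permP => i.
have ilt : i < size (enum (blocks H S)) by rewrite -cardE (eqP hk).
have := mem_nth set0 ilt; rewrite mem_enum => /imsetP[x xS ex].
have <- : ix H x = i.
  by apply: val_inj; rewrite /= inordK ?lt // -ex index_uniq // enum_uniq.
exact: E.
Qed.

Lemma blk_class H S x y : H \in parts S -> x \in S -> y \in blk H S x -> blk H S y = blk H S x.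
Proof. by case/partsP => _ pf; apply: blk_sym_eq. Qed.

Lemma card_blk_le H S (Q : {set T}) s : Q \subset S -> (forall x, x \in Q -> #|blk H S x| <= s) ->
  #|Q| <= #|[set blk H S x | x in Q]| * s.
Proof.
move=> /fintype.subsetP QS h; apply: (@leq_card_cover _ _ _ _ (fun C x => blk H S x == C)) => [x xQ|C /imsetP[z zQ ->]].
  by exists (blk H S x) => //; apply: imset_f.
apply: leq_trans (h z zQ); apply: subset_leq_card; apply/fintype.subsetP => x /setIdP[xQ /eqP <-].
by apply: blk_refl; apply: QS.
Qed.

Lemma card_blk_ge H S (Q : {set T}) s : H \in parts S -> Q \subset S -> (forall x, x \in Q -> s <= #|blk H S x|) ->
  #|[set blk H S x | x in Q]| * s <= #|S|.
Proof.
move=> HP /fintype.subsetP QS h; set P := [set _ | _ in Q].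
have tP : trivIset P.
  apply/trivIsetP => _ _ /imsetP[x xQ ->] /imsetP[y yQ ->]; apply: contraR => /pred0Pn[z /andP[/= zx zy]].
  by rewrite -(blk_class HP (QS _ xQ) zx) (blk_class HP (QS _ yQ) zy).
have cs : cover P \subset S.
  by apply/fintype.subsetP => z /bigcupP[C /imsetP[x _ ->]]; rewrite inE => /andP[].
apply: leq_trans (subset_leq_card cs); rewrite -(eqP tP) -sum_nat_const.
by apply: leq_sum => C /imsetP[x xQ ->]; apply: h.
Qed.

End Bell.

Lemma fact_ge j k : j <= k -> j ^ (k - j) <= k`!.
Proof.
move=> jk; rewrite -{2}(subnK jk); elim: (k - j) => [|d IH]; first by rewrite expn0 fact_gt0.
by rewrite addSn factS expnS; apply: leq_mul IH; rewrite -addSn leq_addl.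
Qed.

Lemma leq_pow4_exp2 y : 16 <= y -> y ^ 4 <= 2 ^ y.
Proof.
move=> h; rewrite -(subnK h); elim: (y - 16) => [|d IH]; first by rewrite add0n -[16 in X in X <= _]/(2 ^ 4) -expnM.
rewrite addSn [2 ^ _]expnS mul2n -addnn; set z := d + 16 in IH *.
apply: leq_trans (leq_add IH IH); have z16 : 16 <= z by apply: leq_addl.
rewrite !expnS !expn0 !muln1; clear -z16.
have h1 : 16 * z <= z * z by rewrite leq_mul2r z16 orbT.
have h2 : 16 * (z * z) <= z * (z * z) by rewrite leq_mul2r z16 orbT.
have h3 : 16 * (z * (z * z)) <= z * (z * (z * z)) by rewrite leq_mul2r z16 orbT.
have -> : z.+1 * (z.+1 * (z.+1 * z.+1)) = z * (z * (z * z)) + 4 * (z * (z * z)) + 6 * (z * z) + 4 * z + 1 by ring.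
by lia.
Qed.

(** The last hypothesis says that [j * log j] is at least [3 * m / 4]. With [k <= y * j] and
    [fact_ge], the claim reduces to [y ^ m * 2 ^ m <= j ^ ((y - 3) * j)], whose fourth power follows
    from [y ^ 4 <= 2 ^ y]. *)
Lemma many_blocks_arith m j k : 0 < j -> j <= m -> 16 * j <= k -> 2 ^ (3 * m) <= j ^ (4 * j) ->
  k ^ m * 2 ^ m <= k`! * j ^ (m - j).
Proof.
move=> j0 jm hk hj; set y := (k %/ j).+1.
have y17 : 17 <= y by rewrite ltnS leq_divRL.
have ky : k <= y * j by rewrite ltnW // ltn_ceil.
have yk : (y - 1) * j <= k by rewrite subn1 leq_divM.
have jk : j <= k by apply: leq_trans hk; rewrite leq_pmull.
apply: leq_trans (leq_mul (fact_ge jk) (leqnn _)); rewrite -expnD.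
apply: leq_trans (leq_mul (leq_expl m ky) (leqnn _)) _.
apply: (@leq_trans (j ^ ((y - 3) * j + m))); last first.
  apply: leq_pexp2l => //; have -> : y - 3 = (y - 1) - 2 by clear; lia.
  rewrite mulnBl; have : 2 * j <= (y - 1) * j by rewrite leq_mul2r; apply/orP; right; move: y17; clear; lia.
  by move: yk jm jk; clear; move: ((y - 1) * j) => t; lia.
rewrite expnD expnMn mulnAC leq_mul2r; apply/orP; right.
rewrite -(@leq_exp2r _ _ 4) // expnMn -!expnM [m * 4]mulnC expnM.
apply: (@leq_trans (2 ^ (y * m + 4 * m))).
  rewrite expnD leq_mul2r [2 ^ (y * m)]expnM; apply/orP; right; apply: leq_expl; apply: leq_pow4_exp2.
  by apply: leq_trans y17.
rewrite -mulnA [j * 4]mulnC [(y - 3) * _]mulnC expnM; apply: leq_trans (leq_expl (y - 3) hj).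
rewrite -expnM leq_exp2l // -mulnDl [3 * m]mulnC -mulnA [X in _ <= X]mulnC leq_mul2r; apply/orP; right.
by move: y17; clear; lia.
Qed.

(** The factor [512 ^ q = 2 ^ (9 * q)] is at least [2 ^ (3 * m)]: one [m] pays for [j ^ j], two are
    gained. *)
Lemma few_blocks_arith m j h q : 512 * h <= j -> j ^ j <= 2 ^ m -> m <= 3 * q -> j <= q ->
  h ^ q * 2 ^ (2 * m) <= j ^ (q - j).
Proof.
move=> hj jj mq jq; rewrite -(@leq_pmul2r (2 ^ m)) ?expn_gt0 // -mulnA -expnD.
apply: (@leq_trans (j ^ q)); last by rewrite -{1}(subnK jq) expnD leq_mul2l jj orbT.
apply: (@leq_trans ((512 * h) ^ q)); last exact: leq_expl.
rewrite expnMn mulnC leq_mul2r -[512]/(2 ^ 9) -expnM leq_exp2l //; apply/orP; right.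
by move: mq; clear; lia.
Qed.

Section Typical.
Variables (T : finType) (S : {set T}) (L r0 : nat).
Let m := #|S|.
Let j := m %/ L.
Hypothesis L0 : 0 < L.
Hypothesis j0 : 0 < j.
Hypothesis L3 : 3 <= L.
Hypothesis hj1 : 2 ^ (3 * m) <= j ^ (4 * j).
Hypothesis hj2 : j ^ j <= 2 ^ m.
Hypothesis hr : 3 * (r0 * (1024 * L)) <= m.
Hypothesis hm : 8 * (m + 2) <= 2 ^ m.

(** The constants come from dividing [S] into thirds. If a third lies in blocks smaller than
    [L / 48], there are at least [16 * j] blocks; if a third lies in blocks larger than [1024 * L],
    these number at most [j / 512]. Both are rare, so a third lies in blocks of the stated sizes. *)
Definition typical (H : sgraph T) := exists u : 'I_r0 -> T,
  [/\ forall i, u i \in S, forall i i', blk H S (u i) = blk H S (u i') -> i = i',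
      forall i, L <= 48 * #|blk H S (u i)| & forall i, #|blk H S (u i)| <= 1024 * L].

Let jL : j * L <= m. Proof. exact: leq_divM. Qed.
Let mL : m < j.+1 * L. Proof. exact: ltn_ceil. Qed.
Let jm : j <= m. Proof. exact: leq_div. Qed.
Let j3m : 3 * j <= m.
Proof. by apply: leq_trans jL; rewrite mulnC leq_mul2l L3 orbT. Qed.

Definition fine := [set H in parts S | 16 * j <= #|blocks H S|].
Definition bigs (H : sgraph T) := [set x in S | 1024 * L < #|blk H S x|].
Definition coarse := [set H in parts S | m <= 3 * #|bigs H|].

Lemma card_fine : #|fine| * 2 ^ m <= m.+1 * #|parts S|.
Proof.
have <- : #|[set: 'I_m.+1]| = m.+1 by rewrite cardsT card_ord.
apply: (@leq_trans (#|[set: 'I_m.+1]| * (#|parts S| %/ 2 ^ m) * 2 ^ m)); last first.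
  by rewrite -mulnA leq_mul2l leq_divM orbT.
rewrite leq_mul2r; apply/orP; right.
apply: (@leq_card_cover _ _ _ _ (fun (k : 'I_m.+1) H => #|blocks H S| == k)) => [H _|k _].
  have h : #|blocks H S| < m.+1 by rewrite ltnS leq_imset_card.
  by exists (Ordinal h); rewrite ?inE.
rewrite leq_divRL ?expn_gt0 //; set F := [set _ in _ | _].
case: (leqP (16 * j) k) => hk; last first.
  rewrite (_ : F = set0) ?cards0 //; apply/setP => H; rewrite inE [RHS]inE; apply/negbTE/negP.
  by case/andP => /setIdP[_ h] /eqP e; move: hk; rewrite -e ltnNge h.
have hF : #|F| <= #|[set H in parts S | #|blocks H S| == k]|.
  by apply: subset_leq_card; apply/fintype.subsetP => H /setIdP[/setIdP[HP _] e]; apply/setIdP.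
have ha := many_blocks_arith j0 jm hk hj1.
have hp : j ^ (m - j) <= #|parts S| by apply: parts_ge; rewrite j0.
rewrite -(@leq_pmul2r k`!) ?fact_gt0 // mulnAC.
apply: leq_trans (_ : k ^ m * 2 ^ m <= _).
  rewrite leq_mul2r; apply/orP; right; apply: leq_trans (parts_exact_blocks S k).
  by rewrite leq_mul2r hF orbT.
by apply: leq_trans ha _; rewrite mulnC leq_mul2r hp orbT.
Qed.

(** Replace the few big blocks, which cover the set [Q], by an arbitrary partition of [Q]. This
    gains [2 ^ (2 * m)], half of which (in the exponent) pays for the choice of [Q]. *)
Lemma card_coarse : #|coarse| * 2 ^ m <= #|parts S|.
Proof.
have cP : #|powerset S| = 2 ^ m by rewrite card_powerset.
apply: (@leq_trans (2 ^ m * (#|parts S| %/ 2 ^ (2 * m)) * 2 ^ m)); last first.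
  by rewrite mulnAC -expnD addnn -mul2n mulnC leq_divM.
rewrite leq_mul2r; apply/orP; right; rewrite -cP.
apply: (@leq_card_cover _ _ _ _ (fun (Q : {set T}) H => bigs H == Q)) => [H _|Q QS].
  by exists (bigs H) => //; rewrite powersetE; apply/fintype.subsetP => x; rewrite inE => /andP[].
rewrite powersetE in QS; rewrite leq_divRL ?expn_gt0 //; set F := [set _ in _ | _].
case: (leqP m (3 * #|Q|)) => hQ; last first.
  rewrite (_ : F = set0) ?cards0 //; apply/setP => H; rewrite inE [RHS]inE; apply/negbTE/negP.
  by case/andP => /setIdP[_ h] /eqP e; move: hQ; rewrite -e ltnNge h.
have jQ : j <= #|Q| by move: hQ j3m; clear; lia.
pose h := j %/ 512.
have h512 : 512 * h <= j by rewrite mulnC leq_divM.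
have ha := few_blocks_arith h512 hj2 hQ jQ.
apply: leq_trans (parts_mul QS); apply: (@leq_trans (h ^ #|Q| * #|parts (S :\: Q)| * 2 ^ (2 * m))); last first.
  rewrite mulnAC leq_mul2r; apply/orP; right; apply: leq_trans ha _.
  by apply: parts_ge; rewrite j0.
rewrite leq_mul2r; apply/orP; right.
apply: leq_trans (leq_mul (parts_few_blocks Q h) (leqnn _)); rewrite -cardsX.
have FP H : H \in F -> [/\ H \in parts S, bigs H = Q & forall x y, adj H x y -> (x \in Q) = (y \in Q)].
  case/setIdP => /setIdP[HP _] /eqP e; split=> // x y xy; rewrite -e !inE.
  have [xS yS] : x \in S /\ y \in S by case/partsP: HP => h1 _; apply: h1.
  have : blk H S x = blk H S y by move: xy; rewrite (parts_blkE HP xS yS) => /andP[_ /eqP].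
  by rewrite xS yS => ->.
apply: (@leq_card_inj_in _ _ (fun H => (restr H Q, restr H (S :\: Q)))) => [H HF|H H' HF HF' E].
  have [HP e cl] := FP H HF; rewrite in_setX.
  have sub (V : {set T}) : V \subset S -> restr H V \in parts V.
    move=> VS; apply/partsP; split=> [x y|x y z xV yV zV]; rewrite !adj_restr; first by case/and3P.
    rewrite xV yV zV /=; case/partsP: HP => _ pf; apply: pf; by apply: (fintype.subsetP VS).
  rewrite (sub (S :\: Q)) ?subsetDl // andbT; apply/setIdP; split; first exact: sub.
  have -> : blocks (restr H Q) Q = [set blk H S x | x in Q].
    apply: eq_in_imset => x xQ; apply/setP => y; rewrite !inE adj_restr xQ.
    case yQ : (y \in Q) => /=; first by rewrite (fintype.subsetP QS y yQ).
    symmetry; apply/negbTE; rewrite negb_and negb_or; apply/orP; right; apply/andP; split.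
      by apply: contraFneq yQ => ->.
    by apply/negP => /cl; rewrite xQ yQ.
  have : #|[set blk H S x | x in Q]| * (1024 * L) <= m.
    by apply: card_blk_ge => // x; rewrite -e inE => /andP[_ /ltnW].
  set b := #|_| => hb; rewrite /h leq_divRL //.
  have hb2 : b * 1024 * L < j.+1 * L by rewrite -mulnA; apply: leq_ltn_trans hb mL.
  by rewrite ltn_pmul2r // in hb2; move: hb2 j0; clear; lia.
have [HP _ cl] := FP H HF; have [HP' _ cl'] := FP H' HF'.
have E1 x y := congr1 (fun G => adj G x y) (congr1 fst E).
have E2 x y := congr1 (fun G => adj G x y) (congr1 snd E).
case/partsP: HP => hS _; case/partsP: HP' => hS' _.
have imp G G' : (forall x y, adj G x y -> (x \in Q) = (y \in Q)) -> (forall x y, adj G x y -> x \in S /\ y \in S) ->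
    restr G Q = restr G' Q -> restr G (S :\: Q) = restr G' (S :\: Q) -> forall x y, adj G x y -> adj G' x y.
  move=> c1 c2 r1 r2 x y xy; have [xS yS] := c2 _ _ xy; have cc := c1 _ _ xy.
  case xQ : (x \in Q).
    have := congr1 (fun G => adj G x y) r1; rewrite /= !adj_restr xQ -cc xQ xy /= => <- //.
  have := congr1 (fun G => adj G x y) r2; rewrite /= !adj_restr !inE xS yS -cc xQ xy /= => <- //.
apply: sgraph_ext => x y; apply/idP/idP; apply: imp => //; by [apply: (congr1 fst E)|apply: (congr1 snd E)
  |symmetry; apply: (congr1 fst E)|symmetry; apply: (congr1 snd E)].
Qed.

Lemma typical_or H : H \in parts S -> [\/ typical H, H \in fine | H \in coarse].
Proof.
move=> HP.
case: (leqP m (3 * #|bigs H|)) => hb; first by constructor 3; apply/setIdP.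
pose sm := [set x in S | 48 * #|blk H S x| < L].
case: (leqP m (3 * #|sm|)) => hs.
  constructor 2; apply/setIdP; split=> //.
  have smS : sm \subset S by apply/fintype.subsetP => x; rewrite inE => /andP[].
  have : #|sm| <= #|[set blk H S x | x in sm]| * (L %/ 48).
    by apply: card_blk_le => // x; rewrite inE => /andP[_ /ltnW]; rewrite leq_divRL // mulnC.
  have : #|[set blk H S x | x in sm]| <= #|blocks H S| by apply: subset_leq_card; apply: imsetS.
  have := leq_divM L 48.
  move: hs jL; set a := #|sm|; set b := #|[set _ | _ in sm]|; set c := #|blocks H S|; set d := L %/ 48.
  move: m => m' hs jL' h1 h2 h3.
  have h4 : b * d <= c * d by rewrite leq_mul2r h2 orbT.
  have h5 : c * (d * 48) <= c * L by rewrite leq_mul2l h1 orbT.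
  rewrite -(@leq_pmul2r L) // -mulnA.
  by move: hs jL' h3 h4 h5; clear; rewrite [c * (d * 48)]mulnA; move: (c * d) (b * d) (j * L) (c * L) => *; lia.
constructor 1.
pose md := [set x in S | (L <= 48 * #|blk H S x|) && (#|blk H S x| <= 1024 * L)].
have mdS : md \subset S by apply/fintype.subsetP => x; rewrite inE => /andP[].
have cm : m <= #|sm| + #|bigs H| + #|md|.
  apply: (@leq_trans #|sm :|: bigs H :|: md|).
    apply: subset_leq_card; apply/fintype.subsetP => x xS; rewrite !inE xS /=.
    by case: (ltnP (48 * _) L) => //= _; case: (ltnP (1024 * L)).
  by apply: leq_trans (leq_card_setU _ _) _; rewrite leq_add2r; apply: leq_card_setU.
have hmd : #|md| <= #|[set blk H S x | x in md]| * (1024 * L).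
  by apply: card_blk_le => // x; rewrite inE => /and3P[].
have hb0 : r0 <= #|[set blk H S x | x in md]|.
  rewrite -(@leq_pmul2r (1024 * L)); last by rewrite muln_gt0.
  by move: hr hb hs cm hmd; clear; move: (r0 * (1024 * L)) (_ * (1024 * L)) => a b; lia.
have [f fi fb] := exists_inj_ord hb0.
have /boolp.choice[u hu] : forall i, exists x, x \in md /\ f i = blk H S x.
  by move=> i; case/imsetP: (fb i) => x; exists x.
exists u; split=> [i|i i'|i|i].
- by have [h _] := hu i; apply: (fintype.subsetP mdS).
- by have [_ <-] := hu i; have [_ <-] := hu i'; apply: fi.
- by have [+ _] := hu i; rewrite inE => /and3P[].
- by have [+ _] := hu i; rewrite inE => /and3P[].
Qed.

Lemma card_atypical : 8 * #|[set H in parts S | ~~ `[< typical H >]]| <= #|parts S|.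
Proof.
have h1 : #|[set H in parts S | ~~ `[< typical H >]]| <= #|fine| + #|coarse|.
  apply: leq_trans (leq_card_setU _ _); apply: subset_leq_card; apply/fintype.subsetP => H /setIdP[HP /asboolP nt].
  by rewrite in_setU; case: (typical_or HP) => [//|->|->]; rewrite ?orbT.
have h2 := card_fine; have h3 := card_coarse.
rewrite -(@leq_pmul2r (2 ^ m)) ?expn_gt0 //.
apply: (@leq_trans (8 * (m + 2) * #|parts S|)); last by rewrite mulnC leq_mul2l hm orbT.
rewrite -!mulnA leq_mul2l /=; apply: leq_trans (leq_mul h1 (leqnn _)) _; rewrite mulnDl.
apply: leq_trans (leq_add h2 h3) _; rewrite addn2 -[X in _ + X]mul1n -mulnDl addn1 leqnn //.
Qed.

End Typical.

(** * Random bipartite graphs *)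

Lemma card_fix_pattern (Y : finType) (D C tau : {set Y}) : C \subset D ->
  #|[set J in powerset D | J :&: C == tau]| * 2 ^ #|C| <= 2 ^ #|D|.
Proof.
move=> CD; rewrite -!card_powerset -cardsX.
apply: (@leq_card_inj_in _ _ (fun u => (u.1 :\: C) :|: u.2)) => [[J K]|[J K] [J' K']].
  rewrite in_setX => /andP[/setIdP[JD _] KC]; rewrite !powersetE /= in JD KC *.
  by rewrite subUset (subset_trans KC CD) andbT; apply: subset_trans (subsetDl _ _) JD.
rewrite !in_setX => /andP[/setIdP[_ /eqP e] KC] /andP[/setIdP[_ /eqP e'] KC'] /= /setP E.
rewrite !powersetE in KC KC'; congr pair; apply/setP => y; have := E y; rewrite !inE.
  case yC : (y \in C) => /=.
    by have /setP/(_ y) := etrans e (esym e'); rewrite !inE yC !andbT.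
  have -> : (y \in K) = false by apply/negP => /(fintype.subsetP KC); rewrite yC.
  have -> : (y \in K') = false by apply/negP => /(fintype.subsetP KC'); rewrite yC.
  by rewrite !orbF.
case yC : (y \in C) => //=.
have -> : (y \in K) = false by apply/negP => /(fintype.subsetP KC); rewrite yC.
by have -> : (y \in K') = false by apply/negP => /(fintype.subsetP KC'); rewrite yC.
Qed.

(** Integer form of [(1 - 1/Q) ^ Q <= 1/2], proved through a Bernoulli-type inequality. *)
Lemma pred_pow_self Q : 0 < Q -> Q.-1 ^ Q * 2 <= Q ^ Q.
Proof.
case: Q => [//|a] _ /=.
have key k : a ^ k * (a + k) <= a.+1 ^ k * a.
  elim: k => [|k IH]; first by rewrite !expn0 addn0.
  rewrite !expnS -!mulnA; apply: (@leq_trans (a.+1 * (a ^ k * (a + k)))); last by rewrite leq_mul2l IH orbT.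
  rewrite mulnCA [a.+1 * _]mulnCA leq_mul2l; apply/orP; right; clear; nia.
case: a key => [//|a] key; rewrite -(@leq_pmul2r a.+1) //; apply: leq_trans (key a.+2).
by rewrite -mulnA leq_mul2l; apply/orP; right; clear; lia.
Qed.

(** In a random bipartite graph a vertex of [O] has trace [tau] on [S] with probability [1/Q],
    [Q = 2 ^ #|S|]; every group of [Q] vertices halves the probability that the trace is missed by
    all. *)
Lemma card_miss_pattern (T Y : finType) (c : T -> T -> Y) (O S : {set T}) (D : {set Y}) (tau : {set T}) e :
  (forall o s o' s', c o s = c o' s' -> o = o' /\ s = s') ->
  (forall o s, o \in O -> s \in S -> c o s \in D) -> tau \subset S -> 2 ^ #|S| * e <= #|O| ->
  #|[set J in powerset D | [forall o in O, [set s in S | c o s \in J] != tau]]| * 2 ^ e <= 2 ^ #|D|.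
Proof.
move=> ci cD tS he.
pose g (i : 'I_#|O|) (x : 'I_#|S|) := c (enum_val i) (enum_val x).
have gi i x j y : g i x = g j y -> i = j /\ x = y by case/ci => /enum_val_inj -> /enum_val_inj ->.
have gD i x : g i x \in D by apply: cD; apply: enum_valP.
pose tau' := [set x : 'I_#|S| | enum_val x \in tau].
have B := card_block_traces [set~ tau'] gi gD; rewrite !card_ord in B.
have cP : #|[set~ tau']| = (2 ^ #|S|).-1 by rewrite cardsC1 -cardsT -powersetT card_powerset cardsT card_ord.
rewrite cP in B.
have hSO : #|S| * #|O| <= #|D|.
  rewrite mulnC -cardsX; apply: (@leq_card_inj_in _ _ (fun u => c u.1 u.2)) => [[o s]|[o s] [o' s'] _ _ /ci[/= -> ->]] //.
  by rewrite in_setX => /andP[oO sS]; apply: cD.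
set F := [set J in _ | _].
have hF : #|F| <= (2 ^ #|S|).-1 ^ #|O| * 2 ^ (#|D| - #|S| * #|O|).
  apply: leq_trans B; apply: subset_leq_card; apply/fintype.subsetP => J /setIdP[JD /forall_inP hJ].
  rewrite inE; rewrite powersetE in JD; rewrite JD /=; apply/forallP => i; rewrite !inE.
  apply: contraNneq (hJ _ (enum_valP i)) => e'; apply/eqP/setP => s; rewrite inE.
  case sS : (s \in S); last first.
    by symmetry; apply/negP => /(fintype.subsetP tS); rewrite sS.
  have /setP/(_ (enum_rank_in sS s)) := e'; by rewrite !inE /g enum_rankK_in.
apply: leq_trans (leq_mul hF (leqnn _)) _; rewrite mulnAC.
rewrite -{2}(subnKC hSO) expnD leq_mul2r; apply/orP; right.
set Q := 2 ^ #|S| in he *; rewrite expnM -/Q -(subnKC he) !expnD mulnAC; apply: leq_mul; last exact/leq_expl/leq_pred.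
by rewrite !expnM -expnMn; apply: leq_expl; apply: pred_pow_self; rewrite expn_gt0.
Qed.

Lemma card_small_sets (T : finType) s : #|[set S : {set T} | #|S| <= s]| <= #|T|.+1 ^ s.
Proof.
have <- : #|[set: {ffun 'I_s -> option T}]| = #|T|.+1 ^ s by rewrite cardsT card_ffun card_option card_ord.
apply: leq_trans (leq_imset_card (fun f : {ffun 'I_s -> option T} => [set x | [exists i, f i == Some x]]) _).
apply: subset_leq_card; apply/fintype.subsetP => S; rewrite inE => hS; apply/imsetP.
exists [ffun i : 'I_s => nth None (map Some (enum S)) i] => //; apply/setP => x; rewrite inE; apply/idP/existsP => [xS|[i]].
  have xe : x \in enum S by rewrite mem_enum.
  have hi : index x (enum S) < s by apply: leq_trans hS; rewrite cardE index_mem.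
  by exists (Ordinal hi); rewrite ffunE /=; apply/eqP; rewrite (nth_map x) ?index_mem // nth_index.
rewrite ffunE => /eqP h; rewrite -mem_enum; have [hs|hs] := ltnP i (size (enum S)); last first.
  by move: h; rewrite nth_default // size_map.
by move: h; rewrite (nth_map x) // => -[<-]; apply: mem_nth.
Qed.

Section Bipartite.
Variables (T : finType) (A B : {set T}) (L N t c : nat).
Variables (X XY TB D1 W : {set T}) (Q : 'I_3 -> {set T}).
Hypothesis hL : L = 2 ^ (4 * N).
Hypothesis hN : N = 2 ^ t.
Hypothesis t6 : 6 <= t.
Hypothesis cN : c <= 2 ^ N.
Hypothesis cT : #|T| <= 2 ^ L.
Hypothesis cA : 2 ^ (L - 2) <= #|A|.
Hypothesis cB : 2 ^ (L - 2) <= #|B|.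
Hypothesis XB : X \subset B.
Hypothesis XYB : XY \subset B.
Hypothesis TBB : TB \subset B.
Hypothesis D1B : D1 \subset B.
Hypothesis WB : W \subset B.
Hypothesis QB : forall i, Q i \subset B.
Hypothesis cX : #|X| = L - 3 * N.
Hypothesis cXY : #|XY| = L - (t + 8).
Hypothesis cTB : #|TB| <= 2 * N.
Hypothesis cD1 : #|D1| = N.
Hypothesis cW : #|W| <= c * L.
Hypothesis cQ : forall i, 2 * L <= #|Q i|.
Hypothesis dX : [disjoint X & TB].
Hypothesis dW : [disjoint XY & W].
Hypothesis dD : [disjoint XY & D1].

Let D := setX A B.
Let tot := 2 ^ #|D|.
Implicit Types J : {set T * T}.

Definition nbA J a (S : {set T}) := [set s in S | (a, s) \in J].
Definition nbB J b (S : {set T}) := [set s in S | (s, b) \in J].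

(** [ev_claw] makes every vertex of [A] a claw centre; [ev_A] and [ev_B] let each side cut arbitrary
    subsets out of small sets of the other. A set of [L - d] vertices is missed by about [2 ^ d]
    vertices of [A], up to a factor 4. For [X], with [d = 3 * N], these are few enough for [ev_B] to
    mark any subset of them ([ev_Z]) and enough to show all traces on [TB] ([ev_T]). For [XY], with
    [d = t + 8], they are enough to separate the points of [W] ([ev_W]) and few enough to be
    separated by the [N] vertices of [D1] ([ev_Y]). *)
Definition ev_claw J := [forall a in A, forall i : 'I_3, [exists b in Q i, (a, b) \in J]].
Definition ev_A J := [forall S : {set T}, forall tau : {set T},
  [&& S \subset B, #|S| <= L./2 & tau \subset S] ==> [exists a in A, nbA J a S == tau]].
Definition ev_B J := [forall S : {set T}, forall tau : {set T},
  [&& S \subset A, #|S| <= L./2 & tau \subset S] ==> [exists b in B, nbB J b S == tau]].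
Definition ev_Z J := #|[set a in A | nbA J a X == set0]| <= L./2.
Definition ev_T J := [forall tau : {set T}, (tau \subset TB) ==>
  [exists a in A, (nbA J a X == set0) && (nbA J a TB == tau)]].
Definition ev_W J := [forall w in W, forall w' in W, (w != w') ==>
  [exists a in A, [&& nbA J a XY == set0, (a, w) \in J & (a, w') \notin J]]].
Definition ev_Y J := [forall a in A, forall a' in A, [&& a != a', nbA J a XY == set0 & nbA J a' XY == set0] ==>
  [exists d in D1, ((a, d) \in J) != ((a', d) \in J)]].

Definition bad (P : {set T * T} -> bool) := [set J in powerset D | ~~ P J].

Let N64 : 64 <= N. Proof. by rewrite hN -[64]/(2 ^ 6) leq_exp2l. Qed.
Let LN : N ^ 4 <= L.
Proof.
rewrite hL mulnC expnM; apply: leq_expl.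
by apply: ltnW; apply: ltn_expl.
Qed.
Let NL : 64 * N <= L.
Proof.
have N0 : 0 < N by apply: leq_trans N64.
by apply: leq_trans LN; rewrite expnSr leq_mul2r; apply/orP; right; apply: leq_trans N64 _; rewrite -{1}(expn1 N) leq_pexp2l.
Qed.
Let tN : 2 * t + 22 <= N.
Proof.
rewrite hN; move: t6; clear; move/subnK <-; elim: (t - 6) => [//|d IH].
rewrite addSn expnS mul2n -addnn; move: IH; move: (2 ^ (d + 6)) => z; lia.
Qed.

Lemma exp2_ge_sq y : 18 <= y -> y * y * 16 <= 2 ^ y.
Proof.
move=> h; apply: leq_trans (leq_pow4_exp2 _); last by apply: leq_trans h.
rewrite !expnS !expn0 muln1; clear - h.
have h1 : 18 * y <= y * y by rewrite leq_mul2r h orbT.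
by nia.
Qed.

Lemma card_bad_cover (I : finType) (E : {set I}) (F : {set {set T * T}}) (P : I -> pred {set T * T}) x y :
  {in F, forall J, exists2 i, i \in E & P i J} -> #|E| <= 2 ^ x ->
  {in E, forall i, #|[set J in F | P i J]| * 2 ^ y <= tot} -> x + 6 <= y -> #|F| * 64 <= tot.
Proof.
move=> h1 h2 h3 xy.
have h4 : #|F| <= #|E| * (tot %/ 2 ^ y).
  by apply: leq_card_cover h1 _ => i iE; rewrite leq_divRL ?expn_gt0 //; apply: h3.
apply: leq_trans (leq_mul h4 (leqnn _)) _; rewrite -[64]/(2 ^ 6).
apply: (@leq_trans (2 ^ x * (tot %/ 2 ^ y) * 2 ^ 6)).
  by rewrite leq_mul2r leq_mul2r h2 !orbT.
rewrite mulnAC -expnD; apply: leq_trans (leq_divM tot (2 ^ y)); rewrite mulnC leq_mul2l leq_exp2l //.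
by rewrite xy orbT.
Qed.

Let subF (P : pred {set T * T}) (F : {set {set T * T}}) y :
  (forall J, J \in F -> J \in powerset D) -> #|[set J in powerset D | P J]| * 2 ^ y <= tot -> #|[set J in F | P J]| * 2 ^ y <= tot.
Proof.
move=> h; apply: leq_trans; rewrite leq_mul2r; apply/orP; right; apply: subset_leq_card.
by apply/fintype.subsetP => J /setIdP[/h JD hP]; apply/setIdP.
Qed.

Let cA' : #|A| <= 2 ^ L. Proof. exact: leq_trans (max_card _) cT. Qed.

Lemma bad_claw : #|bad ev_claw| * 64 <= tot.
Proof.
apply: (@card_bad_cover _ (setX A [set: 'I_3]) _ (fun u J => nbA J u.1 (Q u.2) == set0) (L + 2) (2 * L)).
- move=> J /setIdP[_]; rewrite negb_forall_in => /exists_inP[a aA]; rewrite negb_forall => /existsP[i].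
  rewrite negb_exists_in => /forall_inP h; exists (a, i); first by rewrite in_setX aA inE.
  by apply/eqP/setP => b; rewrite !inE /=; case bQ : (b \in Q i) => //=; apply/negbTE/h.
- by rewrite cardsX cardsT card_ord expnD; apply: leq_mul.
- move=> [a i] /[!in_setX] /andP[aA _] /=; apply: subF => [J /setIdP[] //|].
  have CD : setX [set a] (Q i) \subset D.
    by apply/fintype.subsetP => -[x y]; rewrite !in_setX in_set1 => /andP[/eqP -> /(fintype.subsetP (QB i)) ->]; rewrite aA.
  have := card_fix_pattern set0 CD; rewrite cardsX cards1 mul1n; apply: leq_trans.
  apply: leq_mul; last by rewrite leq_exp2l.
  apply: subset_leq_card; apply/fintype.subsetP => J /setIdP[JD /eqP/setP h]; apply/setIdP; split=> //.
  apply/eqP/setP => -[x y]; rewrite !inE; apply/negbTE/negP => /and3P[xyJ /eqP /= E /= yQ]; rewrite E in xyJ.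
  by have := h y; rewrite !inE yQ xyJ.
- by move: NL N64; clear; lia.
Qed.

Let half_ineq : (L.+1 * L./2 + L./2) + 6 <= 2 ^ (L./2 - 2).
Proof.
have hh : L = L./2 + L./2.
  rewrite addnn; have := odd_double_half L; rewrite {1}hL oddX /=; by rewrite muln_eq0 -(negbK (N == 0)) -lt0n (leq_trans _ N64).
have y18 : 18 <= L./2 - 2 by move: NL N64 hh; clear; lia.
apply: leq_trans (exp2_ge_sq y18); move: hh y18; clear; move: (L./2) => l -> h.
have [z E] : exists z, l = z + 2 by exists (l - 2); move: h; lia.
by subst l; rewrite addnK in h *; nia.
Qed.

Let half_pow x : 2 ^ (L - 2) <= x -> 2 ^ L./2 * 2 ^ (L./2 - 2) <= x.
Proof.
apply: leq_trans; rewrite -expnD leq_exp2l //.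
have := odd_double_half L; move: NL N64; clear; lia.
Qed.

Let cardE2 : #|[set S : {set T} | #|S| <= L./2]| <= 2 ^ (L.+1 * L./2).
Proof.
apply: leq_trans (card_small_sets _ _) _; rewrite expnM; apply: leq_expl.
by rewrite expnS mul2n -addnn; apply: (@leq_trans (#|T| + 1)); [rewrite addn1|apply: leq_add; rewrite ?expn_gt0].
Qed.

Lemma bad_universal (O V : {set T}) (cc : T -> T -> T * T) (P : {set T * T} -> bool) :
  (forall o s o' s', cc o s = cc o' s' -> o = o' /\ s = s') ->
  (forall o s, o \in O -> s \in V -> cc o s \in D) -> 2 ^ (L - 2) <= #|O| ->
  (forall J, ~~ P J -> exists S tau : {set T}, [/\ S \subset V, #|S| <= L./2, tau \subset S &
     [forall o in O, [set s in S | cc o s \in J] != tau]]) ->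
  #|bad P| * 64 <= tot.
Proof.
move=> ci cD cO hP.
pose E := [set u : {set T} * {set T} | [&& u.1 \subset V, #|u.1| <= L./2 & u.2 \subset u.1]].
apply: (@card_bad_cover _ E _ (fun u J => [forall o in O, [set s in u.1 | cc o s \in J] != u.2])
  (L.+1 * L./2 + L./2) (2 ^ (L./2 - 2))).
- move=> J /setIdP[_ /hP[S [tau [h1 h2 h3 h4]]]]; exists (S, tau) => //.
  by rewrite inE /= h1 h2 h3.
- rewrite expnD; apply: leq_trans (leq_mul cardE2 (leqnn _)).
  apply: (@leq_card_cover _ _ _ _ (fun S u => u.1 == S)) => [u|S _].
    by rewrite inE => /and3P[_ h _]; exists u.1; rewrite ?inE.
  case: (leqP #|S| L./2) => hS; last first.
    rewrite (_ : [set _ in _ | _] = set0) ?cards0 //; apply/setP => u; rewrite !inE.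
    by apply/negbTE/negP => /andP[/and3P[_ h _] /eqP e]; move: hS; rewrite -e ltnNge h.
  apply: (@leq_trans #|powerset S|); last by rewrite card_powerset leq_exp2l.
  apply: (@leq_card_inj_in _ _ snd) => [u|[a b] [a' b']]; rewrite !inE => /andP[/and3P[_ _ h] /eqP e].
    by rewrite -e.
  by case/andP => _ /eqP e' /= e2; rewrite /= in e e' e2; rewrite e e' e2.
- move=> [S tau] /[!inE] /and3P[/= SV hS tS]; apply: subF => [J /setIdP[] //|].
  apply: card_miss_pattern => // [o s oO sS|]; first by apply: cD => //; apply: (fintype.subsetP SV).
  by apply: leq_trans (half_pow cO); rewrite leq_mul2r leq_exp2l // hS orbT.
- exact: half_ineq.
Qed.

Lemma bad_A : #|bad ev_A| * 64 <= tot.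
Proof.
apply: (@bad_universal A B (fun a s => (a, s))) => //.
- by move=> o s o' s' [-> ->].
- by move=> o s oA sB; rewrite in_setX oA.
move=> J; rewrite negb_forall => /existsP[S]; rewrite negb_forall => /existsP[tau].
rewrite negb_imply => /andP[/and3P[h1 h2 h3]]; rewrite negb_exists_in => h4; by exists S, tau.
Qed.

Lemma bad_B : #|bad ev_B| * 64 <= tot.
Proof.
apply: (@bad_universal B A (fun a s => (s, a))) => //.
- by move=> o s o' s' [-> ->].
- by move=> o s oA sB; rewrite in_setX oA sB.
move=> J; rewrite negb_forall => /existsP[S]; rewrite negb_forall => /existsP[tau].
rewrite negb_imply => /andP[/and3P[h1 h2 h3]]; rewrite negb_exists_in => h4; by exists S, tau.
Qed.

Let missA (S tau : {set T}) e : S \subset B -> tau \subset S -> #|S| + e.1 <= L - 2 -> e.2 <= 2 ^ e.1 ->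
  #|[set J in powerset D | [forall a in A, nbA J a S != tau]]| * 2 ^ e.2 <= tot.
Proof.
move=> SB tS h1 h2; apply: (@card_miss_pattern _ _ (fun a s => (a, s))) => //.
- by move=> o s o' s' [-> ->].
- by move=> o s oA sS; rewrite in_setX oA (fintype.subsetP SB).
apply: leq_trans cA; apply: (@leq_trans (2 ^ #|S| * 2 ^ e.1)); first by rewrite leq_mul2l h2 orbT.
by rewrite -expnD leq_exp2l.
Qed.

Lemma nbA_sub J a (S : {set T}) : nbA J a S \subset S.
Proof. by apply/fintype.subsetP => s; rewrite inE => /andP[]. Qed.

Lemma bad_T : #|bad ev_T| * 64 <= tot.
Proof.
apply: (@card_bad_cover _ (powerset TB) _ (fun tau J => [forall a in A, nbA J a (X :|: TB) != tau])
  (2 * N) (2 ^ (N - 2))).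
- move=> J /setIdP[_]; rewrite negb_forall => /existsP[tau]; rewrite negb_imply => /andP[tT].
  rewrite negb_exists_in => /forall_inP h; exists tau; first by rewrite powersetE.
  apply/forall_inP => a aA; apply: contra (h a aA) => /eqP e.
  have dx s : s \in X -> s \notin tau by move=> sX; apply/negP => /(fintype.subsetP tT); rewrite (disjointFr dX sX).
  have dt s : s \in TB -> s \notin X by move=> sT; rewrite (disjointFl dX sT).
  apply/andP; split; apply/eqP/setP => s; have /setP/(_ s) := e; rewrite !inE.
    by case sX : (s \in X) => //= ->; apply/negbTE/dx.
  case sT : (s \in TB); rewrite ?orbT //= => _; symmetry; apply/negP => /(fintype.subsetP tT); by rewrite sT.
- by rewrite card_powerset leq_exp2l.
- move=> tau; rewrite powersetE => tT; apply: subF => [J /setIdP[] //|].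
  apply: (@missA _ _ (N - 2, 2 ^ (N - 2))) => //=.
  + by rewrite subUset XB TBB.
  + by apply: subset_trans tT _; apply: subsetUr.
  have h1 : #|X :|: TB| <= L - 3 * N + 2 * N.
    by apply: leq_trans (leq_card_setU _ _) _; rewrite cX leq_add2l.
  by move: h1 NL N64; move: #|_| => z; clear; lia.
- have y18 : 18 <= N - 2 by move: N64; clear; lia.
  apply: leq_trans (exp2_ge_sq y18); move: N64; clear => h.
  have [z E] : exists z, N = z + 2 by exists (N - 2); move: h; lia.
  by rewrite E addnK in h *; nia.
Qed.

(** There are at most [2 ^ (10 * N)] pairs. A fixed trace on [XY] and two more vertices is missed
    with probability at most [2 ^ (- 16 * N)], because [2 ^ (t + 4) = 16 * N]. *)
Lemma bad_W : #|bad ev_W| * 64 <= tot.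
Proof.
apply: (@card_bad_cover _ [set u in setX W W | u.1 != u.2] _ (fun u J => [forall a in A, nbA J a (XY :|: [set u.1; u.2]) != [set u.1]])
  (10 * N) (16 * N)).
- move=> J /setIdP[_]; rewrite negb_forall_in => /exists_inP[w wW]; rewrite negb_forall_in => /exists_inP[w' wW'].
  rewrite negb_imply => /andP[ww]; rewrite negb_exists_in => /forall_inP h; exists (w, w').
    by apply/setIdP; split=> //; rewrite in_setX wW.
  apply/forall_inP => a aA; apply: contra (h a aA) => /eqP /= e.
  have [wX wX'] : w \notin XY /\ w' \notin XY by rewrite !(disjointFl dW).
  have E s : s \in XY :|: [set w; w'] -> ((a, s) \in J) = (s == w).
    by move=> hs; have /setP/(_ s) := e; rewrite in_set1 inE hs.
  apply/and3P; split.
  + apply/eqP/setP => s; rewrite !inE; case sX : (s \in XY) => //=; rewrite E; last by rewrite inE sX.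
    by apply/negbTE; apply: contraNneq wX => <-.
  + by rewrite E ?eqxx // !inE eqxx orbT.
  + by rewrite E ?(eq_sym w') // !inE eqxx !orbT.
- apply: (@leq_trans #|setX W W|); first by apply: subset_leq_card; apply/fintype.subsetP => u /setIdP[].
  rewrite cardsX; apply: (@leq_trans ((2 ^ N * L) * (2 ^ N * L))).
    by apply: leq_mul; apply: leq_trans cW _; rewrite leq_mul2r cN orbT.
  rewrite hL -!expnD leq_exp2l //; clear; lia.
- move=> [w w'] /setIdP[/[!in_setX] /andP[wW wW'] /= ww]; apply: subF => [J /setIdP[] //|].
  apply: (@missA _ _ (t + 4, 16 * N)) => //=.
  + by rewrite !subUset XYB !sub1set !(fintype.subsetP WB).
  + by apply: subset_trans (subsetUr _ _); rewrite sub1set set21.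
  + have h1 : #|XY :|: [set w; w']| <= L - (t + 8) + 2.
      by apply: leq_trans (leq_card_setU _ _) _; rewrite cXY cards2 ww.
    by move: h1 tN NL N64; move: #|_| => z; clear; lia.
  + by rewrite addnC expnD -hN leq_mul2r orbT.
- by move: N64; clear; lia.
Qed.

(** First moment: on average at most [2 ^ (3 * N)] vertices of [A] miss [X], while [L./2] is
    [2 ^ (4 * N - 1)]. *)
Lemma bad_Z : #|bad ev_Z| * 64 <= tot.
Proof.
pose Z J := [set a in A | nbA J a X == set0].
have hL2 : 2 ^ (4 * N - 1) <= L./2.
  rewrite hL; have -> : 4 * N = (4 * N - 1).+1 by move: N64; clear; lia.
  by rewrite expnS mul2n doubleK subn1 /= leqnn.
have h1 : #|bad ev_Z| * L./2 <= \sum_(J in powerset D) #|Z J|.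
  rewrite -sum_nat_const; apply: (@leq_trans (\sum_(J in bad ev_Z) #|Z J|)).
    by apply: leq_sum => J /setIdP[_]; rewrite -ltnNge => /ltnW.
  rewrite [X in _ <= X](big_setID (bad ev_Z)) /= (_ : powerset D :&: _ = bad ev_Z) ?leq_addr //.
  by apply/setIidPr; apply/fintype.subsetP => J /setIdP[].
have h2 : \sum_(J in powerset D) #|Z J| = \sum_(a in A) #|[set J in powerset D | nbA J a X == set0]|.
  under eq_bigr => J _ do rewrite -sum1_card big_mkcond /=.
  rewrite exchange_big /= [RHS]big_mkcond /=; apply: eq_bigr => a _.
  rewrite -big_mkcondr /= -sum1_card; case: ifP => aA.
    by apply: eq_bigl => J; rewrite !inE aA.
  by rewrite big_pred0 // => J; rewrite !inE aA andbF.
have h3 a : a \in A -> #|[set J in powerset D | nbA J a X == set0]| * 2 ^ #|X| <= tot.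
  move=> aA; have CD : setX [set a] X \subset D.
    by apply/fintype.subsetP => -[x y]; rewrite !in_setX in_set1 => /andP[/eqP -> /(fintype.subsetP XB) ->]; rewrite aA.
  have := card_fix_pattern set0 CD; rewrite cardsX cards1 mul1n; apply: leq_trans.
  rewrite leq_mul2r; apply/orP; right.
  apply: subset_leq_card; apply/fintype.subsetP => J /setIdP[JD /eqP/setP h]; apply/setIdP; split=> //.
  apply/eqP/setP => -[x y]; rewrite !inE; apply/negbTE/negP => /and3P[xyJ /eqP /= E /= yQ]; rewrite E in xyJ.
  by have := h y; rewrite !inE yQ xyJ.
have h4 : (\sum_(a in A) #|[set J in powerset D | nbA J a X == set0]|) * 2 ^ #|X| <= 2 ^ L * tot.
  rewrite big_distrl /=; apply: (@leq_trans (\sum_(a in A) tot)); first by apply: leq_sum => a; apply: h3.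
  by rewrite sum_nat_const leq_mul2r cA' orbT.
have h5 : #|bad ev_Z| * 2 ^ (4 * N - 1) * 2 ^ (L - 3 * N) <= 2 ^ L * tot.
  rewrite -cX; apply: leq_trans h4; rewrite -h2 leq_mul2r; apply/orP; right; apply: leq_trans h1.
  by rewrite leq_mul2l hL2 orbT.
rewrite -(@leq_pmul2l (2 ^ L)) ?expn_gt0 //; apply: leq_trans h5; rewrite mulnCA -mulnA -expnD leq_mul2l.
rewrite mulnC -[64]/(2 ^ 6) -expnD leq_exp2l //; apply/orP; right.
by move: NL N64; clear; lia.
Qed.

(** Union bound over [2 ^ (2 * L)] pairs of vertices and [2 ^ N] common traces on [D1]; each event
    fixes [2 * (L - (t + 8) + N)] bits. The margin [N - 2 * t - 16] is at least 6 by [tN]. *)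
Lemma bad_Y : #|bad ev_Y| * 64 <= tot.
Proof.
pose E := [set u in setX (setX A A) (powerset D1) | u.1.1 != u.1.2].
apply: (@card_bad_cover _ E _ (fun u J => J :&: setX [set u.1.1; u.1.2] (XY :|: D1) == setX [set u.1.1; u.1.2] u.2)
  (2 * L + N) (2 * (L - (t + 8) + N))).
- move=> J /setIdP[_]; rewrite negb_forall_in => /exists_inP[a aA]; rewrite negb_forall_in => /exists_inP[a' aA'].
  rewrite negb_imply => /andP[/and3P[aa /eqP/setP e1 /eqP/setP e2]]; rewrite negb_exists_in => /forall_inP h.
  exists ((a, a'), nbA J a D1).
    by apply/setIdP; split=> //; rewrite !in_setX aA aA' powersetE nbA_sub.
  apply/eqP/setP => -[x s]; rewrite !inE /=.
  case xa : (_ || _); rewrite ?andbF //=.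
  have sD : s \in XY -> s \in D1 = false by move=> sX; rewrite (disjointFr dD sX).
  case sX : (s \in XY) => /=; rewrite ?andbT.
    rewrite (sD sX) /=; have := e1 s; have := e2 s; rewrite !inE sX /=.
    by case/orP: xa => /eqP ->.
  case sD1 : (s \in D1); rewrite ?andbF //= andbT.
  by case/orP: xa => /eqP -> //; have := h s sD1; rewrite negbK => /eqP ->.
- apply: (@leq_trans #|setX (setX A A) (powerset D1)|); first by apply: subset_leq_card; apply/fintype.subsetP => u /setIdP[].
  rewrite !cardsX card_powerset cD1 expnD mul2n -addnn expnD; apply: leq_mul => //; exact: leq_mul.
- move=> [[a a'] tau] /setIdP[/[!in_setX] /andP[/andP[aA aA'] tD] /= aa]; apply: subF => [J /setIdP[] //|].
  have CD : setX [set a; a'] (XY :|: D1) \subset D.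
    apply/fintype.subsetP => -[x y]; rewrite !in_setX in_set2 in_setU => /andP[/orP[/eqP ->|/eqP ->] h].
      by rewrite aA /=; case/orP: h; apply: fintype.subsetP.
    by rewrite aA' /=; case/orP: h; apply: fintype.subsetP.
  have := card_fix_pattern (setX [set a; a'] tau) CD; rewrite cardsX cards2 aa.
  have -> : #|XY :|: D1| = L - (t + 8) + N.
    have := cardsUI XY D1; rewrite (_ : XY :&: D1 = set0) ?cards0 ?addn0 => [->|]; first by rewrite cXY cD1.
    by apply/eqP; rewrite setI_eq0.
  exact.
- by move: tN NL N64; clear; lia.
Qed.

Definition good_bip J := [&& ev_claw J, ev_A J, ev_B J, ev_Z J, ev_T J, ev_W J & ev_Y J].

Lemma card_bad_bip : #|bad good_bip| * 8 <= tot.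
Proof.
have s : bad good_bip \subset bad ev_claw :|: bad ev_A :|: bad ev_B :|: bad ev_Z :|: bad ev_T :|: bad ev_W :|: bad ev_Y.
  apply/fintype.subsetP => J; rewrite !in_setU !inE => /andP[->] /=; rewrite !negb_and.
  by case: (ev_claw J); case: (ev_A J); case: (ev_B J); case: (ev_Z J); case: (ev_T J); case: (ev_W J); case: (ev_Y J).
have h : #|bad good_bip| <= #|bad ev_claw| + #|bad ev_A| + #|bad ev_B| + #|bad ev_Z| + #|bad ev_T| + #|bad ev_W| + #|bad ev_Y|.
  apply: leq_trans (subset_leq_card s) _.
  by do 5![apply: leq_trans (leq_card_setU _ _) _; apply: leq_add => //]; apply: leq_card_setU.
have := bad_claw; have := bad_A; have := bad_B; have := bad_Z; have := bad_T; have := bad_W; have := bad_Y.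
move: h; set b1 := #|bad ev_claw|; set b2 := #|bad ev_A|; set b3 := #|bad ev_B|; set b4 := #|bad ev_Z|.
set b5 := #|bad ev_T|; set b6 := #|bad ev_W|; set b7 := #|bad ev_Y|; set b8 := #|bad good_bip|.
by clearbody tot; clear; lia.
Qed.

End Bipartite.

(** * Towers of power sets *)

Fixpoint tower k := if k is k'.+1 then 2 ^ tower k' else 1.

Lemma tower_gt0 k : 0 < tower k.
Proof. by case: k => //= k; rewrite expn_gt0. Qed.

Section Tower.
Variables (V : finType) (K : nat) (cls : pred nat) (M : nat -> pred V) (F : pred V) (R : rel V).

Definition members i g : {set V} := [set y | M (i.+1 %% K) y && R g y].

(** Being a power set is second order; it is replaced by a first order condition: a full member,
    closure under toggling single elements, and extensionality. The recursion bottoms out at a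
    singleton, where [cls] tests the depth. *)
Definition layer (D : {set V}) i := (#|D| == 1) && cls i ||
  [exists f in D, [&& F f, [forall x in D, members i x \subset members i f],
    [forall x in D, forall y in members i f, exists x' in D, members i x' == symdiff (members i x) [set y]] &
    [forall x in D, forall x' in D, (members i x == members i x') ==> (x == x')]]].

(* Every member of [F] with mark [i] is a full set, whose elements form the next
   layer down; marks are taken modulo [K] as the height is unbounded. *)
Definition tower_ok (D1 : {set V}) := [&& [forall d in D1, M 0 d], layer D1 0 &
  [forall i : 'I_K, forall g, (F g && M i g) ==> layer (members i g) (i.+1 %% K)]].

(** Starting from the full set [f], single toggles reach every subset, by induction on the number of
    missing elements. *)
Lemma powerset_of_toggles (D : {set V}) i f : f \in D ->
  [forall x in D, members i x \subset members i f] ->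
  [forall x in D, forall y in members i f, exists x' in D, members i x' == symdiff (members i x) [set y]] ->
  [forall x in D, forall x' in D, (members i x == members i x') ==> (x == x')] -> #|D| = 2 ^ #|members i f|.
Proof.
move=> fD /forall_inP h1 /forall_inP h2 /forall_inP h3.
have surj (S : {set V}) : S \subset members i f -> exists2 x, x \in D & members i x = S.
  move: {2}(#|_ :\: S|) (leqnn #|members i f :\: S|) => k.
  elim: k S => [|k IH] S; rewrite ?leqn0 => hS SN.
    by exists f => //; apply/eqP; rewrite eqEsubset SN andbT -setD_eq0 -cards_eq0.
  case: (set_0Vmem (members i f :\: S)) => [E|[y]].
    by exists f => //; apply/eqP; rewrite eqEsubset SN andbT -setD_eq0 E.
  rewrite inE => /andP[yS yN].
  have [||x xD xS] := IH (y |: S).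
  - rewrite -ltnS; apply: leq_trans hS; apply: proper_card; apply/properP; split.
      by apply/fintype.subsetP => z; rewrite !inE negb_or -andbA => /and3P[_ -> ->].
    by exists y; rewrite in_setD ?yS ?yN // in_setU1 eqxx.
  - by rewrite subUset sub1set yN.
  have /forall_inP/(_ y yN)/exists_inP[x' x'D /eqP e] := h2 x xD; exists x' => //.
  rewrite e xS; apply/setP => z; rewrite !inE.
  by case: (altP (z =P y)) => [->|_] /=; rewrite ?(negbTE yS) ?andbF ?orbF.
rewrite -card_powerset; rewrite -(card_in_imset (f := members i) (D := mem D)).
  apply: eq_card => S; rewrite powersetE; apply/imsetP/idP => [[x xD ->]|/surj[x xD <-]]; [exact: h1|by exists x].
move=> x x' xD xD' e; apply/eqP; have /forall_inP/(_ x' xD')/implyP := h3 x xD; apply; exact/eqP.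
Qed.

(** Induction on cardinality: a layer that is not a singleton is the power set of the next one,
    which is strictly smaller since [c < 2 ^ c]. The mark grows by one at each step, so the bottom
    is met at mark [k %% K]. *)
Lemma tower_sound D1 : 0 < K -> tower_ok D1 -> exists2 k, #|D1| = tower k & cls (k %% K).
Proof.
move=> K0 /and3P[/forall_inP hM hl /forallP hF].
have main (n : nat) : forall (D : {set V}) i, #|D| <= n -> i < K -> (forall d, d \in D -> M i d) -> layer D i ->
    exists2 k, #|D| = tower k & cls ((i + k) %% K).
  elim: n => [|n IH] D i hn iK DM /orP[/andP[/eqP c1 ci]|/exists_inP[f fD /and4P[Ff q1 q2 q3]]].
  - by rewrite c1 in hn.
  - by move: hn; rewrite leqn0 cards_eq0 => /eqP E; rewrite E inE in fD.
  - by exists 0; rewrite // addn0 modn_small.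
  have cD := powerset_of_toggles fD q1 q2 q3.
  have [||||k e ck] := IH (members i f) (i.+1 %% K).
  - rewrite -ltnS; apply: leq_trans hn; rewrite cD; exact: ltn_expl.
  - by rewrite ltn_mod.
  - by move=> d; rewrite inE => /andP[].
  - by have /forallP/(_ f) := hF (Ordinal iK); rewrite /= Ff (DM f fD) implyTb.
  exists k.+1; first by rewrite cD e.
  by move: ck; rewrite modnDml addSnnS.
have [|//|//|//|k e ck] := main #|D1| D1 0; first by [].
by exists k.
Qed.

End Tower.

(** A new top layer, the power set of the old one, is added at each step; [R v y] says that [y] is
    an element of [v]. *)
Lemma tower_exists k : exists (V : finType) (ly : V -> nat) (R : rel V),
  [/\ forall v, ly v <= k, #|[set v | ly v == k]| = tower k, #|[set v | ly v == 0]| = 1, #|V| < 2 * tower k &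
   [/\ forall v y, R v y -> ly v = (ly y).+1,
       forall m (S : {set V}), m < k -> S \subset [set v | ly v == m] -> exists2 v, ly v = m.+1 & [set y | R v y] = S &
       forall v v', ly v = ly v' -> 0 < ly v -> [set y | R v y] = [set y | R v' y] -> v = v']].
Proof.
elim: k => [|k [V [ly [R [h1 h2 h3 h4 [h5 h6 h7]]]]]].
  exists unit, (fun _ => 0), (fun _ _ => false); split=> //.
  - by rewrite (_ : [set _ | _] = setT) ?cardsT ?card_unit //; apply/setP => -[]; rewrite !inE.
  - by rewrite (_ : [set _ | _] = setT) ?cardsT ?card_unit //; apply/setP => -[]; rewrite !inE.
  - by rewrite card_unit.
pose top := [set v | ly v == k].
pose V' := {S : {set V} | S \subset top}.
have cV' : #|{: V'}| = tower k.+1.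
  by rewrite card_sig -cardsE -[RHS]/(2 ^ tower k) -h2 -card_powerset; apply: eq_card => S; rewrite !inE.
exists (V + V')%type, (fun v => match v with inl w => ly w | inr _ => k.+1 end).
exists (fun v y : (V + V')%type => match v, y with inl w, inl z => R w z | inr Q, inl z => z \in val Q | _, _ => false end).
split.
- by case=> [w|S] //; apply: ltnW; rewrite ltnS.
- rewrite -cV' -cardsT -(card_imset _ (@inr_inj V V')); apply: eq_card => -[w|S]; rewrite !inE.
    rewrite (ltn_eqF (h1 w : ly w < k.+1)); symmetry; by apply/imsetP => -[].
  by rewrite eqxx; symmetry; apply/imsetP; exists S.
- rewrite -h3 -(card_imset _ (@inl_inj V V')); apply: eq_card => -[w|S]; rewrite !inE.
    by rewrite (mem_imset _ _ (@inl_inj V V')) inE.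
  by symmetry; apply/imsetP => -[].
- rewrite card_sum cV' /= mul2n -addnn ltn_add2r.
  by apply: leq_trans h4 _; rewrite -[2 ^ _]/(tower k.+1) /=; case: (tower k) (tower_gt0 k) => // t _; rewrite expnS leq_mul2l ltn_expl.
split.
- case=> [w|S] [z|S'] //; first exact: h5.
  by move=> zS; have := fintype.subsetP (valP S) z zS; rewrite inE => /eqP ->.
- move=> m S; rewrite ltnS => mk Sm.
  have noR S' : inr S' \notin S.
    by apply/negP => /(fintype.subsetP Sm); rewrite inE => /eqP E; move: mk; rewrite -E ltnn.
  pose S0 := [set w : V | inl w \in S].
  have S0E y : (y \in S) = if y is inl w then w \in S0 else false.
    by case: y => [w|S']; rewrite ?inE //; apply/negbTE.
  have S0m : S0 \subset [set v | ly v == m].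
    apply/fintype.subsetP => w wS; have wS' : inl w \in S by rewrite S0E.
    by have := fintype.subsetP Sm _ wS'; rewrite !inE.
  move: mk; rewrite leq_eqVlt => /orP[/eqP mk|mk].
    have S0t : S0 \subset top by rewrite /top -mk.
    exists (inr (exist _ S0 S0t)); first by rewrite mk.
    by apply/setP => y; rewrite inE S0E; case: y.
  have [v v1 v2] := h6 m S0 mk S0m; exists (inl v) => //.
  by apply/setP => y; rewrite inE S0E -v2; case: y => // w; rewrite inE.
- case=> [w|S] [w'|S'] //=.
  + move=> e0 e1 /setP E; congr inl; apply: h7 => //; apply/setP => y; by have := E (inl y); rewrite !inE.
  + by move=> E; have := h1 w; rewrite E ltnn.
  + by move=> E; have := h1 w'; rewrite -E ltnn.
  + by move=> _ _ /setP E; congr inr; apply: val_inj; apply/setP => y; have := E (inl y); rewrite !inE.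
Qed.

Section Complete.
Variables (k K : nat) (cls : pred nat) (V T : finType) (ly : V -> nat) (R : rel V) (phi : V -> T).
Hypothesis K3 : 2 < K.
Hypothesis clk : cls (k %% K).
Hypothesis phi_inj : injective phi.
Hypothesis h1 : forall v, ly v <= k.
Hypothesis h3 : #|[set v | ly v == 0]| = 1.
Hypothesis h5 : forall v y, R v y -> ly v = (ly y).+1.
Hypothesis h6 : forall m (S : {set V}), m < k -> S \subset [set v | ly v == m] -> exists2 v, ly v = m.+1 & [set y | R v y] = S.
Hypothesis h7 : forall v v', ly v = ly v' -> 0 < ly v -> [set y | R v y] = [set y | R v' y] -> v = v'.

(** Depth is measured from the top layer, so [D1] has mark 0 whatever the height is, and the bottom
    point carries the residue of [k]. *)
Definition mark v := (k - ly v) %% K.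
Definition full v := (0 < ly v) && [forall y, (ly v == (ly y).+1) ==> R v y].

Variables (MT : nat -> pred T) (FT : pred T) (RT : rel T).
Hypothesis hMT : forall i x, i < K -> MT i x = [exists v, (phi v == x) && (mark v == i)].
Hypothesis hFT : forall v, FT (phi v) = full v.
Hypothesis hRT : forall v y, v != y -> RT (phi v) (phi y) = R v y || R y v.

Let K0 : 0 < K. Proof. by apply: leq_trans K3. Qed.

Lemma MT_phi i v : i < K -> MT i (phi v) = (mark v == i).
Proof.
move=> iK; rewrite hMT //; apply/existsP/idP => [[w /andP[/eqP/phi_inj -> //]]|h]; by exists v; rewrite eqxx.
Qed.

(** [RT] is symmetric, so the marks must give its direction: the layers above and below [v] differ
    in mark by 2 modulo [K], and [K > 2] tells them and the layer of [v] apart. *)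
Lemma members_phi v : members K MT RT (mark v) (phi v) = phi @: [set y | R v y].
Proof.
have mK j : j %% K < K by rewrite ltn_mod.
apply/setP => x; rewrite inE; apply/andP/imsetP => [[]|[y]].
  rewrite hMT // => /existsP[y /andP[/eqP <- /eqP my]].
  have vy : v != y.
    apply/eqP => E; move: my; rewrite -E /mark -addn1 modnDml => /eqP.
    by rewrite -{1}[k - ly v]addn0 eqn_modDl mod0n modn_small // (leq_trans _ K3).
  rewrite hRT // => /orP[vRy|yRv]; first by exists y; rewrite ?inE.
  have e := h5 yRv; exfalso; move: my; rewrite /mark.
  have -> : k - ly v = (k - ly y) + 1 by have := h1 y; rewrite e; clear; lia.
  rewrite -addn1 modnDml -addnA => /eqP; rewrite -{1}[k - ly y]addn0 eqn_modDl mod0n modn_small //.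
rewrite inE => vRy ->; have e := h5 vRy; split.
  rewrite MT_phi // /mark -addn1 modnDml; apply/eqP; congr (_ %% _).
  by have := h1 v; rewrite e; clear; lia.
rewrite hRT ?vRy //; apply/eqP => E; move: e; rewrite E; clear; lia.
Qed.

Lemma layer_phi m : m <= k -> layer K cls MT FT RT (phi @: [set v | ly v == m]) ((k - m) %% K).
Proof.
case: m => [_|m mk]; first by rewrite /layer subn0 card_imset // h3 eqxx clk.
apply/orP; right.
have [f f1 f2] := h6 mk (fintype.subxx _).
have mkE v : ly v = m.+1 -> mark v = (k - m.+1) %% K by rewrite /mark => ->.
have memE v : ly v = m.+1 -> members K MT RT ((k - m.+1) %% K) (phi v) = phi @: [set y | R v y].
  by move=> e; rewrite -(mkE v e) members_phi.
have subm v : ly v = m.+1 -> [set y | R v y] \subset [set v | ly v == m].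
  by move=> e; apply/fintype.subsetP => y; rewrite !inE => /h5; rewrite e => -[->].
apply/exists_inP; exists (phi f); first by apply: imset_f; rewrite inE f1.
have memf : members K MT RT ((k - m.+1) %% K) (phi f) = phi @: [set v | ly v == m] by rewrite memE // f2.
apply/and4P; split.
- rewrite hFT /full f1 /=; apply/forallP => y; apply/implyP; rewrite eqSS => /eqP e.
  by have /setP/(_ y) := f2; rewrite !inE -e eqxx.
- apply/forall_inP => _ /imsetP[v /[!inE] /eqP vm ->]; rewrite memf memE //; apply: imsetS; exact: subm.
- apply/forall_inP => _ /imsetP[v /[!inE] /eqP vm ->]; apply/forall_inP => y; rewrite memf => /imsetP[w /[!inE] /eqP wm ->].
  have sd : symdiff [set y | R v y] [set w] \subset [set v | ly v == m].
    apply/fintype.subsetP => z; rewrite !inE => /orP[/andP[_ /h5]|/andP[_ /eqP ->]]; last by rewrite wm.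
    by rewrite vm => -[->].
  have [v' v'1 v'2] := h6 mk sd; apply/exists_inP; exists (phi v'); first by apply: imset_f; rewrite inE v'1.
  rewrite !memE // v'2; apply/eqP/setP => x; rewrite !inE.
  apply/imsetP/idP => [[z]|].
    rewrite !inE => hz ->; rewrite (mem_imset _ _ phi_inj) !inE (inj_eq phi_inj) //.
  case/orP => /andP[x1].
    case/imsetP => z /[!inE] vz xz; exists z => //; move: x1; rewrite xz (inj_eq phi_inj) => zw; by rewrite !inE zw vz.
  move=> /eqP xw; exists w => //; move: x1; rewrite xw (mem_imset _ _ phi_inj) !inE => ->; by rewrite eqxx orbT.
- apply/forall_inP => _ /imsetP[v /[!inE] /eqP vm ->]; apply/forall_inP => _ /imsetP[v' /[!inE] /eqP vm' ->].
  rewrite !memE //; apply/implyP => /eqP/(imset_inj phi_inj) E.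
  by apply/eqP; congr phi; apply: h7; rewrite ?vm ?vm'.
Qed.

Lemma tower_complete : tower_ok K cls MT FT RT (phi @: [set v | ly v == k]).
Proof.
apply/and3P; split.
- apply/forall_inP => _ /imsetP[v /[!inE] /eqP vk ->].
  by rewrite MT_phi // /mark vk subnn mod0n.
- by have := layer_phi (leqnn k); rewrite subnn mod0n.
- apply/forallP => i; apply/forallP => g; apply/implyP => /andP[Fg]; rewrite hMT // => /existsP[v /andP[/eqP e /eqP mi]].
  move: Fg; rewrite -e hFT => /andP[v0 /forallP fv].
  have [m vm] : exists m, ly v = m.+1 by exists (ly v).-1; rewrite prednK.
  have mk : m < k by rewrite -vm.
  rewrite -mi members_phi.
  have -> : [set y | R v y] = [set y | ly y == m].
    apply/setP => y; rewrite !inE; apply/idP/eqP => [/h5|ym]; first by rewrite vm => -[->].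
    by have /implyP := fv y; apply; rewrite vm ym.
  have -> : (mark v).+1 %% K = (k - m) %% K.
    by rewrite /mark -addn1 modnDml vm; congr (_ %% _); move: mk; clear; lia.
  by apply: layer_phi; apply: ltnW.
Qed.

End Complete.

(** * First order formulas *)

(* Formulas with named variables: [(0, i)] are the bound variables and
   [(c.+1, n)] is the parameter number [n] of kind [c]. *)
Notation var := (nat * nat)%type.

Inductive nform :=
| NEq of var & var | NAdj of var & var | NNot of nform | NAnd of nform & nform | NEx of var & nform.

Definition upd (T : Type) (e : var -> T) x a y := if y == x then a else e y.

Fixpoint nsat (T : finType) (G : sgraph T) (e : var -> T) (f : nform) : bool :=
  match f with
  | NEq x y => e x == e y
  | NAdj x y => adj G (e x) (e y)
  | NNot f => ~~ nsat G e f
  | NAnd f g => nsat G e f && nsat G e g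
  | NEx x f => [exists a, nsat G (upd e x a) f]
  end.

Fixpoint to_formula (k : nat) (pos : var -> 'I_k) (f : nform) : formula k :=
  match f with
  | NEq x y => FEq (pos x) (pos y)
  | NAdj x y => FAdj (pos x) (pos y)
  | NNot f => FNot (to_formula pos f)
  | NAnd f g => FAnd (to_formula pos f) (to_formula pos g)
  | NEx x f => FEx (to_formula (fun y => if y == x then ord0 else lift ord0 (pos y)) f)
  end.

Lemma sat_to_formula (T : finType) (G : sgraph T) f k (pos : var -> 'I_k) (t : k.-tuple T) (e : var -> T) :
  (forall x, tnth t (pos x) = e x) -> sat G (to_formula pos f) t = nsat G e f.
Proof.
elim: f k pos t e => [x y|x y|f IH|f IHf g IHg|x f IH] k pos t e h /=; rewrite ?h //.
- by rewrite (IH _ _ _ e).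
- by rewrite (IHf _ _ _ e) // (IHg _ _ _ e).
- apply: eq_existsb => a; apply: IH => y; rewrite /upd; case: (y == x); [by rewrite tnth0|by rewrite tnthS].
Qed.

(* The dummy outermost quantifier gives a value to every variable. *)
Definition to_sentence (f : nform) : sentence := FEx (to_formula (fun _ => ord0) f).

Lemma models_to_sentence (T : finType) (G : sgraph T) f :
  models G (to_sentence f) = [exists a, nsat G (fun _ => a) f].
Proof.
by rewrite /models /=; apply: eq_existsb => a; apply: sat_to_formula => x; rewrite tnth0.
Qed.

Definition lv i : var := (0, i).

Definition NOr f g := NNot (NAnd (NNot f) (NNot g)).
Definition NImp f g := NNot (NAnd f (NNot g)).
Definition NAll x f := NNot (NEx x (NNot f)).
Definition NXor f g := NOr (NAnd f (NNot g)) (NAnd (NNot f) g).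
Definition NTrue := NAll (0, 0) (NEq (0, 0) (0, 0)).
Definition NBool (b : bool) := if b then NTrue else NNot NTrue.
Definition NAnds (fs : seq nform) := foldr NAnd NTrue fs.
Definition NOrs (fs : seq nform) := foldr NOr (NNot NTrue) fs.
Definition NExs (xs : seq var) f := foldr NEx f xs.

Section Semantics.
Variables (T : finType) (G : sgraph T).
Implicit Types e : var -> T.

Lemma nsat_and e f g : nsat G e (NAnd f g) = nsat G e f && nsat G e g.
Proof. by []. Qed.
Lemma nsat_not e f : nsat G e (NNot f) = ~~ nsat G e f.
Proof. by []. Qed.
Lemma nsat_ex e x f : nsat G e (NEx x f) = [exists a, nsat G (upd e x a) f].
Proof. by []. Qed.
Lemma nsat_or e f g : nsat G e (NOr f g) = nsat G e f || nsat G e g.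
Proof. by rewrite /= negb_and !negbK. Qed.
Lemma nsat_imp e f g : nsat G e (NImp f g) = (nsat G e f ==> nsat G e g).
Proof. by rewrite /= negb_and negbK implybE. Qed.
Lemma nsat_all e x f : nsat G e (NAll x f) = [forall a, nsat G (upd e x a) f].
Proof. by rewrite /= negb_exists; apply: eq_forallb => a; rewrite negbK. Qed.
Lemma nsat_xor e f g : nsat G e (NXor f g) = (nsat G e f != nsat G e g).
Proof. by rewrite nsat_or /=; case: (nsat G e f); case: (nsat G e g). Qed.
Lemma nsat_true e : nsat G e NTrue.
Proof. by rewrite nsat_all; apply/forallP => a /=. Qed.
Lemma nsat_bool e b : nsat G e (NBool b) = b.
Proof. by case: b; [exact: nsat_true|apply/negbTE; rewrite /= negbK; exact: nsat_true]. Qed.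
Lemma nsat_ands (I : Type) e (fs : I -> nform) s : nsat G e (NAnds (map fs s)) = all (fun i => nsat G e (fs i)) s.
Proof. by elim: s => [|i s IH]; rewrite /= ?IH // -[LHS]/(nsat G e NTrue) nsat_true. Qed.
Lemma nsat_ors (I : Type) e (fs : I -> nform) s : nsat G e (NOrs (map fs s)) = has (fun i => nsat G e (fs i)) s.
Proof.
elim: s => [|i s IH]; last by rewrite -[NOrs _]/(NOr (fs i) (NOrs (map fs s))) nsat_or IH.
by apply/negbTE; rewrite -[nsat _ _ _]/(~~ nsat G e NTrue) negbK nsat_true.
Qed.

Lemma nsat_exs e xs f : nsat G e (NExs xs f) <-> exists e', (forall x, x \notin xs -> e' x = e x) /\ nsat G e' f.
Proof.
elim: xs e => [|x xs IH] e /=.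
  split=> [h|[e' [h]]]; first by exists e.
  by have -> : e' = e by apply: funext => x; apply: h.
split=> [/existsP[a /IH[e' [h1 h2]]]|[e' [h1 h2]]].
  exists e'; split=> // y; rewrite inE negb_or => /andP[yx yxs].
  by rewrite h1 // /upd (negbTE yx).
apply/existsP; exists (e' x); apply/IH; exists e'; split=> // y yxs.
rewrite /upd; case: eqP => [-> //|/eqP yx]; by apply: h1; rewrite inE negb_or yx.
Qed.

Lemma upd_eq e x a : upd e x a x = a. Proof. by rewrite /upd eqxx. Qed.

Lemma upd_ne e i j a : i != j -> upd e (lv j) a (lv i) = e (lv i).
Proof. by move=> ij; rewrite /upd /lv xpair_eqE /= (negbTE ij). Qed.

End Semantics.

(** * Sentences that describe towers *)

Section Witness.
Variables (K s r : nat) (cls : pred nat).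

(** The bound variables of the auxiliary formulas are numbered downwards with nesting, 8 to 10 here,
    7 in [fanti], 6 in [fR], 1 to 5 in [flayer]; arguments always have smaller numbers, so nothing
    is captured. *)
Definition fA x := NEx (lv 8) (NEx (lv 9) (NEx (lv 10)
  (NAnd (NAdj x (lv 8)) (NAnd (NAdj x (lv 9)) (NAnd (NAdj x (lv 10))
  (NAnd (NNot (NEq (lv 8) (lv 9))) (NAnd (NNot (NEq (lv 8) (lv 10))) (NAnd (NNot (NEq (lv 9) (lv 10)))
  (NAnd (NNot (NAdj (lv 8) (lv 9))) (NAnd (NNot (NAdj (lv 8) (lv 10))) (NNot (NAdj (lv 9) (lv 10))))))))))))).
Definition fU x := NAnd (NNot (fA x)) (NOrs [seq NOr (NEq x (1, l)) (NAdj x (1, l)) | l <- iota 0 r]).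
(** A subset of [U] as a disjunction of [s] conjunctions of [s] adjacencies to parameters. The cuts
    0 and 1 define the sets to be missed by [fanti], cut 2 is the top layer, cut 3 the full sets,
    and the cuts from 4 on are the marks. *)
Definition fcut c x := NAnd (fU x) (NOrs [seq NAnds [seq NAdj x (c.+3, l * s + j) | j <- iota 0 s] | l <- iota 0 s]).
Definition fanti c x := NAnd (fA x) (NAll (lv 7) (NImp (fcut c (lv 7)) (NNot (NAdj x (lv 7))))).
Definition fE x := NAnd (fanti 0 x) (NAdj x (2, 0)).
(** A pair is joined when some marked vertex of [A] sees both ends; marking is adjacency to the
    single parameter [(2, 0)], which allows an arbitrary graph on the tower. *)
Definition fR x y := NEx (lv 6) (NAnd (fE (lv 6)) (NAnd (NAdj (lv 6) x) (NAdj (lv 6) y))).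
Definition fW x := NAnd (fU x) (NNot (fcut 1 x)).
Definition fM i := fcut i.+4.
Definition fmem i g y := NAnd (fM (i.+1 %% K) y) (fR g y).

Definition flayer (D : var -> nform) i := NOr
  (NAnd (NBool (cls i)) (NEx (lv 1) (NAnd (D (lv 1)) (NAll (lv 2) (NImp (D (lv 2)) (NEq (lv 2) (lv 1)))))))
  (NEx (lv 1) (NAnd (D (lv 1)) (NAnd (fcut 3 (lv 1)) (NAnd
    (NAll (lv 2) (NImp (D (lv 2)) (NAll (lv 5) (NImp (fmem i (lv 2) (lv 5)) (fmem i (lv 1) (lv 5)))))) (NAnd
    (NAll (lv 2) (NImp (D (lv 2)) (NAll (lv 3) (NImp (fmem i (lv 1) (lv 3)) (NEx (lv 4) (NAnd (D (lv 4))
       (NAll (lv 5) (NNot (NXor (fmem i (lv 4) (lv 5)) (NXor (fmem i (lv 2) (lv 5)) (NEq (lv 5) (lv 3))))))))))))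
    (NAll (lv 2) (NImp (D (lv 2)) (NAll (lv 3) (NImp (D (lv 3)) (NImp
       (NAll (lv 5) (NNot (NXor (fmem i (lv 2) (lv 5)) (fmem i (lv 3) (lv 5))))) (NEq (lv 2) (lv 3)))))))))))).

(** The first clause says that [A] does not shatter [W]: toggling [w] in the trace of some [a] gives
    no trace. It bounds [W] from below. The next two separate [W] by the vertices missing cut 1, and
    those by the top layer, so that [W] has size at most double exponential in the top layer. The
    rest is [tower_ok]. *)
Definition fwit := NAnds [::
  NEx (lv 0) (NAnd (fA (lv 0)) (NEx (lv 1) (NAnd (fW (lv 1)) (NAll (lv 2) (NImp (fA (lv 2))
    (NEx (lv 3) (NAnd (fW (lv 3)) (NXor (NAdj (lv 2) (lv 3)) (NXor (NAdj (lv 0) (lv 3)) (NEq (lv 3) (lv 1)))))))))));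
  NAll (lv 0) (NImp (fW (lv 0)) (NAll (lv 1) (NImp (fW (lv 1)) (NImp (NNot (NEq (lv 0) (lv 1)))
    (NEx (lv 2) (NAnd (fanti 1 (lv 2)) (NXor (NAdj (lv 2) (lv 0)) (NAdj (lv 2) (lv 1)))))))));
  NAll (lv 0) (NImp (fanti 1 (lv 0)) (NAll (lv 1) (NImp (fanti 1 (lv 1)) (NImp (NNot (NEq (lv 0) (lv 1)))
    (NEx (lv 2) (NAnd (fcut 2 (lv 2)) (NXor (NAdj (lv 0) (lv 2)) (NAdj (lv 1) (lv 2)))))))));
  NAll (lv 0) (NImp (fcut 2 (lv 0)) (fM 0 (lv 0)));
  flayer (fcut 2) 0;
  NAnds [seq NAll (lv 0) (NImp (NAnd (fcut 3 (lv 0)) (fM i (lv 0))) (flayer (fmem i (lv 0)) (i.+1 %% K))) | i <- iota 0 K]].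

Definition params : seq var := [seq (1, l) | l <- iota 0 r] ++ [:: (2, 0)] ++
  [seq (c.+3, n) | c <- iota 0 (4 + K), n <- iota 0 (s * s)].

Definition fsent := NExs params fwit.

Variables (T : finType) (G : sgraph T).

Definition claw_centre x := [exists a, exists b, exists c, [&& adj G x a, adj G x b, adj G x c,
  a != b, a != c, b != c, ~~ adj G a b, ~~ adj G a c & ~~ adj G b c]].

Section Sem.
(* [q c n] is the value of the parameter [(c.+1, n)]. *)
Variable q : nat -> nat -> T.

Definition sA : {set T} := [set x | claw_centre x].
Definition sU : {set T} := [set x | (x \notin sA) && has (fun l => (x == q 0 l) || adj G x (q 0 l)) (iota 0 r)].
Definition scut c : {set T} := [set x in sU | has (fun l => all (fun j => adj G x (q c.+2 (l * s + j))) (iota 0 s)) (iota 0 s)].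
Definition santi c : {set T} := [set a in sA | [forall x in scut c, ~~ adj G a x]].
Definition sE : {set T} := [set a in santi 0 | adj G a (q 1 0)].
Definition sR x y := [exists a in sE, adj G a x && adj G a y].
Definition sW := sU :\: scut 1.
Definition sM i := [in scut i.+4].
Definition sF := [in scut 3].

Definition wit := [&& [exists a in sA, exists w in sW, forall a' in sA, exists v in sW,
     adj G a' v != (adj G a v != (v == w))],
   [forall w in sW, forall w' in sW, (w != w') ==> [exists y in santi 1, adj G y w != adj G y w']],
   [forall y in santi 1, forall y' in santi 1, (y != y') ==> [exists d in scut 2, adj G y d != adj G y' d]] &
   tower_ok K cls sM sF sR (scut 2)].
End Sem.

Definition pe (e : var -> T) c n := e (c.+1, n).

Lemma nsat_A e i : i < 8 -> nsat G e (fA (lv i)) = (e (lv i) \in sA).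
Proof.
move=> i8; have [n8 n9 n10] : [/\ i != 8, i != 9 & i != 10] by split; apply: contraTneq i8 => ->.
rewrite inE nsat_ex; apply: eq_existsb => a; rewrite nsat_ex; apply: eq_existsb => b; rewrite nsat_ex; apply: eq_existsb => c.
by rewrite !nsat_and !nsat_not /= !(upd_eq, upd_ne).
Qed.

Lemma nsat_U e i : i < 8 -> nsat G e (fU (lv i)) = (e (lv i) \in sU (pe e)).
Proof. by move=> i8; rewrite inE -nsat_A // nsat_and nsat_not nsat_ors; congr (_ && _); apply: eq_has => l; rewrite nsat_or. Qed.

Lemma nsat_cut e c i : i < 8 -> nsat G e (fcut c (lv i)) = (e (lv i) \in scut (pe e) c).
Proof.
move=> i8; rewrite inE -nsat_U // nsat_and nsat_ors; congr (_ && _); apply: eq_has => l.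
by rewrite nsat_ands.
Qed.

Lemma pe_upd e i a : pe (upd e (lv i) a) = pe e. Proof. by []. Qed.

Lemma nsat_anti e c i : i < 7 -> nsat G e (fanti c (lv i)) = (e (lv i) \in santi (pe e) c).
Proof.
move=> i7; have i8 : i < 8 by apply: ltnW.
rewrite inE -nsat_A // nsat_and nsat_all; congr (_ && _); apply: eq_forallb => x.
by rewrite nsat_imp nsat_cut // upd_eq pe_upd /= upd_eq upd_ne // ltn_eqF.
Qed.

Lemma nsat_E e i : i < 7 -> nsat G e (fE (lv i)) = (e (lv i) \in sE (pe e)).
Proof. by move=> i7; rewrite inE -nsat_anti. Qed.

Lemma nsat_R e i j : i < 6 -> j < 6 -> nsat G e (fR (lv i) (lv j)) = sR (pe e) (e (lv i)) (e (lv j)).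
Proof.
move=> i6 j6; rewrite nsat_ex; apply: eq_existsb => a; rewrite nsat_and nsat_E // upd_eq pe_upd; congr (_ && _).
by rewrite nsat_and /= upd_eq !upd_ne // ltn_eqF.
Qed.

Lemma nsat_W e i : i < 8 -> nsat G e (fW (lv i)) = (e (lv i) \in sW (pe e)).
Proof. by move=> i8; rewrite in_setD nsat_and nsat_not nsat_U // nsat_cut // andbC. Qed.

Lemma nsat_mem e i x y : x < 6 -> y < 6 ->
  nsat G e (fmem i (lv x) (lv y)) = (e (lv y) \in members K (sM (pe e)) (sR (pe e)) i (e (lv x))).
Proof.
move=> x6 y6; rewrite inE nsat_and nsat_R // nsat_cut //.
by apply: leq_trans y6 _.
Qed.

Lemma nsat_layer (D : var -> nform) (S : {set T}) e i :
  (forall e' j, 0 < j < 6 -> pe e' = pe e -> e' (lv 0) = e (lv 0) -> nsat G e' (D (lv j)) = (e' (lv j) \in S)) ->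
  nsat G e (flayer D i) = layer K cls (sM (pe e)) (sF (pe e)) (sR (pe e)) S i.
Proof.
move=> hD; rewrite nsat_or /layer; congr (_ || _).
  rewrite nsat_and nsat_bool andbC; congr (_ && _); rewrite nsat_ex; apply/existsP/cards1P => [[x]|[x E]].
    rewrite nsat_and hD // upd_eq nsat_all => /andP[xS /forallP h]; exists x.
    apply/setP => y; rewrite inE; have := h y; rewrite nsat_imp hD // upd_eq => /implyP h'.
    apply/idP/eqP => [/h'/eqP|->] //.
  exists x; rewrite nsat_and hD // upd_eq E set11 nsat_all; apply/forallP => y.
  by rewrite nsat_imp hD // upd_eq E inE; apply/implyP => /eqP ->; apply/eqP.
rewrite nsat_ex; apply: eq_existsb => f; rewrite nsat_and hD // upd_eq nsat_and nsat_cut // upd_eq pe_upd 2!nsat_and.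
congr (_ && _); congr (_ && _); congr (_ && _); [|congr (_ && _)].
- rewrite nsat_all; apply: eq_forallb => x; rewrite nsat_imp hD // upd_eq; congr (_ ==> _).
  rewrite nsat_all; apply/forallP/fintype.subsetP => h y.
    by have := h y; rewrite nsat_imp !nsat_mem //= => /implyP.
  by rewrite nsat_imp !nsat_mem //=; apply/implyP; apply: h.
- rewrite nsat_all; apply: eq_forallb => x; rewrite nsat_imp hD // upd_eq; congr (_ ==> _).
  rewrite nsat_all; apply: eq_forallb => y; rewrite nsat_imp nsat_mem //; congr (_ ==> _).
  rewrite nsat_ex; apply: eq_existsb => x'; rewrite nsat_and hD // upd_eq; congr (_ && _).
  rewrite nsat_all; apply/forallP/eqP => [h|E z].
    apply/setP => z; have := h z; rewrite nsat_not !nsat_xor !nsat_mem //= negbK => /eqP ->.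
    by rewrite !in_setU !in_setD !in_set1; case: (z == y); case: (z \in _).
  rewrite nsat_not !nsat_xor !nsat_mem //= negbK E !in_setU !in_setD !in_set1.
  by rewrite /upd /=; case: (z == y); case: (z \in _).
- rewrite nsat_all; apply: eq_forallb => x; rewrite nsat_imp hD // upd_eq; congr (_ ==> _).
  rewrite nsat_all; apply: eq_forallb => x'; rewrite nsat_imp hD // upd_eq nsat_imp; congr (_ ==> (_ ==> _)).
  rewrite nsat_all; apply/forallP/eqP => [h|E z].
    by apply/setP => z; have := h z; rewrite nsat_not nsat_xor !nsat_mem //= negbK => /eqP ->.
  by rewrite nsat_not nsat_xor !nsat_mem //= negbK E.
Qed.

Lemma nsat_wit e : nsat G e fwit = wit (pe e).
Proof.
rewrite /wit /tower_ok /fwit /NAnds [foldr _ _ _]/= !nsat_and nsat_true andbT.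
congr (_ && _); last congr (_ && _); last congr (_ && _); last congr (_ && _); last congr (_ && _).
- rewrite nsat_ex; apply: eq_existsb => a; rewrite nsat_and nsat_A // upd_eq; congr (_ && _).
  rewrite nsat_ex; apply: eq_existsb => w; rewrite nsat_and nsat_W // upd_eq; congr (_ && _).
  rewrite nsat_all; apply: eq_forallb => a'; rewrite nsat_imp nsat_A // upd_eq; congr (_ ==> _).
  by rewrite nsat_ex; apply: eq_existsb => v; rewrite nsat_and nsat_W // upd_eq !nsat_xor.
- rewrite nsat_all; apply: eq_forallb => w; rewrite nsat_imp nsat_W // upd_eq; congr (_ ==> _).
  rewrite nsat_all; apply: eq_forallb => w'; rewrite nsat_imp nsat_W // upd_eq nsat_imp; congr (_ ==> (_ ==> _)).
  by rewrite nsat_ex; apply: eq_existsb => y; rewrite nsat_and nsat_anti // upd_eq nsat_xor.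
- rewrite nsat_all; apply: eq_forallb => w; rewrite nsat_imp nsat_anti // upd_eq; congr (_ ==> _).
  rewrite nsat_all; apply: eq_forallb => w'; rewrite nsat_imp nsat_anti // upd_eq nsat_imp; congr (_ ==> (_ ==> _)).
  by rewrite nsat_ex; apply: eq_existsb => y; rewrite nsat_and nsat_cut // upd_eq nsat_xor.
- by rewrite nsat_all; apply: eq_forallb => d; rewrite nsat_imp !nsat_cut // upd_eq.
- apply: nsat_layer => e' j /andP[_ j6] h1 h2; rewrite nsat_cut; last by apply: leq_trans j6 _.
  by rewrite h1.
- rewrite nsat_ands; apply/allP/forallP => [h i|h i].
    have := h i; rewrite mem_iota leq0n add0n ltn_ord => /(_ isT); rewrite nsat_all => /forallP h'.
    apply/forallP => g; have := h' g; rewrite nsat_imp nsat_and !nsat_cut // upd_eq !pe_upd.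
    rewrite (@nsat_layer _ (members K (sM (pe e)) (sR (pe e)) i g)) // => e' j /andP[_ j6] h1 h2.
    by rewrite nsat_mem // h2 h1.
  rewrite mem_iota leq0n add0n andTb => iK; rewrite nsat_all; apply/forallP => g.
  have /forallP/(_ g) := h (Ordinal iK); rewrite nsat_imp nsat_and !nsat_cut // upd_eq !pe_upd.
  rewrite (@nsat_layer _ (members K (sM (pe e)) (sR (pe e)) i g)) // => e' j /andP[_ j6] h1 h2.
  by rewrite nsat_mem // h2 h1.
Qed.

Lemma models_wit : models G (to_sentence fsent) -> exists q, wit q.
Proof.
rewrite models_to_sentence => /existsP[a /nsat_exs[e [_]]]; rewrite nsat_wit => h; by exists (pe e).
Qed.

Lemma wit_models (q : nat -> nat -> T) (a : T) :
  (forall c n, (c.+1, n) \notin params -> q c n = a) -> wit q -> models G (to_sentence fsent).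
Proof.
move=> hq hw; rewrite models_to_sentence; apply/existsP; exists a; apply/nsat_exs.
exists (fun x : var => if x.1 is c.+1 then q c x.2 else a); split=> [[[|c] n] hx|]; [by []|exact: hq|by rewrite nsat_wit].
Qed.

End Witness.

(** * The sentences on typical unipolar graphs *)

Lemma symdiff0 (T : finType) (S : {set T}) : symdiff S set0 = S.
Proof. by apply/setP => x; rewrite !inE andbF orbF. Qed.

Lemma symdiff_inj (T : finType) (S : {set T}) : injective (symdiff S).
Proof.
by move=> D D' /setP E; apply/setP => x; have := E x; rewrite !inE; case: (x \in S); case: (x \in D); case: (x \in D').
Qed.

(** When every trace can be toggled at every point of [W], all subsets of [W] are reached from the
    trace of [a0], giving [2 ^ #|W|] different traces. *)
Lemma shatter_bound (T : finType) (A W : {set T}) (tr : T -> {set T}) a0 : a0 \in A ->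
  (forall a w, a \in A -> w \in W -> exists2 a', a' \in A & tr a' = symdiff (tr a) [set w]) -> 2 ^ #|W| <= #|A|.
Proof.
move=> a0A h.
have reach (D : {set T}) : D \subset W -> exists2 a, a \in A & tr a = symdiff (tr a0) D.
  move: {2}#|D| (leqnn #|D|) => k; elim: k D => [|k IH] D.
    by rewrite leqn0 cards_eq0 => /eqP -> _; exists a0; rewrite ?symdiff0.
  move=> hD DW; case: (set_0Vmem D) => [->|[w wD]]; first by exists a0; rewrite ?symdiff0.
  have [||a aA e] := IH (D :\ w).
  - by rewrite -ltnS; apply: leq_trans hD; rewrite [#|D|](cardsD1 w) wD.
  - by apply: subset_trans DW; apply: subsetDl.
  have [a' a'A e'] := h a w aA (fintype.subsetP DW w wD); exists a' => //; rewrite e' e.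
  apply/setP => x; rewrite !inE; case: (altP (x =P w)) => [->|_]; rewrite ?wD /=; by case: (_ \in tr a0); case: (_ \in D).
have /boolp.choice[f hf] : forall D : {set T}, exists a, D \subset W -> a \in A /\ tr a = symdiff (tr a0) D.
  move=> D; case: (boolP (D \subset W)) => [/reach[a aA e]|_]; by [exists a|exists a0].
rewrite -card_powerset; apply: (@leq_card_inj_in _ _ f) => [D|D D']; rewrite !powersetE.
  by case/hf.
by move=> /hf[_ e] /hf[_ e'] E; apply: (@symdiff_inj _ (tr a0)); rewrite -e -e' E.
Qed.

Lemma separated_card (T : finType) (S Y : {set T}) (r : rel T) :
  (forall x x', x \in S -> x' \in S -> x != x' -> exists2 y, y \in Y & r x y != r x' y) -> #|S| <= 2 ^ #|Y|.
Proof.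
move=> h; rewrite -card_powerset; apply: (@leq_card_inj_in _ _ (fun x => [set y in Y | r x y])) => [x _|x x' xS xS' /setP E].
  by rewrite powersetE; apply/fintype.subsetP => y /setIdP[].
apply/eqP; apply: contraT => xx; have [y yY] := h x x' xS xS' xx.
by have := E y; rewrite !inE yY /= => ->; rewrite eqxx.
Qed.

Lemma in_nbA (T : finType) (J : {set T * T}) a (S : {set T}) x : (x \in nbA J a S) = (x \in S) && ((a, x) \in J).
Proof. by rewrite inE. Qed.

(** * Unipolar graphs from a clique, a partition and a bipartite graph *)

Section Glue.
Variables (T : finType) (A : {set T}) (H : sgraph T) (J : {set T * T}).
Let B := ~: A.

Definition glue := graph_of (fun x y => if x \in A then (y \in A) || ((x, y) \in J) else (y \notin A) && adj H x y).

Lemma glue_AA x y : x \in A -> y \in A -> adj glue x y = (x != y).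
Proof. by move=> xA yA; rewrite adj_graph_of xA yA andbT. Qed.

Lemma glue_AB a b : a \in A -> b \notin A -> adj glue a b = ((a, b) \in J).
Proof.
move=> aA bA; rewrite adj_graph_of aA (negbTE bA) /= orbF.
by have -> : a != b by apply: contraNneq bA => <-.
Qed.

Lemma glue_BB x y : x \notin A -> y \notin A -> adj glue x y = adj H x y.
Proof.
move=> xA yA; rewrite adj_graph_of (negbTE xA) (negbTE yA) /= (adj_sym H y) orbb.
by case: (altP (x =P y)) => [->|] //=; rewrite adj_irrefl.
Qed.

Hypothesis HP : H \in parts B.

Lemma glue_P3free : P3free_on glue B.
Proof.
case/partsP: HP => _ pf x y z xB yB zB; have [xA yA zA] : [/\ x \notin A, y \notin A & z \notin A] by rewrite -!in_setC.
by rewrite !glue_BB //; apply: pf.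
Qed.

Lemma glue_cliq : cliq glue A.
Proof. by move=> x y xA yA; rewrite glue_AA. Qed.

Lemma glue_unipolar : unipolar glue.
Proof. by exists A; split; [exact: glue_cliq|exact: glue_P3free]. Qed.

(** Of three pairwise non-adjacent leaves at most one lies in the clique [A]; two leaves outside [A]
    with their centre outside [A] would be an induced path there. *)
Lemma claw_centres_sub : sA glue \subset A.
Proof.
apply/fintype.subsetP => x; rewrite inE => /existsP[a /existsP[b /existsP[c]]].
case/and5P => xa xb xc ab /and5P[ac bc nab nac nbc]; apply: contraT => xA.
have cl u v : u \in A -> v \in A -> u != v -> ~~ adj glue u v -> False by move=> uA vA uv; rewrite glue_AA // uv.
have pf u v : u \notin A -> v \notin A -> u != v -> adj glue x u -> adj glue x v -> ~~ adj glue u v -> False.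
  move=> uA vA uv xu xv; rewrite (glue_P3free (x := u) (y := x) (z := v)) ?inE //; by rewrite adj_sym.
exfalso; case aA : (a \in A); case bA : (b \in A); case cA : (c \in A);
  solve [exact: (cl a b)|exact: (cl a c)|exact: (cl b c)
        |by apply: (pf a b); rewrite ?aA ?bA|by apply: (pf a c); rewrite ?aA ?cA|by apply: (pf b c); rewrite ?bA ?cA].
Qed.

Section Sound.
Variables (L K s r : nat) (cls : pred nat).
Hypothesis sAE : sA glue = A.
Hypothesis eA : ev_A A B L J.
Hypothesis K0 : 0 < K.

(* A set of vertices outside [A] that is not shattered by [A] has more than [L./2]
   elements, and two separations bring its size down to a double logarithm. *)
Lemma wit_bounds q : wit K s r cls glue q ->
  exists k, [/\ cls (k %% K), L./2 < 2 ^ (2 ^ tower k) & tower k <= #|T|].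
Proof.
case/and4P => /exists_inP[a aA /exists_inP[w wW /forall_inP h1]] /forall_inP h2 /forall_inP h3 /(tower_sound K0)[k e ck].
exists k; split=> //; last by rewrite -e max_card.
have WB : sW s r glue q \subset B.
  by apply/fintype.subsetP => x; rewrite in_setD => /andP[_]; rewrite inE sAE => /andP[xA _]; rewrite inE.
have c1 : L./2 < #|sW s r glue q|.
  rewrite ltnNge; apply/negP => hW; pose tau := [set v in sW s r glue q | adj glue a v != (v == w)].
  have tW : tau \subset sW s r glue q by apply/fintype.subsetP => v /setIdP[].
  have /forallP/(_ tau)/implyP := forallP eA (sW s r glue q); rewrite WB hW tW => /(_ isT)/exists_inP[a' a'A /eqP/setP E].
  rewrite -sAE in a'A; have /exists_inP[v vW] := h1 a' a'A; rewrite sAE in a'A.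
  have vA : v \notin A by have := fintype.subsetP WB v vW; rewrite inE.
  have tE : (v \in tau) = (adj glue a v != (v == w)) by apply/setIdP/idP => [[]|].
  by have := E v; rewrite in_nbA vW tE (glue_AB a'A vA) andTb => ->; rewrite eqxx.
apply: leq_trans c1 _; rewrite -e.
apply: (@leq_trans (2 ^ #|santi s r glue q 1|)).
  apply: (separated_card (r := fun x y => adj glue y x)) => x x' xW xW' xx.
  by have /forall_inP/(_ x' xW')/implyP/(_ xx)/exists_inP := h2 x xW.
rewrite leq_exp2l //; apply: (separated_card (r := adj glue)) => x x' xW xW' xx.
by have /forall_inP/(_ x' xW')/implyP/(_ xx)/exists_inP := h3 x xW.
Qed.

End Sound.

(* [U] is split into [s] pieces of size at most [L %/ 4], so that each condition
   involves at most [L./2] vertices. *)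
Lemma cut_exists (L s : nat) (U C : {set T}) : ev_A A B L J -> U \subset B -> #|U| <= s * (L %/ 4) -> C \subset U ->
  exists q : nat -> T, (forall n, q n \in A) /\ forall x, x \in U ->
    (x \in C) = has (fun l => all (fun j => (q (l * s + j), x) \in J) (iota 0 s)) (iota 0 s).
Proof.
move=> eA UB hU CU; set h := L %/ 4 in hU.
pose ix x := index x (enum U) %/ h.
pose P l := [set x in U | ix x == l].
have cP l : #|P l| <= h.
  case: (posnP h) => [h0|h0].
    apply: leq_trans (_ : #|U| <= h); first by apply: subset_leq_card; apply/fintype.subsetP => x /setIdP[].
    by move: hU; rewrite h0 muln0.
  have <- : #|[set: 'I_h]| = h by rewrite cardsT card_ord.
  apply: (@leq_card_inj_in _ _ (fun x => Ordinal (ltn_pmod (index x (enum U)) h0))) => [x _|x y]; first by rewrite inE.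
  move=> /setIdP[xU /eqP ex] /setIdP[yU /eqP ey] /(congr1 val) /= em.
  have E : index x (enum U) = index y (enum U).
    by rewrite (divn_eq (index x (enum U)) h) (divn_eq (index y (enum U)) h) em -/(ix x) -/(ix y) ex ey.
  have xe : x \in enum U by rewrite mem_enum.
  have ye : y \in enum U by rewrite mem_enum.
  by rewrite -(nth_index x xe) E nth_index.
(* The vertex [a (l, j)] is adjacent to all of [C] in piece [l] and to nothing outside [C] in piece
   [j], taken off [C] when [j = l]. A point of [C] satisfies the conjunction of its own piece; a
   point of piece [j] off [C] fails each conjunction at its [j]-th term. *)
have /boolp.choice[a ha] : forall lj : nat * nat, exists a, a \in A /\
    nbA J a ((C :&: P lj.1) :|: (P lj.2 :\: C)) = C :&: P lj.1.
  move=> [l j]; set S := _ :|: _.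
  have SB : S \subset B.
    apply: subset_trans UB; rewrite subUset; apply/andP; split.
      by apply: subset_trans (subsetIl _ _) CU.
    by apply: subset_trans (subsetDl _ _) _; apply/fintype.subsetP => x /setIdP[].
  have hS : #|S| <= L./2.
    apply: leq_trans (leq_card_setU _ _) _; apply: (@leq_trans (h + h)).
      by apply: leq_add; [apply: leq_trans (cP l); apply: subset_leq_card; apply: subsetIr
        |apply: leq_trans (cP j); apply: subset_leq_card; apply: subsetDl].
    by rewrite /h; clear; lia.
  have /forallP/(_ (C :&: P l))/implyP := forallP eA S; rewrite SB hS subsetUl => /(_ isT)/exists_inP[b bA /eqP e].
  by exists b.
exists (fun n => a (n %/ s, n %% s)); split=> [n|x xU]; first by case: (ha (n %/ s, n %% s)).
have qE l j : j < s -> ((l * s + j) %/ s, (l * s + j) %% s) = (l, j).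
  by move=> js; have s0 : 0 < s by [apply: leq_trans js]; rewrite divnMDl // divn_small // addn0 modnMDl modn_small.
have ixs : ix x < s.
  have : index x (enum U) < s * h by apply: leq_trans hU; rewrite cardE index_mem mem_enum.
  by case: (posnP h) => [->|h0]; rewrite ?muln0 // /ix ltn_divLR.
have tr l j : l < s -> j < s -> x \in (C :&: P l) :|: (P j :\: C) -> ((a (l, j), x) \in J) = (x \in C :&: P l).
  by move=> ls js xS; have [_ /setP/(_ x)] := ha (l, j); rewrite inE xS.
apply/idP/hasP => [xC|[l]].
  exists (ix x); first by rewrite mem_iota.
  apply/allP => j; rewrite mem_iota add0n => /andP[_ js]; rewrite qE // tr //; rewrite !inE xC xU eqxx //.
rewrite mem_iota add0n => /andP[_ ls] /allP/(_ (ix x)); rewrite mem_iota add0n ixs qE // => /(_ isT) hJ.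
apply: contraT => xC; move: hJ; rewrite tr // !inE (negbTE xC) ?xU ?eqxx //.
Qed.

Section Complete.
Variables (L k r s K : nat) (cls : pred nat) (u : 'I_r -> T) (Q : 'I_3 -> {set T}) (X XY : {set T}).
Variables (V : finType) (ly : V -> nat) (R : rel V) (phi : V -> T).
Let U := [set x | [exists i, x \in blk H B (u i)]].
Let TB := phi @: setT.
Let D1 := phi @: [set v | ly v == k].
Let W := U :\: XY.
Hypothesis uB : forall i, u i \in B.
Hypothesis hQ : forall g g' x y, x \in Q g -> y \in Q g' -> g != g' -> [/\ x \in B, y \in B, x != y & ~~ adj H x y].
Hypothesis QB : forall g, Q g \subset B.
Hypothesis XU : X \subset U.
Hypothesis XYU : XY \subset U.
Hypothesis phiU : forall v, phi v \in U.
Hypothesis phi_inj : injective phi.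
Hypothesis cU : #|U| <= s * (L %/ 4).
Hypothesis cW : L < #|W|.
Hypothesis cT : #|T| <= 2 ^ L.
Hypothesis h1 : forall v, ly v <= k.
Hypothesis h3 : #|[set v | ly v == 0]| = 1.
Hypothesis h5 : forall v y, R v y -> ly v = (ly y).+1.
Hypothesis h6 : forall m (S : {set V}), m < k -> S \subset [set v | ly v == m] -> exists2 v, ly v = m.+1 & [set y | R v y] = S.
Hypothesis h7 : forall v v', ly v = ly v' -> 0 < ly v -> [set y | R v y] = [set y | R v' y] -> v = v'.
Hypothesis K3 : 2 < K.
Hypothesis clk : cls (k %% K).
Hypothesis gJ : good_bip A B L X XY TB D1 W Q J.

Let eclaw : ev_claw A Q J. Proof. by case/and5P: gJ. Qed.
Let eA : ev_A A B L J. Proof. by case/and5P: gJ. Qed.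
Let eB : ev_B A B L J. Proof. by case/and5P: gJ. Qed.
Let eZ : ev_Z A L X J. Proof. by case/and5P: gJ. Qed.
Let eT : ev_T A X TB J. Proof. by case/and5P: gJ => _ _ _ _ /and3P[]. Qed.
Let eW : ev_W A XY W J. Proof. by case/and5P: gJ => _ _ _ _ /and3P[]. Qed.
Let eY : ev_Y A XY D1 J. Proof. by case/and5P: gJ => _ _ _ _ /and3P[]. Qed.

Let UB : U \subset B.
Proof. by apply/fintype.subsetP => x; rewrite inE => /existsP[i]; rewrite inE => /andP[]. Qed.
Let UA x : x \in U -> x \notin A. Proof. by move/(fintype.subsetP UB); rewrite inE. Qed.

Lemma claw_centresE : sA glue = A.
Proof.
apply/eqP; rewrite eqEsubset claw_centres_sub /=; apply/fintype.subsetP => a aA.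
have nb g : exists2 b, b \in Q g & (a, b) \in J.
  by have /forallP/(_ g)/exists_inP := forall_inP eclaw a aA.
have [b0 b0Q ab0] := nb i30; have [b1 b1Q ab1] := nb i31; have [b2 b2Q ab2] := nb i32.
have [q0 q1 n01 e01] := hQ b0Q b1Q isT; have [_ q2 n02 e02] := hQ b0Q b2Q isT; have [_ _ n12 e12] := hQ b1Q b2Q isT.
rewrite !inE in q0 q1 q2.
rewrite inE; apply/existsP; exists b0; apply/existsP; exists b1; apply/existsP; exists b2.
rewrite (glue_AB aA q0) (glue_AB aA q1) (glue_AB aA q2) (glue_BB q0 q1) (glue_BB q0 q2) (glue_BB q1 q2).
by rewrite ab0 ab1 ab2 n01 n02 n12 e01 e02 e12.
Qed.

Definition target c : {set T} := match c with 0 => X | 1 => XY | 2 => D1 |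
  3 => phi @: [set v | full ly R v] | i.+4 => phi @: [set v | mark k K ly v == i] end.

Lemma target_sub c : target c \subset U.
Proof.
have h (S : {set V}) : phi @: S \subset U by apply/fintype.subsetP => x /imsetP[v _ ->].
by case: c => [|[|[|[|c]]]]; rewrite /target; [exact: XU|exact: XYU|exact: h|exact: h|exact: h].
Qed.

(** The vertices that miss [X] serve as names of pairs: [Eset] keeps those whose trace on the tower
    is a pair related by [R]. *)
Definition Zset := [set a in A | nbA J a X == set0].
Definition Eset := [set a in Zset | [exists v, exists y, (R v y || R y v) && (nbA J a TB == [set phi v; phi y])]].

(** Cuts are realised by [cut_exists] and pairs of the tower by [ev_T]. The shattering clause holds
    by counting: [W] has more than [L] points and [A] at most [2 ^ L]. *)
Lemma glue_models : models glue (to_sentence (fsent K s r cls)).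
Proof.
have [a0 a0A] : exists a0, a0 \in A.
  have /forallP/(_ set0)/implyP := forallP eA set0; rewrite !sub0set cards0 => /(_ isT)/exists_inP[a aA _].
  by exists a.
have /boolp.choice[qc hqc] : forall c, exists q : nat -> T, (forall n, q n \in A) /\ forall x, x \in U ->
    (x \in target c) = has (fun l => all (fun j => (q (l * s + j), x) \in J) (iota 0 s)) (iota 0 s).
  by move=> c; apply: cut_exists eA UB cU (target_sub c).
(* [Zset] has at most [L./2] elements, so by [ev_B] one vertex [p] outside [A] sees exactly [Eset]
   in it. *)
have [p pA hp] : exists2 p, p \notin A & forall a, a \in Zset -> ((a, p) \in J) = (a \in Eset).
  have ZA : Zset \subset A by apply/fintype.subsetP => a /setIdP[].
  have EZ : Eset \subset Zset by apply/fintype.subsetP => a /setIdP[].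
  have hZ : #|Zset| <= L./2 := eZ.
  have /forallP/(_ Eset)/implyP := forallP eB Zset; rewrite ZA hZ EZ => /(_ isT)/exists_inP[p pB /eqP/setP E].
  exists p; first by rewrite inE in pB.
  by move=> a aZ; have := E a; rewrite inE aZ.
pose q c n := match c with
  | 0 => if insub n is Some i then u i else a0
  | 1 => if n == 0 then p else a0
  | c.+2 => if (c < 4 + K) && (n < s * s) then qc c n else a0 end.
apply: (@wit_models K s r cls T glue q a0).
  move=> c n; apply: contraNeq => hq; rewrite /params mem_cat mem_cat; case: c hq => [|[|c]] hq.
  - apply/orP; left; move: hq; rewrite /q; case: insubP => [i ni _ _|_]; last by rewrite eqxx.
    by apply: map_f; rewrite mem_iota.
  - apply/orP; right; apply/orP; left; move: hq; rewrite /q; case: (n =P 0) => [-> _|_]; last by rewrite eqxx.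
    exact: mem_head.
  - apply/orP; right; apply/orP; right; move: hq; rewrite /q; case: andP => [[cK ns] _|_]; last by rewrite eqxx.
    by apply: (allpairs_f (fun c n => (c.+3, n))); rewrite mem_iota.
have sAE := claw_centresE.
have sUE : sU r glue q = U.
  apply/setP => x; rewrite [in RHS]inE [in LHS]inE sAE; apply/andP/existsP => [[xA /hasP[l]]|[i xb]].
    rewrite mem_iota add0n => /andP[_ lr]; rewrite /q insubT => h; exists (Ordinal lr).
    have ulA : u (Ordinal lr) \notin A by have := uB (Ordinal lr); rewrite inE.
    move: h; rewrite glue_BB // => h; rewrite inE inE xA adj_sym.
    by rewrite (_ : Ordinal lr = Sub l lr).
  have uA : u i \notin A by have := uB i; rewrite inE.
  move: xb; rewrite inE inE => /andP[xA h]; split=> //; apply/hasP; exists (i : nat); first by rewrite mem_iota /=.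
  by rewrite /q valK glue_BB // adj_sym.
have scE c : c < 4 + K -> scut s r glue q c = target c.
  move=> cK; apply/setP => x; rewrite inE sUE; case xU : (x \in U); last first.
    by symmetry; apply/negP => /(fintype.subsetP (target_sub c)); rewrite xU.
  have [qA ->] := hqc c; last by rewrite xU.
  rewrite /=; apply: eq_in_has => l; rewrite mem_iota add0n => /andP[_ ls]; apply: eq_in_all => j.
  rewrite mem_iota add0n => /andP[_ js].
  have lt : l * s + j < s * s by apply: leq_trans (leq_mul ls (leqnn s)); rewrite mulSn addnC ltn_add2r.
  by rewrite cK lt /= adj_sym glue_AB // UA // xU.
have saE c : c < 4 + K -> santi s r glue q c = [set a in A | nbA J a (target c) == set0].
  move=> cK; rewrite /santi sAE scE //; apply/setP => a; apply/setIdP/setIdP => -[aA h]; split=> //.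
    apply/eqP/setP => x; rewrite in_nbA in_set0; case xC : (x \in target c) => //=; apply/negbTE.
    by have := forall_inP h x xC; rewrite glue_AB // UA // (fintype.subsetP (target_sub c)).
  apply/forall_inP => x xC; have xA : x \notin A by apply: UA; apply: (fintype.subsetP (target_sub c)).
  by have /eqP/setP/(_ x) := h; rewrite in_nbA xC in_set0 glue_AB //= => ->.
have sEE : sE s r glue q = Eset.
  apply/setP => a; rewrite inE saE // -/Zset; case aZ : (a \in Zset) => /=.
    have aA : a \in A by case/setIdP: aZ.
    by rewrite glue_AB // hp.
  by symmetry; apply/negP => /setIdP[]; rewrite aZ.
have RTE v y : v != y -> sR s r glue q (phi v) (phi y) = R v y || R y v.
  move=> vy; apply/exists_inP/idP => [[a]|vRy].
    rewrite sEE => /setIdP[/setIdP[aA _] /existsP[v' /existsP[y' /andP[h /eqP/setP E]]]].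
    rewrite !glue_AB ?UA // => /andP[av ay].
    have inT z : phi z \in TB by apply: imset_f.
    have := E (phi v); have := E (phi y); rewrite !inE !inT av ay /= => /esym/orP e1 /esym/orP e2.
    case: e1 => /eqP/phi_inj e1; case: e2 => /eqP/phi_inj e2; subst v y; by rewrite ?eqxx in vy *; rewrite ?h // orbC.
  have tT : [set phi v; phi y] \subset TB by rewrite subUset !sub1set !imset_f.
  have /implyP/(_ tT)/exists_inP[a aA /andP[aX /eqP aT]] := forallP eT [set phi v; phi y].
  exists a.
    rewrite sEE; apply/setIdP; split; first exact/setIdP.
    by apply/existsP; exists v; apply/existsP; exists y; rewrite vRy aT eqxx.
  have inT z : phi z \in [set phi v; phi y] -> (a, phi z) \in J by rewrite -aT inE => /andP[].
  by rewrite !glue_AB ?UA // !inT // !inE eqxx ?orbT.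
have K0 : 0 < K by apply: leq_trans K3.
have sWE : sW s r glue q = W by rewrite /sW sUE scE.
have WA x : x \in W -> x \notin A by rewrite inE => /andP[_]; apply: UA.
apply/and4P; split.
- rewrite sAE sWE; apply: contraT; rewrite negb_exists_in => /forall_inP h; exfalso.
  have : 2 ^ #|W| <= #|A|.
    apply: (@shatter_bound _ _ _ (fun a => [set v in W | adj glue a v]) a0) => // a w aA wW.
    have := h a aA; rewrite negb_exists_in => /forall_inP/(_ w wW); rewrite negb_forall_in => /exists_inP[a' a'A].
    rewrite negb_exists_in => /forall_inP h'; exists a' => //; apply/setP => v.
    have trE b : (v \in [set v in W | adj glue b v]) = (v \in W) && adj glue b v by apply/setIdP/andP.
    rewrite in_setU !in_setD !in_set1 !trE; case vW : (v \in W) => /=.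
      by have := h' v vW; rewrite negbK => /eqP ->; case: (v == w); case: (adj glue a v).
    by rewrite andbF /=; symmetry; apply/eqP => E; rewrite E wW in vW.
  apply/negP; rewrite -ltnNge; apply: leq_ltn_trans (_ : 2 ^ L < _); first exact: leq_trans (max_card _) cT.
  by rewrite ltn_exp2l.
- rewrite sWE saE //; apply/forall_inP => w wW; apply/forall_inP => w' wW'; apply/implyP => ww.
  have /forall_inP/(_ w' wW')/implyP/(_ ww)/exists_inP[a aA /and3P[e1 e2 e3]] := forall_inP eW w wW.
  by apply/exists_inP; exists a; [exact/setIdP|rewrite !glue_AB ?WA // e2 (negbTE e3)].
- rewrite saE // scE //; apply/forall_inP => a /setIdP[aA e1]; apply/forall_inP => a' /setIdP[aA' e1']; apply/implyP => aa.
  have := forall_inP eY a aA => /forall_inP/(_ a' aA'); rewrite aa e1 e1' /= => /exists_inP[d dD hd].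
  have dA : d \notin A by apply: UA; apply: (fintype.subsetP (target_sub 2)).
  by apply/exists_inP; exists d => //; rewrite !glue_AB.
- rewrite scE //; apply: (tower_complete K3 clk phi_inj h1 h3 h5 h6 h7) => [i x iK|v|//].
    have i4 : i.+4 < 4 + K by rewrite -[i.+4]/(4 + i) ltn_add2l.
    rewrite -[LHS]/(x \in scut s r glue q i.+4) scE //; apply/imsetP/existsP => [[v /[!inE] hv ->]|[v /andP[/eqP <- hv]]].
      by exists v; rewrite eqxx.
    by exists v; rewrite ?inE.
  by rewrite -[LHS]/(phi v \in scut s r glue q 3) scE //= (mem_imset _ _ phi_inj) inE.
Qed.

End Complete.

End Glue.

(** * Most unipolar graphs are typical *)

Lemma exists_subset (T : finType) (S : {set T}) m : m <= #|S| -> exists2 X : {set T}, X \subset S & #|X| = m.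
Proof.
move=> h; have [p pi pS] := exists_inj_ord h; exists (p @: setT); last by rewrite card_imset // cardsT card_ord.
by apply/fintype.subsetP => x /imsetP[i _ ->].
Qed.

Lemma card_fibers (X I : finType) (f : X -> I) (S S' : {set X}) c :
  (forall i, c * #|[set x in S | f x == i]| <= #|[set x in S' | f x == i]|) -> c * #|S| <= #|S'|.
Proof.
move=> h.
have E (D : {set X}) : #|D| = \sum_i #|[set x in D | f x == i]|.
  rewrite -sum1_card (partition_big f predT) //=; apply: eq_bigr => i _; rewrite -sum1_card.
  by apply: eq_bigl => x; rewrite !inE.
by rewrite (E S) (E S') big_distrr /=; apply: leq_sum => i _; apply: h.
Qed.

(** Three groups of 96 blocks: blocks have at least [L / 48] vertices, so each group has at least
    [2 * L], enough for one leaf set [Q i], and all together [6 * L]. [usize * L] bounds the union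
    from above, and [ncut] pieces of size [L %/ 4] cover it. *)
Definition nblk := 288.
Definition usize := nblk * 1024.
Definition ncut := 4 * usize.
Definition wsentence K cls := to_sentence (fsent K ncut nblk cls).

Section Blocks.
Variables (T : finType) (H : sgraph T) (B : {set T}) (L : nat) (u : 'I_nblk -> T).
Hypothesis HP : H \in parts B.
Hypothesis uB : forall i, u i \in B.
Hypothesis ui : forall i i', blk H B (u i) = blk H B (u i') -> i = i'.
Hypothesis ul : forall i, L <= 48 * #|blk H B (u i)|.
Hypothesis uu : forall i, #|blk H B (u i)| <= 1024 * L.

Definition ublk (I : {set 'I_nblk}) := [set x | [exists i in I, x \in blk H B (u i)]].

Lemma ublk_sub (I : {set 'I_nblk}) : ublk I \subset B.
Proof. by apply/fintype.subsetP => x; rewrite inE => /exists_inP[i _]; rewrite inE => /andP[]. Qed.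

Lemma blk_uniq i i' x y : x \in blk H B (u i) -> y \in blk H B (u i') -> i != i' -> x != y /\ ~~ adj H x y.
Proof.
move=> xi yi ne.
have xB : x \in B by move: xi; rewrite inE => /andP[].
have yB : y \in B by move: yi; rewrite inE => /andP[].
have nb : blk H B x != blk H B y.
  rewrite (blk_class HP (uB i) xi) (blk_class HP (uB i') yi); apply: contraNneq ne => /ui -> //.
split; first by apply: contraNneq nb => ->.
by rewrite (parts_blkE HP xB yB) (negbTE nb) andbF.
Qed.

Lemma ublk_ge (I : {set 'I_nblk}) : #|I| * L <= 48 * #|ublk I|.
Proof.
pose s := (L + 47) %/ 48.
have sl : L <= 48 * s by rewrite /s; clear; lia.
have su i : s <= #|blk H B (u i)| by have := ul i; rewrite /s; move: #|_| => z; clear; lia.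
have /boolp.choice[g hg] : forall i, exists g : 'I_s -> T, injective g /\ forall l, g l \in blk H B (u i).
  by move=> i; have [g g1 g2] := exists_inj_ord (su i); exists g.
have h : #|I| * s <= #|ublk I|.
  have <- : #|setX I [set: 'I_s]| = #|I| * s by rewrite cardsX cardsT card_ord.
  apply: (@leq_card_inj_in _ _ (fun v => g v.1 v.2)) => [[i l]|[i l] [i' l']].
    rewrite in_setX => /andP[iI _]; rewrite inE; apply/exists_inP; exists i => //; by have [_] := hg i.
  move=> _ _ /= E; have [g1 g2] := hg i; have [g1' g2'] := hg i'.
  have ii : i = i'.
    apply/eqP; apply: contraT => ne; have [] := blk_uniq (g2 l) (g2' l') ne; by rewrite E eqxx.
  by subst i'; rewrite (g1 _ _ E).
apply: (@leq_trans (#|I| * (48 * s))); first by rewrite leq_mul2l sl orbT.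
by rewrite mulnCA leq_mul2l h orbT.
Qed.

Lemma ublk_le (I : {set 'I_nblk}) : #|ublk I| <= usize * L.
Proof.
rewrite -mulnA; have <- : #|[set: 'I_nblk]| = nblk by rewrite cardsT card_ord.
apply: (@leq_card_cover _ _ _ _ (fun i x => x \in blk H B (u i))) => [x|i _].
  by rewrite inE => /exists_inP[i _ xi]; exists i.
by apply: leq_trans (uu i); apply: subset_leq_card; apply/fintype.subsetP => x /setIdP[].
Qed.

End Blocks.

Definition good_triple (T : finType) (k L : nat) (A : {set T}) (H : sgraph T) (J : {set T * T}) :=
  [/\ sA (glue A H J) = A, ev_A A (~: A) L J &
      forall K (cls : pred nat), 2 < K -> cls (k %% K) -> models (glue A H J) (wsentence K cls)].

(** * Half of the unipolar graphs are good *)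

Section Fraction.
Variables (T : finType) (k t N L : nat).
Hypothesis hk : 3 < k.
Hypothesis hN : N = tower k.
Hypothesis ht : t = tower k.-1.
Hypothesis hL : L = 2 ^ (4 * N).
Hypothesis cT : #|T| = 2 ^ L.

Let N2t : N = 2 ^ t. Proof. by rewrite hN ht; case: k hk. Qed.
Let t6 : 6 <= t.
Proof.
rewrite ht; have [k' ->] : exists k', k.-1 = k'.+3 by case: k hk => [|[|[|[|k']]]] //= _; exists k'.
rewrite /=; apply: (@leq_trans (2 ^ (2 ^ (2 ^ 1)))) => //.
by rewrite !leq_exp2l // tower_gt0.
Qed.
Let N64 : 64 <= N. Proof. by rewrite N2t -[64]/(2 ^ 6) leq_exp2l. Qed.
Let NL : 64 * N <= L.
Proof.
have N0 : 0 < N by apply: leq_trans N64.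
apply: (@leq_trans (N ^ 4)); last by rewrite hL mulnC expnM; apply: leq_expl; apply: ltnW; apply: ltn_expl.
by rewrite expnSr leq_mul2r; apply/orP; right; apply: leq_trans N64 _; rewrite -{1}(expn1 N) leq_pexp2l.
Qed.
Let usN : usize <= 2 ^ N.
Proof.
apply: (@leq_trans (2 ^ 9 * 2 ^ 10)); first by rewrite leq_mul.
by rewrite -expnD leq_exp2l //; apply: leq_trans N64.
Qed.

(** The tower, with fewer than [2 * N] points, is placed in the union [U] of the chosen blocks, and
    [X] and [XY] are taken from [U] off the tower, which leaves [W] with more than [L] points. *)
Lemma card_bad_J (A : {set T}) (H : sgraph T) : H \in parts (~: A) -> typical (~: A) L nblk H ->
  2 ^ (L - 2) <= #|A| -> 2 ^ (L - 2) <= #|~: A| ->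
  #|[set J in powerset (setX A (~: A)) | ~~ `[< good_triple k L A H J >]]| * 8 <= 2 ^ #|setX A (~: A)|.
Proof.
move=> HP [u [uB ui ul uu]] cA cB; set B := ~: A in HP uB ui ul uu cB *.
have [V [ly [R [h1 h2 h3 h4 [h5 h6 h7]]]]] := tower_exists k; rewrite -hN in h2 h4.
pose U := ublk H B u setT.
have UE : U = [set x | [exists i, x \in blk H B (u i)]].
  by apply/setP => x; rewrite !inE; apply: eq_existsb => i; rewrite inE.
have UB : U \subset B by apply: ublk_sub.
have cU : 6 * L <= #|U|.
  have := ublk_ge HP uB ui ul setT; rewrite cardsT card_ord /nblk -/U; move: #|U| => z; clear; lia.
have cU' : #|U| <= usize * L by apply: ublk_le.
pose Q (g : 'I_3) := ublk H B u [set i : 'I_nblk | i %/ 96 == g].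
have cQ g : 2 * L <= #|Q g|.
  have c96 : 96 <= #|[set i : 'I_nblk | i %/ 96 == g]|.
    have lt (l : 'I_96) : g * 96 + l < nblk.
      by have := ltn_ord l; have := ltn_ord g; rewrite /nblk; move: (val g) (val l) => a b; clear; lia.
    rewrite -[96 in X in X <= _]card_ord -cardsT; apply: (@leq_card_inj_in _ _ (fun l => Ordinal (lt l))) => [l _|l l' _ _].
      by rewrite inE /= divnMDl // divn_small // addn0.
    by move/(congr1 val) => /= /addnI E; apply: val_inj.
  have := ublk_ge HP uB ui ul [set i : 'I_nblk | i %/ 96 == g]; rewrite -/(Q g) => h.
  have h' : 96 * L <= 48 * #|Q g| by apply: leq_trans h; rewrite leq_mul2r c96 orbT.
  by move: h'; move: #|Q g| => z; clear; lia.
have QB g : Q g \subset B by apply: ublk_sub.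
have hQ g g' x y : x \in Q g -> y \in Q g' -> g != g' -> [/\ x \in B, y \in B, x != y & ~~ adj H x y].
  move=> xQ yQ gg; have xB := fintype.subsetP (QB g) x xQ; have yB := fintype.subsetP (QB g') y yQ.
  suff [e1 e2] : x != y /\ ~~ adj H x y by split.
  move: xQ yQ; rewrite !inE => /exists_inP[i ig xi] /exists_inP[i' ig' yi]; rewrite inE in ig; rewrite inE in ig'.
  have ii : i != i' by apply: contraNneq gg => E; rewrite -val_eqE /= -(eqP ig) -(eqP ig') E.
  by have [e1 e2] := blk_uniq HP uB ui xi yi ii; split.
have VU : #|V| <= #|U| by apply: leq_trans cU; move: h4 NL N64; clear; lia.
have [p pi pU] := exists_inj_ord VU; pose phi v := p (enum_rank v).
have phi_inj : injective phi by move=> v v' /pi/enum_rank_inj.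
pose TB := phi @: setT.
have TBU : TB \subset U by apply/fintype.subsetP => x /imsetP[v _ ->]; apply: pU.
have cTB : #|TB| = #|V| by rewrite card_imset // cardsT.
have cUT : L <= #|U :\: TB|.
  by rewrite cardsD (setIidPr TBU) cTB; move: h4 NL N64 cU; move: #|U| => z; clear; lia.
have [X XU cX] : exists2 X : {set T}, X \subset U :\: TB & #|X| = L - 3 * N.
  by apply: exists_subset; apply: leq_trans (leq_subr _ _) cUT.
have [XY XYU cXY] : exists2 X : {set T}, X \subset U :\: TB & #|X| = L - (t + 8).
  by apply: exists_subset; apply: leq_trans (leq_subr _ _) cUT.
pose D1 := phi @: [set v | ly v == k]; pose W := U :\: XY.
have sub1 (S S' : {set T}) : S \subset U :\: S' -> S \subset U by move=> h; apply: subset_trans h (subsetDl _ _).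
have XU' := sub1 _ _ XU; have XYU' := sub1 _ _ XYU.
have dis (S S' : {set T}) : S \subset U :\: S' -> [disjoint S & S'].
  move=> h; rewrite -setI_eq0; apply/eqP/setP => x; rewrite !inE; apply/negbTE/negP => /andP[xS xS'].
  by have := fintype.subsetP h x xS; rewrite inE xS'.
have D1T : D1 \subset TB by apply: imsetS; apply: subsetT.
have cW : L < #|W|.
  by rewrite cardsD (setIidPr XYU') cXY; move: cU NL N64; move: #|U| => z; clear; lia.
have bnd := @card_bad_bip T A B L N t usize X XY TB D1 W Q hL N2t t6 usN.
apply: leq_trans (bnd _ cA cB _ _ _ _ _ QB cX cXY _ _ _ cQ _ _ _).
- rewrite leq_mul2r; apply/orP; right; apply: subset_leq_card; apply/fintype.subsetP => J /setIdP[JD ng].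
  apply/setIdP; split=> //; apply: contra ng => gJ; apply/asboolP.
  have cUs : #|[set x | [exists i, x \in blk H B (u i)]]| <= ncut * (L %/ 4).
    have gen z : z * L <= 4 * z * (L %/ 4).
      rewrite [4 * _]mulnC -mulnA leq_mul2l; apply/orP; right.
      rewrite mulnC divnK // hL; have -> : 4 * N = (4 * N - 2) + 2 by move: N64; clear; lia.
      by rewrite expnD dvdn_mull.
    by rewrite -UE; apply: leq_trans cU' (gen usize).
  have cT' : #|T| <= 2 ^ L by rewrite cT.
  have UU : forall x, x \in U -> x \in [set x | [exists i, x \in blk H B (u i)]] by rewrite UE.
  have gJ' : good_bip A (~: A) L X XY (phi @: setT) (phi @: [set v | ly v == k])
     ([set x | [exists i, x \in blk H (~: A) (u i)]] :\: XY) Q J by rewrite -/B -UE.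
  have XU2 : X \subset [set x | [exists i, x \in blk H (~: A) (u i)]] by rewrite -/B -UE.
  split.
  + exact: (claw_centresE HP hQ gJ').
  + by case/and5P: gJ.
  + move=> K cls K3 clk.
    apply: (@glue_models T A H J HP L k nblk ncut K cls u Q X XY V ly R phi) => //; rewrite -/B -?UE //.
    by move=> v; apply: pU.
- by rewrite cT.
- exact: subset_trans UB.
- exact: subset_trans UB.
- exact: subset_trans UB.
- by apply: subset_trans D1T _; apply: subset_trans UB.
- by apply: subset_trans (subsetDl _ _) UB.
- by rewrite cTB; apply: ltnW.
- by rewrite card_imset.
- by apply: leq_trans cU'; apply: subset_leq_card; apply: subsetDl.
- exact: dis.
- by rewrite -setI_eq0; apply/eqP/setP => x; rewrite !inE; case: (x \in XY).
- by apply: disjointWr D1T (dis _ _ XYU).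
Qed.

(** For [m] between [2 ^ (L - 2)] and [2 ^ L], the quotient [j = m %/ L] is at least
    [2 ^ (L - 2 - 4 * N)], so [log j] is close to [L] and [j * log j] is close to [m], as the
    arithmetic of set partitions demands. *)
Lemma card_atypical_parts (S : {set T}) : 2 ^ (L - 2) <= #|S| ->
  8 * #|[set H in parts S | ~~ `[< typical S L nblk H >]]| <= #|parts S|.
Proof.
move=> cS; set m := #|S|.
have L0 : 0 < L by apply: leq_trans NL; rewrite muln_gt0 /=; apply: leq_trans N64.
have L4 : 4 * N + 30 <= L - 2 by move: NL N64; clear; lia.
have mL : m <= 2 ^ L by rewrite -cT max_card.
set j := m %/ L.
have jlo : 2 ^ (L - 2 - 4 * N) <= j.
  rewrite leq_divRL // [X in _ * X <= _]hL -expnD; apply: leq_trans cS; rewrite leq_exp2l // subnK //.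
  by apply: leq_trans L4; apply: leq_addr.
have j64 : 64 <= j by apply: leq_trans jlo; rewrite -[64]/(2 ^ 6) leq_exp2l //; move: L4; clear; lia.
have jL : j * L <= m by apply: leq_divM.
have mjL : m < j.+1 * L by apply: ltn_ceil.
apply: card_atypical => //.
- by apply: leq_trans j64.
- by move: NL N64; clear; lia.
- apply: (@leq_trans (2 ^ ((L - 2 - 4 * N) * (4 * j)))).
    rewrite leq_exp2l //; apply: (@leq_trans (3 * (j.+1 * L))); first by rewrite leq_mul2l; apply: ltnW.
    have h1 : 64 * (j * N) <= j * L by rewrite mulnCA leq_mul2l NL orbT.
    have h2 : 64 * L <= j * L by rewrite leq_mul2r j64 orbT.
    have h3 : 64 * j <= j * N by rewrite mulnC leq_mul2l N64 orbT.
    have -> : (L - 2 - 4 * N) * (4 * j) = 4 * (j * L) - 4 * (j * 2) - 16 * (j * N).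
      by rewrite !mulnBl; congr (_ - _ - _); clear; lia.
    by move: h1 h2 h3; rewrite [j.+1 * L]mulSn; move: (j * L) (j * N) => a b; clear; lia.
  by rewrite expnM; apply: leq_expl.
- apply: (@leq_trans ((2 ^ L) ^ j)); first by apply: leq_expl; apply: leq_trans (leq_div _ _) mL.
  by rewrite -expnM leq_exp2l // mulnC.
- apply: (@leq_trans (2 ^ 2 * (2 ^ 9 * (2 ^ 10 * L)))).
    by apply: leq_mul => //; apply: leq_mul => //; apply: leq_mul.
  apply: leq_trans cS; rewrite [X in _ * (_ * (_ * X))]hL -!expnD leq_exp2l //.
  by move: L4; clear; lia.
- rewrite -/m; have m64 : 64 <= m by apply: leq_trans j64 (leq_div _ _).
  have h : 18 <= m by apply: leq_trans m64.
  apply: leq_trans (exp2_ge_sq h); move: m64; clear; nia.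
Qed.

(** Given [A], the partition and the bipartite graph are independent choices, so fractions of
    triples can be estimated fibre by fibre. A graph may have several splits, hence the separate
    injections in both directions. *)
Let Om : {set {set T} * (sgraph T * {set T * T})} :=
  [set x | (x.2.1 \in parts (~: x.1)) && (x.2.2 \in powerset (setX x.1 (~: x.1)))].
Let OmP x : reflect (x.2.1 \in parts (~: x.1) /\ x.2.2 \in powerset (setX x.1 (~: x.1))) (x \in Om).
Proof.
have -> : (x \in Om) = (x.2.1 \in parts (~: x.1)) && (x.2.2 \in powerset (setX x.1 (~: x.1))) by rewrite [LHS]in_set.
exact: andP.
Qed.
Let balanced (A : {set T}) := (2 ^ (L - 2) <= #|A|) && (2 ^ (L - 2) <= #|~: A|).

Lemma unipolar_le_triples : #|unipolar_graphs T| <= #|Om|.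
Proof.
have /boolp.choice[f hf] : forall G : sgraph T, exists A : {set T}, unipolar G -> cliq G A /\ P3free_on G (~: A).
  by move=> G; case: (EM (unipolar G)) => [[A hA]|n]; [exists A|exists set0].
apply: (@leq_card_inj_in _ _ (fun G => (f G, (restr G (~: f G), cross G (f G) (~: f G))))) => [G|G G'].
  rewrite inE => /asboolP/hf[cA pB]; rewrite inE /= powersetE; apply/andP; split.
    apply/partsP; split=> [x y|x y z xB yB zB]; rewrite !adj_restr; first by case/and3P.
    by rewrite xB yB zB; apply: pB.
  by apply/fintype.subsetP => v; rewrite !inE => /andP[].
rewrite !inE => /asboolP/hf[cA _] /asboolP/hf[cA' _] E.
have /= E0 := congr1 fst E; have /= E1 := congr1 (fun x => x.2.1) E; have /= /setP E2 := congr1 (fun x => x.2.2) E.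
rewrite -E0 in cA' E1 E2.
have X u v : u \in f G -> v \notin f G -> adj G u v = adj G' u v.
  by move=> uA vA; have := E2 (u, v); rewrite !inE /= uA vA.
apply: sgraph_ext => u v; case: (altP (u =P v)) => [->|uv]; first by rewrite !adj_irrefl.
case uA : (u \in f G); case vA : (v \in f G).
- by rewrite cA // cA'.
- by rewrite X // vA.
- by rewrite adj_sym X ?uA // adj_sym.
- by have := congr1 (fun G => adj G u v) E1; rewrite /= !adj_restr !inE uA vA.
Qed.

Lemma triples_fiber (A : {set T}) (P : {set sgraph T * {set T * T}}) (S : {set {set T} * (sgraph T * {set T * T})}) :
  {in S, forall x, x.1 = A -> x.2 \in P} -> #|[set x in S | x.1 == A]| <= #|P|.
Proof.
move=> h; apply: (@leq_card_inj_in _ _ snd) => [x /setIdP[xS /eqP e]|[a b] [a' b'] /setIdP[_ /eqP /= ->] /setIdP[_ /eqP /= ->] /= -> //].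
exact: h.
Qed.

Lemma triples_fiber_ge (A : {set T}) : #|parts (~: A)| * 2 ^ #|setX A (~: A)| <= #|[set x in Om | x.1 == A]|.
Proof.
rewrite -card_powerset -cardsX; apply: (@leq_card_inj_in _ _ (pair A)) => [[H J]|u v _ _ [] //].
by rewrite in_setX => /andP[HP JP]; rewrite inE eqxx andbT inE /= HP.
Qed.

Let atyp := [set x in Om | balanced x.1 && ~~ `[< typical (~: x.1) L nblk x.2.1 >]].
Let badJ := [set x in Om | [&& balanced x.1, `[< typical (~: x.1) L nblk x.2.1 >] &
   ~~ `[< good_triple k L x.1 x.2.1 x.2.2 >]]].
Let unb := [set x in Om | ~~ balanced x.1].

Lemma card_atyp : 8 * #|atyp| <= #|Om|.
Proof.
apply: (@card_fibers _ _ fst) => A.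
apply: leq_trans (triples_fiber_ge A).
case bA : (balanced A); last first.
  rewrite (_ : [set _ in _ | _] = set0) ?cards0 ?muln0 //; apply/setP => x; rewrite [RHS]inE; apply/negbTE/negP.
  by case/setIdP => /setIdP[_ /andP[b _]] /eqP e; rewrite e bA in b.
have /andP[_ cB] := bA.
apply: leq_trans (_ : 8 * (#|[set H in parts (~: A) | ~~ `[< typical (~: A) L nblk H >]]| * 2 ^ #|setX A (~: A)|) <= _).
  rewrite leq_mul2l /= -card_powerset -cardsX; apply: triples_fiber => -[A' [H J]] /setIdP[/OmP[/= HP JP] /andP[_ /= h]] /= e.
  by subst A'; rewrite in_setX JP andbT; apply/setIdP.
by rewrite mulnA leq_mul2r card_atypical_parts ?orbT.
Qed.

Lemma card_badJ : 8 * #|badJ| <= #|Om|.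
Proof.
apply: (@card_fibers _ _ (fun x => (x.1, x.2.1))) => -[A H].
case: (boolP [&& balanced A, `[< typical (~: A) L nblk H >] & H \in parts (~: A)]) => [/and3P[/andP[cA cB] /asboolP ty HP]|h]; last first.
  rewrite (_ : [set _ in _ | _] = set0) ?cards0 ?muln0 //; apply/setP => x; rewrite [RHS]inE; apply/negbTE/negP.
  case/setIdP => /setIdP[/OmP[x1 _] /and3P[x2 x3 _]] /eqP[e1 e2]; move/negP: h; apply.
  by rewrite -e1 -e2 x2 x3 x1.
apply: leq_trans (_ : 8 * #|[set J in powerset (setX A (~: A)) | ~~ `[< good_triple k L A H J >]]| <= _).
  rewrite leq_mul2l /=; apply: (@leq_card_inj_in _ _ (fun x => x.2.2)) => [[A' [H' J]]|[A1 [H1 J1]] [A2 [H2 J2]]].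
    case/setIdP => /setIdP[/OmP[_ JP] /and3P[_ _ ng]] /eqP[e1 e2]; rewrite /= in e1 e2 JP ng; subst A' H'.
    by apply/setIdP.
  by case/setIdP => _ /eqP[/= -> ->] /setIdP[_ /eqP[/= -> ->]] /= ->.
rewrite mulnC; apply: leq_trans (card_bad_J HP ty cA cB) _.
rewrite -card_powerset; apply: (@leq_card_inj_in _ _ (fun J => (A, (H, J)))) => [J JP|J J' _ _ [] //].
by apply/setIdP; split=> //; apply/OmP.
Qed.

(** With [n = 4 * M], an unbalanced [A] leaves at most [3 * (M * M)] cross edges, against an
    exponent of [4 * (M * M)] for unipolar graphs; the difference pays for [A] and for the
    partition. *)
Lemma card_unb : 4 * #|unb| <= #|Om|.
Proof.
apply: leq_trans unipolar_le_triples; rewrite card_unipolar.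
apply: leq_trans (nUni_ge _); rewrite cT.
pose M := 2 ^ (L - 2).
have M4 : 2 ^ L = 4 * M by rewrite /M -[4]/(2 ^ 2) -expnD subnKC //; move: NL N64; clear; lia.
have hLM : 16 * (L + 2) <= M.
  have y18 : 18 <= L - 2 by move: NL N64; clear; lia.
  apply: leq_trans (exp2_ge_sq y18); move: y18; clear => h.
  have [z E] : exists z, L = z + 2 by exists (L - 2); move: h; lia.
  by rewrite E addnK in h *; nia.
have h : #|unb| <= 2 ^ 2 ^ L * ((2 ^ L) ^ 2 ^ L * 2 ^ (3 * (M * M))).
  have <- : #|[set: {set T}]| = 2 ^ 2 ^ L by rewrite -powersetT card_powerset cardsT cT.
  apply: (@leq_card_cover _ _ _ _ (fun A x => x.1 == A)) => [x _|A _]; first by exists x.1; rewrite ?inE.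
  case bA : (balanced A).
    rewrite (_ : [set _ in _ | _] = set0) ?cards0 //; apply/setP => x; rewrite [RHS]inE; apply/negbTE/negP.
    by case/setIdP => /setIdP[_ b] /eqP e; rewrite e bA in b.
  apply: leq_trans (_ : #|parts (~: A)| * 2 ^ #|setX A (~: A)| <= _).
    rewrite -card_powerset -cardsX; apply: triples_fiber => -[A' [H J]] /setIdP[/OmP[/= HP JP] _] /= e.
    by subst A'; rewrite in_setX HP.
  apply: leq_mul.
    apply: (@leq_trans (#|~: A| ^ #|~: A|)).
      apply: leq_trans (parts_few_blocks (~: A) #|~: A|); apply: subset_leq_card; apply/fintype.subsetP => H HP.
      by apply/setIdP; split=> //; apply: leq_imset_card.
    have cB : #|~: A| <= 2 ^ L by rewrite -cT max_card.
    by apply: leq_trans (leq_expl _ cB) _; rewrite leq_exp2l // (ltn_trans _ (ltn_expl L _)) //; move: NL N64; clear; lia.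
  rewrite leq_exp2l // cardsX; have := cardsC A; rewrite cT M4.
  move: bA; rewrite /balanced -/M => /negbT; rewrite negb_and -!ltnNge; move: #|A| #|~: A| => a b.
  by clear; move=> h e; nia.
have h' : 4 * #|unb| <= 2 ^ 2 * (2 ^ 2 ^ L * ((2 ^ L) ^ 2 ^ L * 2 ^ (3 * (M * M)))) by rewrite leq_mul2l h.
apply: leq_trans h' _; clear h; clearbody M.
rewrite -expnM -!expnD leq_exp2l // [2 ^ (L + L)]expnD !M4.
have -> : 4 * M * (4 * M) %/ 4 = 4 * (M * M) by rewrite (_ : 4 * M * (4 * M) = 4 * (M * M) * 4) ?mulnK //; clear; lia.
move: hLM; clear; nia.
Qed.

Definition good_graphs : {set sgraph T} := [set G | `[< [/\ unipolar G,
  forall K (cls : pred nat), 2 < K -> cls (k %% K) -> models G (wsentence K cls) &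
  forall K (cls : pred nat), 0 < K -> models G (wsentence K cls) -> exists2 i, i < 4 & cls ((k + i) %% K)] >]].

Lemma tower_lt i j : i < j -> tower i < tower j.
Proof.
elim: j => // j IH; rewrite ltnS leq_eqVlt => /orP[/eqP ->|/IH h]; first exact: ltn_expl.
by apply: ltn_trans h _; apply: ltn_expl.
Qed.

(** As [L./2 = 2 ^ (4 * N - 1)] is at least [tower k.+1], the first bound excludes [j < k]. As
    [2 ^ L] is below [tower k.+4], the second excludes [j >= k + 4]. *)
Lemma tower_window j : L./2 < 2 ^ (2 ^ tower j) -> tower j <= 2 ^ L -> k <= j < k + 4.
Proof.
move=> h1 h2; apply/andP; split.
  rewrite leqNgt; apply/negP => jk.
  have : tower j.+2 <= tower k.+1.
    by case: (ltngtP j.+2 k.+1) => [/tower_lt/ltnW //||->//]; rewrite ltnS ltnNge jk.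
  rewrite leqNgt => /negP; apply; apply: leq_ltn_trans h1.
  rewrite -[tower k.+1]/(2 ^ tower k) -hN hL.
  have -> : 4 * N = (4 * N - 1).+1 by move: N64; clear; lia.
  by rewrite expnS mul2n doubleK leq_exp2l //; move: N64; clear; lia.
rewrite ltnNge; apply/negP => kj.
have : tower (k + 4) <= tower j by case: (ltngtP (k + 4) j) kj => [/tower_lt/ltnW|//|->].
rewrite leqNgt => /negP; apply; apply: leq_ltn_trans h2 _.
rewrite addn4 -[tower k.+4]/(2 ^ (2 ^ (2 ^ tower k.+1))) hL ltn_exp2l // ltn_exp2l //.
rewrite -[tower k.+1]/(2 ^ tower k) -hN.
apply: leq_ltn_trans (ltn_expl (2 ^ N) _) => //.
have y18 : 18 <= N by apply: leq_trans N64.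
by apply: leq_trans (exp2_ge_sq y18); move: y18; clear; nia.
Qed.

(** Bad triples make up at most [1/8 + 1/8 + 1/4] of all. On good triples [glue] is injective,
    because [A] is recovered as the set of claw centres. *)
Lemma unipolar_le_good : #|unipolar_graphs T| <= 2 * #|good_graphs|.
Proof.
pose gd := [set x in Om | `[< good_triple k L x.1 x.2.1 x.2.2 >]].
have h1 : #|Om| <= 2 * #|gd|.
  have s : Om \subset gd :|: (atyp :|: badJ :|: unb).
    apply/fintype.subsetP => x xO; rewrite !in_setU; case g : (x \in gd) => //=.
    have ng : ~~ `[< good_triple k L x.1 x.2.1 x.2.2 >] by apply/negP => h; move: g; rewrite inE xO h.
    case b : (balanced x.1); last by apply/orP; right; apply/setIdP; rewrite b.
    apply/orP; left; case ty : `[< typical (~: x.1) L nblk x.2.1 >]; apply/orP; [right|left]; apply/setIdP; rewrite ?b ?ty //.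
  have cU (X Y : {set {set T} * (sgraph T * {set T * T})}) : #|X :|: Y| <= #|X| + #|Y| by rewrite cardsU leq_subr.
  have := subset_leq_card s; have := cU gd (atyp :|: badJ :|: unb).
  have := cU (atyp :|: badJ) unb; have := cU atyp badJ; have := card_atyp; have := card_badJ; have := card_unb.
  move: #|Om| #|atyp| #|badJ| #|unb| #|gd| #|atyp :|: badJ| #|atyp :|: badJ :|: unb| #|gd :|: _|.
  by clear; lia.
apply: leq_trans unipolar_le_triples (leq_trans h1 _); rewrite leq_mul2l /=.
apply: (@leq_card_inj_in _ _ (fun x => glue x.1 x.2.1 x.2.2)) => [[A [H J]]|[A [H J]] [A' [H' J']]].
  case/setIdP => /OmP[/= HP JP] /asboolP[g1 g2 g3]; rewrite inE; apply/asboolP; split=> //; first exact: glue_unipolar.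
  move=> K cls K0 /models_wit[q hq].
  have [j [cj j1 j2]] := wit_bounds g1 g2 K0 hq; rewrite cT in j2.
  have /andP[kj jk] := tower_window j1 j2; exists (j - k); last by rewrite subnKC.
  by move: kj jk; clear; lia.
case/setIdP => /OmP[/= HP JP] /asboolP[g1 _ _] /setIdP[/OmP[/= HP' JP'] /asboolP[g1' _ _]] E.
have EA : A = A' by rewrite -g1 E g1'.
subst A'; congr pair; congr pair.
  case/partsP: HP => hs _; case/partsP: HP' => hs' _; apply: sgraph_ext => x y.
  case xA : (x \in A).
    have -> : adj H x y = false by apply/negP => /hs[]; rewrite inE xA.
    by symmetry; apply/negP => /hs'[]; rewrite inE xA.
  case yA : (y \in A).
    have -> : adj H x y = false by apply/negP => /hs[_]; rewrite inE yA.
    by symmetry; apply/negP => /hs'[_]; rewrite inE yA.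
  by have := congr1 (fun G => adj G x y) E; rewrite /= !glue_BB ?xA ?yA.
rewrite !powersetE in JP JP'; apply/setP => -[x y]; case xy : ((x, y) \in setX A (~: A)); last first.
  by apply/idP/idP => [/(fintype.subsetP JP)|/(fintype.subsetP JP')]; rewrite xy.
move: xy; rewrite in_setX in_setC => /andP[/= xA yA].
by have := congr1 (fun G => adj G x y) E; rewrite /= !glue_AB.
Qed.

End Fraction.

(** * Non-convergence *)

Definition exclusive (C : nat) (phi : nat -> sentence) c : sentence :=
  foldr (fun c' acc => FAnd acc (FNot (phi c'))) (phi c) [seq c' <- iota 0 C | c' != c].

Lemma models_exclusive (T : finType) (G : sgraph T) C phi c :
  models G (exclusive C phi c) = models G (phi c) && [forall c' : 'I_C, (val c' != c) ==> ~~ models G (phi c')].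
Proof.
have gen s : models G (foldr (fun c' acc => FAnd acc (FNot (phi c'))) (phi c) s) =
    models G (phi c) && all (fun c' => ~~ models G (phi c')) s.
  elim: s => [|c' s IH]; first by rewrite andbT.
  have E a b : models G (FAnd a (FNot b)) = models G a && ~~ models G b by [].
  by rewrite [foldr _ _ (c' :: s)]/= E IH [all _ (c' :: s)]/= -andbA; congr (_ && _); rewrite andbC.
rewrite gen; congr (_ && _); apply/allP/forallP => [h c'|h c'].
  by apply/implyP => cc; apply: h; rewrite mem_filter cc mem_iota /=.
rewrite mem_filter mem_iota add0n => /andP[cc /andP[_ cC]].
by have /implyP := h (Ordinal cC); apply.
Qed.

Lemma tower_gt k : k < tower k.
Proof. by elim: k => //= k IH; apply: leq_ltn_trans IH (ltn_expl _ _). Qed.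

Section Final.
Variable R : realType.
Local Open Scope ring_scope.

Lemma Pr_exclusive_sum C phi n : \sum_(c < C) Pr_perfect R (exclusive C phi c) n <= 1.
Proof.
rewrite /Pr_perfect -mulr_suml; set q := #|[set G | perfect G]|.
have q0 : (0 < q)%N.
  apply/card_gt0P; exists (graph_of (fun _ _ => false)); rewrite inE; apply: unipolar_perfect.
  by exists set0; split=> [x y|x y z]; rewrite ?inE // adj_graph_of andbF.
rewrite ler_pdivrMr ?ltr0n // mul1r -natr_sum ler_nat.
pose S (c : 'I_C) := [set G : sgraph 'I_n | perfect G & models G (exclusive C phi c)].
rewrite (_ : \sum_(c < C) _ = \sum_(c < C) #|S c|)%N //.
have -> : (\sum_(c < C) #|S c| = #|[set u : 'I_C * sgraph 'I_n | u.2 \in S u.1]|)%N.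
  rewrite -sum1_card (eq_bigl (fun u : 'I_C * sgraph 'I_n => u.2 \in S u.1)); last by move=> u; rewrite inE.
  rewrite -(pair_big_dep predT (fun c G => G \in S c) (fun _ _ => 1%N)) /=.
  by apply: eq_bigr => c _; rewrite -sum1_card.
apply: (@leq_card_inj_in _ _ snd) => [u|[c G] [c' G']].
  by rewrite !inE => /andP[].
rewrite !inE !models_exclusive /= => /and3P[_ m1 /forallP h1] /and3P[_ m2 _] E; subst G'.
congr pair; apply/eqP; apply: contraT => cc.
by have := h1 c'; rewrite eq_sym val_eqE cc m2.
Qed.

(** A true sentence has residue among those of [k], ..., [k + 3]; residues [4 * c] modulo [4 * C]
    are spaced by 4, so in a good graph only the sentence of [c] holds. *)
Lemma Pr_exclusive_ge M C c k (phi := fun c => wsentence (4 * C) (pred1 (4 * c)%N)) :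
  (forall n, (nC5free n <= M * nUni n)%N) -> (c < C)%N -> (3 < k)%N -> (k %% (4 * C) = 4 * c)%N ->
  1 / (2 * M)%:R <= Pr_perfect R (exclusive C phi c) (2 ^ (2 ^ (4 * tower k)))%N.
Proof.
move=> hM cC k3 kc; set n := (2 ^ _)%N; rewrite /Pr_perfect.
set p := #|[set G | perfect G & _]|; set q := #|[set G | perfect G]|.
have hT : #|'I_n| = (2 ^ (2 ^ (4 * tower k)))%N by rewrite card_ord.
have ug := unipolar_le_good k3 erefl erefl erefl hT; rewrite card_unipolar card_ord in ug.
have gp : (#|good_graphs 'I_n k| <= p)%N.
  apply: subset_leq_card; apply/fintype.subsetP => G; rewrite inE => /asboolP[uG g1 g2].
  rewrite inE unipolar_perfect //= models_exclusive; apply/andP; split.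
    apply: g1; last by rewrite /= kc.
    by apply: (@leq_trans (4 * 1)) => //; rewrite leq_mul2l /=; apply: leq_trans cC.
  apply/forallP => c'; apply/implyP => cc; apply/negP => /g2[]; first by rewrite muln_gt0; apply: leq_trans cC.
  move=> i i4 /=; rewrite -modnDml kc modn_small => [/eqP E|].
    move: cc E i4; rewrite -[\val c']/(nat_of_ord c'); move: (nat_of_ord c') => z; clear; lia.
  by move: i4 cC; clear; lia.
have qp : (q <= 2 * M * p)%N.
  apply: leq_trans (_ : nC5free n <= _)%N.
    apply: subset_leq_card; apply/fintype.subsetP => G; rewrite !inE => pG; apply/asboolP; exact: perfect_C5free.
  apply: leq_trans (hM n) _; rewrite [(2 * M)%N]mulnC -mulnA leq_mul2l; apply/orP; right.
  by apply: leq_trans ug _; rewrite leq_mul2l.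
have q0 : (0 < q)%N.
  apply/card_gt0P; exists (graph_of (fun _ _ => false)); rewrite inE; apply: unipolar_perfect.
  by exists set0; split=> [x y|x y z]; rewrite ?inE // adj_graph_of andbF.
have M0 : (0 < 2 * M)%N by move: (leq_trans q0 qp); rewrite muln_gt0 => /andP[].
by rewrite ler_pdivrMr ?ltr0n // mulrAC ler_pdivlMr ?ltr0n // mul1r -natrM ler_nat mulnC.
Qed.

Lemma exclusive_family : exists (C : nat) (de : R) (psi : nat -> sentence),
  [/\ 0 < de, 1 < C%:R * (de / 2), forall c N, (c < C)%N -> exists2 n, (N <= n)%N & de <= Pr_perfect R (psi c) n &
      forall n, \sum_(c < C) Pr_perfect R (psi c) n <= 1].
Proof.
have [M hM] := C5free_unipolar_bound R.
have M0 : (0 < M)%N.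
  have := hM 0%N; case: M {hM} => //; rewrite mul0n leqn0 => /eqP h.
  have : graph_of (fun _ _ => false) \in C5free_graphs 'I_0 by rewrite inE; apply/asboolP => -[].
  by move/card0_eq: h => ->.
(* Each probability is at least [1 / (2 * M)] infinitely often, and [4 * M + 1] halves of this add
   up to more than 1. *)
pose C := (4 * M).+1.
exists C, (1 / (2 * M)%:R), (exclusive C (fun c => wsentence (4 * C) (pred1 (4 * c)%N))); split.
- by rewrite divr_gt0 // ltr0n muln_gt0.
- rewrite /C -natr1 !natrM; have m0 : 0 < M%:R :> R by rewrite ltr0n.
  rewrite mul1r -invfM -(mulrA _ M%:R) (mulrC M%:R) mulrA -(natrM _ 2 2).
  by rewrite ltr_pdivlMr ?mulr_gt0 // mul1r -natrM ltrDl.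
- move=> c N cC; pose k := (4 * c + 4 * C * (N + 4))%N.
  have kc : (k %% (4 * C) = 4 * c)%N by rewrite /k addnC [(4 * C * _)%N]mulnC modnMDl modn_small // ltn_mul2l.
  have kN : (N + 4 <= k)%N by rewrite /k; apply: leq_trans (leq_addl _ _); rewrite leq_pmull // muln_gt0.
  have k3 : (3 < k)%N by apply: leq_trans kN; apply: leq_addl.
  exists (2 ^ (2 ^ (4 * tower k)))%N; last exact: Pr_exclusive_ge.
  apply: leq_trans (leq_addr 4 N) (leq_trans kN _); apply: ltnW.
  apply: ltn_trans (tower_gt k) _; apply: leq_ltn_trans (leq_pmull _ (isT : 0 < 4)%N) _.
  by apply: ltn_trans (ltn_expl _ _) (ltn_expl _ _).
- exact: Pr_exclusive_sum.
Qed.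

End Final.

From mathcomp Require Import all_classical all_reals all_analysis.
Import numFieldNormedType.Exports.
Local Open Scope classical_set_scope.
Local Open Scope ring_scope.

Theorem theorem1 (R : realType) :
  exists phi : sentence,
    ~ exists l : R, (fun n : nat => Pr_perfect R phi n) @ \oo --> l.
Proof.
have [C [de [psi [de0 Cde hge hsum]]]] := exclusive_family R.
apply: contrapT => hno.
have cv c : exists l : R, (fun n : nat => Pr_perfect R (psi c) n) @ \oo --> l.
  by apply: contrapT => h; apply: hno; exists (psi c).
have ev (c : 'I_C) : exists N, forall n, (N <= n)%N -> de / 2 <= Pr_perfect R (psi c) n.
  (* Beyond [N] all values lie within [de / 4] of the limit, hence within [de / 2] of each other;
     one of them is at least [de], so all are at least [de / 2]. At a common [n] the sum then
     exceeds 1. *)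
  have [l /cvgrPdist_lt/(_ (de / 4)) h] := cv c.
  have [|N _ hN] := h; first by rewrite divr_gt0.
  exists N => n Nn; have [n' Nn' hn'] := hge c N (ltn_ord c).
  have := hN n Nn; have := hN n' Nn'; rewrite /= !ltr_norml => /andP[a1 a2] /andP[b1 b2].
  lra.
have /choice[N hN] := ev.
pose n := (\max_(c < C) N c)%N.
have : 1 < \sum_(c < C) Pr_perfect R (psi c) n.
  apply: lt_le_trans Cde _; rewrite -[C in C%:R]card_ord -sum1_card natr_sum mulr_suml.
  by apply: ler_sum => c _; rewrite mul1r; apply: hN; apply: leq_bigmax.
by rewrite ltNge hsum.
Qed.
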